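(* Let $G$ be the simply connected simple complex algebraic group of type $E_6$ and let $H\subset G$ be the maximal reductive subgroup of type $F_4$. Then $G/P_i$, $i\neq 4$, are spherical $H$-varieties. The variety $G/P_4$ is not $H$-spherical.
   Context: The ground field is $\mathbb{C}$. Fix a Borel subgroup $B$ of $G$; with simple roots $\alpha_1,\dots,\alpha_6$ and fundamental weights $\omega_1,\ldots,\omega_6$ in Bourbaki numbering, $P_i\supset B$ ($1\le i\le 6$) is the maximal parabolic subgroup associated to $\omega_i$ (the stabilizer of the highest weight line in the irreducible $G$-module of highest weight $\omega_i$). The subgroup $H$ is the connected subgroup whose Lie algebra is the simple subalgebra of type $F_4$ having simple root vectors $X_{\alpha_2}$, $X_{\alpha_4}$, $\frac{1}{\sqrt2}(X_{\alpha_3}+X_{\alpha_5})$, $\frac{1}{\sqrt2}(X_{\alpha_1}+X_{\alpha_6})$, where $X_\alpha$ is a suitably chosen nonzero root vector for $\alpha$; it is unique up to conjugacy in $\mathrm{Aut}(G)$. $H$ acts on $G/P_i$ by left multiplication. $G/P_i$ is $H$-spherical (a spherical $H$-variety) if a Borel subgroup of $H$ has an open orbit in it. *)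

(* Defs.v *)
From HB Require Import structures.
From mathcomp Require Import all_boot all_order all_algebra.
From mathcomp Require Import classical_sets reals complex mpoly.
Set Implicit Arguments.
Unset Strict Implicit.
Unset Printing Implicit Defensive.
Import Order.TTheory GRing.Theory Num.Theory.
Local Open Scope classical_set_scope.
Local Open Scope ring_scope.

(* Linear algebraic groups are Zariski-closed subgroups of GL_n(K), K being an
   algebraically closed field of characteristic 0, so that a group can be
   identified with its set of K-points. *)
Section AlgebraicGroups.
Variable K : fieldType.

Section ZariskiTopology.
Variable n : nat.
Implicit Types (S Z U : set 'M[K]_n) (p : {mpoly K[n * n]}).

Definition mxeval p (A : 'M[K]_n) : K := p.@[fun k => mxvec A 0 k].

Definition zero_locus (I : set {mpoly K[n * n]}) : set 'M[K]_n :=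
  [set A | forall p, I p -> mxeval p A = 0].

Definition zclosed_in S Z := exists I, Z = S `&` zero_locus I.

Definition zopen_in S U := exists I, U = S `\` zero_locus I.

Definition zconnected S := forall Z1 Z2,
  zclosed_in S Z1 -> zclosed_in S Z2 -> Z1 `|` Z2 = S -> Z1 `&` Z2 = set0 ->
  Z1 = set0 \/ Z2 = set0.

(* Meant for S closed in GL_n, whose coordinate ring is a quotient of
   K[x_ij][1/det]. *)
Definition regular_fun S (f : 'M[K]_n -> K) :=
  exists p k, forall A, S A -> f A = mxeval p A / \det A ^+ k.

End ZariskiTopology.

Section Groups.
Variable n : nat.
Implicit Types (G H B T N D : set 'M[K]_n).

Definition GLset : set 'M[K]_n := [set A | A \in unitmx].

Definition mxgroup G :=
  [/\ G `<=` GLset, G 1%:M,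
      forall x y, G x -> G y -> G (x *m y)
    & forall x, G x -> G (invmx x)].

Definition alg_group G := mxgroup G /\ zclosed_in GLset G.

Definition conn_group G := alg_group G /\ zconnected G.

Definition mx_normal N G :=
  forall g x, G g -> N x -> N (g *m x *m invmx g).

Definition simple_group G :=
  [/\ conn_group G,
      exists x y, [/\ G x, G y & x *m y <> y *m x]
    & forall N, conn_group N -> N `<=` G -> mx_normal N G ->
        N = [set 1%:M] \/ N = G].

Definition commutator_group G : set 'M[K]_n :=
  [set z | forall D, mxgroup D ->
     (forall x y, G x -> G y -> D (x *m y *m invmx x *m invmx y)) -> D z].

Definition mx_solvable G := exists k, iter k commutator_group G = [set 1%:M].

Definition borel_subgroup G B :=
  [/\ B `<=` G, conn_group B, mx_solvable B
    & forall D, D `<=` G -> conn_group D -> mx_solvable D -> B `<=` D -> D = B].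

Definition torus T := conn_group T /\
  exists2 Q : 'M[K]_n, Q \in unitmx
    & forall t, T t -> is_diag_mx (Q *m t *m invmx Q).

Definition max_torus G T :=
  [/\ T `<=` G, torus T
    & forall D, D `<=` G -> torus D -> T `<=` D -> D = T].

(* Tangent space of G at the identity. *)
Definition Lie G : set 'M[K]_n :=
  [set X | forall p : {mpoly K[n * n]}, (forall g, G g -> mxeval p g = 0) ->
     \sum_(k < n * n) mxeval (p^`M(k)) 1%:M * mxvec X 0 k = 0].

End Groups.

Definition alg_hom n m (G : set 'M[K]_n) (G' : set 'M[K]_m)
    (f : 'M[K]_n -> 'M[K]_m) :=
  [/\ forall i j, regular_fun G (fun x => f x i j),
      forall x, G x -> G' (f x)
    & forall x y, G x -> G y -> f (x *m y) = f x *m f y].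

Definition SL2 : set 'M[K]_2 := [set A | \det A = 1].
Definition upper2 (x : K) : 'M[K]_2 := 1%:M + x *: delta_mx 0 1.
Definition lower2 (x : K) : 'M[K]_2 := 1%:M + x *: delta_mx 1 0.
Definition diag2 (z : K) : 'M[K]_2 :=
  z *: delta_mx 0 0 + z^-1 *: delta_mx 1 1.

(* Characters of a torus T are functions on all matrices that matter only
   through their values on T; the group of characters is written
   multiplicatively. *)
Section Roots.
Variable n : nat.
Implicit Types (G B T : set 'M[K]_n) (a w : 'M[K]_n -> K) (c : K -> 'M[K]_n).

Definition character T w :=
  [/\ regular_fun T w, w 1%:M = 1
    & forall s t, T s -> T t -> w (s *m t) = w s * w t].

Definition root_vector G T a (X : 'M[K]_n) :=
  [/\ X != 0, Lie G X & forall t, T t -> t *m X *m invmx t = a t *: X].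

Definition root G T a :=
  (exists2 t, T t & a t != 1) /\ exists X, root_vector G T a X.

(* The positive roots determined by B are the roots of T in Lie B; the simple
   ones are those that are not sums of two positive roots. *)
Definition simple_root B T a :=
  root B T a /\
  ~ exists b1 b2, [/\ root B T b1, root B T b2
                    & forall t, T t -> a t = b1 t * b2 t].

(* c is the coroot of a: the restriction to the diagonal torus of a nontrivial
   homomorphism SL_2 -> G sending the upper and lower unipotent subgroups to
   the root subgroups of a and -a. *)
Definition coroot G T a c :=
  exists phi : 'M[K]_2 -> 'M[K]_n,
    [/\ alg_hom SL2 G phi,
        phi (upper2 1) != 1%:M,
        forall t x, T t ->
          t *m phi (upper2 x) *m invmx t = phi (upper2 (a t * x)),
        forall t x, T t ->
          t *m phi (lower2 x) *m invmx t = phi (lower2 ((a t)^-1 * x))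
      & forall z, z != 0 -> c z = phi (diag2 z) /\ T (c z)].

(* G is a simple group with Borel subgroup B containing the maximal torus T,
   simple roots a_i, simple coroots c_i, and Cartan matrix
   A i j = <a_i, c_j>. *)
Definition simple_group_of_type r (A : 'M[int]_r) G B T
    (a : 'I_r -> 'M[K]_n -> K) (c : 'I_r -> K -> 'M[K]_n) :=
  [/\ simple_group G,
      [/\ borel_subgroup G B, max_torus G T & T `<=` B],
      [/\ forall i, simple_root B T (a i),
          forall i j, i != j -> exists2 t, T t & a i t != a j t
        & forall b, simple_root B T b ->
            exists i, forall t, T t -> b t = a i t],
      forall i, coroot G T (a i) (c i)
    & forall i j z, z != 0 -> a i (c j z) = z ^ A i j].

Definition fundamental_weights r T (c : 'I_r -> K -> 'M[K]_n)
    (om : 'I_r -> 'M[K]_n -> K) :=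
  forall i, character T (om i) /\
    forall j z, z != 0 -> om i (c j z) = z ^+ (i == j).

(* The character lattice of T is the full weight lattice, i.e. the fundamental
   weights are characters of T. *)
Definition simply_connected r T (c : 'I_r -> K -> 'M[K]_n) :=
  exists om, fundamental_weights T c om.

Definition irreducible_rep G m (rho : 'M[K]_n -> 'M[K]_m) :=
  [/\ (0 < m)%N, alg_hom G (@GLset m) rho
    & forall W : set 'cV[K]_m,
        W 0 -> (forall (k : K) u v, W u -> W v -> W (k *: u + v)) ->
        (forall g v, G g -> W v -> W (rho g *m v)) ->
        W = [set 0] \/ W = setT].

Definition highest_weight_vector B T w m (rho : 'M[K]_n -> 'M[K]_m)
    (v : 'cV[K]_m) :=
  [/\ v != 0, forall b, B b -> exists k : K, rho b *m v = k *: v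
    & forall t, T t -> rho t *m v = w t *: v].

Definition line_stabilizer G m (rho : 'M[K]_n -> 'M[K]_m) (v : 'cV[K]_m) :
    set 'M[K]_n :=
  [set g | G g /\ exists k : K, rho g *m v = k *: v].

Definition parabolic_of_weight G B T w (P : set 'M[K]_n) :=
  exists m (rho : 'M[K]_n -> 'M[K]_m) (v : 'cV[K]_m),
    [/\ irreducible_rep G rho, highest_weight_vector B T w rho v
      & P = line_stabilizer G rho v].

End Roots.

(* G/P is the set of left cosets with the quotient of the Zariski topology. *)
Section Spherical.
Variable n : nat.
Implicit Types (G H B P S : set 'M[K]_n) (U : set (set 'M[K]_n)).

Definition lcoset (g : 'M[K]_n) S : set 'M[K]_n := [set g *m x | x in S].

Definition coset_space G P : set (set 'M[K]_n) := [set lcoset g P | g in G].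

Definition coset_space_open G P U :=
  U `<=` coset_space G P /\ zopen_in G [set g | G g /\ U (lcoset g P)].

Definition left_orbit B S : set (set 'M[K]_n) := [set lcoset b S | b in B].

Definition spherical G H P :=
  exists2 B, borel_subgroup H B
    & exists2 S, coset_space G P S & coset_space_open G P (left_orbit B S).

End Spherical.

End AlgebraicGroups.

(* Bourbaki numbering starts at 1. *)
Definition node r (k : nat) : 'I_r.+1 := inord k.-1.

Definition adjacentE6 (i j : 'I_6) : bool :=
  let edges := [:: (1, 3); (3, 4); (4, 5); (5, 6); (2, 4)]%N in
  ((i.+1, j.+1) \in edges) || ((j.+1, i.+1) \in edges).

Definition cartanE6 : 'M[int]_6 := \matrix_(i, j)
  (if i == j then 2 else if adjacentE6 i j then -1 else 0).

Definition cartanF4 : 'M[int]_4 := \matrix_(i, j)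
  (nth [::] [:: [::  2; -1;  0;  0];
                [:: -1;  2; -2;  0];
                [::  0; -1;  2; -1];
                [::  0;  0; -1;  2]] i)`_j.

(* The simple root vectors of F4 (in the order of cartanF4) in terms of root
   vectors X_i for the simple roots of E6. *)
Definition F4_root_vectors (C : numClosedFieldType) n (X : 'I_6 -> 'M[C]_n)
    (k : 'I_4) : 'M[C]_n :=
  let X_ i := X (node 5 i) in
  [:: X_ 2; X_ 4; (sqrtC 2)^-1 *: (X_ 3 + X_ 5);
      (sqrtC 2)^-1 *: (X_ 1 + X_ 6)]`_k.

(* H is the connected subgroup of G whose Lie algebra is simple of type F4 with
   simple root vectors Y_1, ..., Y_4. *)
Definition F4_subgroup (K : fieldType) n (G H : set 'M[K]_n)
    (Y : 'I_4 -> 'M[K]_n) :=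
  H `<=` G /\
  exists B T b c, simple_group_of_type cartanF4 H B T b c /\
    forall k, root_vector H T (b k) (Y k).

(* Main.v *)
Require Import Defs.
From HB Require Import structures.
From mathcomp Require Import all_boot all_order all_algebra.
From mathcomp Require Import ring_quotient generic_quotient.
From mathcomp Require Import boolp classical_sets functions filter reals complex mpoly.
From mathcomp Require Import zify ring lra.
Set Implicit Arguments.
Unset Strict Implicit.
Unset Printing Implicit Defensive.
Import Order.TTheory GRing.Theory Num.Theory.
Local Open Scope classical_set_scope.
Local Open Scope ring_scope.
Local Open Scope quotient_scope.

(** If [P] is one of the five [P_i], there is [x] such that the Lie algebras of a Borel
    subgroup of [H] and of [x P x^-1] span that of [G]; for this, [x] is a product of
    exponentials, [P] is conjugated to the opposite parabolic, and brackets of the known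
    vectors with the simple root vectors of [H] are followed along an explicit finite
    computation with roots. The double coset of [x] is then dense and contains an open set.
    For [P_4] an open orbit would make a solvable subalgebra of [Lie H] surject onto
    [Lie G / Lie P_4], of dimension 29. But a solvable subalgebra has dimension at most
    24 + 4, since it cannot have leading terms in two opposite root spaces. *)

(** Groups are known only by their points and by the tangent space that vanishing polynomials cut
    out. Smoothness and dominance therefore come from generic points: an ultrapower of the ground
    field receives the polynomials, derivations and homomorphisms are extended to it coordinate by
    coordinate, and everything is specialized back.

    Two obstacles shape the rest. The maximal torus of $H$ is not assumed to lie in that of $G$. But
    a combination of the simple root vectors of $H$ is a principal nilpotent element of $G$, so
    their common centralizer has positive degree, and exponentials from it carry the Lie algebra of
    the torus of $H$ into that of $T$. In the negative half the Borel subgroup of $H$ is arbitrary;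
    no conjugacy theorem is invoked, only its solvability.

    The numbers are 24 positive roots and rank 4 for $F_4$, against the 29 positive roots of $E_6$
    that involve $\alpha_4$. *)

Notation acf := numClosedFieldType.
Notation hev := horner_eval.
Notation mxi := mxvec_index.
Ltac mxP := apply/matrixP.
Ltac eqb := apply: eq_bigr.
Ltac sub0P := apply/eqP;rewrite -subr_eq0;apply/eqP.

(** * Ultrapowers of a field *)

Section UltraPower.
Variables (K : fieldType) (X : choiceType) (U : set (set (option X))).
Hypothesis hU : UltraFilter U.
(** The functions that vanish on a set of the ultrafilter. The type [option X] is never empty, so
    that the functions on it form a nonzero ring. *)
Definition ultra_null : {pred option X -> K} :=
 fun f=> `[< U [set z | f z = 0] >].
Lemma unullP (f : option X -> K) :
 reflect (U [set z | f z = 0]) (f \in ultra_null).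
exact: asboolP. Qed.
Lemma ultra_null_ideal : idealr_closed ultra_null.
have FU: Filter U by exact: @ultra_proper _ _ hU.
split.
- by apply/unullP;apply: filterS filterT.
- apply/negP=> /unullP h.
 apply: (@filter_not_empty _ U (@ultra_proper _ _ hU)).
 apply: filterS h=> z /= /eqP;rewrite /cst /=.
 by rewrite [X in X == _]/(1 : K) oner_eq0.
- move=> a u v /unullP hu /unullP hv;apply/unullP.
 apply: filterS2 hu hv=> z /= hu hv.
 by change (a z * u z + v z = 0);rewrite hu hv mulr0 addr0.
Qed.
(** The ultrafilter contains the zero set of [u] or its complement; in the second case [v] vanishes
    where both [u * v = 0] and [u <> 0], again a set of the ultrafilter. *)
Lemma ultra_null_prime : prime_idealr_closed ultra_null.
have FU: Filter U by exact: @ultra_proper _ _ hU.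
move=> u v /unullP h.
case: (in_ultra_setVsetC [set z | u z = 0] hU)=> [hu|hu].
 by apply/orP;left;apply/unullP.
apply/orP;right;apply/unullP.
apply: filterS2 h hu=> z /= h hu.
by move/eqP: h;rewrite [_ z]/(u z * v z) mulf_eq0=> /orP [/eqP|/eqP].
Qed.
End UltraPower.

Section UltraField.
Variables (K : fieldType) (X : choiceType) (U : set (set (option X))).
Hypothesis hU : UltraFilter U.
Definition ultra_pred : prime_idealr (option X -> K) :=
 HB.pack (@ultra_null K X U)
  (isIdealr.Build _ (@ultra_null K X U) (@ultra_null_ideal K X U hU))
  (isPrimeIdealrClosed.Build _ (@ultra_null K X U) (@ultra_null_prime K X U hU)).
Definition upow := {ideal_quot ultra_pred}.
HB.instance Definition _ := GRing.ComNzRing.on upow.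
Definition ucls (f : option X -> K) : upow := \pi f.
Lemma ucls_eq f g : ucls f = ucls g <-> U [set z | f z = g z].
have ->: ucls f = ucls g <-> f - g \in ultra_null U.
 rewrite /ucls;split=> [/eqP h|h].
  by have:= Quotient.idealrBE ultra_pred f g=> ->.
 by apply/eqP;have:= Quotient.idealrBE ultra_pred f g=> <-.
have FU: Filter U by exact: @ultra_proper _ _ hU.
split=> [/unullP h|h].
 by apply: filterS h=> z /= /eqP;rewrite [X in X == _]/(f z - g z) subr_eq0=> /eqP.
apply/unullP;apply: filterS h=> z /= h.
by change (f z - g z = 0);rewrite h subrr.
Qed.
(** Zeros of the representative are harmless: a nonzero class is nonzero on a set of the
    ultrafilter. *)
Definition uinv (x : upow) : upow := ucls (fun z=> (repr x z)^-1).
Lemma umulVf : forall x : upow, x != 0 -> uinv x * x = 1.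
move=> x x0.
have FU: Filter U by exact: @ultra_proper _ _ hU.
have ex: x = ucls (repr x) by rewrite /ucls reprK.
rewrite [X in _ * X]ex.
have ->: uinv x * ucls (repr x) = ucls ((fun z=> (repr x z)^-1 : K) * repr x).
 by rewrite /uinv /ucls rmorphM.
have ->: (1 : upow) = ucls 1 by rewrite /ucls rmorph1.
apply/ucls_eq.
case: (in_ultra_setVsetC [set z | repr x z = 0] hU)=> h.
 case/negP: x0;apply/eqP;rewrite ex.
 have ->: (0 : upow) = ucls 0 by rewrite /ucls rmorph0.
 exact/ucls_eq.
apply: filterS h=> z /= /eqP h.
by change ((repr x z)^-1 * repr x z = 1);rewrite mulVf.
Qed.
Lemma uinv0 : uinv 0 = 0.
have FU: Filter U by exact: @ultra_proper _ _ hU.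
have e0: (0 : upow) = ucls 0 by rewrite /ucls rmorph0.
rewrite [RHS]e0;apply/ucls_eq.
have : ucls (repr (0 : upow)) = ucls 0 by rewrite {1}/ucls reprK.
by move/ucls_eq;apply: filterS=> z /= ->;rewrite [X in X^-1]/(0 : K) invr0.
Qed.
HB.instance Definition _ := GRing.ComNzRing_isField.Build upow umulVf uinv0.
(** The interface through which the quotient is used: a ring homomorphism from functions to a field
    whose zeros are governed by [U]. *)
Lemma ultrapower_field : exists (L : fieldType) (cls : (option X -> K) -> L),
 [/\ cls (fun=> 1) = 1,
   forall f g, cls (fun z=> f z - g z) = cls f - cls g,
   forall f g, cls (fun z=> f z * g z) = cls f * cls g
  & forall f, cls f = 0 <-> U [set z | f z = 0]].
exists upow, ucls;split.
- by rewrite /ucls -(rmorph1 (\pi_upow)).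
- by move=> f g;rewrite /ucls -rmorphB.
- by move=> f g;rewrite /ucls -rmorphM.
- move=> f;have ->: (0 : upow) = ucls 0 by rewrite /ucls rmorph0.
 exact: ucls_eq.
Qed.
End UltraField.

(** * Subrings of a field and adjunction of one element *)

Section Adjunction.
Variable L : fieldType.
Implicit Types (A : set L) (p q r s m : {poly L}).
Definition sring A :=
 [/\ A 1, forall x y, A x -> A y -> A (x - y)
  & forall x y, A x -> A y -> A (x * y)].
Definition pin A q := forall i, A q`_i.
Definition adjoin A x : set L := [set y | exists2 q, pin A q & y = q.[x]].

Section Subring.
Variable A : set L.
Hypothesis hA : sring A.
Lemma sub0 : A 0. by case: hA=> h1 hB _;rewrite -(subrr 1);apply: hB. Qed.
Lemma subN x : A x -> A (- x).
by case: hA=> h1 hB _ hx;rewrite -sub0r;apply: hB=> //;exact: sub0. Qed.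
Lemma subD x y : A x -> A y -> A (x + y).
by case: hA=> h1 hB _ hx hy;rewrite -[y]opprK;apply: hB=> //;exact: subN. Qed.
Lemma subM x y : A x -> A y -> A (x * y). by case: hA=> _ _;apply. Qed.
Lemma sub_sum (I : Type) (r : seq I) (P : pred I) F :
 (forall i, A (F i)) -> A (\sum_(i <- r | P i) F i).
by move=> h;elim/big_ind: _=> //;[exact: sub0|exact: subD]. Qed.
Lemma subXn x k : A x -> A (x ^+ k).
move=> hx;elim: k=> [|k IH];first by rewrite expr0;case: hA.
by rewrite exprS;apply: subM.
Qed.
Lemma poly_inC c : A c -> pin A c%:P.
by move=> h i;rewrite coefC;case: ifP=> // _;exact: sub0. Qed.
Lemma poly_inX : pin A 'X.
by move=> i;rewrite coefX;case: (i == 1)%N;[case: hA|exact: sub0].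
Qed.
Lemma poly_inB p q : pin A p -> pin A q -> pin A (p - q).
by move=> hp hq i;rewrite coefB;case: hA=> _ hB _;apply: hB. Qed.
Lemma poly_inM p q : pin A p -> pin A q -> pin A (p * q).
by move=> hp hq i;rewrite coefM;apply: sub_sum=> j;apply: subM. Qed.
Lemma poly_inD p q : pin A p -> pin A q -> pin A (p + q).
by move=> hp hq i;rewrite coefD;apply: subD. Qed.
Lemma poly_inZ c p : A c -> pin A p -> pin A (c *: p).
by move=> hp hq i;rewrite coefZ;apply: subM. Qed.
Lemma poly_in0 : pin A 0.
by move=> i;rewrite coef0;exact: sub0. Qed.
Lemma poly_inXn k : pin A 'X^k.
move=> i;rewrite coefXn;case: (i == k)%N;[by case: hA|exact: sub0].
Qed.
Lemma adjoin_sring x : sring (adjoin A x).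
split.
- by exists 1%:P;[apply: poly_inC;case: hA|rewrite hornerC].
- move=> _ _ [p hp ->] [q hq ->];exists (p - q);first exact: poly_inB.
 by rewrite hornerD hornerN.
- move=> _ _ [p hp ->] [q hq ->];exists (p * q);first exact: poly_inM.
 by rewrite hornerM.
Qed.
Lemma adjoin_sub x : A `<=` adjoin A x.
by move=> y hy;exists y%:P;[exact: poly_inC|rewrite hornerC]. Qed.
Lemma adjoin_gen x : adjoin A x x.
by exists 'X;[exact: poly_inX|rewrite hornerX]. Qed.
(** Over a ring a power of the leading coefficient of [m] takes the place of its inverse: a suitable
    multiple of [m] subtracted from [lead_coef m *: r] lowers the size. *)
Lemma pseudo_division m r : pin A m -> m != 0 -> pin A r ->
 exists k s t, [/\ pin A s, pin A t, (size t < size m)%N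
  & lead_coef m ^+ k *: r = s * m + t].
move=> hm m0;have [N]:= ubnP (size r);elim: N r=> // N IH r hN hr.
have [hlt|hge]:= ltnP (size r) (size m).
 exists 0%N, 0, r;split=> //;first exact: poly_in0.
 by rewrite expr0 scale1r mul0r add0r.
have r0: r != 0.
 by apply: contraTneq hge=> ->;rewrite size_poly0 -ltnNge lt0n size_poly_eq0.
set d := (size r - size m)%N.
set r' := lead_coef m *: r - lead_coef r *: ('X^d * m).
have hlm: A (lead_coef m) by exact: hm.
have hlr: A (lead_coef r) by exact: hr.
have hr': pin A r'.
 apply: poly_inB;apply: poly_inZ=> //;apply: poly_inM=> //;exact: poly_inXn.
have sr: (0 < size r)%N by rewrite lt0n size_poly_eq0.
have sm: (0 < size m)%N by rewrite lt0n size_poly_eq0.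
have szX: size ('X^d * m) = size r.
 by rewrite mulrC size_mulXn // /d subnK.
have hs: (size r' < size r)%N.
 have le: (size r' <= size r)%N.
  rewrite (leq_trans (size_polyD _ _)) // size_polyN geq_max.
  by rewrite !(leq_trans (size_scale_leq _ _)) ?szX.
 rewrite ltn_neqAle le andbT;apply/eqP=> e.
 have r'0: r' != 0 by rewrite -size_poly_eq0 e size_poly_eq0.
 case/negP: r'0;rewrite -lead_coef_eq0 lead_coefE e.
 rewrite coefB !coefZ coefXnM /d.
 have ->: ((size r).-1 < size r - size m)%N = false.
  by apply/negbTE;rewrite -leqNgt;lia.
 have ->: ((size r).-1 - (size r - size m))%N = (size m).-1 by lia.
 by rewrite -!lead_coefE mulrC subrr.
have [k [s [t [h1 h2 h3 h4]]]]:= IH r' (leq_trans hs hN) hr'.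
exists k.+1, (s + (lead_coef m ^+ k * lead_coef r) *: 'X^d), t;split=> //.
 apply: poly_inD=> //;apply: poly_inZ;last exact: poly_inXn.
 by apply: subM=> //;exact: subXn.
rewrite exprSr -scalerA mulrDl -addrA [X in _ + X]addrC addrA -h4 /r'.
by rewrite -scalerAl -[(_ * _) *: _]scalerA -scalerDr subrK.
Qed.
End Subring.
(** The relation of least size cannot be made monic, since its coefficients stay in a ring;
    pseudo-division by it makes up for that. *)
Lemma min_poly_exists A x : (exists2 q, pin A q & q != 0 /\ q.[x] = 0) ->
 exists m, [/\ pin A m, m != 0, m.[x] = 0
   & forall q, pin A q -> q.[x] = 0 -> (size q < size m)%N -> q = 0].
move=> [q hq [q0 qx]];have [N]:= ubnP (size q).
elim: N q hq q0 qx=> // N IH q hq q0 qx hN.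
have [h|h]:= pselect (exists q', [/\ pin A q', q' != 0, q'.[x] = 0 & (size q' < size q)%N]).
 by case: h=> q' [h1 h2 h3 h4];apply: (IH q')=> //;exact: leq_trans h4 hN.
exists q;split=> // q' h1 h2 h3;apply/eqP/negP=> /negP q'0.
by apply: h;exists q'.
Qed.
End Adjunction.
Lemma poly_nonroot (K : numFieldType) (p : {poly K}) : p != 0 -> exists k : nat, p.[k%:R] != 0.
move=> p0;apply: contrapT=> h.
have hr: forall k : nat, root p k%:R.
 by move=> k;apply/negPn/negP=> hk;apply: h;exists k.
have:= @max_poly_roots K p [seq k%:R | k <- iota 0 (size p)] p0.
rewrite size_map size_iota ltnn;case/(_ _ _)/negP=> //.
 by apply/allP=> _ /mapP [k _ ->].
by rewrite map_inj_uniq ?iota_uniq // => i j /eqP;rewrite eqr_nat=> /eqP.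
Qed.

(** * Extension of homomorphisms and derivations *)

Section HomExtension.
Variables (K : acf) (L : fieldType).
Implicit Types (A : set L) (p q r s m : {poly L}) (f : L -> K).
Definition hom_on A f :=
 [/\ f 1 = 1, forall x y, A x -> A y -> f (x - y) = f x - f y
  & forall x y, A x -> A y -> f (x * y) = f x * f y].

Section HomOn.
Variables (A : set L) (f : L -> K).
Hypotheses (hA : sring A) (hf : hom_on A f).
Lemma hom_on0 : f 0 = 0.
by case: hA hf=> h1 _ _ [_ hB _];rewrite -(subrr 1) hB // subrr. Qed.
Lemma hom_onN x : A x -> f (- x) = - f x.
by case: hf=> _ hB _ hx;rewrite -sub0r hB ?hom_on0 ?sub0r //;exact: sub0.
Qed.
Lemma hom_onD x y : A x -> A y -> f (x + y) = f x + f y.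
move=> hx hy;case: (hf)=> _ hB _.
by rewrite -{1}[y]opprK hB ?hom_onN ?opprK //;exact: subN.
Qed.
Lemma hom_onM x y : A x -> A y -> f (x * y) = f x * f y.
by case: hf=> _ _;apply. Qed.
Lemma hom_onX x k : A x -> f (x ^+ k) = f x ^+ k.
move=> hx;elim: k=> [|k IH];first by rewrite !expr0;case: hf.
by rewrite !exprS hom_onM ?IH //;exact: subXn.
Qed.
Lemma hom_on_sum (I : Type) (r : seq I) (P : pred I) F : (forall i, A (F i)) ->
 f (\sum_(i <- r | P i) F i) = \sum_(i <- r | P i) f (F i).
move=> h;elim: r=> [|i r IH];first by rewrite !big_nil hom_on0.
rewrite !big_cons;case: ifP=> // _;rewrite hom_onD ?IH //.
exact: sub_sum.
Qed.
Lemma map_homc q i : (map_poly f q)`_i = f q`_i.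
by rewrite coef_map_id0 //;exact: hom_on0. Qed.
Lemma map_homB p q : pin A p -> pin A q ->
 map_poly f (p - q) = map_poly f p - map_poly f q.
move=> hp hq;apply/polyP=> i;rewrite coefB !map_homc coefB.
by case: hf=> _ hB _;rewrite hB.
Qed.
Lemma map_homD p q : pin A p -> pin A q ->
 map_poly f (p + q) = map_poly f p + map_poly f q.
by move=> hp hq;apply/polyP=> i;rewrite coefD !map_homc coefD hom_onD.
Qed.
Lemma map_homM p q : pin A p -> pin A q ->
 map_poly f (p * q) = map_poly f p * map_poly f q.
move=> hp hq;apply/polyP=> i;rewrite coefM !map_homc coefM hom_on_sum.
 by eqb=> j _;rewrite !map_homc hom_onM.
by move=> j;apply: subM.
Qed.
Lemma map_homC c : map_poly f c%:P = (f c)%:P.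
apply/polyP=> i;rewrite map_homc !coefC.
by case: ifP=> // _;exact: hom_on0.
Qed.
Lemma map_homZ c p : A c -> pin A p -> map_poly f (c *: p) = f c *: map_poly f p.
by move=> hc hp;apply/polyP=> i;rewrite coefZ !map_homc coefZ hom_onM.
Qed.
(** The extension must send [q.[x]] to [(map_poly f q).[y]]; the hypothesis on the relations of [x]
    makes this independent of [q]. Outside [adjoin A x] the value 0 is a dummy. *)
Lemma hom_extend x y b q : b = q.[x] -> pin A q ->
 (forall r, pin A r -> r.[x] = 0 -> (map_poly f r).[y] = 0) ->
 (map_poly f q).[y] != 0 ->
 exists g, [/\ hom_on (adjoin A x) g, forall z, A z -> g z = f z, g x = y & g b != 0].
move=> eb hq hr hqy.
have ex: forall z, exists v, forall r, pin A r -> z = r.[x] -> v = (map_poly f r).[y].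
 move=> z;have [[r hr0 zr]|h]:= pselect (adjoin A x z).
  exists (map_poly f r).[y]=> r' hr' zr'.
  apply/eqP;rewrite -subr_eq0 -hornerN -hornerD -map_homB //.
  apply/eqP;apply: hr;first exact: poly_inB.
  by rewrite hornerD hornerN -zr -zr' subrr.
 by exists 0=> r hr0 zr;case: h;exists r.
have [g hg]:= choice ex.
exists g;split.
- split.
 + rewrite (hg 1 1%:P) ?hornerC //;first by rewrite map_homC hornerC;case: hf.
  by apply: poly_inC=> //;case: hA.
 + move=> _ _ [p hp ->] [r hr0 ->].
  rewrite (hg _ (p - r)) ?hornerD ?hornerN //;last exact: poly_inB.
  by rewrite map_homB // hornerD hornerN -(hg p.[x] p) // -(hg r.[x] r).
 + move=> _ _ [p hp ->] [r hr0 ->].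
  rewrite (hg _ (p * r)) ?hornerM //;last exact: poly_inM.
  by rewrite map_homM // hornerM -(hg p.[x] p) // -(hg r.[x] r).
- move=> z hz;rewrite (hg z z%:P) ?hornerC // ?map_homC ?hornerC //;exact: poly_inC.
- rewrite (hg x 'X) ?hornerX //;last exact: poly_inX.
 have ->: map_poly f 'X = 'X;last by rewrite hornerX.
 apply/polyP=> i;rewrite map_homc !coefX.
 by case: (i == 1)%N;[case: hf|exact: hom_on0].
- by rewrite (hg b q).
Qed.
End HomOn.

(** If [x] is transcendental over [A], the leading coefficient of a polynomial expression of [b]
    serves as [a]: while it survives, the image polynomial has a nonroot, and [x] may be sent there.
    If [x] is algebraic, its minimal relation [m] and [q] generate an ideal that contains a nonzero
    constant, and [a] is this constant times the leading coefficient of [m]. *)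
Theorem hom_extension A x b : sring A -> adjoin A x b -> b != 0 ->
 exists2 a, A a & a != 0 /\ forall f, hom_on A f -> f a != 0 ->
  exists g, [/\ hom_on (adjoin A x) g, forall z, A z -> g z = f z & g b != 0].
move=> hA [q hq eb] b0.
have [halg|htr]:= pselect (exists2 q, pin A q & q != 0 /\ q.[x] = 0).
 have [m [hm m0 mx mmin]]:= min_poly_exists halg.
 have hlm: A (lead_coef m) by exact: hm.
 have lm0: lead_coef m != 0 by rewrite lead_coef_eq0.
 (* [J] is the ideal generated by [q] and [m] over [A]; its nonzero elements of least size turn out
    to be constants. *)
 pose J := fun d=> exists u v, [/\ pin A u, pin A v & d = u * q + v * m].
 have q0: q != 0 by apply: contra_neq b0=> q0;rewrite eb q0 horner0.
 have hJ: forall d, J d -> pin A d.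
  by move=> d [u [v [hu hv ->]]];apply: poly_inD=> //;apply: poly_inM.
 have JB: forall c d e s, A c -> pin A s -> J d -> J e -> J (c *: d - s * e).
  move=> c d e s hc hs [u [v [hu hv ->]]] [u' [v' [hu' hv' ->]]].
  exists (c *: u - s * u'), (c *: v - s * v');split.
  - by apply: poly_inB=> //;[apply: poly_inZ|apply: poly_inM].
  - by apply: poly_inB=> //;[apply: poly_inZ|apply: poly_inM].
  - rewrite scalerDr !mulrBl mulrDr -!scalerAl !mulrA opprD.
   by rewrite !addrA;congr (_ + _);rewrite -!addrA;congr (_ + _);rewrite addrC.
 have Jq: J q.
  exists 1, 0;split;[by apply: (poly_inC hA (c:=1));case: hA|exact: poly_in0|].
  by rewrite mul1r mul0r addr0.
 have Jm: J m.
  exists 0, 1;split;[exact: poly_in0|by apply: (poly_inC hA (c:=1));case: hA|].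
  by rewrite mul1r mul0r add0r.
 have [d [Jd d0 dmin]]: exists d, [/\ J d, d != 0 &
   forall e, J e -> (size e < size d)%N -> e = 0].
  have [N]:= ubnP (size q);move: (Jq) (q0);move: {1 2 3}q.
  elim: N=> // N IH d Jd d0 hN.
  have [h|h]:= pselect (exists e, [/\ J e, e != 0 & (size e < size d)%N]).
   by case: h=> e [h1 h2 h3];apply: (IH e)=> //;exact: leq_trans h3 hN.
  exists d;split=> // e h1 h2;apply/eqP/negP=> /negP e0;apply: h.
  by exists e.
 have hd := hJ _ Jd.
 have ld0: lead_coef d != 0 by rewrite lead_coef_eq0.
 have hld: A (lead_coef d) by exact: hd.
 have divd: forall e, J e -> exists k s, pin A s /\ lead_coef d ^+ k *: e = s * d.
  move=> e Je;have [k [s [t [h1 h2 h3 h4]]]]:= pseudo_division hA hd d0 (hJ _ Je).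
  have t0: t = 0.
   apply: dmin h3;have ->: t = lead_coef d ^+ k *: e - s * d.
    by rewrite h4 addrAC subrr add0r.
   by apply: JB=> //;exact: subXn.
  by exists k, s;rewrite h4 t0 addr0.
 have dx: d.[x] != 0.
  apply/eqP=> dx;have [k [s [hs e]]]:= divd _ Jq.
  have:= congr1 (fun p=> p.[x]) e;rewrite hornerZ hornerM dx mulr0=> /eqP.
  by rewrite mulf_eq0 expf_eq0 (negbTE ld0) andbF -eb (negbTE b0).
 (* Up to powers of its leading coefficient, [d] divides [q], so [d.[x]] is nonzero, and it divides
    [m], so the cofactor of [m] vanishes at [x]. By minimality of [m] this cofactor is not smaller
    than [m]. *)
 have sd: size d = 1%N.
  have [k [s [hs e]]]:= divd _ Jm.
  have:= congr1 (fun p=> p.[x]) e;rewrite hornerZ mx mulr0 hornerM=> /esym/eqP.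
  rewrite mulf_eq0 (negbTE dx) orbF=> /eqP sx.
  have e': size m = size (s * d).
   by rewrite -e size_scale // expf_neq0.
  have s0: s != 0.
   apply/eqP=> s0;move: e';rewrite s0 mul0r size_poly0=> /eqP.
   by rewrite size_poly_eq0 (negbTE m0).
  move: e';rewrite size_mul // => e'.
  have sd0: (0 < size d)%N by rewrite lt0n size_poly_eq0.
  have : (size d <= 1)%N;last by lia.
  rewrite leqNgt;apply/negP=> h.
  have ss0: (0 < size s)%N by rewrite lt0n size_poly_eq0.
  case/eqP: s0;apply: mmin=> //;rewrite e'.
  by case: (size s) ss0=> // i _;case: (size d) h=> [|[|j]] // _;lia.
 have [u [v [hu hv ed]]]:= Jd.
 pose c := d`_0.
 have dc: d = c%:P.
  by rewrite [LHS]size1_polyC // sd.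
 have c0: c != 0 by move: d0;rewrite dc polyC_eq0.
 have hc: A c by exact: hd.
 exists (lead_coef m * c);first exact: subM.
 split;first by rewrite mulf_neq0.
 move=> f hf;rewrite (hom_onM hf) // mulf_eq0 negb_or=> /andP [fl fc].
 have szm: size (map_poly f m) = size m.
  rewrite size_map_poly_id0 //;apply: fl.
 have sm1: size m != 1%N.
  apply/eqP=> s1;move: mx m0;rewrite [m]size1_polyC ?s1 // hornerC=> ->.
  by rewrite eqxx.
 (* The image of [m] keeps its size because the leading coefficient survives. Hence it has a root,
    which is chosen as the image of [x]; the constant of [J] then keeps the image of [q] away from 0
    at that root. *)
 have /closed_rootP [y /rootP hy]: size (map_poly f m) != 1%N by rewrite szm.
 have rel: forall r, pin A r -> r.[x] = 0 -> (map_poly f r).[y] = 0.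
  move=> r hr rx;have [k [s [t [h1 h2 h3 h4]]]]:= pseudo_division hA hm m0 hr.
  have t0: t = 0.
   apply: mmin=> //;have:= congr1 (fun p=> p.[x]) h4.
   by rewrite hornerZ rx mulr0 hornerD hornerM mx mulr0 add0r.
  move: h4;rewrite t0 addr0=> h4.
  have:= congr1 (fun p=> (map_poly f p).[y]) h4.
  have hk: A (lead_coef m ^+ k) by exact: subXn.
  rewrite (map_homZ hA hf) // (map_homM hA hf) // hornerZ hornerM hy mulr0=> /eqP.
  by rewrite mulf_eq0 (hom_onX hA hf) // expf_eq0 (negbTE fl) andbF=> /eqP.
 have qy: (map_poly f q).[y] != 0.
  apply/eqP=> qy;have:= congr1 (fun p=> (map_poly f p).[y]) ed.
  rewrite (map_homD hA hf) ?(map_homM hA hf) //;try exact: poly_inM.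
  rewrite hornerD !hornerM qy hy !mulr0 addr0 dc (map_homC hA hf) hornerC=> /eqP.
  by rewrite (negbTE fc).
 have [g [h1 h2 _ h3]]:= hom_extend hA hf eb hq rel qy.
 by exists g.
have q0: q != 0 by apply: contra_neq b0=> q0;rewrite eb q0 horner0.
exists (lead_coef q);first exact: hq.
split;first by rewrite lead_coef_eq0.
move=> f hf fl.
have fq0: map_poly f q != 0.
 by rewrite -size_poly_eq0 size_map_poly_id0 // size_poly_eq0.
have [y hy]:= poly_nonroot fq0.
have []:= hom_extend hA hf eb hq (y := y%:R) _ hy.
 move=> r hr rx;have ->: r = 0.
  by apply/eqP/negP=> /negP r0;apply: htr;exists r.
 by rewrite (map_homC hA hf 0) (hom_on0 hA hf) hornerC.
by move=> g [h1 h2 _ h3];exists g.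
Qed.
End HomExtension.

Section DerivationExtension.
Variables (L : fieldType) (A : set L) (D : L -> L).
Hypothesis L0 : [pchar L] =i pred0.
Implicit Types (p q r s m : {poly L}).
Definition der_on (A : set L) (D : L -> L) :=
 (forall x y, A x -> A y -> D (x - y) = D x - D y) /\
 (forall x y, A x -> A y -> D (x * y) = D x * y + x * D y).
Hypotheses (hA : sring A) (hD : der_on A D).
Lemma der_on0 : D 0 = 0.
by have h := sub0 hA;rewrite -{1}(subrr 0) (proj1 hD) // subrr. Qed.
Lemma der_on1 : D 1 = 0.
have h1: A 1 by case: hA.
have:= proj2 hD 1 1 h1 h1;rewrite !mulr1 mul1r=> /eqP.
by rewrite -subr_eq0 opprD addNKr oppr_eq0=> /eqP.
Qed.
Lemma der_onD x y : A x -> A y -> D (x + y) = D x + D y.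
move=> hx hy;have hN := subN hA hy.
have e: D (- y) = - D y by rewrite -sub0r (proj1 hD) ?der_on0 ?sub0r //;exact: sub0.
by rewrite -{1}[y]opprK (proj1 hD) // e opprK.
Qed.
Lemma der_on_sum (I : Type) (r : seq I) (P : pred I) F : (forall i, A (F i)) ->
 D (\sum_(i <- r | P i) F i) = \sum_(i <- r | P i) D (F i).
move=> h;elim: r=> [|i r IH];first by rewrite !big_nil der_on0.
rewrite !big_cons;case: ifP=> // _;rewrite der_onD ?IH //.
exact: sub_sum.
Qed.
Lemma map_derc q i : (map_poly D q)`_i = D q`_i.
by rewrite coef_map_id0 //;exact: der_on0. Qed.
Lemma map_derB p q : pin A p -> pin A q ->
 map_poly D (p - q) = map_poly D p - map_poly D q.
move=> hp hq;apply/polyP=> i;rewrite coefB !map_derc coefB.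
by rewrite (proj1 hD).
Qed.
Lemma map_derM p q : pin A p -> pin A q ->
 map_poly D (p * q) = map_poly D p * q + p * map_poly D q.
move=> hp hq;apply/polyP=> i;rewrite coefD !coefM map_derc coefM der_on_sum.
 rewrite -big_split /=;eqb=> j _.
 by rewrite !map_derc (proj2 hD).
by move=> j;apply: subM.
Qed.
Lemma map_derC c : map_poly D c%:P = (D c)%:P.
apply/polyP=> i;rewrite map_derc !coefC.
by case: ifP=> // _;exact: der_on0.
Qed.
Variables (x d : L).
Let E q := (map_poly D q).[x] + q^`().[x] * d.
Let EB p q : pin A p -> pin A q -> E (p - q) = E p - E q.
move=> hp hq;rewrite /E map_derB // derivB !hornerD !hornerN.
ring.
Qed.
Let EM p q : pin A p -> pin A q -> E (p * q) = E p * q.[x] + p.[x] * E q.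
move=> hp hq;rewrite /E map_derM // derivM !hornerD !hornerM.
ring.
Qed.
(** By the chain rule a derivation with value [d] at [x] must send [q.[x]] to [E q]; the hypothesis
    says that this depends only on [q.[x]]. *)
Lemma derivation_extend : (forall r, pin A r -> r.[x] = 0 -> E r = 0) ->
 exists D', [/\ der_on (adjoin A x) D', forall z, A z -> D' z = D z & D' x = d].
move=> hE.
have ex: forall z, exists v, forall r, pin A r -> z = r.[x] -> v = E r.
 move=> z;have [[r hr0 zr]|h]:= pselect (adjoin A x z).
  exists (E r)=> r' hr' zr'.
  apply/eqP;rewrite -subr_eq0 -EB //.
  apply/eqP;apply: hE;first exact: poly_inB.
  by rewrite hornerD hornerN -zr -zr' subrr.
 by exists 0=> r hr0 zr;case: h;exists r.
have [g hg]:= choice ex.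
exists g;split.
- split.
 + move=> _ _ [p hp ->] [r hr0 ->].
  rewrite (hg _ (p - r)) ?hornerD ?hornerN //;last exact: poly_inB.
  by rewrite EB // -(hg p.[x] p) // -(hg r.[x] r).
 + move=> _ _ [p hp ->] [r hr0 ->].
  rewrite (hg _ (p * r)) ?hornerM //;last exact: poly_inM.
  by rewrite EM // -(hg p.[x] p) // -(hg r.[x] r).
- move=> z hz;rewrite (hg z z%:P) ?hornerC //;last exact: poly_inC.
 by rewrite /E map_derC hornerC derivC horner0 mul0r addr0.
- rewrite (hg x 'X) ?hornerX //;last exact: poly_inX.
 rewrite /E derivX hornerC mul1r.
 have ->: map_poly D 'X = 0;last by rewrite horner0 add0r.
 apply/polyP=> i;rewrite map_derc coefX coef0.
 by case: (i == 1)%N;[exact: der_on1|exact: der_on0].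
Qed.
End DerivationExtension.

Section DerivationExtension2.
Variables (L : fieldType) (A : set L) (D : L -> L) (x : L).
Hypothesis L0 : [pchar L] =i pred0.
Hypotheses (hA : sring A) (hD : der_on A D).
Lemma der_transcendental d :
 ~ (exists2 q, pin A q & q != 0 /\ q.[x] = 0) ->
 exists D', [/\ der_on (adjoin A x) D', forall z, A z -> D' z = D z & D' x = d].
move=> htr;apply: derivation_extend=> // r hr rx.
have ->: r = 0 by apply/eqP/negP=> /negP r0;apply: htr;exists r.
by rewrite (map_derC hA hD 0) (der_on0 hA hD) deriv0 !horner0 mul0r addr0.
Qed.
Lemma derivation_extension :
 exists2 D', der_on (adjoin A x) D' & forall z, A z -> D' z = D z.
have [halg|htr]:= pselect (exists2 q, pin A q & q != 0 /\ q.[x] = 0);last first.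
 by have [D' [h1 h2 _]]:= der_transcendental 0 htr;exists D'.
have [m [hm m0 mx mmin]]:= min_poly_exists halg.
have sm: (1 < size m)%N.
 rewrite ltnNge;apply/negP=> s1;move: mx m0;rewrite [m]size1_polyC ?s1 // hornerC=> ->.
 by rewrite eqxx.
have m'0: m^`() != 0.
 apply/eqP=> h;have:= congr1 (fun p : {poly L}=> p`_(size m).-2) h.
 rewrite coef_deriv coef0 -mulr_natr=> /eqP.
 have ->: ((size m).-2.+1 = (size m).-1)%N by lia.
 rewrite mulf_eq0 -lead_coefE lead_coef_eq0 (negbTE m0) /=.
 by rewrite ((pcharf0P _ ).1 L0);case: (size m) sm=> [|[|k]].
have hm': pin A m^`().
 move=> i;rewrite coef_deriv -mulr_natr;apply: (subM hA)=> //.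
 elim: i.+1=> [|k IH];first exact: (sub0 hA).
 by rewrite mulrS;apply: (subD hA)=> //;case: hA.
have m'x: m^`().[x] != 0.
 by apply: contra_neq m'0=> h;apply: mmin=> //;exact: lt_size_deriv.
pose d := - (map_poly D m).[x] / m^`().[x].
have [|D' [h1 h2 _]]:= @derivation_extend L A D hA hD x d;last by exists D'.
move=> r hr rx;have [k [s [t [h1 h2 h3 h4]]]]:= pseudo_division hA hm m0 hr.
have t0: t = 0.
 apply: mmin=> //;have:= congr1 (fun p=> p.[x]) h4.
 by rewrite hornerZ rx mulr0 hornerD hornerM mx mulr0 add0r.
move: h4;rewrite t0 addr0=> h4.
have hk: A (lead_coef m ^+ k) by apply: (subXn hA);exact: hm.
have hP := poly_inC hA hk.
have e1: (map_poly D (lead_coef m ^+ k *: r)).[x] + (lead_coef m ^+ k *: r)^`().[x] * d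
   = lead_coef m ^+ k * ((map_poly D r).[x] + r^`().[x] * d).
 rewrite -mul_polyC (map_derM hA hD) // derivM derivC mul0r add0r.
 rewrite !hornerD !hornerM rx !hornerC.
 ring.
have e2: (map_poly D (s * m)).[x] + (s * m)^`().[x] * d = 0.
 rewrite (map_derM hA hD) // derivM !hornerD !hornerM mx /d.
 by field.
move: e1;rewrite h4 e2=> /esym/eqP;rewrite mulf_eq0 expf_eq0 lead_coef_eq0.
by rewrite (negbTE m0) andbF=> /eqP.
Qed.
End DerivationExtension2.
Lemma mpoly_ind' n (R : comNzRingType) (P : {mpoly R[n]} -> Prop) :
 (forall c, P c%:MP) -> (forall i, P 'X_i) ->
 (forall p q, P p -> P q -> P (p + q)) ->
 (forall p q, P p -> P q -> P (p * q)) -> forall p, P p.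
move=> hC hX hD hM;elim/mpolyind=> [|c m p _ _ IH];first exact: hC 0.
apply: (hD)=> //;rewrite -mul_mpolyC;apply: (hM)=> //.
rewrite mpolyXE_id;apply: (big_ind P)=> [|x y hx hy|i _];[by have:= hC 1;rewrite mpolyC1|exact: hM|].
elim: (m i)=> [|k IHk].
 by rewrite expr0;have:= hC 1;rewrite mpolyC1.
by rewrite exprS;apply: (hM).
Qed.

(** * Generic points, generic smoothness and images of polynomial maps *)

Section GenericPoint.
Variable K : acf.
(** [L] plays the role of the function field of a component of the closure of [Z] on which no
    element of [S] vanishes identically. The nonvanishing loci of the elements of [S] on [Z] form
    the base of a filter because [S] is multiplicative, and [L] is the ultrapower along a finer
    ultrafilter. *)
Lemma generic_point N (Z : set 'rV[K]_N) (S : set {mpoly K[N]}) :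
 S 1 -> (forall s t, S s -> S t -> S (s * t)) ->
 (forall s, S s -> exists2 z, Z z & s.@[z 0] != 0) ->
 exists (L : fieldType) (ev : {mpoly K[N]} -> L),
 [/\ ev 1 = 1, forall p q, ev (p - q) = ev p - ev q,
   forall p q, ev (p * q) = ev p * ev q,
   forall p, (forall z, Z z -> p.@[z 0] = 0) -> ev p = 0
  & forall s, S s -> ev s != 0].
move=> S1 SM SZ.
pose F : set (set (option 'rV[K]_N)) :=
 [set A | exists2 s, S s & forall z, Z z -> s.@[z 0] != 0 -> A (Some z)].
have FF: ProperFilter F.
 split.
  move=> [s Ss h];have [z Zz sz]:= SZ s Ss.
  exact: h Zz sz.
 split.
 - by exists 1.
 - move=> A B [s Ss hs] [t St ht];exists (s * t);first exact: SM.
  by move=> z Zz;rewrite mevalM mulf_eq0 negb_or=> /andP [h1 h2];split;auto.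
 - by move=> A B AB [s Ss hs];exists s=> // z Zz h;apply: AB;auto.
have [U [hU FU]]:= ultraFilterLemma FF.
have [L [cls [h1 hB hM h0]]]:= ultrapower_field K hU.
have UF: ProperFilter U by exact: ultra_proper.
pose ev (p : {mpoly K[N]}) := cls (fun z=> if z is Some v then p.@[v 0] else 1).
pose ev0 (p : {mpoly K[N]}) := cls (fun z=> if z is Some v then p.@[v 0] else 0).
have same: forall f g, (forall z, Z z -> f (Some z) = g (Some z)) -> cls f = cls g.
 move=> f g h;apply/eqP;rewrite -subr_eq0 -hB;apply/eqP/h0.
 apply: FU;exists 1=> // z Zz _ /=;rewrite h // subrr //.
exists L, ev;split.
- by rewrite -h1;apply: same=> z _;rewrite meval1.
- by move=> p q;rewrite -hB;apply: same=> z _;rewrite mevalB.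
- by move=> p q;rewrite -hM;apply: same=> z _;rewrite mevalM.
- move=> p hp;rewrite /ev (same _ (fun=> 1 - 1));first by rewrite hB subrr.
 by move=> z Zz;rewrite hp // subrr.
- move=> s Ss;apply/negP=> /eqP/h0 h.
 have h': U [set z | exists2 v : 'rV[K]_N, z = Some v & s.@[v 0] != 0].
  by apply: FU;exists s=> // z Zz sz /=;exists z.
 have [z [/= hz [v ev' sv]]]:= filter_ex (filterI h h').
 by case/eqP: sv;move: hz;rewrite ev'.
Qed.

Section Iterate.
Variable L : fieldType.
Implicit Type A : set L.
Definition adjs A (xs : seq L) : set L := foldl (@adjoin L) A xs.
Lemma subring_adjoins A xs : sring A -> sring (adjs A xs).
by elim: xs A=> //= x xs IH A hA;apply: IH;exact: adjoin_sring. Qed.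
Lemma adjoins_sub A xs : sring A -> A `<=` adjs A xs.
elim: xs A=> [|x xs IH] A hA z hz //=;apply: IH;first exact: adjoin_sring.
exact: adjoin_sub.
Qed.
Lemma adjoins_gen A xs x : sring A -> x \in xs -> adjs A xs x.
elim: xs A=> [|y xs IH] A hA //=;rewrite inE=> /orP [/eqP <-|h].
 by apply: adjoins_sub;[exact: adjoin_sring|exact: adjoin_gen].
by apply: IH=> //;exact: adjoin_sring.
Qed.
(** The adjunctions are undone from the last one: the nonvanishing condition in each ring becomes
    one in the ring before it. *)
Lemma hom_extensions A xs b : sring A -> adjs A xs b -> b != 0 ->
 exists2 a, A a & a != 0 /\ forall f : L -> K, hom_on A f -> f a != 0 ->
  exists g : L -> K,
   [/\ hom_on (adjs A xs) g, forall z, A z -> g z = f z & g b != 0].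
elim: xs A b=> [|x xs IH] A b hA /= hb b0.
 by exists b=> //;split=> // f hf fb;exists f.
have [a ha [a0 h]]:= IH _ _ (adjoin_sring hA x) hb b0.
have [c hc [c0 h']]:= hom_extension K hA ha a0.
exists c=> //;split=> // f hf fc.
have [g [hg hgf ga]]:= h' f hf fc.
have [k [hk hkg kb]]:= h g hg ga.
exists k;split=> // z hz;rewrite hkg ?hgf //;exact: adjoin_sub.
Qed.
Lemma derivation_extensions A xs D : [pchar L] =i pred0 -> sring A ->
 der_on A D ->
 exists2 D', der_on (adjs A xs) D' & forall z, A z -> D' z = D z.
move=> L0;elim: xs A D=> [|x xs IH] A D hA hD /=;first by exists D.
have [D1 h1 h2]:= derivation_extension x L0 hA hD.
have [D2 h3 h4]:= IH _ _ (adjoin_sring hA x) h1.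
by exists D2=> // z hz;rewrite h4 ?h2 //;exact: adjoin_sub.
Qed.
End Iterate.

Section EvalMorphism.
Variables (L : fieldType) (N : nat) (ev : {mpoly K[N]} -> L).
Hypotheses (ev1 : ev 1 = 1) (evB : forall p q, ev (p - q) = ev p - ev q)
 (evM : forall p q, ev (p * q) = ev p * ev q).
Lemma ev_zero : ev 0 = 0. by rewrite -(subrr 1) evB subrr. Qed.
Lemma ev_add p q : ev (p + q) = ev p + ev q.
by rewrite -{1}[q]opprK -[- q]sub0r !evB ev_zero sub0r opprK. Qed.
(** This is how a homomorphism to [K] produces a point: composed with [ev] it is evaluation at the
    images of the coordinates. *)
Lemma hom_on_ev A (f : L -> K) p : sring A -> hom_on A f ->
 (forall c, A (ev c%:MP) /\ f (ev c%:MP) = c) -> (forall i, A (ev 'X_i)) ->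
 A (ev p) /\ f (ev p) = p.@[fun i=> f (ev 'X_i)].
move=> hA hf hC hX;elim/mpoly_ind': p=> [c|i|p q [h1 h2] [h3 h4]|p q [h1 h2] [h3 h4]].
- by rewrite mevalC;exact: hC.
- by rewrite mevalXU.
- rewrite ev_add mevalD (hom_onD hA hf) // h2 h4;split=> //;exact: subD.
- rewrite evM mevalM (hom_onM hf) // h2 h4;split=> //;exact: subM.
Qed.
Lemma derivation_on_ev A (D : L -> L) p : sring A -> der_on A D ->
 (forall c, A (ev c%:MP) /\ D (ev c%:MP) = 0) -> (forall i, A (ev 'X_i)) ->
 A (ev p) /\ D (ev p) = \sum_i ev p^`M(i) * D (ev 'X_i).
move=> hA hD hC hX;elim/mpoly_ind': p=> [c|i|p q [h1 h2] [h3 h4]|p q [h1 h2] [h3 h4]].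
- case: (hC c)=> h1 h2;split=> //;rewrite h2 big1 // => i _.
 by rewrite mderivC ev_zero mul0r.
- split=> //;rewrite (bigD1 i) //= mderivX.
 rewrite big1 ?addr0=> [|j ji].
  have ->: (U_(i) - U_(i) = 0 :> 'X_{1..N})%MM by apply/mnmP=> k;rewrite mnmBE mnm0E subnn.
  by rewrite mnm1E eqxx scale1r mpolyX0 ev1 mul1r.
 by rewrite mderivX mnm1E eq_sym (negbTE ji) scale0r ev_zero mul0r.
- rewrite ev_add (der_onD hA hD) // h2 h4 -big_split /=;split;first exact: subD.
 by eqb=> i _;rewrite mderivD ev_add mulrDl.
- rewrite evM (proj2 hD) // h2 h4 mulr_suml mulr_sumr -big_split /=.
 split;first exact: subM.
 eqb=> i _;rewrite mderivM ev_add !evM;ring.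
Qed.
End EvalMorphism.

(** At a generic point [ev f] is transcendental over the constants, so some derivation takes the
    value 1 on it. This derivation extends to all the coordinates, and a homomorphism to [K]
    specializes the coordinates to a point of the closure of [Z] and their derivatives to a tangent
    vector there. The polynomial [s] lets finitely many values of [f] be avoided. *)
Theorem generic_smoothness N (Z : set 'rV[K]_N) (f : {mpoly K[N]}) (s : {poly K}) :
 (forall p : {poly K}, p != 0 -> exists2 z, Z z & p.[f.@[z 0]] != 0) -> s != 0 ->
 exists z xi : 'I_N -> K,
 [/\ forall q : {mpoly K[N]}, (forall z, Z z -> q.@[z 0] = 0) ->
    q.@[z] = 0 /\ \sum_i (q^`M(i)).@[z] * xi i = 0,
   \sum_i (f^`M(i)).@[z] * xi i = 1 & s.[f.@[z]] != 0].
move=> hZ s0.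
pose comp (p : {poly K}) : {mpoly K[N]} := (map_poly (@mpolyC N K) p).[f].
have compE p v: (comp p).@[v] = p.[f.@[v]].
 rewrite /comp horner_coef raddf_sum /= horner_coef size_map_poly.
 by eqb=> i _;rewrite mevalM coef_map /= mevalC rmorphXn.
pose S : set {mpoly K[N]} := [set q | exists2 p, p != 0 & q = comp p].
(* Keeping all the nonzero polynomials in [f] away from 0 is what makes [ev f] transcendental. *)
have [L [ev [ev1 evB evM evZ evS]]]: exists (L : fieldType) (ev : {mpoly K[N]} -> L),
 [/\ ev 1 = 1, forall p q, ev (p - q) = ev p - ev q,
   forall p q, ev (p * q) = ev p * ev q,
   forall p, (forall z, Z z -> p.@[z 0] = 0) -> ev p = 0
  & forall s, S s -> ev s != 0].
 apply: generic_point.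
 - exists 1;first exact: oner_neq0.
  by rewrite /comp rmorph1 hornerC.
 - move=> _ _ [p p0 ->] [q q0 ->];exists (p * q);first exact: mulf_neq0.
  by rewrite /comp rmorphM hornerM.
 - by move=> _ [p p0 ->];have [z Zz h]:= hZ p p0;exists z;rewrite ?compE.
pose A : set L := [set x | exists c : K, x = ev c%:MP].
have ev0 := ev_zero evB.
have evD := ev_add evB.
have evC_eq0 c: ev c%:MP = 0 -> c = 0.
 move=> h;apply/eqP/negP=> /negP c0.
 have /evS/eqP : S c%:MP.
  by exists c%:P;rewrite ?polyC_eq0 // /comp map_polyC /= hornerC.
 by [].
have hA: sring A.
 split;first by exists 1;rewrite mpolyC1 ev1.
 - by move=> _ _ [c ->] [d ->];exists (c - d);rewrite -evB -mpolyCB.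
 - by move=> _ _ [c ->] [d ->];exists (c * d);rewrite -evM -mpolyCM.
have L0: [pchar L] =i pred0.
 apply/pcharf0P=> k.
 have ->: (k%:R : L) = ev (k%:R)%:MP.
  elim: k=> [|k IH];first by rewrite mpolyC0 ev0.
  by rewrite -!natr1 IH mpolyCD evD mpolyC1 ev1.
 apply/eqP/eqP=> [/evC_eq0/eqP|->];last by rewrite mpolyC0 ev0.
 by rewrite pnatr_eq0=> /eqP.
have hD0: der_on A (fun=> 0).
 by split=> *;rewrite ?subr0 // mul0r mulr0 addr0.
have [phi hphi]: exists phi : L -> K, forall c, phi (ev c%:MP) = c.
 have ex: forall x, exists v : K, forall c, x = ev c%:MP -> v = c.
  move=> x;have [[d ->]|h]:= pselect (A x);last by exists 0=> d e;case: h;exists d.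
  exists d=> e h;apply/eqP;rewrite -subr_eq0;apply/eqP/evC_eq0.
  by rewrite mpolyCB evB h subrr.
 by have [phi h]:= choice ex;exists phi=> d;apply: h.
have evX p k: ev (p ^+ k) = ev p ^+ k.
 by elim: k=> [|k IH];rewrite ?expr0 // !exprS evM IH.
have htr: ~ (exists2 q : {poly L}, pin A q & q != 0 /\ q.[ev f] = 0).
 move=> [q hq [q0 qf]];pose p := \poly_(i < size q) phi q`_i.
 have cp i: q`_i = ev (phi q`_i)%:MP by case: (hq i)=> c ->;rewrite hphi.
 have e: ev (comp p) = q.[ev f].
  rewrite /comp (@horner_coef_wide _ (size q)) ?size_map_poly ?size_poly //.
  rewrite (big_morph ev evD ev0) horner_coef;eqb=> i _.
  by rewrite evM evX coef_map coef_poly ltn_ord /= -cp.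
 have : p != 0.
  apply: contra_neq q0=> p0;apply/polyP=> i;rewrite coef0.
  have [h|h]:= ltnP i (size q);last by rewrite nth_default.
  rewrite cp;have:= congr1 (fun r : {poly K}=> r`_i) p0.
  by rewrite coef_poly h coef0=> ->;rewrite mpolyC0 ev0.
 by move=> p0;have /evS : S (comp p) by [exists p];rewrite e qf eqxx.
have [D1 [hD1 hD1A hD1t]]:= der_transcendental hA hD0 1 htr.
have xsA := adjoin_sring hA (ev f).
pose xs := [seq ev 'X_i | i <- enum 'I_N].
have [D hD hDD1]:= derivation_extensions xs L0 xsA hD1.
(* The derivatives of the coordinates are adjoined as well, so that the homomorphism to [K] is
   defined on them. *)
pose ds := [seq D (ev 'X_i) | i <- enum 'I_N].
set A1 := adjoin A (ev f) in xsA hD1 hDD1 hD.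
have hA2 := subring_adjoins xs xsA.
have hA3: sring (adjs (adjs A1 xs) ds) := subring_adjoins ds hA2.
have A2C c: adjs A1 xs (ev c%:MP).
 by apply: adjoins_sub=> //;apply: adjoin_sub=> //;exists c.
have A2X i: adjs A1 xs (ev 'X_i).
 by apply: adjoins_gen=> //;apply: map_f;rewrite mem_enum.
have hDC c: adjs A1 xs (ev c%:MP) /\ D (ev c%:MP) = 0.
 split=> //;have Ac: A (ev c%:MP) by exists c.
 by rewrite hDD1 ?hD1A //;exact: adjoin_sub.
have Dev p := derivation_on_ev ev1 evB evM p hA2 hD hDC A2X.
have eA: adjs (adjs A1 xs) ds = adjs A ([:: ev f] ++ xs ++ ds).
 by rewrite /adjs !foldl_cat.
have bin: adjs A ([:: ev f] ++ xs ++ ds) (ev (comp s)).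
 by rewrite -eA;apply: adjoins_sub=> //;case: (Dev (comp s)).
have b0: ev (comp s) != 0 by apply: evS;exists s.
have [a [c ->] [c0 hext]]:= hom_extensions hA bin b0.
have []:= hext phi.
- split;first by rewrite -ev1 -mpolyC1 hphi.
 + by move=> _ _ [u ->] [v ->];rewrite -evB -mpolyCB !hphi.
 + by move=> _ _ [u ->] [v ->];rewrite -evM -mpolyCM !hphi.
- by rewrite hphi;apply: contra_neq c0=> ->;rewrite mpolyC0 ev0.
move=> g;rewrite -eA=> -[hg hgA gb].
have gC d: adjs (adjs A1 xs) ds (ev d%:MP) /\ g (ev d%:MP) = d.
 split;first by apply: adjoins_sub=> //;exact: A2C.
 by rewrite hgA ?hphi //;exists d.
have gX i: adjs (adjs A1 xs) ds (ev 'X_i) by apply: adjoins_sub=> //;exact: A2X.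
have gev p := hom_on_ev evB evM p hA3 hg gC gX.
have Ads i: adjs (adjs A1 xs) ds (D (ev 'X_i)).
 by apply: adjoins_gen=> //;apply: map_f;rewrite mem_enum.
have gsum p: g (D (ev p)) = \sum_i (p^`M(i)).@[fun i=> g (ev 'X_i)] * g (D (ev 'X_i)).
 case: (Dev p)=> _ ->;rewrite (hom_on_sum hA3 hg).
  eqb=> i _;rewrite (hom_onM hg) //;last by case: (gev p^`M(i)).
  by case: (gev p^`M(i))=> _ ->.
 by move=> i;apply: subM=> //;case: (gev p^`M(i)).
exists (fun i=> g (ev 'X_i)), (fun i=> g (D (ev 'X_i)));split.
- move=> q hq;have e := evZ q hq;case: (gev q)=> _ <-.
 by rewrite -gsum e (der_on0 hA2 hD) (hom_on0 hA3 hg).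
- rewrite -gsum hDD1;last exact: adjoin_gen.
 by rewrite hD1t;case: hg.
- by rewrite -compE;case: (gev (comp s))=> _ <-.
Qed.
Lemma meval_mmap N M (g : 'I_M -> {mpoly K[N]}) (p : {mpoly K[M]}) (v : 'I_N -> K) :
 (mmap (@mpolyC N K) g p).@[v] = p.@[fun j=> (g j).@[v]].
elim/mpoly_ind': p=> [c|i|p q h1 h2|p q h1 h2].
- by rewrite mmapC /= !mevalC.
- by rewrite mmapX mmap1U mevalXU.
- by rewrite mmapD !mevalD h1 h2.
- by rewrite rmorphM !mevalM h1 h2.
Qed.

(* The second hypothesis says that the closure of [Y] is irreducible. *)
Theorem image_contains_open N M (Z : set 'rV[K]_N) (g : 'I_M -> {mpoly K[N]})
  (Y : set ('I_M -> K)) :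
 let nz (p : {mpoly K[M]}) := exists2 y, Y y & p.@[y] != 0 in
 (forall p, nz p -> exists2 z, Z z & p.@[fun j=> (g j).@[z 0]] != 0) ->
 (forall p q, nz p -> nz q -> nz (p * q)) ->
 (forall z, Z z -> Y (fun j=> (g j).@[z 0])) ->
 (exists y, Y y) ->
 exists2 p, nz p &
  forall y, Y y -> p.@[y] != 0 ->
  exists2 z : 'I_N -> K,
   forall q : {mpoly K[N]}, (forall z, Z z -> q.@[z 0] = 0) -> q.@[z] = 0 &
   forall j, (g j).@[z] = y j.
move=> nz hdom hirr hYZ [y0 Yy0].
pose comp (p : {mpoly K[M]}) : {mpoly K[N]} := mmap (@mpolyC N K) g p.
have compM: {morph comp : p q / p * q} by move=> p q;rewrite /comp rmorphM.
have compC c: comp c%:MP = c%:MP by rewrite /comp mmapC.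
have compX i: comp 'X_i = g i by rewrite /comp mmapX mmap1U.
have compB: {morph comp : p q / p - q} by move=> p q;rewrite /comp rmorphB.
have compE p v: (comp p).@[v] = p.@[fun j=> (g j).@[v]] by exact: meval_mmap.
have [L [ev [ev1 evB evM evZ evS]]]: exists (L : fieldType) (ev : {mpoly K[N]} -> L),
 [/\ ev 1 = 1, forall p q, ev (p - q) = ev p - ev q,
   forall p q, ev (p * q) = ev p * ev q,
   forall p, (forall z, Z z -> p.@[z 0] = 0) -> ev p = 0
  & forall s, [set comp p | p in nz] s -> ev s != 0].
 apply: generic_point.
 - by exists 1;[exists y0=> //;rewrite meval1 oner_neq0|rewrite -mpolyC1 compC].
 - move=> _ _ [p hp <-] [q hq <-];exists (p * q);last by rewrite compM.
  exact: hirr.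
 - by move=> _ [p hp <-];have [z Zz h]:= hdom p hp;exists z;rewrite ?compE.
have evD := ev_add evB.
pose A : set L := [set x | exists p, x = ev (comp p)].
have hA: sring A.
 split;first by exists 1;rewrite -mpolyC1 compC mpolyC1 ev1.
 - by move=> _ _ [p ->] [q ->];exists (p - q);rewrite -evB -compB.
 - by move=> _ _ [p ->] [q ->];exists (p * q);rewrite -evM -compM.
pose xs := [seq ev 'X_i | i <- enum 'I_N].
have hA1 := subring_adjoins xs hA.
have h1: adjs A xs 1 by case: hA1.
(* Used with [b = 1], the extension theorem returns the required [p]: evaluation at a point of [Y]
   where [p] is nonzero extends to the coordinates of the source, and the extension is a
   preimage. *)
have [_ [p ->] [p0 hext]]:= hom_extensions hA h1 (oner_neq0 _).
have evY q: ev (comp q) = 0 -> forall y, Y y -> q.@[y] = 0.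
 move=> e y Yy;apply/eqP/negP=> /negP h.
 have /evS : [set comp p | p in nz] (comp q) by exists q=> //;exists y.
 by rewrite e eqxx.
exists p.
 apply: contrapT=> h;case/eqP: p0;apply: evZ=> z Zz;rewrite compE.
 apply/eqP/negP=> /negP hz;apply: h;exists (fun j=> (g j).@[z 0])=> //.
 exact: hYZ.
move=> y Yy py.
have [phi hphi]: exists phi : L -> K, forall q, phi (ev (comp q)) = q.@[y].
 have ex: forall x, exists v : K, forall q, x = ev (comp q) -> v = q.@[y].
  move=> x;have [[r ->]|h]:= pselect (A x);last by exists 0=> d e;case: h;exists d.
  exists r.@[y]=> q e;apply/eqP;rewrite -subr_eq0 -mevalB;apply/eqP.
  by apply: evY=> //;rewrite compB evB e subrr.
 by have [phi h]:= choice ex;exists phi=> d;apply: h.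
have []:= hext phi.
- split;first by rewrite -ev1 -mpolyC1 -compC hphi mevalC.
 + by move=> _ _ [u ->] [v ->];rewrite -evB -compB !hphi mevalB.
 + by move=> _ _ [u ->] [v ->];rewrite -evM -compM !hphi mevalM.
- by rewrite hphi.
move=> f [hf hfA _].
have fC d: adjs A xs (ev d%:MP) /\ f (ev d%:MP) = d.
 have Ad: A (ev d%:MP) by exists d%:MP;rewrite compC.
 split;first exact: adjoins_sub.
 by rewrite hfA // -compC hphi mevalC.
have fX i: adjs A xs (ev 'X_i).
 by apply: adjoins_gen=> //;apply: map_f;rewrite mem_enum.
have fev q := hom_on_ev evB evM q hA1 hf fC fX.
exists (fun i=> f (ev 'X_i)).
 move=> q hq;case: (fev q)=> _ <-;rewrite evZ //;exact: hom_on0 hA1 hf.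
move=> j;case: (fev (g j))=> _ <-;rewrite -compX hfA ?hphi ?mevalXU //.
by exists 'X_j.
Qed.
End GenericPoint.

(** * Differential calculus on matrices *)

Definition lb (R : pzRingType) n (X Y : 'M[R]_n) := X *m Y - Y *m X.

Section MatrixCalculus.
Variables (K : acf) (n : nat).
Implicit Types (p q : {mpoly K[n * n]}) (A X Y : 'M[K]_n) (S G : set 'M[K]_n).
(** The target ring varies: polynomials in one variable for curves, in several variables for
    substitutions and generic diagonal matrices, and both together for the Jordan decomposition. *)
Definition pev (R : comNzRingType) (f : K -> R) (M : 'M[R]_n) p : R :=
 mmap f (fun k=> mxvec M 0 k) p.
(** The differential of [p] at [A] applied to [X]; at the identity it is the expression that defines
    [Lie]. *)
Definition dmx p A X := \sum_k mxeval p^`M(k) A * mxvec X 0 k.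
Definition gmx : 'M[{mpoly K[n * n]}]_n := \matrix_(i, j) 'X_(mxi i j).
Definition cmx N (A : 'M[K]_n) : 'M[{mpoly K[N]}]_n := map_mx (@mpolyC N K) A.
Lemma dmx_is_linear p A : linear_for *%R (dmx p A : 'M[K]_n -> K).
move=> a X Y;rewrite /dmx mulr_sumr -big_split /=;eqb=> k _.
by rewrite linearP !mxE;ring.
Qed.
HB.instance Definition _ p A := GRing.isLinear.Build K 'M[K]_n K *%R (dmx p A)
 (dmx_is_linear p A).
Lemma mxevalD p q A : mxeval (p + q) A = mxeval p A + mxeval q A.
exact: mevalD. Qed.
Lemma mxevalM p q A : mxeval (p * q) A = mxeval p A * mxeval q A.
exact: mevalM. Qed.
Lemma mxevalC c A : mxeval c%:MP A = c. exact: mevalC. Qed.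
Lemma mxevalX i j A : mxeval 'X_(mxi i j) A = A i j.
by rewrite /mxeval mevalXU mxvecE. Qed.
Lemma dmxD p q A X : dmx (p + q) A X = dmx p A X + dmx q A X.
by rewrite /dmx -big_split /=;eqb=> k _;rewrite mderivD mxevalD mulrDl.
Qed.
Lemma dmxM p q A X : dmx (p * q) A X = dmx p A X * mxeval q A + mxeval p A * dmx q A X.
rewrite /dmx mulr_suml mulr_sumr -big_split /=;eqb=> k _.
by rewrite mderivM mxevalD !mxevalM;ring.
Qed.
Lemma dmxC c A X : dmx c%:MP A X = 0.
by rewrite /dmx big1 // => k _;rewrite mderivC /mxeval meval0 mul0r. Qed.
Lemma dmxXk k A X : dmx 'X_k A X = mxvec X 0 k.
rewrite /dmx (bigD1 k) //= mderivX big1 ?addr0=> [|j ji].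
 have ->: (U_(k) - U_(k) = 0 :> 'X_{1..n * n})%MM.
  by apply/mnmP=> i;rewrite mnmBE mnm0E subnn.
 by rewrite mnm1E eqxx scale1r mpolyX0 /mxeval meval1 mul1r.
by rewrite mderivX mnm1E eq_sym (negbTE ji) scale0r /mxeval meval0 mul0r.
Qed.
Lemma dmxX i j A X : dmx 'X_(mxi i j) A X = X i j.
by rewrite dmxXk mxvecE. Qed.

Section MatrixIndex.
Variable P : {mpoly K[n * n]} -> Prop.
Lemma mxp_ind : (forall c, P c%:MP) -> (forall i j, P 'X_(mxi i j)) ->
 (forall p q, P p -> P q -> P (p + q)) ->
 (forall p q, P p -> P q -> P (p * q)) -> forall p, P p.
move=> h1 h2;apply: mpoly_ind'=> // k.
by case/mxvec_indexP: k=> i j;exact: h2.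
Qed.
End MatrixIndex.

Section Pev.
Variables (R : comNzRingType) (f : {rmorphism K -> R}) (M : 'M[R]_n).
Lemma pevD p q : pev f M (p + q) = pev f M p + pev f M q.
exact: mmapD. Qed.
Lemma pevM p q : pev f M (p * q) = pev f M p * pev f M q.
by rewrite /pev rmorphM. Qed.
Lemma pevC c : pev f M c%:MP = f c. exact: mmapC. Qed.
Lemma pevX i j : pev f M 'X_(mxi i j) = M i j.
by rewrite /pev mmapX mmap1U mxvecE. Qed.
(** The chain rule, for any derivation of the target that kills the constants: it is applied to
    [deriv], to Euler fields and to these combined with a time derivative. *)
Lemma pev_derivation (d : R -> R) p : (forall x y, d (x + y) = d x + d y) ->
 (forall x y, d (x * y) = d x * y + x * d y) -> (forall c, d (f c) = 0) ->
 d (pev f M p) = \sum_k pev f M p^`M(k) * mxvec (map_mx d M) 0 k.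
move=> dD dM dC.
have p0: pev f M 0 = 0 by rewrite /pev mmap0.
elim/mpoly_ind': p=> [c|k|p q h1 h2|p q h1 h2].
- by rewrite pevC dC big1 // => k _;rewrite mderivC p0 mul0r.
- rewrite (bigD1 k) //= mderivX big1 ?addr0=> [|j ji].
  have ->: (U_(k) - U_(k) = 0 :> 'X_{1..n * n})%MM.
   by apply/mnmP=> i;rewrite mnmBE mnm0E subnn.
  rewrite mnm1E eqxx scale1r mpolyX0 -mpolyC1 pevC rmorph1 mul1r.
  by rewrite /pev mmapX mmap1U;case/mxvec_indexP: k=> i j;rewrite !mxvecE mxE.
 by rewrite mderivX mnm1E eq_sym (negbTE ji) scale0r p0 mul0r.
- rewrite pevD dD h1 h2 -big_split /=;eqb=> k _.
 by rewrite mderivD pevD mulrDl.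
- rewrite pevM dM h1 h2 mulr_suml mulr_sumr -big_split /=;eqb=> k _.
 by rewrite mderivM pevD !pevM;ring.
Qed.
End Pev.
Lemma pev_morph (R R' : comNzRingType) (f : {rmorphism K -> R}) (g : {rmorphism R -> R'})
 (h : {rmorphism K -> R'}) (M : 'M[R]_n) p : (forall c, g (f c) = h c) ->
 g (pev f M p) = pev h (map_mx g M) p.
move=> gf;elim/mxp_ind: p=> [c|i j|p q h1 h2|p q h1 h2].
- by rewrite !pevC gf.
- by rewrite !pevX mxE.
- by rewrite !pevD rmorphD h1 h2.
- by rewrite !pevM rmorphM h1 h2.
Qed.
Lemma mxeval_pev p A : mxeval p A = pev idfun A p.
by []. Qed.
Definition psub (M : 'M[{mpoly K[n * n]}]_n) p := pev (@mpolyC (n * n) K) M p.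
Definition mev (M : 'M[{mpoly K[n * n]}]_n) A : 'M[K]_n := map_mx (fun q=> mxeval q A) M.
Definition dev (M : 'M[{mpoly K[n * n]}]_n) A X : 'M[K]_n :=
 map_mx (fun q=> dmx q A X) M.
Lemma mevM M N A : mev (M *m N) A = mev M A *m mev N A.
mxP=> i j;rewrite !mxE /mxeval raddf_sum /=;eqb=> k _.
by rewrite mevalM !mxE.
Qed.
Lemma mev_c B A : mev (cmx _ B) A = B.
by mxP=> i j;rewrite !mxE mxevalC. Qed.
Lemma mev_g A : mev gmx A = A.
by mxP=> i j;rewrite !mxE mxevalX. Qed.
Lemma dev_mul M N A X : dev (M *m N) A X = dev M A X *m mev N A + mev M A *m dev N A X.
mxP=> i j;rewrite !mxE -big_split /=.
have dsum (r : seq 'I_n) F : dmx (\sum_(k <- r) F k) A X = \sum_(k <- r) dmx (F k) A X.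
 elim: r=> [|k r IH];last by rewrite !big_cons dmxD IH.
 by rewrite !big_nil -mpolyC0 dmxC.
rewrite dsum;eqb=> k _.
by rewrite dmxM !mxE.
Qed.
Lemma dev_c B A X : dev (cmx _ B) A X = 0.
by mxP=> i j;rewrite !mxE dmxC. Qed.
Lemma dev_g A X : dev gmx A X = X.
by mxP=> i j;rewrite !mxE dmxX. Qed.
Lemma mxevps M p A : mxeval (psub M p) A = mxeval p (mev M A).
elim/mxp_ind: p=> [c|i j|p q h1 h2|p q h1 h2].
- by rewrite /psub pevC !mxevalC.
- by rewrite /psub pevX mxevalX mxE.
- by rewrite /psub pevD !mxevalD h1 h2.
- by rewrite /psub pevM !mxevalM h1 h2.
Qed.
Lemma dmx_psubst M p A X : dmx (psub M p) A X = dmx p (mev M A) (dev M A X).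
elim/mxp_ind: p=> [c|i j|p q h1 h2|p q h1 h2].
- by rewrite /psub pevC !dmxC.
- by rewrite /psub pevX dmxX mxE.
- by rewrite /psub pevD !dmxD h1 h2.
- by rewrite /psub pevM !dmxM h1 h2 !mxevps.
Qed.
(** The derivative of [p] along the polynomial vector field [M] on the space of matrices. *)
Definition vfd (M : 'M[{mpoly K[n * n]}]_n) p :=
 \sum_k p^`M(k) * mxvec M 0 k.
Lemma mxevvf M p A : mxeval (vfd M p) A = dmx p A (mev M A).
rewrite /mxeval raddf_sum /=;eqb=> k _;rewrite mevalM;congr (_ * _).
by case/mxvec_indexP: k=> i j;rewrite !mxvecE mxE.
Qed.
(** The second-order part depends on the field only through its value at [A], so it cancels when two
    fields with the same value there are compared. *)
Lemma dmx_vfield M p A X : dmx (vfd M p) A X =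
 (\sum_k dmx p^`M(k) A X * mxvec (mev M A) 0 k) + dmx p A (dev M A X).
have dsum (r : seq 'I_(n * n)) F : dmx (\sum_(k <- r) F k) A X = \sum_(k <- r) dmx (F k) A X.
 elim: r=> [|k r IH];last by rewrite !big_cons dmxD IH.
 by rewrite !big_nil -mpolyC0 dmxC.
rewrite dsum -big_split /=;eqb=> k _;rewrite dmxM.
by case/mxvec_indexP: k=> i j;rewrite !mxvecE !mxE.
Qed.
End MatrixCalculus.

(** * The Lie algebra of a matrix group *)

Section LieAlgebra.
Variables (K : acf) (n : nat).
Implicit Types (p q : {mpoly K[n * n]}) (A X Y : 'M[K]_n) (S G : set 'M[K]_n)
 (g : 'M[{poly K}]_n).
Lemma LieP G X : Lie G X <->
 forall p, (forall A, G A -> mxeval p A = 0) -> dmx p 1%:M X = 0.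
by []. Qed.
Lemma Lielin G (a : K) X Y : Lie G X -> Lie G Y -> Lie G (a *: X + Y).
by move=> /LieP hX /LieP hY;apply/LieP=> p hp;rewrite linearP /= hX // hY // mulr0 add0r.
Qed.
Lemma Lie0 G : Lie G 0.
by apply/LieP=> p _;rewrite linear0. Qed.
Lemma LieD G X Y : Lie G X -> Lie G Y -> Lie G (X + Y).
by move=> hX hY;rewrite -[X]scale1r;exact: Lielin. Qed.
Lemma LieZ G (a : K) X : Lie G X -> Lie G (a *: X).
by move=> hX;rewrite -[_ *: _]addr0;apply: Lielin=> //;exact: Lie0. Qed.
Lemma LieN G X : Lie G X -> Lie G (- X).
by rewrite -scaleN1r;exact: LieZ. Qed.
Lemma LieB G X Y : Lie G X -> Lie G Y -> Lie G (X - Y).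
by move=> hX hY;apply: LieD=> //;exact: LieN. Qed.
Lemma Lie_sum G (I : Type) (r : seq I) (P : pred I) F :
 (forall i, P i -> Lie G (F i)) -> Lie G (\sum_(i <- r | P i) F i).
by move=> h;elim/big_ind: _=> //;[exact: Lie0|move=> x y;exact: LieD]. Qed.
Lemma Lie_sub G S : G `<=` S -> Lie G `<=` Lie S.
by move=> h X /LieP hX;apply/LieP=> p hp;apply: hX=> A /h;exact: hp. Qed.

Section Group.
Variable G : set 'M[K]_n.
Hypothesis hG : mxgroup G.
Lemma mxgrpU A : G A -> A \in unitmx. by case: hG=> h _ _ _ /h. Qed.
Lemma mxgrp1 : G 1%:M. by case: hG. Qed.
Lemma mxgrpM A B : G A -> G B -> G (A *m B). by case: hG=> _ _ h _;exact: h. Qed.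
Lemma mxgrpV A : G A -> G (invmx A). by case: hG=> _ _ _ h;exact: h. Qed.
Lemma dmx_left p A X : (forall A, G A -> mxeval p A = 0) -> Lie G X -> G A ->
 dmx p A (A *m X) = 0.
move=> hp /LieP hX GA.
have:= hX (psub (cmx _ A *m gmx K n) p).
rewrite dmx_psubst mevM dev_mul mev_c dev_c mev_g dev_g mul0mx add0r mulmx1.
apply=> B GB;rewrite mxevps mevM mev_c mev_g;apply: hp.
exact: mxgrpM.
Qed.
Lemma dmx_right p A X : (forall A, G A -> mxeval p A = 0) -> Lie G X -> G A ->
 dmx p A (X *m A) = 0.
move=> hp /LieP hX GA.
have:= hX (psub (gmx K n *m cmx _ A) p).
rewrite dmx_psubst mevM dev_mul mev_c dev_c mev_g dev_g mulmx0 addr0 mul1mx.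
apply=> B GB;rewrite mxevps mevM mev_c mev_g;apply: hp.
exact: mxgrpM.
Qed.
Lemma Lie_left A X : G A ->
 (forall p, (forall A, G A -> mxeval p A = 0) -> dmx p A X = 0) -> Lie G (invmx A *m X).
move=> GA h;apply/LieP=> p hp.
have:= h (psub (cmx _ (invmx A) *m gmx K n) p).
rewrite dmx_psubst mevM dev_mul mev_c dev_c mev_g dev_g mul0mx add0r.
rewrite mulVmx ?mxgrpU //;apply=> B GB;rewrite mxevps mevM mev_c mev_g.
by apply: hp;apply: mxgrpM=> //;exact: mxgrpV.
Qed.
(** The fields sending [A] to [A Y] and to [Y A] both preserve the ideal of [G] and agree at 1.
    Differentiated there in the direction [X], their second-order parts cancel and the differential
    of [p] at [X, Y] remains. *)
Lemma Lie_lb X Y : Lie G X -> Lie G Y -> Lie G (lb X Y).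
move=> hX hY;apply/LieP=> p hp.
have h1: dmx (vfd (gmx K n *m cmx _ Y) p) 1%:M X = 0.
 apply: (proj1 (LieP G X) hX)=> A GA.
 by rewrite mxevvf mevM mev_c mev_g;exact: dmx_left.
have h2: dmx (vfd (cmx _ Y *m gmx K n) p) 1%:M X = 0.
 apply: (proj1 (LieP G X) hX)=> A GA.
 by rewrite mxevvf mevM mev_c mev_g;exact: dmx_right.
have e1 := dmx_vfield (gmx K n *m cmx _ Y) p 1%:M X.
have e2 := dmx_vfield (cmx _ Y *m gmx K n) p 1%:M X.
rewrite h1 mevM dev_mul mev_c dev_c mev_g dev_g mulmx0 addr0 mul1mx in e1.
rewrite h2 mevM dev_mul mev_c dev_c mev_g dev_g mul0mx add0r mulmx1 in e2.
have e := addrI _ (etrans (esym e1) e2).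
by rewrite /lb linearB /= e subrr.
Qed.
End Group.
Lemma Lie_conj G S A X : A \in unitmx -> (forall B, G B -> S (A *m B *m invmx A)) ->
 Lie G X -> Lie S (A *m X *m invmx A).
move=> uA h /LieP hX;apply/LieP=> p hp.
have:= hX (psub (cmx _ A *m gmx K n *m cmx _ (invmx A)) p).
rewrite dmx_psubst !mevM !dev_mul !mev_c !dev_c !mev_g !dev_g.
rewrite !mul0mx mulmx0 add0r addr0 mulmx1 mulmxV //.
apply=> B GB;rewrite mxevps !mevM !mev_c mev_g;apply: hp;exact: h.
Qed.
Lemma Lie_Ad G A X : mxgroup G -> G A -> Lie G X -> Lie G (A *m X *m invmx A).
move=> hG GA;apply: Lie_conj;first exact: mxgrpU GA.
by move=> B GB;apply: mxgrpM=> //;[exact: mxgrpM|exact: mxgrpV].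
Qed.
Definition hmx (t : K) g : 'M[K]_n := map_mx (hev t) g.
Definition dermx g : 'M[{poly K}]_n := map_mx (@deriv K) g.
Lemma hmxM t g h : hmx t (g *m h) = hmx t g *m hmx t h. exact: map_mxM. Qed.
Lemma hmxD t g h : hmx t (g + h) = hmx t g + hmx t h. exact: map_mxD. Qed.
Lemma hmxC t A : hmx t (map_mx polyC A) = A.
by mxP=> i j;rewrite !mxE /hev hornerC. Qed.
Lemma dermxM g h : dermx (g *m h) = dermx g *m h + g *m dermx h.
mxP=> i j;rewrite !mxE raddf_sum -big_split /=;eqb=> k _.
by rewrite derivM !mxE.
Qed.
Lemma dermxC A : dermx (map_mx polyC A) = 0.
by mxP=> i j;rewrite !mxE derivC. Qed.
Lemma deriv_mxD g h : dermx (g + h) = dermx g + dermx h.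
by mxP=> i j;rewrite !mxE derivD. Qed.
Lemma pev_horner p g t : (pev polyC g p).[t] = mxeval p (hmx t g).
rewrite mxeval_pev -(@pev_morph K n _ _ polyC (hev t) idfun g p) //.
by move=> c;exact: hornerC.
Qed.
Lemma deriv_pev p g :
 (pev polyC g p)^`() = \sum_k pev polyC g p^`M(k) * mxvec (dermx g) 0 k.
by apply: pev_derivation=> [x y|x y|c];[rewrite derivD|rewrite derivM|rewrite derivC].
Qed.
Lemma pev_horner' p g t :
 (pev polyC g p)^`().[t] = dmx p (hmx t g) (hmx t (dermx g)).
rewrite deriv_pev horner_sum;eqb=> k _;rewrite hornerM pev_horner.
by congr (_ * _);case/mxvec_indexP: k=> i j;rewrite !mxvecE !mxE.
Qed.
Lemma poly_zero (d p : {poly K}) : d != 0 ->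
 (forall t, d.[t] != 0 -> p.[t] = 0) -> p = 0.
move=> d0 h;apply/eqP;apply/negP=> /negP p0.
have [k]:= poly_nonroot (mulf_neq0 d0 p0).
by rewrite hornerM mulf_eq0 negb_or=> /andP [h1];rewrite h ?eqxx.
Qed.
(** The zeros of [d] are finitely many exceptional parameters: a polynomial in [t] vanishing outside
    them is 0. *)
Lemma Lie_curve G g d : d != 0 -> (forall t, d.[t] != 0 -> G (hmx t g)) ->
 hmx 0 g = 1%:M -> Lie G (hmx 0 (dermx g)).
move=> d0 h g0;apply/LieP=> p hp;rewrite -g0 -pev_horner'.
suff ->: pev polyC g p = 0 by rewrite deriv0 horner0.
by apply: (poly_zero d0)=> t dt;rewrite pev_horner;apply: hp;exact: h.
Qed.

(** * Exponentials of nilpotent matrices *)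
Definition nilp X := exists k, X ^+ k = 0.
(** Some exponent that kills [X]; by [mexpE] any other gives the same exponential. The default 0
    makes [mexp X] an empty sum when [X] is not nilpotent. *)
Definition nil_index X : nat := xget 0%N [set k | X ^+ k = 0].
Definition mexp X : 'M[K]_n := \sum_(k < nil_index X) (k`!%:R)^-1 *: X ^+ k.
(** exp(tX) with [t] the polynomial variable, so that identities between exponentials follow by
    formal differentiation. *)
Definition pexp X : 'M[{poly K}]_n :=
 \sum_(k < nil_index X) ((k`!%:R)^-1 *: 'X^k) *: map_mx polyC (X ^+ k).
Lemma nil_indexP X : nilp X -> X ^+ nil_index X = 0.
by move=> [k hk];rewrite /nil_index;case: xgetP=> [m _ //|/(_ k)]. Qed.
Lemma exp_nil_ge X k m : X ^+ k = 0 -> (k <= m)%N -> X ^+ m = 0.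
by move=> h km;rewrite -(subnK km) exprD h mulr0. Qed.
Lemma expmxZ (a : K) X k : (a *: X) ^+ k = a ^+ k *: X ^+ k.
elim: k=> [|k IH];first by rewrite !expr0 scale1r.
rewrite !exprS IH;rewrite -[LHS]/((a *: X) *m (a ^+ k *: X ^+ k)).
by rewrite -scalemxAl -scalemxAr scalerA.
Qed.
Lemma nilpZ (a : K) X : nilp X -> nilp (a *: X).
by move=> [k hk];exists k;rewrite expmxZ hk scaler0. Qed.
Lemma exp_sum_nil X k m (F : nat -> K) : X ^+ k = 0 -> X ^+ m = 0 ->
 \sum_(i < k) F i *: X ^+ i = \sum_(i < m) F i *: X ^+ i.
have wlog: forall k m, (k <= m)%N -> X ^+ k = 0 ->
  \sum_(i < k) F i *: X ^+ i = \sum_(i < m) F i *: X ^+ i.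
 move=> {}k {}m km hk;rewrite (big_ord_widen m (fun i=> F i *: X ^+ i) km).
 rewrite [RHS](bigID (fun i : 'I_m=> (i < k)%N)) /= [X in _ + X]big1 ?addr0 // => i.
 by rewrite -leqNgt=> h;rewrite (exp_nil_ge hk h) scaler0.
move=> hk hm;have [h|h]:= leqP k m;first exact: wlog.
by symmetry;apply: wlog=> //;exact: ltnW.
Qed.
Lemma mexpE X m : X ^+ m = 0 -> mexp X = \sum_(i < m) (i`!%:R)^-1 *: X ^+ i.
move=> hm;apply: (exp_sum_nil (fun i=> (i`!%:R)^-1))=> //.
by apply: nil_indexP;exists m.
Qed.
Lemma hpexp X t : nilp X -> hmx t (pexp X) = mexp (t *: X).
move=> hX;have h := nil_indexP hX.
rewrite (@mexpE _ (nil_index X));last by rewrite expmxZ h scaler0.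
mxP=> i j;rewrite mxE !summxE /hev horner_sum.
by eqb=> k _;rewrite expmxZ !mxE hornerM hornerC hornerZ hornerXn;ring.
Qed.
Lemma mexp0 : mexp 0 = 1%:M.
by rewrite (@mexpE _ 1) ?expr1 // big_ord1 expr0 fact0 invr1 scale1r.
Qed.
Lemma dpexp X : nilp X -> dermx (pexp X) = pexp X *m map_mx polyC X.
move=> hX;have h := nil_indexP hX;rewrite /pexp.
case E : (nil_index X)=> [|m].
 by rewrite !big_ord0 mul0mx;mxP=> i j;rewrite !mxE deriv0.
rewrite [in LHS]big_ord_recl [in RHS]big_ord_recr /= mulmxDl.
have ->: ((m`!%:R)^-1 *: 'X^m) *: map_mx polyC (X ^+ m) *m map_mx polyC X = 0.
 have eX: X ^+ m *m X = 0 by rewrite -h E exprSr.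
 by rewrite -scalemxAl -map_mxM /= eX map_mx0 scaler0.
rewrite addr0 deriv_mxD.
have ->: dermx (((0`!%:R)^-1 *: 'X^0) *: map_mx polyC (X ^+ 0)) = 0.
 by mxP=> i j;rewrite !mxE fact0 invr1 scale1r expr0 mul1r derivC.
rewrite add0r mulmx_suml.
have dsum (r : seq 'I_m) F : dermx (\sum_(k <- r) F k) = \sum_(k <- r) dermx (F k).
 elim: r=> [|k r IH];last by rewrite !big_cons deriv_mxD IH.
 by rewrite !big_nil;mxP=> i j;rewrite !mxE deriv0.
rewrite dsum;eqb=> i _.
rewrite -scalemxAl -map_mxM /=.
have eX: X ^+ i *m X = X ^+ i.+1 by rewrite exprSr.
rewrite eX.
mxP=> a b;rewrite !mxE derivM derivC mulr0 addr0 derivZ derivXn.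
rewrite /bump /= add1n factS natrM invfM -mulr_natl.
congr (_ * _);rewrite mulr1 add0n -scaler_nat scalerA;congr (_ *: _).
by rewrite mulrAC mulVf ?mul1r // pnatr_eq0.
Qed.
Lemma mx_deriv0 g : dermx g = 0 -> forall t, hmx t g = hmx 0 g.
move=> h t;mxP=> i j;rewrite !mxE /hev.
have:= congr1 (fun M : 'M[{poly K}]_n=> M i j) h;rewrite !mxE=> e.
suff ->: g i j = ((g i j)`_0)%:P by rewrite !hornerC.
apply/polyP=> k;rewrite coefC;case: k=> [|k] //=.
have:= congr1 (fun p : {poly K}=> p`_k) e;rewrite coef_deriv coef0=> /eqP.
by rewrite mulrn_eq0 /= => /eqP.
Qed.
Lemma nilpN X : nilp X -> nilp (- X).
by rewrite -scaleN1r;exact: nilpZ. Qed.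
Lemma pexp_comm X : nilp X -> pexp X *m map_mx polyC X = map_mx polyC X *m pexp X.
move=> _;rewrite /pexp mulmx_suml mulmx_sumr;eqb=> i _.
rewrite -scalemxAl -scalemxAr -!map_mxM /=;congr (_ *: map_mx _ _).
by rewrite -[LHS]/(X ^+ i * X) -[RHS]/(X * X ^+ i) -exprS -exprSr.
Qed.
(** The derivative of exp(tX) exp(-tX) is 0, and its values at 1 and at 0 are compared. *)
Lemma mexpN X : nilp X -> mexp X *m mexp (- X) = 1%:M.
move=> hX;have hN := nilpN hX.
have:= @mx_deriv0 (pexp X *m pexp (- X)) _ 1.
rewrite !hmxM !hpexp // !scale1r !scale0r mexp0 mulmx1;apply.
rewrite dermxM !dpexp // [pexp (- X) *m _]pexp_comm //.
by rewrite map_mxN mulNmx mulmxN !mulmxA subrr.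
Qed.
Lemma mexpU X : nilp X -> mexp X \in unitmx.
by move=> /mexpN /mulmx1_unit []. Qed.
Lemma mexpV X : nilp X -> invmx (mexp X) = mexp (- X).
move=> hX;rewrite -[RHS]mul1mx -(mulVmx (mexpU hX)) -mulmxA mexpN //.
by rewrite mulmx1.
Qed.
(** The derivative of exp(tX) Y exp(-tX) is the same curve with [X, Y] in place of [Y]. So the
    Taylor coefficients at 0 are iterated brackets, and they stop at [m]. *)
Lemma mexp_Ad X Y m : nilp X -> iter m (lb X) Y = 0 ->
 mexp X *m Y *m mexp (- X) = \sum_(k < m) (k`!%:R)^-1 *: iter k (lb X) Y.
move=> hX hm;have hN := nilpN hX.
pose F j := pexp X *m map_mx polyC (iter j (lb X) Y) *m pexp (- X).
have dF j: dermx (F j) = F j.+1.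
 rewrite /F !dermxM !dpexp // dermxC mulmx0 addr0.
 rewrite [pexp (- X) *m _]pexp_comm // map_mxN mulNmx mulmxN /= /lb.
 rewrite map_mxB !map_mxM /= mulmxBr mulmxBl;congr (_ - _);rewrite !mulmxA //.
have F0 j: hmx 0 (F j) = iter j (lb X) Y.
 by rewrite /F !hmxM !hpexp // hmxC !scale0r mexp0 mul1mx mulmx1.
have cF k: forall j a b, (F j a b)`_k *+ k`! = iter (j + k) (lb X) Y a b.
 elim: k=> [|k IH] j a b.
  by rewrite fact0 mulr1n addn0 -F0 /hmx [RHS]mxE;apply/esym;exact: horner_coef0.
 have dE M: dermx M a b = (M a b)^`() by rewrite mxE.
 by rewrite addnS -addSn -IH -dF dE coef_deriv -mulrnA factS.
have zero k: (m <= k)%N -> iter k (lb X) Y = 0.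
 move=> h;rewrite -(subnK h) iterD hm;elim: (k - m)%N=> //= i ->.
 by rewrite /lb mulmx0 mul0mx subrr.
have fact_neq0 k: (k`!%:R : K) != 0 by rewrite pnatr_eq0 -lt0n fact_gt0.
have ->: mexp X *m Y *m mexp (- X) = hmx 1 (F 0).
 by rewrite /F !hmxM !hpexp // hmxC !scale1r.
mxP=> a b;rewrite mxE /hev summxE.
have cE k: (F 0 a b)`_k = (k`!%:R)^-1 * iter k (lb X) Y a b.
 by apply: (mulfI (fact_neq0 k));rewrite mulVKf // mulr_natl cF add0n.
have sz: (size (F 0 a b) <= m)%N.
 apply/leq_sizeP=> k hk;rewrite cE zero // mxE mulr0 //.
rewrite (horner_coef_wide _ sz);eqb=> k _.
by rewrite expr1n mulr1 cE !mxE.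
Qed.

Section Closed.
Variable G : set 'M[K]_n.
Hypothesis hG : alg_group G.
Lemma alg_group_eqs A : A \in unitmx ->
 (forall p, (forall A, G A -> mxeval p A = 0) -> mxeval p A = 0) -> G A.
case: hG=> _ [I eI] uA h;rewrite eI;split=> // p Ip;apply: h=> B.
by rewrite eI=> -[_];apply.
Qed.
(** If [p] vanishes on [G], then the derivative of p(exp(tX)) in [t] is q(exp(tX)), where [q] is the
    derivative of [p] along the field sending [A] to [A X]; it vanishes on [G] again. Hence all
    Taylor coefficients at 0 vanish. *)
Lemma mexp_grp X (t : K) : Lie G X -> nilp X -> G (mexp (t *: X)).
move=> hX nX;apply: alg_group_eqs;first exact/mexpU/nilpZ.
move=> p hp;rewrite -hpexp // -pev_horner.
have hGg: mxgroup G by case: hG.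
suff ->: pev polyC (pexp X) p = 0 by rewrite horner0.
apply/polyP=> k;rewrite coef0;elim: k p hp=> [|k IH] p hp.
 rewrite -horner_coef0 pev_horner hpexp // scale0r mexp0;apply: hp.
 exact: mxgrp1.
have:= IH (vfd (gmx K n *m cmx _ X) p).
have ->: pev polyC (pexp X) (vfd (gmx K n *m cmx _ X) p) = (pev polyC (pexp X) p)^`().
 rewrite deriv_pev /pev raddf_sum /=;eqb=> i _.
 rewrite -[LHS]/(pev polyC (pexp X) _) pevM;congr (_ * _).
 rewrite dpexp //;case/mxvec_indexP: i=> i j;rewrite !mxvecE !mxE.
 rewrite /pev raddf_sum /=;eqb=> k' _.
 rewrite -[LHS]/(pev polyC (pexp X) _) pevM !mxE pevX pevC //.
rewrite coef_deriv=> h;apply/eqP.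
have : (pev polyC (pexp X) p)`_k.+1 *+ k.+1 = 0.
 by apply: h=> A GA;rewrite mxevvf mevM mev_c mev_g;exact: dmx_left GA.
by move/eqP;rewrite mulrn_eq0.
Qed.
End Closed.
End LieAlgebra.

(** * Zariski closures and generated groups *)

Section ZariskiClosure.
Variables (K : acf) (n : nat).
Implicit Types (p q : {mpoly K[n * n]}) (A B X Y : 'M[K]_n) (S G : set 'M[K]_n)
 (F : set (set 'M[K]_n)).
Definition vanish S p := forall A, S A -> mxeval p A = 0.
Definition zcl S : set 'M[K]_n :=
 [set A | A \in unitmx /\ forall p, vanish S p -> mxeval p A = 0].
(** Connectedness, and below irreducibility, are phrased by polynomials for arbitrary sets, so that
    they can be established for generated groups before closures are taken. *)
Definition sconn S := forall I1 I2 : set {mpoly K[n * n]},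
 (forall A, S A -> zero_locus I1 A \/ zero_locus I2 A) ->
 (forall A, S A -> zero_locus I1 A -> zero_locus I2 A -> False) ->
 S `<=` zero_locus I1 \/ S `<=` zero_locus I2.
Definition sirr S := forall p q,
 (forall A, S A -> mxeval p A = 0 \/ mxeval q A = 0) -> vanish S p \/ vanish S q.
Lemma sirr_sconn S : sirr S -> sconn S.
move=> h I1 I2 hc _;apply: contrapT=> /not_orP [h1 h2].
have [A1 [S1 [p1 [Ip1 e1]]]]: exists A, S A /\ exists p, I1 p /\ mxeval p A != 0.
 apply: contrapT=> h';apply: h1=> A SA p Ip;apply/eqP/negP=> /negP e.
 by apply: h';exists A;split=> //;exists p.
have [A2 [S2 [p2 [Ip2 e2]]]]: exists A, S A /\ exists p, I2 p /\ mxeval p A != 0.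
 apply: contrapT=> h';apply: h2=> A SA p Ip;apply/eqP/negP=> /negP e.
 by apply: h';exists A;split=> //;exists p.
have [A SA|/(_ A1 S1)/eqP|/(_ A2 S2)/eqP]:= h p1 p2.
- by case: (hc A SA)=> hA;[left|right];apply: hA.
- by rewrite (negbTE e1).
- by rewrite (negbTE e2).
Qed.
Lemma zconnected_sconn G : zconnected G -> sconn G.
move=> h I1 I2 hc hd.
have [||||h1|h2]:= h (G `&` zero_locus I1) (G `&` zero_locus I2).
- by exists I1.
- by exists I2.
- apply/seteqP;split=> [A [[]|[]]|A GA] //.
 by case: (hc A GA)=> hA;[left|right].
- by apply/seteqP;split=> // A [[GA h1] [_ h2]];exact: hd h1 h2.
- right=> A GA;case: (hc A GA)=> // hA.
 by have : (G `&` zero_locus I1) A by [];rewrite h1.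
- left=> A GA;case: (hc A GA)=> // hA.
 by have : (G `&` zero_locus I2) A by [];rewrite h2.
Qed.
Lemma zcl_vanish S p : vanish S p -> vanish (zcl S) p.
by move=> h A [_];apply. Qed.
Lemma zcl_sub S : S `<=` @GLset K n -> S `<=` zcl S.
by move=> h A SA;split;[exact: h|move=> p;apply]. Qed.
Lemma sconn_zcl S : S `<=` @GLset K n -> sconn S -> zconnected (zcl S).
move=> hGL h Z1 Z2 [I1 ->] [I2 ->] hU hI.
have sub A (SA : S A) := zcl_sub hGL SA.
have cl I: S `<=` zero_locus I -> zcl S `<=` zero_locus I.
 by move=> hI' A hA p Ip;apply: zcl_vanish hA=> B /hI';apply.
have [A SA|A SA h1 h2|h1|h2]:= h I1 I2.
- have : (zcl S) A by exact: sub.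
 by rewrite -hU=> -[[_ ?]|[_ ?]];[left|right].
- by have : (set0 : set 'M[K]_n) A;[rewrite -hI;split;split=> //;exact: sub|].
- right;apply/seteqP;split=> // A [SA hA].
 by rewrite -hI;split;split=> //;exact: (cl _ h1).
- left;apply/seteqP;split=> // A [SA hA].
 by rewrite -hI;split;split=> //;exact: (cl _ h2).
Qed.
Lemma mxeval_det A : mxeval (\det (gmx K n)) A = \det A.
rewrite /mxeval -det_map_mx;congr (\det _);mxP=> i j.
by rewrite 2!mxE;exact: etrans (mevalXU _ _) (mxvecE _ _ _).
Qed.
Lemma mxeval_adj A i j : mxeval ((\adj (gmx K n)) i j) A = (\adj A) i j.
have e: map_mx (meval (fun k=> mxvec A 0 k)) (gmx K n) = A.
 by mxP=> a b;rewrite 2!mxE;exact: etrans (mevalXU _ _) (mxvecE _ _ _).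
have:= map_mx_adj (meval (fun k=> mxvec A 0 k)) (gmx K n).
by rewrite e=> /matrixP /(_ i j) <-;rewrite [RHS]mxE.
Qed.
(** Inversion is polynomial up to a power of the determinant; this is what carries inverses over to
    closures. *)
Lemma poly_inv p : exists N q, forall A, A \in unitmx ->
 mxeval q A = \det A ^+ N * mxeval p (invmx A).
elim/mxp_ind: p=> [c|i j|p q [N1 [q1 h1]] [N2 [q2 h2]]|p q [N1 [q1 h1]] [N2 [q2 h2]]].
- by exists 0%N, c%:MP=> A _;rewrite !mxevalC mul1r.
- exists 1%N, ((\adj (gmx K n)) i j)=> A uA.
 have ->: mxeval 'X_(mxi i j) (invmx A) = (\det A)^-1 * (\adj A) i j.
  by rewrite mxevalX /invmx uA mxE.
 rewrite mxeval_adj expr1 mulVKf //.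
 by rewrite -unitfE -unitmxE.
- exists (N1 + N2)%N, (q1 * \det (gmx K n) ^+ N2 + q2 * \det (gmx K n) ^+ N1)=> A uA.
 rewrite !mxevalD !mxevalM h1 // h2 // /mxeval !rmorphXn /= -!/(mxeval _ _) mxeval_det.
 by rewrite exprD;ring.
- exists (N1 + N2)%N, (q1 * q2)=> A uA.
 by rewrite !mxevalM h1 // h2 // exprD;ring.
Qed.
Lemma mxgroup_zcl S : mxgroup S -> mxgroup (zcl S).
move=> hS;have hGL: S `<=` @GLset K n by case: hS.
(* The factors are moved to the closure one after the other: here only the left one. *)
have right A B: zcl S A -> S B -> zcl S (A *m B).
 move=> [uA hA] SB;split;first by rewrite unitmx_mul uA hGL.
 move=> p hp;have:= hA (psub (gmx K n *m cmx _ B) p).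
 rewrite mxevps mevM mev_c mev_g;apply=> C SC.
 by rewrite mxevps mevM mev_c mev_g;apply: hp;exact: mxgrpM.
split.
- by move=> A [].
- by apply: zcl_sub=> //;exact: mxgrp1.
- move=> A B hA [uB hB];split;first by rewrite unitmx_mul uB andbT;case: hA.
 move=> p hp;have:= hB (psub (cmx _ A *m gmx K n) p).
 rewrite mxevps mevM mev_c mev_g;apply=> C SC.
 rewrite mxevps mevM mev_c mev_g;apply: zcl_vanish hp _ _.
 exact: right.
- move=> A [uA hA];split;first by rewrite unitmx_inv.
 move=> p hp;have [N [q hq]]:= poly_inv p.
 have:= hA q;rewrite hq // => h;apply/eqP.
 have : \det A ^+ N * mxeval p (invmx A) = 0.
  apply: h=> B SB;rewrite hq ?hGL // hp ?mulr0 //;exact: mxgrpV.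
 move/eqP;rewrite mulf_eq0 expf_eq0;case/orP=> // /andP [_ /eqP d0].
 by move: uA;rewrite unitmxE d0 unitr0.
Qed.
Lemma alg_group_zcl S : mxgroup S -> alg_group (zcl S).
move=> hS;split;first exact: mxgroup_zcl.
exists [set p | vanish S p];apply/seteqP;split=> A.
 by move=> [uA hA];split=> // p;exact: hA.
by move=> [uA hA];split=> // p hp;exact: hA.
Qed.
Lemma alg_group_zcl_sub G S : alg_group G -> S `<=` G -> zcl S `<=` G.
by move=> hG hS A [uA hA];apply: alg_group_eqs=> // p hp;apply: hA=> B /hS;exact: hp.
Qed.
Lemma conn_group_zcl S : mxgroup S -> sconn S -> conn_group (zcl S).
move=> hS hc;split;first exact: alg_group_zcl.
by apply: sconn_zcl=> //;case: hS.
Qed.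
Inductive gen F : 'M[K]_n -> Prop :=
| gen1 : gen F 1%:M
| genM A C B : gen F A -> F C -> C B -> gen F (A *m B).
Definition gen_fam F := forall C, F C ->
 [/\ C 1%:M, C `<=` @GLset K n & forall A, C A -> C (invmx A)].
Lemma gen_mul F A B : gen F A -> gen F B -> gen F (A *m B).
move=> hA;elim=> [|B' C c _ IH FC Cc];first by rewrite mulmx1.
by rewrite mulmxA;apply: genM FC Cc.
Qed.
Lemma gen_gen F C B : F C -> C B -> gen F B.
by move=> FC CB;rewrite -[B]mul1mx;apply: genM FC CB;exact: gen1. Qed.
Lemma mxgrp_gen F : gen_fam F -> mxgroup (gen F : set 'M[K]_n).
move=> hF.
have hGL A: gen F A -> A \in unitmx.
 elim=> [|B C c _ uB FC Cc];first exact: unitmx1.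
 by rewrite unitmx_mul uB;case: (hF C FC)=> _ h _;exact: h.
split=> //;[exact: gen1|by move=> A B;exact: gen_mul|].
move=> A;elim=> [|B C c hB IH FC Cc];first by rewrite invmx1;exact: gen1.
case: (hF C FC)=> _ h hi.
have uc := h c Cc;have uB := hGL B hB.
have ->: invmx (B *m c) = invmx c *m invmx B.
 have uBc: B *m c \in unitmx by rewrite unitmx_mul uB.
 by rewrite -[RHS](mulKmx uBc) !mulmxA -(mulmxA _ c) mulmxV // mulmx1 mulmxK.
by apply: gen_mul=> //;apply: gen_gen FC _;exact: hi.
Qed.
Lemma gen_sub F G : mxgroup G -> (forall C, F C -> C `<=` G) -> gen F `<=` G.
move=> hG h A;elim=> [|B C c _ IH FC Cc];first exact: mxgrp1.
by apply: mxgrpM=> //;exact: h FC _ Cc.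
Qed.
Definition ltr A p := psub (cmx _ A *m gmx K n) p.
Definition rtr A p := psub (gmx K n *m cmx _ A) p.
Lemma mxev_l A p B : mxeval (ltr A p) B = mxeval p (A *m B).
by rewrite mxevps mevM mev_c mev_g. Qed.
Lemma mxev_r A p B : mxeval (rtr A p) B = mxeval p (B *m A).
by rewrite mxevps mevM mev_c mev_g. Qed.
(** Induction on words: if [B] lies in the first closed set, so does [B C] for a connected member
    [C] of the family, since [C] contains 1. *)
Lemma sconn_gen F : (forall C, F C -> C 1%:M /\ sconn C) -> sconn (gen F).
move=> hF I1 I2 hc hd.
wlog h1 : I1 I2 hc hd / zero_locus I1 1%:M.
 move=> hw;case: (hc 1%:M (gen1 F))=> h1;first exact: hw.
 case: (hw I2 I1)=> //.
 - by move=> A /hc [] h;[right|left].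
 - by move=> A hA h2 h3;exact: hd hA h3 h2.
 - by right.
 - by left.
left=> A;elim=> // B C c hB IH FC Cc.
have [C1 hC]:= hF C FC.
have tr I D: zero_locus [set ltr B p | p in I] D <-> zero_locus I (B *m D).
 split=> [h p Ip|h _ [p Ip <-]];last by rewrite mxev_l;exact: h.
 by rewrite -mxev_l;apply: h;exists p.
have hBD D: C D -> gen F (B *m D) by move=> CD;exact: genM FC CD.
have [D CD|D CD /tr h /tr h'|h|h]:= hC [set ltr B p | p in I1] [set ltr B p | p in I2].
- by case: (hc _ (hBD D CD))=> h;[left|right];apply/tr.
- exact: hd (hBD D CD) h h'.
- by have /tr := h c Cc.
- have /tr := h _ C1;rewrite mulmx1=> h';case: (hd B hB IH h').
Qed.
(** Given points where [p] and [q] do not vanish, the word that leads from the first to the second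
    is shortened letter by letter. Translated to a member of the family, [p] is nonzero at 1 and [q]
    at the letter, so irreducibility of the member yields a point where both are nonzero. *)
Lemma sirr_gen F : gen_fam F -> (forall C, F C -> sirr C) -> sirr (gen F).
move=> hF hC.
have hG := mxgrp_gen hF.
have key: forall w, gen F w -> forall p q A, gen F A -> mxeval p A != 0 ->
  mxeval q (A *m w) != 0 -> exists B, [/\ gen F B, mxeval p B != 0 & mxeval q B != 0].
 move=> w;elim=> [|w' C c hw' IH FC Cc] p q A hA pA.
  by rewrite mulmx1=> qA;exists A.
 rewrite mulmxA -mxev_r=> qA.
 have [B [hB pB]]:= IH p _ A hA pA qA;rewrite mxev_r=> qB.
 have [C1 _ _]:= hF C FC.
 apply: contrapT=> h.
 have [D CD|/(_ _ C1)/eqP|/(_ _ Cc)/eqP]:= hC C FC (ltr B p) (ltr B q).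
 - rewrite !mxev_l;apply: contrapT=> /not_orP [/eqP h1 /eqP h2];apply: h.
  by exists (B *m D);split=> //;exact: genM FC CD.
 - by rewrite mxev_l mulmx1 (negbTE pB).
 - by rewrite mxev_l (negbTE qB).
move=> p q h;apply: contrapT=> /not_orP [h1 h2].
have [A [hA pA]]: exists A, gen F A /\ mxeval p A != 0.
 apply: contrapT=> h';apply: h1=> A hA;apply/eqP/negP=> /negP e.
 by apply: h';exists A.
have [B [hB qB]]: exists A, gen F A /\ mxeval q A != 0.
 apply: contrapT=> h';apply: h2=> A' hA';apply/eqP/negP=> /negP e.
 by apply: h';exists A'.
have hw: gen F (invmx A *m B) by apply: gen_mul=> //;exact: (mxgrpV hG).
have [|D [hD pD qD]]:= key _ hw p q A hA pA.
 by rewrite mulmxA mulmxV ?mul1mx //;exact: (mxgrpU hG).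
by case: (h D hD)=> /eqP;[rewrite (negbTE pD)|rewrite (negbTE qD)].
Qed.
Lemma sirr_zcl S : sirr S -> S `<=` @GLset K n -> sirr (zcl S).
move=> h hGL p q hpq;have [A SA|hp|hq]:= h p q.
- by apply: hpq;exact: zcl_sub.
- by left;exact: zcl_vanish.
- by right;exact: zcl_vanish.
Qed.
Lemma zcl_normal S G : mxgroup G -> S `<=` @GLset K n ->
 (forall g x, G g -> S x -> S (g *m x *m invmx g)) -> mx_normal (zcl S) G.
move=> hG hGL h g x Gg [ux hx].
have ug := mxgrpU hG Gg.
split;first by rewrite !unitmx_mul ug ux unitmx_inv.
move=> p hp;have:= hx (ltr g (rtr (invmx g) p)).
rewrite mxev_l mxev_r;apply=> A SA.
by rewrite mxev_l mxev_r;apply: hp;exact: h.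
Qed.
Lemma gen_normal F G : mxgroup G -> (forall C g, F C -> G g ->
  F [set g *m c *m invmx g | c in C]) ->
 forall g x, G g -> gen F x -> gen F (g *m x *m invmx g).
move=> hG h g x Gg;have ug := mxgrpU hG Gg.
elim=> [|A C c hA IH FC Cc];first by rewrite mulmx1 mulmxV //;exact: gen1.
have ->: g *m (A *m c) *m invmx g = (g *m A *m invmx g) *m (g *m c *m invmx g).
 by rewrite !mulmxA mulmxKV.
apply: genM (h C g FC Gg) _=> //;by exists c.
Qed.

(** * Rational curves *)
Lemma frac_curve_poly (gam : 'M[{poly K}]_n) (e : {poly K}) p : exists N P,
 forall t, e.[t] != 0 -> P.[t] = e.[t] ^+ N * mxeval p (e.[t]^-1 *: hmx t gam).
elim/mxp_ind: p=> [c|i j|p q [N1 [q1 h1]] [N2 [q2 h2]]|p q [N1 [q1 h1]] [N2 [q2 h2]]].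
- by exists 0%N, c%:P=> t _;rewrite mxevalC hornerC mul1r.
- by exists 1%N, (gam i j)=> t et;rewrite mxevalX !mxE mulVKf.
- exists (N1 + N2)%N, (q1 * e ^+ N2 + q2 * e ^+ N1)=> t et.
 by rewrite hornerD !hornerM h1 // h2 // !horner_exp mxevalD exprD;ring.
- exists (N1 + N2)%N, (q1 * q2)=> t et.
 by rewrite hornerM h1 // h2 // mxevalM exprD;ring.
Qed.
(** Up to powers of the denominator, polynomial functions along the curve are polynomials in one
    variable, which have no zero divisors. *)
Lemma sirr_frac_curve (gam : 'M[{poly K}]_n) (e : {poly K}) : e != 0 ->
 sirr [set e.[t]^-1 *: hmx t gam | t in [set t | e.[t] != 0]].
move=> e0 p q h.
have [N1 [P1 h1]]:= frac_curve_poly gam e p.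
have [N2 [P2 h2]]:= frac_curve_poly gam e q.
have : P1 * P2 = 0.
 apply: (poly_zero e0)=> t et;rewrite hornerM h1 // h2 //.
 have [|->|->]:= h (e.[t]^-1 *: hmx t gam);first by exists t.
  by rewrite mulr0 mul0r.
 by rewrite !mulr0.
move/eqP;rewrite mulf_eq0=> /orP [] /eqP P0;[left|right].
- move=> _ [t et <-];apply/eqP;have:= h1 t et;rewrite P0 horner0=> /esym/eqP.
 by rewrite mulf_eq0 expf_eq0 (negbTE et) andbF.
- move=> _ [t et <-];apply/eqP;have:= h2 t et;rewrite P0 horner0=> /esym/eqP.
 by rewrite mulf_eq0 expf_eq0 (negbTE et) andbF.
Qed.
Definition expcv X : set 'M[K]_n := [set mexp (t *: X) | t in setT].
Definition exp_fam G : set (set 'M[K]_n) :=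
 [set C | exists X, [/\ Lie G X, nilp X & C = expcv X]].
Lemma exp_fam2 G : gen_fam (exp_fam G).
move=> _ [X [hX nX ->]];split.
- by exists 0=> //;rewrite scale0r mexp0.
- by move=> _ [t _ <-];apply/mexpU/nilpZ.
- move=> _ [t _ <-];exists (- t)=> //.
 by rewrite mexpV ?scaleNr //;exact: nilpZ.
Qed.
Lemma sirr_exp_curve X : nilp X -> sirr (expcv X).
move=> nX;have:= @sirr_frac_curve (pexp X) 1 (oner_neq0 _).
congr sirr;apply/seteqP;split=> A [t _ <-];exists t=> //=.
- by rewrite hornerC invr1 scale1r hpexp.
- by rewrite hornerC oner_neq0.
- by rewrite hornerC invr1 scale1r hpexp.
Qed.
Lemma mexp_conj A X : A \in unitmx -> nilp X ->
 A *m mexp X *m invmx A = mexp (A *m X *m invmx A) /\ nilp (A *m X *m invmx A).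
move=> uA [k hk].
have eX i: (A *m X *m invmx A) ^+ i = A *m X ^+ i *m invmx A.
 elim: i=> [|i IH];first by rewrite !expr0 mulmx1 mulmxV.
 rewrite !exprS IH -[LHS]/((A *m X *m invmx A) *m (A *m X ^+ i *m invmx A)).
 by rewrite -[X * X ^+ i]/(X *m X ^+ i) !mulmxA mulmxKV.
have hk': (A *m X *m invmx A) ^+ k = 0 by rewrite eX hk mulmx0 mul0mx.
split;last by exists k.
rewrite (mexpE hk) (mexpE hk') mulmx_sumr mulmx_suml;eqb=> i _.
by rewrite eX -scalemxAr -scalemxAl.
Qed.
Lemma exp_family_normal G C g : mxgroup G -> exp_fam G C -> G g ->
 exp_fam G [set g *m c *m invmx g | c in C].
move=> hG [X [hX nX ->]] Gg;have ug := mxgrpU hG Gg.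
have [e n']:= mexp_conj ug nX.
exists (g *m X *m invmx g);split=> //;first exact: Lie_Ad.
apply/seteqP;split=> A.
 move=> [_ [t _ <-] <-];exists t=> //.
 have [-> _]:= mexp_conj ug (nilpZ t nX).
 by rewrite -scalemxAr -scalemxAl.
move=> [t _ <-];exists (mexp (t *: X));first by exists t.
have [-> _]:= mexp_conj ug (nilpZ t nX).
by rewrite -scalemxAr -scalemxAl.
Qed.

Section SimpleExp.
Variable G : set 'M[K]_n.
Hypothesis hG : simple_group G.
Lemma simple_conn : conn_group G. by case: hG. Qed.
Lemma simple_alg : alg_group G. by case: simple_conn. Qed.
Lemma simple_grp : mxgroup G. by case: simple_alg. Qed.
Lemma simple_normal S : mxgroup S -> sconn S -> S `<=` G ->
 (forall g x, G g -> S x -> S (g *m x *m invmx g)) -> S `<=` [set 1%:M] \/ zcl S = G.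
move=> hS hc hSG hn;case: hG=> _ _ h.
have hGL: S `<=` @GLset K n by case: hS.
have [|||h1|h1]:= h (zcl S);last by right.
- exact: conn_group_zcl.
- exact: alg_group_zcl_sub simple_alg _.
- exact: zcl_normal simple_grp _ _.
- by left;rewrite -h1;exact: zcl_sub.
Qed.
Lemma mexp_eq1 X : nilp X -> (forall t, mexp (t *: X) = 1%:M) -> X = 0.
move=> nX h;have:= dpexp nX=> /(congr1 (hmx 0)).
rewrite hmxM hmxC hpexp // scale0r mexp0 mul1mx=> <-.
suff ->: pexp X = map_mx polyC 1%:M by rewrite dermxC;mxP=> i j;rewrite !mxE /hev horner0.
mxP=> i j;sub0P.
apply: (@poly_zero K 1)=> [|t _];first exact: oner_neq0.
rewrite hornerD hornerN;have:= congr1 (fun M : 'M[K]_n=> M i j) (hpexp t nX).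
by rewrite h !mxE /hev=> ->;rewrite hornerC subrr.
Qed.

(** Exponentials of nilpotent elements generate a normal subgroup with connected closure, and by
    simplicity one nontrivial exponential makes this closure all of [G]. *)
Theorem simple_exp : (exists X, [/\ Lie G X, nilp X & X != 0]) ->
 zcl (gen (exp_fam G)) = G.
move=> [X [hX nX X0]].
have [||||h|//]:= @simple_normal (gen (exp_fam G)).
- exact/mxgrp_gen/exp_fam2.
- apply: sirr_sconn;apply: sirr_gen;first exact: exp_fam2.
 by move=> _ [Y [_ nY ->]];exact: sirr_exp_curve.
- apply: gen_sub simple_grp _=> _ [Y [hY nY ->]] _ [t _ <-].
 exact: mexp_grp simple_alg _ _ _ _.
- by apply: gen_normal simple_grp _=> C g;exact: exp_family_normal simple_grp.
case/eqP: X0;apply: mexp_eq1=> // t;apply: h.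
by apply: (@gen_gen _ (expcv X));[exists X|exists t].
Qed.
Hypothesis hexp : zcl (gen (exp_fam G)) = G.
Lemma simple_irreducible : sirr G.
rewrite -hexp;apply: sirr_zcl;last by case: (mxgrp_gen (@exp_fam2 G)).
apply: sirr_gen;first exact: exp_fam2.
by move=> _ [Y [_ nY ->]];exact: sirr_exp_curve.
Qed.
(** The determinant of exp(tX) is a polynomial in [t] without zeros, hence constant. *)
Lemma det_mexp X : nilp X -> \det (mexp X) = 1.
move=> nX;have hd t: (\det (pexp X)).[t] = \det (mexp (t *: X)).
 by rewrite -hpexp // /hmx det_map_mx.
have : size (\det (pexp X)) == 1%N.
 apply/negPn/negP=> /closed_rootP [t /rootP];rewrite hd=> h.
 by have:= mexpU (nilpZ t nX);rewrite unitmxE h unitr0.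
move=> /eqP sz;have e: \det (pexp X) = ((\det (pexp X))`_0)%:P by apply: size1_polyC;rewrite sz.
have:= hd 1;rewrite scale1r=> <-;have:= hd 0;rewrite scale0r mexp0 det1=> <-.
by rewrite e !hornerC.
Qed.
(** With determinant 1 the inverse is the adjugate, hence polynomial on [G], and closed subgroups of
    [G] are closed among all matrices. *)
Lemma det1G A : G A -> \det A = 1.
rewrite -hexp=> -[_ h];have:= h (\det (gmx K n) - 1%:MP).
rewrite /mxeval mevalB -!/(mxeval _ _) mxeval_det mxevalC=> h1.
apply/eqP;rewrite -subr_eq0;apply/eqP/h1=> B hB.
rewrite /mxeval mevalB -!/(mxeval _ _) mxeval_det mxevalC.
apply/eqP;rewrite subr_eq0;apply/eqP;elim: hB=> [|B' C c _ IH [Y [_ nY ->]] [t _ <-]].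
 exact: det1.
by rewrite det_mulmx IH det_mexp ?mulr1 //;exact: nilpZ.
Qed.
Lemma closed_in_det1 S A : alg_group S -> S `<=` G ->
 (forall p, vanish S p -> mxeval p A = 0) -> S A.
move=> hS hSG h;apply: alg_group_eqs=> //.
have : mxeval (\det (gmx K n) - 1%:MP) A = 0.
 apply: h=> B /hSG GB;rewrite /mxeval mevalB -!/(mxeval _ _) mxeval_det mxevalC.
 by rewrite det1G ?subrr.
rewrite /mxeval mevalB -!/(mxeval _ _) mxeval_det mxevalC=> /eqP.
by rewrite subr_eq0 unitmxE=> /eqP ->;exact: unitr1.
Qed.
End SimpleExp.
End ZariskiClosure.

(** * Jordan decomposition and one-parameter tori *)
Lemma derivn_mulXsubC (K : fieldType) (g : {poly K}) a k j : (j <= k)%N ->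
 exists2 g', (g * ('X - a%:P) ^+ k)^`(j) = g' * ('X - a%:P) ^+ (k - j) &
  g'.[a] = (k ^_ j)%:R * g.[a].
elim: j=> [|j IH] jk;first by exists g;rewrite ?subn0 // ffactn0 mul1r.
have [g' e h]:= IH (ltnW jk).
have ek: (k - j = (k - j.+1).+1)%N by lia.
rewrite ek in e.
exists (g'^`() * ('X - a%:P) + g' *+ (k - j.+1).+1).
 rewrite derivnS e derivM deriv_exp derivXsubC mul1r /= exprS.
 by rewrite [RHS]mulrDl -mulrA mulrnAr mulrnAl.
rewrite hornerD hornerM hornerXsubC subrr mulr0 add0r hornerMn h.
by rewrite -ek ffactnSr natrM -mulr_natr;ring.
Qed.
Lemma map_polyC0 (R : nzRingType) (f : R -> R) c : f 0 = 0 -> map_poly f c%:P = (f c)%:P.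
by move=> f0;apply/polyP=> i;rewrite coef_map_id0 // !coefC;case: ifP.
Qed.

Section JordanLie.
Variables (K : acf) (n : nat).
Implicit Types (Q S N X : 'M[K]_n) (s y : 'rV[K]_n) (m : 'rV[int]_n) (G : set 'M[K]_n).
Definition qdiag Q s := invmx Q *m diag_mx s *m Q.
Definition qlam Q m (w : K) := qdiag Q (\row_i (w ^ m 0 i)).
(** The [y] that satisfy every integer relation between the coordinates of [s] form the Lie algebra
    of the smallest diagonal torus whose Lie algebra contains [s]. *)
Definition rel_le s y := forall l : 'rV[int]_n,
 \sum_i (l 0 i)%:~R * s 0 i = 0 -> \sum_i (l 0 i)%:~R * y 0 i = 0.

Section EulerField.
Variable y : 'rV[K]_n.
(** The vector field whose flow multiplies the coordinate [i] by exp(t y_i); the monomials are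
    eigenvectors, with eigenvalues [mu]. *)
Definition euler (q : {mpoly K[n]}) : {mpoly K[n]} :=
 \sum_i (y 0 i)%:MP * 'X_i * q^`M(i).
Definition mu (l : 'X_{1..n}) : K := \sum_i (l i)%:R * y 0 i.
Lemma eulerD p q : euler (p + q) = euler p + euler q.
by rewrite /euler -big_split /=;eqb=> i _;rewrite mderivD mulrDr.
Qed.
Lemma eulerM p q : euler (p * q) = euler p * q + p * euler q.
rewrite /euler mulr_suml mulr_sumr -big_split /=;eqb=> i _.
by rewrite mderivM;ring.
Qed.
Lemma eulerC c : euler c%:MP = 0.
by rewrite /euler big1 // => i _;rewrite mderivC mulr0. Qed.
Lemma euler0 : euler 0 = 0. by rewrite -mpolyC0 eulerC. Qed.
Lemma eulerX l : euler 'X_[l] = mu l *: 'X_[l].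
rewrite /euler /mu scaler_suml;eqb=> i _;rewrite mderivX.
case E : (l i)=> [|k];first by rewrite !scale0r mul0r scale0r mulr0.
have eX: 'X_i * 'X_[l - U_(i)] = 'X_[l] :> {mpoly K[n]}.
 rewrite -mpolyXD;congr 'X_[_];apply/mnmP=> j;rewrite mnmDE mnmBE mnm1E.
 by case: eqP=> [<-|_];rewrite ?E ?add0n ?subn0 // add1n subn1.
by rewrite -mulrA -scalerAr eX mul_mpolyC scalerA mulrC.
Qed.
Lemma eulerZ c p : euler (c *: p) = c *: euler p.
by rewrite -!mul_mpolyC eulerM eulerC mul0r add0r. Qed.
Lemma eulerXi i : euler 'X_i = y 0 i *: 'X_i.
rewrite eulerX /mu (bigD1 i) //= big1 ?addr0=> [|j ji];rewrite mnm1E.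
 by rewrite eqxx mul1r.
by rewrite eq_sym (negbTE ji) mul0r.
Qed.
End EulerField.
Definition zdiag Q : 'M[{mpoly K[n]}]_n :=
 cmx n (invmx Q) *m diag_mx (\row_i 'X_i) *m cmx n Q.
Lemma map_zdiag Q (v : 'I_n -> K) :
 map_mx (meval v) (zdiag Q) = qdiag Q (\row_i v i).
have eC A: map_mx (meval v) (cmx n A) = A.
 by mxP=> i j;rewrite 2!mxE;exact: mevalC.
rewrite /zdiag !map_mxM /= !eC map_diag_mx;congr (_ *m diag_mx _ *m _).
by apply/rowP=> i;rewrite 3!mxE;exact: mevalXU.
Qed.
Lemma cmxM (k : nat) (A B : 'M[K]_n) : cmx k (A *m B) = cmx k A *m cmx k B.
exact: map_mxM. Qed.
Lemma zdiag_euler Q y : Q \in unitmx ->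
 map_mx (euler y) (zdiag Q) = zdiag Q *m cmx n (qdiag Q y).
move=> uQ;rewrite /qdiag !cmxM [cmx n (diag_mx y)]map_diag_mx.
have eM (A B : 'M[{mpoly K[n]}]_n) : map_mx (euler y) (A *m B) = map_mx (euler y) A *m B + A *m map_mx (euler y) B.
 mxP=> i j;rewrite !mxE.
 rewrite (big_morph (euler y) (eulerD y) (euler0 y)) -big_split /=.
 by eqb=> k _;rewrite eulerM !mxE.
have eC A: map_mx (euler y) (cmx n A) = 0 by mxP=> i j;rewrite !mxE eulerC.
have uC: cmx n Q *m cmx n (invmx Q) = 1%:M.
 by rewrite -map_mxM mulmxV // map_mx1.
rewrite /zdiag !eM !eC mul0mx add0r mulmx0 addr0.
rewrite -!mulmxA [in RHS](mulmxA (cmx n Q)) uC mul1mx;congr (_ *m _).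
rewrite [RHS]mulmxA;congr (_ *m _).
mxP=> i j;rewrite mul_diag_mx !mxE.
case: eqP=> [_|_];rewrite ?mulr1n ?mulr0n ?mulr0 ?euler0 //.
by rewrite eulerXi mulrC mul_mpolyC.
Qed.

Section HermiteCoefficients.
Variable y : 'rV[K]_n.
Local Notation R := {poly {mpoly K[n]}}.
(** The Euler field together with a time derivative: the inner variables are torus coordinates, the
    outer variable is the parameter of a unipotent one-parameter group. *)
Definition eult (F : R) : R := map_poly (euler y) F + F^`().
Lemma coef_eulert F i : (eult F)`_i = euler y F`_i + F`_i.+1 *+ i.+1.
by rewrite coefD coef_map_id0 ?euler0 // coef_deriv. Qed.
Lemma eulertD F F' : eult (F + F') = eult F + eult F'.
apply/polyP=> i;rewrite coefD !coef_eulert !coefD eulerD mulrnDl.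
by rewrite !addrA;congr (_ + _);rewrite -!addrA;congr (_ + _);rewrite addrC.
Qed.
Lemma eulert0 : eult 0 = 0.
by apply/polyP=> i;rewrite coef_eulert !coef0 euler0 mul0rn addr0. Qed.
Lemma eulertM F F' : eult (F * F') = eult F * F' + F * eult F'.
rewrite /eult derivM mulrDl mulrDr.
have ->: map_poly (euler y) (F * F') = map_poly (euler y) F * F' + F * map_poly (euler y) F'.
 apply/polyP=> i;rewrite coefD !coefM coef_map_id0 ?euler0 // coefM.
 rewrite (big_morph (euler y) (eulerD y) (euler0 y)) -big_split /=.
 by eqb=> k _;rewrite eulerM !coef_map_id0 ?euler0.
by rewrite !addrA;congr (_ + _);rewrite -!addrA;congr (_ + _);rewrite addrC.
Qed.
Lemma eulertZ c F : eult (c%:MP *: F) = c%:MP *: eult F.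
apply/polyP=> i;rewrite coefZ !coef_eulert !coefZ mul_mpolyC eulerZ.
by rewrite mulrDr !mul_mpolyC scalerMnr.
Qed.
Lemma eulert_polyC c : eult c%:P = (euler y c)%:P.
by rewrite /eult derivC addr0 map_polyC0 ?euler0.
Qed.
Lemma eulert_map q : eult (map_poly (@mpolyC n K) q) = map_poly (@mpolyC n K) q^`().
apply/polyP=> i;rewrite coef_eulert !coef_map /= eulerC add0r coef_deriv.
by rewrite mpolyCMn.
Qed.
(** Evaluation at the torus point 1 and time 0. Preceded by iterates of [eult] it gives the
    derivatives at u = 0 of [F] along the curve u to (exp(u y), u). *)
Definition epsi (F : R) : K := (F`_0).@[fun=> 1].
Lemma epsilonD F F' : epsi (F + F') = epsi F + epsi F'.
by rewrite /epsi coefD mevalD. Qed.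
Lemma epsilonZ c F : epsi (c%:MP *: F) = c * epsi F.
by rewrite /epsi coefZ mevalM mevalC. Qed.
Lemma epsilon0 : epsi 0 = 0. by rewrite /epsi coef0 meval0. Qed.
Lemma iter_eulertD k F F' : iter k eult (F + F') = iter k eult F + iter k eult F'.
by elim: k=> //= k ->;rewrite eulertD. Qed.
Lemma iter_eulert0 k : iter k eult 0 = 0.
by elim: k=> //= k ->;rewrite eulert0. Qed.
Lemma iter_eulertZ k c F : iter k eult (c%:MP *: F) = c%:MP *: iter k eult F.
by elim: k=> //= k ->;rewrite eulertZ. Qed.
Lemma eulert_mono l j : eult ('X_[l] *: 'X^j) =
 (mu y l)%:MP *: ('X_[l] *: 'X^j) + (j%:R)%:MP *: ('X_[l] *: 'X^(j.-1)).
apply/polyP=> i;rewrite coef_eulert !coefD !coefZ !coefXn.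
congr (_ + _).
 case: (i == j)=> /=;last by rewrite !mulr0 euler0.
 by rewrite !mulr1 eulerX mul_mpolyC.
case: j=> [|j] /=;first by rewrite mulr0 mul0rn mpolyC0 mul0r.
rewrite eqSS;case: eqP=> [->|_];last by rewrite !mulr0 mul0rn.
by rewrite !mulr1 mul_mpolyC scaler_nat.
Qed.
Lemma epsilon_mono k l j : epsi (iter k eult ('X_[l] *: 'X^j)) = ('X^k : {poly K})^`(j).[mu y l].
elim: k j=> [|k IH] j.
 rewrite /= /epsi coefZ coefXn expr0.
 have ->: (1 : {poly K})^`(j) = (j == 0%N)%:R.
  by case: j=> [|j];rewrite ?derivn0 // -polyC1 derivnC.
 case: j=> [|j] /=;rewrite ?mulr0 ?mulr1 ?meval0 ?horner0 // hornerC mevalX.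
 by rewrite big1 // => i _;rewrite expr1n.
rewrite iterSr eulert_mono iter_eulertD !iter_eulertZ epsilonD !epsilonZ !IH exprS.
have key: forall j, (('X : {poly K}) * 'X^k)^`(j) = 'X * 'X^k^`(j) + 'X^k^`(j.-1) *+ j.
 elim=> [|i IHi];first by rewrite !derivn0 mulr0n addr0.
 rewrite derivnS IHi derivD derivM derivX mul1r derivMn -!derivnS.
 case: i {IHi}=> [|i] /=;first by rewrite !mulr0n addr0 mulr1n addrC.
 by rewrite [in RHS]mulrS addrA;congr (_ + _);rewrite addrC.
by rewrite key hornerD hornerM hornerX hornerMn mulr_natl.
Qed.
Variable F : R.
Hypothesis hF : forall k, epsi (iter k eult F) = 0.
(** With c_{j,l} the coefficients of [F], the hypothesis says that the sum of the c_{j,l} u^j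
    exp(mu(l) u) vanishes to all orders at u = 0. Its derivative of order k at 0 is the sum
    displayed for [h = 'X^k], and the general case follows by linearity. *)
Lemma hermite_sum (h : {poly K}) :
 \sum_(j < size F) \sum_(l <- msupp F`_j) F`_j@_l * h^`(j).[mu y l] = 0.
have eF: F = \sum_(j < size F) \sum_(l <- msupp F`_j) (F`_j@_l)%:MP *: ('X_[l] *: 'X^j).
 rewrite -[LHS]coefK poly_def;eqb=> j _.
 rewrite {1}[F`_j]mpolyE scaler_suml;eqb=> l _.
 by rewrite -mul_mpolyC scalerA.
have e1 k: \sum_(j < size F) \sum_(l <- msupp F`_j) F`_j@_l * ('X^k)^`(j).[mu y l] = 0.
 rewrite -[RHS](hF k) [X in iter _ _ X]eF.
 rewrite (big_morph _ (iter_eulertD k) (iter_eulert0 k)) (big_morph _ epsilonD epsilon0).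
 eqb=> j _.
 rewrite (big_morph _ (iter_eulertD k) (iter_eulert0 k)) (big_morph _ epsilonD epsilon0).
 by eqb=> l _;rewrite iter_eulertZ epsilonZ epsilon_mono.
have e2 j a: h^`(j).[a] = \sum_(k < size h) h`_k * ('X^k)^`(j).[a].
 rewrite -{1}[h]coefK poly_def raddf_sum horner_sum;eqb=> k _.
 by rewrite /= derivnZ hornerZ.
rewrite (eq_bigr (fun j : 'I_(size F)=> \sum_(k < size h) h`_k *
  \sum_(l <- msupp F`_j) F`_j@_l * ('X^k)^`(j).[mu y l])).
 rewrite exchange_big /= big1 // => k _.
 by rewrite -mulr_sumr e1 mulr0.
move=> j _;rewrite (eq_bigr (fun l=> \sum_(k < size h) F`_j@_l * (h`_k * ('X^k)^`(j).[mu y l]))).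
 rewrite exchange_big /=;eqb=> k _.
 by rewrite mulr_sumr;eqb=> l _;rewrite mulrCA.
by move=> l _;rewrite e2 mulr_sumr.
Qed.
Let C a j := \sum_(l <- msupp F`_j | mu y l == a) F`_j@_l.
(** Linear independence of the functions u^j exp(a u), by descending induction on [j]: the test
    polynomial vanishes to high order at the other frequencies and exactly to order [i] at [a]. *)
Lemma hermite_class a j : C a j = 0.
have big_j i: (size F <= i)%N -> C a i = 0.
 by move=> h;rewrite /C nth_default // msupp0 big_nil.
suff H: forall k i, (size F - i <= k)%N -> C a i = 0 by exact: (H _ _ (leqnn _)).
elim=> [|k IH] i hi;first by apply: big_j;lia.
have hgt i': (i < i')%N -> C a i' = 0 by move=> h;apply: IH;lia.
have [hs|hs]:= leqP (size F) i;first exact: big_j.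
pose U := undup (flatten [seq [seq mu y l | l <- msupp F`_j] | j <- iota 0 (size F)]).
(* Only derivatives of order less than [size F] occur in [hermite_sum], so this exponent silences
   the other frequencies. *)
pose g := \prod_(b <- rem a U) ('X - b%:P) ^+ (size F).
pose h := g * ('X - a%:P) ^+ i.
have uU: uniq U by exact: undup_uniq.
have ga: g.[a] != 0.
 rewrite /g horner_prod prodf_seq_neq0;apply/allP=> b hb /=.
 rewrite horner_exp hornerXsubC expf_neq0 // subr_eq0.
 by move: hb;rewrite rem_filter // mem_filter /= eq_sym=> /andP [].
have inU j' l: (j' < size F)%N -> l \in msupp F`_j' -> mu y l \in U.
 move=> hj hl;rewrite mem_undup;apply/flattenP.
 exists [seq mu y l | l <- msupp F`_j'];last exact: map_f.
 by apply: map_f;rewrite mem_iota.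
have hz b j': b \in U -> b != a -> (j' < size F)%N -> h^`(j').[b] = 0.
 move=> bU ba hj';have bU': b \in rem a U by rewrite rem_filter // mem_filter /= ba.
 have ->: h = (\prod_(c <- rem b (rem a U)) ('X - c%:P) ^+ size F * ('X - a%:P) ^+ i) * ('X - b%:P) ^+ size F.
  by rewrite /h /g (big_rem b bU') /=;ring.
 have [g' -> _]:= derivn_mulXsubC (\prod_(c <- rem b (rem a U)) ('X - c%:P) ^+ size F * ('X - a%:P) ^+ i) b (ltnW hj').
 by rewrite hornerM horner_exp hornerXsubC subrr expr0n subn_eq0 leqNgt hj' mulr0.
have ha j': (j' < i)%N -> h^`(j').[a] = 0.
 move=> hj';have [g' -> _]:= derivn_mulXsubC g a (ltnW hj').
 by rewrite hornerM horner_exp hornerXsubC subrr expr0n subn_eq0 leqNgt hj' mulr0.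
have hi0: h^`(i).[a] != 0.
 have [g' -> e]:= derivn_mulXsubC g a (leqnn i).
 rewrite subnn expr0 mulr1 e mulf_neq0 // pnatr_eq0 ffactnn -lt0n fact_gt0 //.
have:= hermite_sum h.
rewrite (bigD1 (Ordinal hs)) //= [X in _ + X]big1 ?addr0;last first.
 move=> j' hj';rewrite (bigID (fun l=> mu y l == a)) /= [X in _ + X]big1_seq;last first.
  by move=> l /andP [la hl];rewrite hz ?mulr0 //;exact: (inU j').
 rewrite addr0 (eq_bigr (fun l=> F`_j'@_l * h^`(j').[a]))=> [|l /eqP -> //].
 rewrite -mulr_suml -/(C a j').
 have:= hj';rewrite -val_eqE /= neq_ltn=> /orP [h1|h1];first by rewrite ha ?mulr0.
 by rewrite hgt ?mul0r.
rewrite (bigID (fun l=> mu y l == a)) /= [X in _ + X]big1_seq;last first.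
 by move=> l /andP [la hl];rewrite hz ?mulr0 //;exact: (inU i).
rewrite addr0 (eq_bigr (fun l=> F`_i@_l * h^`(i).[a]))=> [|l /eqP -> //].
by rewrite -mulr_suml -/(C a i)=> /eqP;rewrite mulf_eq0 (negbTE hi0) orbF=> /eqP.
Qed.
(** A function of the exponents that factors through [mu] is constant on each frequency class, so
    the sum splits into the class sums, which vanish. *)
Lemma hermite_character j (chi : 'X_{1..n} -> K) :
 (forall l l', mu y l = mu y l' -> chi l = chi l') ->
 \sum_(l <- msupp F`_j) F`_j@_l * chi l = 0.
move=> hchi;pose U := undup [seq mu y l | l <- msupp F`_j].
have ->: \sum_(l <- msupp F`_j) F`_j@_l * chi l =
   \sum_(l <- msupp F`_j) \sum_(a <- U | mu y l == a) F`_j@_l * chi l.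
 apply: eq_big_seq=> l hl;rewrite -big_filter.
 have ->: [seq a <- U | mu y l == a] = [:: mu y l].
  have:= filter_pred1_uniq (undup_uniq [seq mu y l | l <- msupp F`_j]) (_ : mu y l \in _).
  rewrite mem_undup map_f // => /(_ isT) <-;apply: eq_filter=> a;exact: eq_sym.
 by rewrite big_seq1.
rewrite (exchange_big_dep xpredT) //= big1 // => a _.
have [[l0 hl0]|hn]:= pselect (exists l0, mu y l0 = a);last first.
 by rewrite big1 // => l /eqP h;case: hn;exists l.
rewrite (eq_bigr (fun l=> F`_j@_l * chi l0))=> [|l /eqP h];last by rewrite (hchi l l0) // h.
by rewrite -mulr_suml -/(C a j) hermite_class mul0r.
Qed.
End HermiteCoefficients.
End JordanLie.

Section JordanLie2.
Variables (K : acf) (n : nat).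
Implicit Types (p : {mpoly K[n * n]}) (Q S N X : 'M[K]_n) (s y : 'rV[K]_n) (m : 'rV[int]_n).
Lemma qdiag1 Q : Q \in unitmx -> qdiag Q (\row__ 1) = 1%:M.
move=> uQ;rewrite /qdiag;have ->: diag_mx (\row__ 1) = 1%:M :> 'M[K]_n.
 by mxP=> i j;rewrite !mxE.
by rewrite mulmx1 mulVmx.
Qed.

Section OneElement.
Variables (G : set 'M[K]_n) (Q : 'M[K]_n) (s : 'rV[K]_n) (N : 'M[K]_n).
Hypotheses (hG : alg_group G) (uQ : Q \in unitmx) (nN : nilp N)
 (cSN : qdiag Q s *m N = N *m qdiag Q s) (hX : Lie G (qdiag Q s + N)).
Local Notation R := {poly {mpoly K[n]}}.
Let iota (c : K) : R := ((@polyC {mpoly K[n]}) \o (@mpolyC n K)) c.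
(** A formal substitute for exp(uX): the generic diagonal matrix times exp(tN). By [eulert_gamma],
    [eult s] acts on it as right multiplication by [qdiag Q s + N], just as differentiation acts on
    an exponential. *)
Let gamma : 'M[R]_n :=
 map_mx polyC (zdiag Q) *m map_mx (map_poly (@mpolyC n K)) (pexp N).
Let eulert_mxM (A B : 'M[R]_n) :
 map_mx (eult s) (A *m B) = map_mx (eult s) A *m B + A *m map_mx (eult s) B.
mxP=> i j;rewrite !mxE.
rewrite (big_morph (eult s) (@eulertD _ _ s) (@eulert0 _ _ s)) -big_split /=.
by eqb=> k _;rewrite eulertM !mxE.
Qed.
Let iota_pexp S : S *m N = N *m S -> map_mx (map_poly (@mpolyC n K)) (pexp N) *m map_mx iota S =
 map_mx iota S *m map_mx (map_poly (@mpolyC n K)) (pexp N).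
move=> cS;have cSk k: S *m N ^+ k = N ^+ k *m S.
 elim: k=> [|k IH];first by rewrite expr0 mulmx1 mul1mx.
 by rewrite exprS -[N * _]/(N *m _) mulmxA cS -mulmxA IH mulmxA.
have e: map_mx iota S = map_mx (map_poly (@mpolyC n K)) (map_mx polyC S).
 by mxP=> i j;rewrite !mxE /iota /= map_polyC.
rewrite e -!map_mxM /=;congr (map_mx _ _).
rewrite /pexp mulmx_suml mulmx_sumr;eqb=> k _.
by rewrite -scalemxAl -scalemxAr -!map_mxM /= cSk.
Qed.
Let eulert_gamma : map_mx (eult s) gamma = gamma *m map_mx iota (qdiag Q s + N).
have e1: map_mx (eult s) (map_mx polyC (zdiag Q)) = map_mx polyC (map_mx (euler s) (zdiag Q)).
 by mxP=> i j;rewrite !mxE eulert_polyC.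
have e2: map_mx (eult s) (map_mx (map_poly (@mpolyC n K)) (pexp N)) =
  map_mx (map_poly (@mpolyC n K)) (dermx (pexp N)).
 by mxP=> i j;rewrite !mxE eulert_map.
rewrite eulert_mxM e1 e2 dpexp // zdiag_euler //.
rewrite map_mxM /= [X in _ + _ *m X]map_mxM /=.
have e3 A: map_mx (@polyC {mpoly K[n]}) (cmx n A) = map_mx iota A.
 by mxP=> i j;rewrite !mxE.
have e4: map_mx (map_poly (@mpolyC n K)) (map_mx polyC N) = map_mx iota N.
 by mxP=> i j;rewrite !mxE /iota /= map_polyC.
have e5 A B: map_mx iota (A + B) = map_mx iota A + map_mx iota B.
 by mxP=> i j;rewrite !mxE /iota /= !rmorphD.
rewrite e3 e4 e5 mulmxDr /gamma -!mulmxA;congr (_ *m _ + _).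
by rewrite iota_pexp.
Qed.
Let pev_eulert p : eult s (pev iota gamma p) =
 pev iota gamma (vfd (gmx K n *m cmx _ (qdiag Q s + N)) p).
rewrite (@pev_derivation K n R (polyC \o @mpolyC n K) gamma (eult s)).
- rewrite /vfd /pev raddf_sum /=;eqb=> k _.
 rewrite -[RHS]/(pev (polyC \o @mpolyC n K) gamma _) pevM;congr (_ * _).
 rewrite eulert_gamma;case/mxvec_indexP: k=> i j;rewrite !mxvecE !mxE.
 rewrite /pev raddf_sum /=;eqb=> k _.
 rewrite -[RHS]/(pev (polyC \o @mpolyC n K) gamma _) pevM.
 by rewrite [gmx _ _ _ _]mxE pevX [cmx _ _ _ _]mxE pevC;congr (_ * _);rewrite mxE.
- exact: eulertD.
- exact: eulertM.
- by move=> c;rewrite /= eulert_polyC eulerC polyC0.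
Qed.
Let gamma0 : map_mx (hev (0 : {mpoly K[n]})) gamma = zdiag Q.
rewrite /gamma map_mxM /=.
have ->: map_mx (hev (0 : {mpoly K[n]})) (map_mx polyC (zdiag Q)) = zdiag Q.
 by mxP=> i j;rewrite !mxE /hev hornerC.
have ->: map_mx (hev (0 : {mpoly K[n]})) (map_mx (map_poly (@mpolyC n K)) (pexp N)) = map_mx (@mpolyC n K) (hmx 0 (pexp N)).
 mxP=> i j;rewrite !mxE /hev.
 by rewrite -[0 in LHS](mpolyC0 n K) horner_map.
by rewrite hpexp // scale0r mexp0 map_mx1 mulmx1.
Qed.
Let coef0_pev p : (pev iota gamma p)`_0 = pev (@mpolyC n K) (zdiag Q) p.
rewrite -horner_coef0 -[LHS]/(hev 0 (pev iota gamma p)).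
rewrite (@pev_morph K n _ _ (polyC \o @mpolyC n K) (hev (0 : {mpoly K[n]})) (@mpolyC n K)).
 by rewrite gamma0.
by move=> c;exact: hornerC.
Qed.
Let meval_pev p (v : 'I_n -> K) :
 (pev (@mpolyC n K) (zdiag Q) p).@[v] = mxeval p (qdiag Q (\row_i v i)).
rewrite (@pev_morph K n _ _ (@mpolyC n K) (meval v) idfun);last by move=> c;exact: mevalC.
by rewrite map_zdiag.
Qed.
Let hF p : vanish G p -> forall k, epsi (iter k (eult s) (pev iota gamma p)) = 0.
move=> hp k;elim: k p hp=> [|k IH] p hp.
 rewrite /= /epsi coef0_pev meval_pev.
 rewrite qdiag1 //;apply: hp;exact: mxgrp1 (proj1 hG).
rewrite iterSr pev_eulert;apply: IH=> A GA.
by rewrite mxevvf mevM mev_c mev_g;exact: (dmx_left (proj1 hG) hp hX GA).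
Qed.
Lemma rel_le_mu y l l' : rel_le s y -> mu s l = mu s l' -> mu y l = mu y l'.
move=> hy e;apply/eqP;rewrite -subr_eq0.
have sumE (z : 'rV[K]_n) :
  \sum_i ((\row_i ((l i)%:Z - (l' i)%:Z)) 0 i)%:~R * z 0 i = mu z l - mu z l'.
 by rewrite /mu -sumrB;eqb=> i _;rewrite mxE rmorphB /= mulrBl.
by have:= hy (\row_i ((l i)%:Z - (l' i)%:Z));rewrite !sumE e subrr=> ->.
Qed.
(** The differential of [p] at 1 in the direction [qdiag Q y] is the sum of the monomial
    coefficients of [p] on the diagonal torus, weighted by [mu y]. This weight factors through
    [mu s], so [hermite_character] applies. For [y = s] it gives the semisimple part. *)
Lemma jordan_qdiag y : rel_le s y -> Lie G (qdiag Q y).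
move=> hy;apply/LieP=> p hp.
have:= hermite_character (hF hp) 0 (chi := mu y) (fun l l'=> rel_le_mu hy).
rewrite coef0_pev;set f := pev _ _ p=> h.
have e1: (euler y f).@[fun=> 1] = dmx p 1%:M (qdiag Q y).
 rewrite (@pev_derivation K n _ (@mpolyC n K) (zdiag Q) (euler y)).
 - rewrite raddf_sum /=;eqb=> k _;rewrite mevalM meval_pev qdiag1 //.
  congr (_ * _);rewrite zdiag_euler //;case/mxvec_indexP: k=> i j;rewrite !mxvecE.
  rewrite -[LHS](mxE map_mx_key (fun i j=> ((zdiag Q *m cmx n (qdiag Q y)) i j).@[fun=> 1])).
  have ->: \matrix[map_mx_key]_(i, j) ((zdiag Q *m cmx n (qdiag Q y)) i j).@[fun=> 1] = map_mx (meval (fun=> 1)) (zdiag Q *m cmx n (qdiag Q y)) by [].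
  rewrite map_mxM /= map_zdiag qdiag1 // mul1mx.
  by rewrite 2!mxE;exact: mevalC.
 - exact: eulerD.
 - exact: eulerM.
 - exact: eulerC.
rewrite -e1 -[RHS]h.
rewrite {1}[f]mpolyE (big_morph _ (@eulerD K n y) (@euler0 K n y)) raddf_sum /=.
eqb=> l _;rewrite eulerZ eulerX scalerA mevalZ mevalX big1 ?mulr1 // => i _.
by rewrite expr1n.
Qed.
(** The same argument, with the multiplicative character given by the powers of [w] in place of
    [mu y]: the value of [p] at the group element is the weighted sum. *)
Lemma jordan_qlam m w : rel_le s (map_mx intr m) -> w != 0 -> G (qlam Q m w).
move=> hm w0;apply: alg_group_eqs=> //.
 rewrite !unitmx_mul unitmx_inv uQ /= andbT unitmxE det_diag.
 rewrite unitfE;apply/prodf_neq0=> i _;rewrite !mxE expfz_neq0 //.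
move=> p hp;rewrite /qlam -(meval_pev p (fun i=> w ^ m 0 i)).
pose chi (l : 'X_{1..n}) := \prod_i (w ^ m 0 i) ^+ l i.
rewrite mevalE -coef0_pev.
apply: (hermite_character (hF hp) 0 (chi := chi))=> l l' /(rel_le_mu hm) e.
have chiE l0: chi l0 = w ^ (\sum_i (l0 i)%:Z * m 0 i).
 rewrite /chi;elim/big_rec2: _=> [|i y1 y2 _ ->];first by rewrite expr0z.
 by rewrite expfzDr //;congr (_ * _);rewrite mulrC -exprz_exp -exprnP.
rewrite !chiE;congr (_ ^ _);apply/eqP;rewrite -(eqr_int K) !rmorph_sum /=.
move/eqP: e;rewrite /mu;congr (_ == _);eqb=> i _;rewrite mxE rmorphM //.
Qed.
End OneElement.
End JordanLie2.

Section JordanExists.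
Variable K : acf.
Lemma crt_interpolation (rs : seq K) m : uniq rs ->
 exists p : {poly K}, forall a, a \in rs -> ('X - a%:P) ^+ m %| p - a%:P.
elim: rs=> [|a rs IH] /= => [_|/andP [na urs]];first by exists 0.
have [q hq]:= IH urs.
pose M := \prod_(b <- rs) ('X - b%:P) ^+ m.
have cop': forall b, b \in rs -> coprimep (('X - a%:P) ^+ m) (('X - b%:P) ^+ m).
 move=> b hb;apply: coprimep_expl;apply: coprimep_expr;apply: coprimep_XsubC2.
 by rewrite subr_eq0;apply: contraNneq na=> <-.
have copM: coprimep (('X - a%:P) ^+ m) M.
 rewrite /M;elim: (rs) cop'=> [|b s IHs] h;first by rewrite big_nil coprimep1.
 rewrite big_cons coprimepMr h ?mem_head // IHs // => c hc;apply: h.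
 by rewrite inE hc orbT.
have /Bezout_eq1_coprimepP [[u v] /= huv]:= copM.
exists (q + v * M * (a%:P - q));move=> b;rewrite inE=> /orP [/eqP ->|hb].
 have ->: q + v * M * (a%:P - q) - a%:P = (('X - a%:P) ^+ m) * (u * (q - a%:P)).
  have ->: v * M = 1 - u * ('X - a%:P) ^+ m by rewrite -huv addrAC subrr add0r.
  by ring.
 exact: dvdp_mulr.
have ->: q + v * M * (a%:P - q) - b%:P = (q - b%:P) + M * (v * (a%:P - q)) by ring.
apply: dvdp_add;first exact: hq.
by apply: dvdp_mulr;rewrite /M (big_rem b hb) /= dvdp_mulr.
Qed.
Lemma dvdp_prod_XsubC (rs : seq K) (q : {poly K}) : uniq rs ->
 (forall a, a \in rs -> ('X - a%:P) %| q) -> \prod_(a <- rs) ('X - a%:P) %| q.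
move=> urs h;apply: uniq_roots_dvdp;last by rewrite uniq_rootsE.
by apply/allP=> a /h;rewrite dvdp_XsubCl.
Qed.
(** The semisimple part is a polynomial in [X] congruent to [a] modulo a high power of 'X - a for
    each eigenvalue [a]. It is diagonalizable because the characteristic polynomial divides the
    product of the [p - a]; being a polynomial in [X], it commutes with whatever commutes with
    [X]. *)
Lemma jordan_exists n (X : 'M[K]_n) : exists S,
 [/\ exists Q s, Q \in unitmx /\ S = qdiag Q s, nilp (X - S)
  & forall Y, Y *m X = X *m Y -> Y *m S = S *m Y].
case: n X=> [|n] X.
 exists 0;split.
 - exists 1%:M, 0;split;first exact: unitmx1.
  by mxP=> - [].
 - by exists 1%N;mxP=> - [].
 - by move=> Y _;rewrite mulmx0 mul0mx.
have [r hr]:= closed_field_poly_normal (char_poly X).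
move: hr;rewrite (monicP (char_poly_monic X)) scale1r=> hr.
pose rs := undup r.
have urs: uniq rs by exact: undup_uniq.
pose m := size r.
have [p hp]:= crt_interpolation m urs.
pose D := \prod_(a <- rs) ('X - a%:P).
have char_div: char_poly X %| D ^+ m.
 rewrite hr /m;have : {subset r <= rs} by move=> z;rewrite mem_undup.
 elim: (r)=> [|z r' IH] sub;first by rewrite big_nil dvd1p.
 rewrite big_cons /= exprS dvdp_mul //.
  by rewrite /D (big_rem z) ?sub ?mem_head //= dvdp_mulr.
 by apply: IH=> y hy;apply: sub;rewrite inE hy orbT.
have cdiv (q : {poly K}) : D ^+ m %| q -> horner_mx X q = 0.
 move=> h;have /dvdpP [u ->]:= dvdp_trans char_div h.
 by rewrite rmorphM /= Cayley_Hamilton mulr0.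
have m0: (0 < m)%N.
 have:= size_char_poly X;rewrite hr size_prod_XsubC=> -[e];by rewrite /m e.
pose S := horner_mx X p.
have [Q uQ hQ]: exists2 Q : 'M[K]_n.+1, Q \in unitmx & similar_diag Q S.
 apply/diagonalizableP;exists rs=> //;apply: mxminpoly_min.
 have ->: horner_mx S (\prod_(x <- rs) ('X - x%:P)) = horner_mx X (\prod_(x <- rs) (p - x%:P)).
  rewrite !rmorph_prod;eqb=> a _.
  by rewrite !rmorphB /= !horner_mx_X !horner_mx_C.
 apply: cdiv;rewrite /D -prodrXl.
 rewrite !big_seq;elim/big_ind2: _=> [|x1 x2 y1 y2 h1 h2|a ha];first exact: dvdpp.
  exact: dvdp_mul.
 exact: hp.
exists S;split.
- have [d hd]:= elimT (similar_diagLR uQ) hQ.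
 by exists Q, d;split=> //;rewrite hd conjVmx.
- exists m;have ->: X - S = horner_mx X ('X - p) by rewrite rmorphB /= horner_mx_X.
 rewrite -rmorphXn /=;apply: cdiv;apply: dvdp_exp2r.
 apply: dvdp_prod_XsubC=> // a ha;rewrite dvdp_XsubCl /root.
 have : ('X - a%:P) %| p - a%:P.
  by apply: dvdp_trans (hp a ha);rewrite -{1}['X - a%:P]expr1 dvdp_exp2l.
 rewrite dvdp_XsubCl /root !hornerD !hornerN hornerX hornerC subr_eq0=> /eqP ->.
 by rewrite subrr.
- by move=> Y hY;exact: comm_mx_horner.
Qed.
End JordanExists.

(** * Rational hulls of diagonal matrices *)

Section RationalHull.
Variable K : acf.
Local Notation ratK := (ratr : rat -> K).
(** A sum of squares of rational numbers is 0 only if each of them is. *)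
Lemma rat_gram_kermx r n (M : 'M[rat]_(r, n)) (v : 'rV[rat]_r) :
 v *m (M *m M^T) = 0 -> v *m M = 0.
move=> h;set y := v *m M.
have : \sum_i y 0 i ^+ 2 = 0.
 have : (y *m y^T) 0 0 = 0 by rewrite /y trmx_mul !mulmxA -(mulmxA v) h mul0mx mxE.
 by rewrite mxE=> e;rewrite -[RHS]e;eqb=> i _;rewrite /trmx [X in _ * X]mxE expr2.
move/eqP;rewrite psumr_eq0=> [|i _];last exact: sqr_ge0.
move=> /allP hy;apply/rowP=> i;rewrite [RHS]mxE.
by have:= hy i (mem_index_enum i);rewrite expf_eq0 /= => /eqP.
Qed.
(** Kernels of rational matrices are compatible with extension of scalars, so definiteness over the
    rationals survives over [K] in this form. *)
Lemma gram_injective r n (M : 'M[rat]_(r, n)) (c : 'rV[K]_r) :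
 c *m map_mx ratK M *m (map_mx ratK M)^T = 0 -> c *m map_mx ratK M = 0.
move=> h;have h': c *m map_mx ratK (M *m M^T) = 0 by rewrite map_mxM /= -map_trmx mulmxA.
have sub: (kermx (M *m M^T) <= kermx M)%MS.
 apply/row_subP=> i;rewrite sub_kermx;apply/eqP;apply: rat_gram_kermx.
 by apply/eqP;rewrite -sub_kermx row_sub.
apply/eqP;rewrite -sub_kermx -map_kermx.
apply: submx_trans (_ : map_mx ratK (kermx (M *m M^T)) <= _)%MS;last by rewrite map_submx.
by rewrite map_kermx sub_kermx h'.
Qed.
Lemma rat_common_denominator (I : finType) (f : I -> rat) : exists (D : int) (z : I -> int),
 D != 0 /\ forall i, D%:~R * f i = (z i)%:~R.
pose D := \prod_i denq (f i).
exists D, (fun i=> numq (f i) * \prod_(j | j != i) denq (f j));split.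
 by apply/prodf_neq0=> i _;rewrite denq_eq0.
move=> i;rewrite /D (bigD1 i) //= !rmorphM /= mulrAC;congr (_ * _).
by rewrite -{2}[f i]divq_num_den mulrC divfK // intr_eq0 denq_eq0.
Qed.

(* [M] is a basis of the lattice of integer vectors orthogonal to all the
   integer relations between the coordinates of [s]. *)
Lemma rational_hull n (s : 'rV[K]_n) : exists r (M : 'M[int]_(r, n)) (c : 'rV[K]_r),
 s = c *m map_mx intr M /\ forall i, rel_le s (map_mx intr (row i M)).
pose rel (R : 'M[rat]_n) := s *m (map_mx ratK R)^T == 0.
have [R [hR Rmax]]: exists R, rel R /\ forall R', rel R' -> (\rank R' <= \rank R)%N.
 pose P k := `[< exists R, rel R /\ \rank R = k >].
 have exP: exists k, P k.
  by exists 0%N;apply/asboolP;exists 0;rewrite /rel map_mx0 trmx0 mulmx0 mxrank0.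
 have ub k: P k -> (k <= n)%N by move=> /asboolP [R [_ <-]];exact: rank_leq_row.
 have:= ex_maxnP exP ub;case=> k /asboolP [R [hR eR]] kmax.
 by exists R;split=> // R' hR';rewrite eR;apply: kmax;apply/asboolP;exists R'.
have relP (l : 'rV[rat]_n) : s *m (map_mx ratK l)^T = 0 -> (l <= R)%MS.
 move=> hl;set W := (<<col_mx R l>>)%MS.
 have hW: rel W.
  have /submxP [E eE]: (W <= col_mx R l)%MS by rewrite genmxE.
  rewrite /rel eE map_mxM trmx_mul mulmxA map_col_mx tr_col_mx mul_mx_row.
  by rewrite (eqP hR) hl row_mx0 mul0mx.
 have:= Rmax _ hW;rewrite /W mxrank_gen=> h.
 have sub: (R <= col_mx R l)%MS by rewrite -addsmxE addsmxSl.
 have:= mxrank_leqif_sup sub=> -[_];rewrite eqn_leq mxrankS //= h=> /esym.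
 by apply: submx_trans;rewrite -addsmxE addsmxSr.
pose M0 := kermx R^T.
have hsM: (s <= map_mx ratK M0)%MS.
 by rewrite /M0 map_kermx -map_trmx sub_kermx.
have M0R: M0 *m R^T = 0 by exact: mulmx_ker.
move: M0 hsM M0R=> M0 /submxP [c0 hc0] M0R.
have [D [z [D0 hz]]]:= rat_common_denominator (fun ij : 'I_n * 'I_n=> M0 ij.1 ij.2).
have DK: (D%:~R : K) != 0 by rewrite intr_eq0.
pose M : 'M[int]_n := \matrix_(i, j) z (i, j).
have eM: map_mx intr M = D%:~R *: map_mx ratK M0.
 mxP=> i j;rewrite !mxE;have:= congr1 ratK (hz (i, j)).
 by rewrite rmorphM /= !rmorph_int.
exists n, M, (D%:~R^-1 *: c0);split.
 by rewrite eM -scalemxAl -scalemxAr scalerA mulVf // scale1r.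
move=> i l hl.
have /submxP [E eE]: (map_mx intr l <= R)%MS.
 apply: relP;mxP=> a b;rewrite !mxE !ord1 -[RHS]hl.
 by eqb=> j _;rewrite !mxE ratr_int mulrC.
have h0: M0 *m (map_mx (intr : int -> rat) l)^T = 0.
 by rewrite eE trmx_mul mulmxA M0R mul0mx.
have:= congr1 (fun A : 'M[rat]_(n, 1)=> D%:~R * ratK (A i 0)) h0.
rewrite !mxE rmorph0 mulr0 rmorph_sum mulr_sumr=> h.
rewrite -[RHS]h;eqb=> j _.
have:= congr1 (fun A : 'M[K]_n=> A i j) eM;rewrite !mxE=> ->.
by rewrite rmorphM /= ratr_int;ring.
Qed.
(** [s] is a combination of rational vectors, on which the standard form is definite. This is how
    vanishing traces force a semisimple part to be 0. *)
Lemma hull_nondegenerate n (s : 'rV[K]_n) r (M : 'M[int]_(r, n)) (c : 'rV[K]_r) :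
 s = c *m map_mx intr M -> (forall i, \sum_j s 0 j * (M i j)%:~R = 0) -> s = 0.
move=> -> h;have eM: map_mx intr M = map_mx ratK (map_mx intr M).
 by mxP=> i j;rewrite !mxE ratr_int.
rewrite eM;apply: gram_injective;rewrite -eM;apply/rowP=> i;rewrite [RHS]mxE -[RHS](h i) mxE.
eqb=> j _;congr (_ * _).
by have ->: (map_mx intr M : 'M[K]_(r, n))^T j i = (M i j)%:~R by rewrite !mxE.
Qed.
End RationalHull.

(** * Brackets, rational curves and nilpotent matrices *)

Section LieBracket.
Variables (R : comPzRingType) (n : nat).
Implicit Types X Y Z : 'M[R]_n.
Lemma lbC X Y : lb X Y = - lb Y X. by rewrite /lb opprB. Qed.
Lemma lbxx X : lb X X = 0. exact: subrr. Qed.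
Lemma lbDr X Y Z : lb X (Y + Z) = lb X Y + lb X Z.
by rewrite /lb mulmxDr mulmxDl opprD addrACA. Qed.
Lemma lbNr X Y : lb X (- Y) = - lb X Y.
by rewrite /lb mulmxN mulNmx opprD. Qed.
Lemma lbBr X Y Z : lb X (Y - Z) = lb X Y - lb X Z.
by rewrite lbDr lbNr. Qed.
Lemma lbZr (a : R) X Y : lb X (a *: Y) = a *: lb X Y.
by rewrite /lb -scalemxAr -scalemxAl scalerBr. Qed.
Lemma lb0r X : lb X 0 = 0. by rewrite /lb mulmx0 mul0mx subrr. Qed.
Lemma lbDl X Y Z : lb (Y + Z) X = lb Y X + lb Z X.
by rewrite lbC lbDr opprD -!lbC. Qed.
Lemma lbNl X Y : lb (- Y) X = - lb Y X. by rewrite lbC lbNr -lbC. Qed.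
Lemma lbZl (a : R) X Y : lb (a *: Y) X = a *: lb Y X.
by rewrite lbC lbZr -scalerN -lbC. Qed.
Lemma lb0l X : lb 0 X = 0. by rewrite lbC lb0r oppr0. Qed.
Lemma lb_sumr (I : Type) (r : seq I) (P : pred I) F X :
 lb X (\sum_(i <- r | P i) F i) = \sum_(i <- r | P i) lb X (F i).
exact: (big_morph _ (lbDr X) (lb0r X)). Qed.
Lemma lb_suml (I : Type) (r : seq I) (P : pred I) F X :
 lb (\sum_(i <- r | P i) F i) X = \sum_(i <- r | P i) lb (F i) X.
exact: (big_morph (fun Y=> lb Y X) (lbDl X) (lb0l X)). Qed.
Lemma jacobi X Y Z : lb X (lb Y Z) = lb (lb X Y) Z + lb Y (lb X Z).
rewrite /lb !mulmxBr !mulmxBl !mulmxA.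
move: (X *m Y *m Z) (X *m Z *m Y) (Y *m Z *m X) (Z *m Y *m X) (Y *m X *m Z) (Z *m X *m Y).
by move=> a b c d v u;mxP=> i j;rewrite !mxE;ring.
Qed.
Lemma trace_lb X Y Z : \tr (lb X Y *m Z) = \tr (X *m lb Y Z).
rewrite /lb mulmxBl mulmxBr !raddfB /= !mulmxA;congr (_ - _).
by rewrite -mulmxA mxtrace_mulC.
Qed.
End LieBracket.

Section RationalCurves.
Variables (K : acf) (n : nat).
Implicit Types (G : set 'M[K]_n) (X Y : 'M[K]_n).
Lemma frac_curve_tangent (gam : 'M[{poly K}]_n) (e : {poly K}) t0 p :
 e.[t0] = 1 -> hmx t0 gam = 1%:M -> exists N P,
 (forall t, e.[t] != 0 -> P.[t] = e.[t] ^+ N * mxeval p (e.[t]^-1 *: hmx t gam)) /\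
 P^`().[t0] = N%:R * e^`().[t0] * mxeval p 1%:M
  + dmx p 1%:M (hmx t0 (dermx gam) - e^`().[t0]%:M).
move=> e1 g1;have e0: e.[t0] != 0 by rewrite e1 oner_neq0.
elim/mxp_ind: p=> [c|i j|p q [N1 [P1 [h1 d1]]] [N2 [P2 [h2 d2]]]|p q [N1 [P1 [h1 d1]]] [N2 [P2 [h2 d2]]]].
- exists 0%N, c%:P;split=> [t _|];first by rewrite mxevalC hornerC mul1r.
 by rewrite derivC horner0 dmxC !mul0r addr0.
- exists 1%N, (gam i j);split=> [t et|];first by rewrite mxevalX !mxE mulVKf.
 by rewrite dmxX mxevalX mul1r !mxE;case: eqP=> _;rewrite ?mulr1n ?mulr0n /hev;ring.
- have v1 := h1 t0 e0;have v2 := h2 t0 e0.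
 rewrite e1 expr1n mul1r invr1 scale1r g1 in v1.
 rewrite e1 expr1n mul1r invr1 scale1r g1 in v2.
 exists (N1 + N2)%N, (P1 * e ^+ N2 + P2 * e ^+ N1);split=> [t et|].
  by rewrite hornerD !hornerM h1 // h2 // !horner_exp mxevalD exprD;ring.
 have dE k: (e ^+ k)^`().[t0] = k%:R * e^`().[t0].
  by rewrite deriv_exp hornerMn hornerM horner_exp e1 expr1n mulr1 mulr_natl.
 rewrite derivD !derivM !hornerD !hornerM !dE !horner_exp e1 !expr1n d1 d2 v1 v2.
 by rewrite mxevalD dmxD natrD;ring.
- have v1 := h1 t0 e0;have v2 := h2 t0 e0.
 rewrite e1 expr1n mul1r invr1 scale1r g1 in v1.
 rewrite e1 expr1n mul1r invr1 scale1r g1 in v2.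
 exists (N1 + N2)%N, (P1 * P2);split=> [t et|].
  by rewrite hornerM h1 // h2 // mxevalM exprD;ring.
 by rewrite derivM hornerD !hornerM d1 d2 v1 v2 mxevalM dmxM natrD;ring.
Qed.
(** Denominators are allowed because one-parameter subgroups of tori have negative exponents; the
    derivative of the denominator corrects the tangent vector. *)
Lemma Lie_frac_curve G (gam : 'M[{poly K}]_n) (e : {poly K}) t0 :
 e.[t0] = 1 -> hmx t0 gam = 1%:M ->
 (forall t, e.[t] != 0 -> G (e.[t]^-1 *: hmx t gam)) ->
 Lie G (hmx t0 (dermx gam) - e^`().[t0]%:M).
move=> e1 g1 hG;apply/LieP=> p hp.
have [N [P [h d]]]:= frac_curve_tangent p e1 g1.
have e0: e != 0 by apply/eqP=> e0;move: e1;rewrite e0 horner0=> /esym/eqP;rewrite oner_eq0.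
have P0: P = 0.
 by apply: (poly_zero e0)=> t et;rewrite h // hp ?mulr0 //;exact: hG.
have p1: mxeval p 1%:M = 0.
 by apply: hp;have:= hG t0;rewrite e1 invr1 scale1r g1;apply;exact: oner_neq0.
by move: d;rewrite P0 deriv0 horner0 p1 mulr0 add0r=> <-.
Qed.
Lemma pexp_conj_coef X Y k a b : nilp X ->
 ((pexp X *m map_mx polyC Y *m pexp (- X)) a b)`_k *+ k`! = iter k (lb X) Y a b.
move=> hX;have hN := nilpN hX.
pose F j := pexp X *m map_mx polyC (iter j (lb X) Y) *m pexp (- X).
have dF j: dermx (F j) = F j.+1.
 rewrite /F !dermxM !dpexp // dermxC mulmx0 addr0.
 rewrite [pexp (- X) *m _]pexp_comm // map_mxN mulNmx mulmxN /= /lb.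
 rewrite map_mxB !map_mxM /= mulmxBr mulmxBl;congr (_ - _);rewrite !mulmxA //.
have F0 j: hmx 0 (F j) = iter j (lb X) Y.
 by rewrite /F !hmxM !hpexp // hmxC !scale0r mexp0 mul1mx mulmx1.
have cF i: forall j, (F j a b)`_i *+ i`! = iter (j + i) (lb X) Y a b.
 elim: i=> [|i IH] j.
  by rewrite fact0 mulr1n addn0 -F0 /hmx [RHS]mxE;apply/esym;exact: horner_coef0.
 have dE M: dermx M a b = (M a b)^`() by rewrite mxE.
 by rewrite addnS -addSn -IH -dF dE coef_deriv -mulrnA factS.
exact: (cF k 0%N).
Qed.
(** An iterated bracket of length [m] is a combination of products X^i Y X^j with i + j at least
    [m], which vanish for [m = k + k]. [W] expresses this as membership in every set closed under
    differences that contains these products. *)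
Lemma ad_nilp X : nilp X -> exists m, forall Y, iter m (lb X) Y = 0.
move=> nX;have [k hk]:= nX.
pose W m Y Z := forall V : set 'M[K]_n, (forall A B, V A -> V B -> V (A - B)) ->
 (forall i j, (m <= i + j)%N -> V (X ^+ i *m Y *m X ^+ j)) -> V Z.
have hW m Y: W m Y (iter m (lb X) Y).
 elim: m=> [|m IH] V VB Vg.
  by have:= Vg 0%N 0%N isT;rewrite expr0 mul1mx mulmx1.
 apply: (IH [set Z | V (lb X Z)])=> [A B hA hB|i j hij] /=.
  rewrite lbBr.
  exact: VB.
 have ->: lb X (X ^+ i *m Y *m X ^+ j) = X ^+ i.+1 *m Y *m X ^+ j - X ^+ i *m Y *m X ^+ j.+1.
  by rewrite /lb exprS exprSr !mulmxA.
 by apply: VB;apply: Vg;lia.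
exists (k + k)%N=> Y;apply: (hW _ _ [set 0])=> [A B -> ->|i j hij] /=;first by rewrite subr0.
have [h|h]:= leqP k i;first by rewrite (exp_nil_ge hk h) !mul0mx.
by rewrite (@exp_nil_ge _ _ X k j) ?mulmx0 //;lia.
Qed.
Lemma trace_nilp X : nilp X -> \tr X = 0.
case: n X=> [|m] X [k hk];first by rewrite /mxtrace big_ord0.
have [r hr]:= closed_field_poly_normal (char_poly X).
move: hr;rewrite (monicP (char_poly_monic X)) scale1r=> hr.
have r0: forall z, z \in r -> z = 0.
 move=> z hz;have : root (char_poly X) z by rewrite hr root_prod_XsubC.
 rewrite -eigenvalue_root_char=> /eigenvalueP [v hv v0].
 have : v *m X ^+ k = z ^+ k *: v.
  elim: k {hk}=> [|k IH];first by rewrite expr0 mulmx1 scale1r.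
  by rewrite exprSr -[X ^+ k * X]/(X ^+ k *m X) mulmxA IH -scalemxAl hv scalerA exprSr.
 rewrite hk mulmx0=> /esym/eqP;rewrite scaler_eq0 (negbTE v0) orbF expf_eq0.
 by case/andP=> _ /eqP.
have e: char_poly X = 'X^(size r).
 rewrite hr;elim: (r) r0=> [|z s IH] h;first by rewrite big_nil expr0.
 rewrite big_cons IH=> [|y hy];last by apply: h;rewrite inE hy orbT.
 by rewrite (h z (mem_head _ _)) subr0 -exprS.
have sz: size r = m.+1.
 by have:= size_char_poly X;rewrite e size_polyXn=> -[].
have:= @char_poly_trace _ m.+1 X isT;rewrite e sz coefXn /=.
by rewrite (ltn_eqF (ltnSn m))=> /esym/eqP;rewrite oppr_eq0=> /eqP.
Qed.
Lemma mexp_inj X Y : nilp X -> nilp Y -> (forall t, mexp (t *: X) = mexp (t *: Y)) -> X = Y.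
move=> nX nY h;have e: pexp X = pexp Y.
 mxP=> i j;sub0P.
 apply: (@poly_zero K 1)=> [|t _];first exact: oner_neq0.
 rewrite hornerD hornerN;have:= congr1 (fun M : 'M[K]_n=> M i j) (h t).
 by rewrite -!hpexp // !mxE /hev=> ->;rewrite subrr.
have:= congr1 (hmx 0) (dpexp nX);rewrite e (dpexp nY) !hmxM !hmxC.
by rewrite hpexp // scale0r mexp0 !mul1mx.
Qed.
(** Additivity, differentiated, says that the derivative of the curve is the curve times [e]. High
    derivatives of polynomials vanish, so [e] is nilpotent, and the curve times exp(-te) has
    derivative 0. *)
Lemma additive_curve_exp (gam : 'M[{poly K}]_n) : hmx 0 gam = 1%:M ->
 (forall s t, hmx (s + t) gam = hmx s gam *m hmx t gam) ->
 let e := hmx 0 (dermx gam) in nilp e /\ forall t, hmx t gam = mexp (t *: e).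
move=> g0 gD e.
have dg: dermx gam = gam *m map_mx polyC e.
 have key t: hmx t (dermx gam) = hmx t gam *m e.
  pose g1 : 'M[{poly K}]_n := map_mx (fun p=> p \Po ('X + t%:P)) gam.
  have eg: g1 = map_mx polyC (hmx t gam) *m gam.
   mxP=> i j;sub0P.
   apply: (@poly_zero K 1)=> [|s _];first exact: oner_neq0.
   rewrite hornerD hornerN mxE horner_comp hornerD hornerX hornerC.
   have:= congr1 (fun M : 'M[K]_n=> M i j) (gD t s).
   rewrite [X in X = _]mxE /hev addrC=> ->.
   rewrite -[X in X *m _](hmxC s) -hmxM [X in X - _]mxE /hev subrr //.
  have:= congr1 (fun M=> hmx 0 (dermx M)) eg.
  rewrite dermxM dermxC mul0mx add0r hmxM hmxC=> <-.
  mxP=> i j;rewrite !mxE /hev deriv_comp hornerM horner_comp.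
  by rewrite derivD derivX derivC addr0 !hornerE.
 mxP=> i j;sub0P.
 apply: (@poly_zero K 1)=> [|t _];first exact: oner_neq0.
 rewrite hornerD hornerN;have:= congr1 (fun M : 'M[K]_n=> M i j) (key t).
 by rewrite -[X in _ *m X](hmxC t) -hmxM ![hmx _ _ i j]mxE /hev=> ->;rewrite subrr.
have ne: nilp e.
 pose N := (\sum_i \sum_j size (gam i j))%N.
 exists N;have iterd k: iter k (@dermx K n) gam = gam *m map_mx polyC (e ^+ k).
  elim: k=> [|k IH];first by rewrite expr0 map_mx1 mulmx1.
  rewrite iterS IH dermxM dermxC mulmx0 addr0 dg -mulmxA -map_mxM /= exprS //.
 have entry k i j: iter k (@dermx K n) gam i j = (gam i j)^`(k).
  by elim: k=> // k IH;rewrite iterS mxE IH derivnS.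
 have : iter N (@dermx K n) gam = 0.
  mxP=> i j;rewrite entry mxE derivn_poly0 //.
  have h1: (size (gam i j) <= (\sum_j size (gam i j)))%N by rewrite (bigD1 j) //= leq_addr.
  by apply: leq_trans h1 _;rewrite /N [X in (_ <= X)%N](bigD1 i) //= leq_addr.
 rewrite iterd=> /(congr1 (hmx 0));rewrite hmxM hmxC g0 mul1mx=> ->.
 by mxP=> i j;rewrite !mxE /hev horner0.
split=> // t.
clearbody e;have nN := nilpN ne.
have d0: dermx (gam *m pexp (- e)) = 0.
 rewrite dermxM dg dpexp // -[gam *m _ *m _]mulmxA -mulmxDr.
 rewrite [pexp (- e) *m _]pexp_comm // -mulmxDl map_mxN subrr mul0mx mulmx0 //.
have:= mx_deriv0 d0 t;rewrite !hmxM !hpexp //.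
rewrite scale0r mexp0 g0 mulmx1 scalerN=> h.
have nt := nilpZ t ne.
have h2 := mexpN (nilpN nt);rewrite opprK in h2.
by rewrite -[LHS]mulmx1 -h2 mulmxA h mul1mx.
Qed.
End RationalCurves.
Lemma mxZE (R : pzRingType) m n (a : R) (A : 'M[R]_(m, n)) i j : (a *: A) i j = a * A i j.
exact: mxE. Qed.
Lemma mxDE (R : pzRingType) m n (A B : 'M[R]_(m, n)) i j : (A + B) i j = A i j + B i j.
exact: mxE. Qed.

(** * Homomorphisms from SL_2 *)

Section SL2Subgroup.
Variable K : acf.
Definition m2 (R : pzRingType) (a b c d : R) : 'M[R]_2 :=
 \matrix_(i, j) if i == 0 then (if j == 0 then a else b) else (if j == 0 then c else d).
Lemma m2M (R : pzRingType) (a b c d a' b' c' d' : R) :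
 m2 a b c d *m m2 a' b' c' d' =
 m2 (a * a' + b * c') (a * b' + b * d') (c * a' + d * c') (c * b' + d * d').
mxP=> i j;rewrite !mxE big_ord_recl big_ord1 !mxE /=.
by case: (i == 0);case: (j == 0).
Qed.
Lemma det_m2 (R : comPzRingType) (a b c d : R) : \det (m2 a b c d) = a * d - b * c.
rewrite (expand_det_row _ 0) big_ord_recl big_ord1 /cofactor !det_mx11 !mxE /=.
by rewrite /bump /= expr0 mul1r expr1 mulN1r mulrN.
Qed.
Lemma upper2E (x : K) : upper2 x = m2 1 x 0 1.
mxP=> i j;rewrite !mxE.
by case: i=> [[|[|i]] hi] //;case: j=> [[|[|j]] hj] //=;ring.
Qed.
Lemma lower2E (x : K) : lower2 x = m2 1 0 x 1.
mxP=> i j;rewrite !mxE.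
by case: i=> [[|[|i]] hi] //;case: j=> [[|[|j]] hj] //=;ring.
Qed.
Lemma diag2E (z : K) : diag2 z = m2 z 0 0 z^-1.
mxP=> i j;rewrite !mxE.
by case: i=> [[|[|i]] hi] //;case: j=> [[|[|j]] hj] //=;ring.
Qed.
Lemma m2_1 (R : pzRingType) : m2 1 0 0 1 = 1%:M :> 'M[R]_2.
by mxP=> i j;rewrite !mxE;case: i=> [[|[|i]] hi] //;case: j=> [[|[|j]] hj].
Qed.
Variables (n : nat) (G : set 'M[K]_n) (phi : 'M[K]_2 -> 'M[K]_n).
Hypotheses (hG : mxgroup G) (hphi : alg_hom (@SL2 K) G phi).
Lemma phi_poly : exists P : 'M[{mpoly K[2 * 2]}]_n,
 forall A, SL2 A -> phi A = map_mx (fun p=> mxeval p A) P.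
case: hphi=> hreg _ _.
have ex: forall ij : 'I_n * 'I_n, exists p : {mpoly K[2 * 2]},
  forall A, SL2 A -> phi A ij.1 ij.2 = mxeval p A.
 move=> [i j];have [p [k h]]:= hreg i j;exists p=> A hA.
 by rewrite h // hA expr1n divr1.
have [P hP]:= choice ex;exists (\matrix_(i, j) P (i, j))=> A hA.
by mxP=> i j;rewrite !mxE (hP (i, j)).
Qed.
Lemma SL2_m2 (a b c d : K) : a * d - b * c = 1 -> SL2 (m2 a b c d).
by move=> h;rewrite /SL2 /= det_m2. Qed.
Lemma phi1 : phi 1%:M = 1%:M.
case: hphi=> _ hm hM;have h1: SL2 (1%:M : 'M[K]_2) by rewrite /SL2 /= det1.
have:= hM _ _ h1 h1;rewrite mulmx1=> e.
have u := mxgrpU hG (hm _ h1).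
by rewrite -[LHS](mulmxK u) -e mulmxV.
Qed.
Lemma phi_curve_exp (g : K -> 'M[K]_2) (gp : 'M[{poly K}]_2) :
 (forall t, SL2 (g t)) -> (forall t, hmx t gp = g t) -> g 0 = 1%:M ->
 (forall s t, g (s + t) = g s *m g t) ->
 exists e, [/\ nilp e, Lie G e, forall t, phi (g t) = mexp (t *: e) &
   forall P : 'M[{mpoly K[2 * 2]}]_n, (forall A, SL2 A -> phi A = map_mx (fun p=> mxeval p A) P) ->
     e = map_mx (fun p=> dmx p 1%:M (hmx 0 (dermx gp))) P].
move=> hg hgp g0 gD;case: (hphi)=> _ hm hM.
pose pc (P : 'M[{mpoly K[2 * 2]}]_n) := map_mx (fun p=> pev polyC gp p) P.
have pcE P: (forall A, SL2 A -> phi A = map_mx (fun p=> mxeval p A) P) ->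
  forall t, hmx t (pc P) = phi (g t).
 move=> hP t;rewrite hP //;mxP=> i j;rewrite !mxE.
 by rewrite -hgp;exact: pev_horner.
have [P hP]:= phi_poly.
have [||ne he]:= additive_curve_exp (gam := pc P).
- by rewrite pcE // g0 phi1.
- by move=> s t;rewrite !pcE // gD hM.
exists (hmx 0 (dermx (pc P)));split=> //.
- apply: (Lie_curve (d := 1));first exact: oner_neq0.
  by move=> t _;rewrite pcE //;apply: hm.
 by rewrite pcE // g0 phi1.
- by move=> t;rewrite -he pcE.
- move=> P' hP';have ->: pc P = pc P'.
  mxP=> i j;sub0P.
  apply: (@poly_zero K 1)=> [|t _];first exact: oner_neq0.
  rewrite hornerD hornerN;have:= etrans (pcE P hP t) (esym (pcE P' hP' t)).
  by move/(congr1 (fun M : 'M[K]_n=> M i j));rewrite !mxE /hev=> ->;rewrite subrr.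
 mxP=> i j;rewrite !mxE.
 have g1: hmx 0 gp = 1%:M by rewrite hgp g0.
 by rewrite -g1;exact: pev_horner'.
Qed.
(** The hypotheses on coroots concern conjugation by group elements; the last clause turns an
    eigenvalue z^k of such a conjugation into the eigenvalue [k] of the bracket with [e, f]. *)
Lemma sl2_triple_of_hom : exists e f,
 [/\ nilp e /\ Lie G e, nilp f /\ Lie G f,
   forall x, phi (upper2 x) = mexp (x *: e), forall x, phi (lower2 x) = mexp (x *: f)
  & forall (c : K -> 'M[K]_n) X (k : int), (forall z : K, z != 0 -> c z = phi (diag2 z)) ->
   (forall z : K, z != 0 -> c z *m X *m invmx (c z) = z ^ k *: X) ->
   lb (lb e f) X = k%:~R *: X].
case: (hphi)=> _ hm hM.
have [P hP]:= phi_poly.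
pose up : 'M[{poly K}]_2 := m2 1 'X 0 1.
pose lo : 'M[{poly K}]_2 := m2 1 0 'X 1.
have hup t: hmx t up = upper2 t.
 rewrite upper2E;mxP=> i j;rewrite !mxE /hev.
 by case: (i == 0);case: (j == 0);rewrite !hornerE.
have hlo t: hmx t lo = lower2 t.
 rewrite lower2E;mxP=> i j;rewrite !mxE /hev.
 by case: (i == 0);case: (j == 0);rewrite !hornerE.
have Sup (t : K) : SL2 (upper2 t) by have -> := upper2E t;apply: SL2_m2;ring.
have Slo (t : K) : SL2 (lower2 t) by have -> := lower2E t;apply: SL2_m2;ring.
have Sdg (t : K) : t != 0 -> SL2 (diag2 t).
 by move=> t0;have -> := diag2E t;apply: SL2_m2;rewrite mulfV // mulr0 subr0.
have [||||e [ne Le he hde]]:= @phi_curve_exp (@upper2 K) up=> //.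
- by rewrite upper2E m2_1.
- by move=> s t;rewrite !upper2E m2M;congr m2;ring.
have [||||f [nf Lf hf hdf]]:= @phi_curve_exp (@lower2 K) lo=> //.
- by rewrite lower2E m2_1.
- by move=> s t;rewrite !lower2E m2M;congr m2;ring.
exists e, f;split=> // c X k hc hX.
have {}hde := hde P hP;have {}hdf := hdf P hP.
pose dphi Y := map_mx (fun p=> dmx p 1%:M Y) P : 'M[K]_n.
have dphiD Y Z: dphi (Y + Z) = dphi Y + dphi Z.
 by mxP=> i j;rewrite !mxE linearD.
have dphiZ a Y: dphi (a *: Y) = a *: dphi Y.
 by mxP=> i j;rewrite !mxE linearZ.
have dup: hmx 0 (dermx up) = m2 0 1 0 0.
 mxP=> i j;rewrite !mxE /hev.
 by case: (i == 0);case: (j == 0);rewrite ?derivX -?polyC1 ?derivC ?hornerE.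
have dlo: hmx 0 (dermx lo) = m2 0 0 1 0.
 mxP=> i j;rewrite !mxE /hev.
 by case: (i == 0);case: (j == 0);rewrite ?derivX -?polyC1 ?derivC ?hornerE.
(* Differentiating upper(x) lower(t) upper(-x) at t = 0 gives a quadratic polynomial in [x]. Its
   linear coefficient will identify [e, f] with the image of diag(1, -1) under the differential of
   [phi]. *)
have Ef: forall x : K, mexp (x *: e) *m f *m mexp (- (x *: e)) =
  f + x *: dphi (m2 1 0 0 (-1)) - x ^+ 2 *: e.
 move=> x.
 pose cu : 'M[{poly K}]_2 := m2 (1%:P + x%:P * 'X) ((- x ^+ 2)%:P * 'X) 'X (1%:P - x%:P * 'X).
 have hcu t: hmx t cu = upper2 x *m lower2 t *m upper2 (- x).
  rewrite !upper2E lower2E !m2M;mxP=> i j;rewrite !mxE /hev.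
  by case: (i == 0);case: (j == 0)=> /=;rewrite !(hornerD, hornerN, hornerM, hornerX, hornerC);ring.
 have e1 t: hmx t (map_mx (fun p=> pev polyC cu p) P) =
   hmx t (map_mx polyC (mexp (x *: e)) *m pexp f *m map_mx polyC (mexp (- (x *: e)))).
  rewrite !hmxM !hmxC hpexp // -hf -scaleNr -!he -!hM //;last first.
   by rewrite /SL2 /= det_mulmx Sup Slo mulr1.
  rewrite -hcu hP;last by rewrite hcu /SL2 /= !det_mulmx !Sup Slo !mulr1.
  by mxP=> i j;rewrite !mxE;exact: pev_horner.
 have e2: map_mx (fun p=> pev polyC cu p) P = map_mx polyC (mexp (x *: e)) *m pexp f *m map_mx polyC (mexp (- (x *: e))).
  mxP=> i j;sub0P.
  apply: (@poly_zero K 1)=> [|t _];first exact: oner_neq0.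
  rewrite hornerD hornerN;have:= congr1 (fun M : 'M[K]_n=> M i j) (e1 t).
  by rewrite [X in X = _]mxE [X in _ = X]mxE /hev=> ->;rewrite subrr.
 have:= congr1 (fun M=> hmx 0 (dermx M)) e2.
 rewrite !dermxM !dermxC mul0mx add0r mulmx0 addr0 dpexp //.
 rewrite !hmxM !hmxC hpexp // scale0r mexp0 mul1mx=> <-.
 have ->: hmx 0 (dermx (map_mx (fun p=> pev polyC cu p) P)) = dphi (hmx 0 (dermx cu)).
  have c1: hmx 0 cu = 1%:M.
   mxP=> i j;rewrite -m2_1 !mxE /hev.
   by case: (i == 0);case: (j == 0)=> /=;rewrite !(hornerD, hornerN, hornerM, hornerX, hornerC);ring.
  by mxP=> i j;rewrite !mxE -c1;exact: pev_horner'.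
 have ->: hmx 0 (dermx cu) = m2 0 0 1 0 + x *: m2 1 0 0 (-1) + - x ^+ 2 *: m2 0 1 0 0.
  mxP=> i j;rewrite !mxE /hev.
  by case: (i == 0);case: (j == 0)=> /=;rewrite !(derivD, derivN, derivM, derivX, derivC);
   rewrite !(hornerD, hornerN, hornerM, hornerX, hornerC);ring.
 by rewrite !dphiD !dphiZ hde hdf dup dlo scaleNr.
have efh: lb e f = dphi (m2 1 0 0 (-1)).
 have e3: pexp e *m map_mx polyC f *m pexp (- e) = map_mx polyC f + 'X *: map_mx polyC (dphi (m2 1 0 0 (-1))) - 'X^2 *: map_mx polyC e.
  mxP=> i j;sub0P.
  apply: (@poly_zero K 1)=> [|t _];first exact: oner_neq0.
  rewrite hornerD hornerN;have:= congr1 (fun M : 'M[K]_n=> M i j) (Ef t).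
  have nN := nilpN ne;rewrite -scalerN -!hpexp // -{1}(hmxC t f) -!hmxM [X in X = _]mxE /hev=> ->.
  by rewrite !mxE !hornerE;ring.
 mxP=> i j;have:= pexp_conj_coef f 1 i j ne;rewrite e3=> <-.
 move: (dphi _)=> D.
 have ->: 1`! = 1%N by [].
 rewrite mulr1n !mxE !(coefD, coefN, coefC) coefXM coefXnM !coefC /=;ring.
rewrite efh.
(* The integer exponent is written as a difference of natural numbers, so that the conjugation
   formula can be cleared of negative powers of [z]. *)
have [k1 [k2 ek]]: exists k1 k2 : nat, k = k1%:Z - k2%:Z.
 by case: k {hX}=> k;[exists k, 0%N;rewrite subr0|exists 0%N, k.+1;rewrite sub0r NegzE].
have hX' (z : K) : z != 0 -> z ^+ k2 *: (phi (diag2 z) *m X) = z ^+ k1 *: (X *m phi (diag2 z)).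
 move=> z0;have uc: c z \in unitmx.
  by rewrite hc //;apply: (mxgrpU hG);apply: hm;exact: Sdg.
 rewrite -hc //;have:= congr1 (fun M=> M *m c z) (hX z z0);rewrite mulmxKV // => ->.
 by rewrite -scalemxAl scalerA [z ^+ k2]exprnP -expfzDr // ek addrC subrK.
(* z diag(z, 1/z) is polynomial in [z]; [frac_curve_tangent] accounts for the factor [z], and [Psi]
   below brings all entries of the image to the common factor z^N. *)
pose dg : 'M[{poly K}]_2 := m2 'X^2 0%:P 0%:P 1%:P.
have hdg (t : K) : t != 0 -> t^-1 *: hmx t dg = diag2 t.
 move=> t0;rewrite diag2E;mxP=> i j;rewrite !mxE /hev.
 by case: (i == 0);case: (j == 0)=> /=;rewrite ?hornerXn ?hornerC ?mulr0 ?mulr1 // expr2 mulKf.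
have dg1: hmx 1 dg = 1%:M.
 mxP=> i j;rewrite -m2_1 !mxE /hev.
 by case: (i == 0);case: (j == 0)=> /=;rewrite ?hornerXn ?hornerC ?expr1n.
have ddg: hmx 1 (dermx dg) - ('X : {poly K})^`().[1]%:M = m2 1 0 0 (-1).
 mxP=> i j;rewrite derivX hornerC -m2_1 !mxE /hev.
 by case: (i == 0);case: (j == 0)=> /=;rewrite ?derivXn ?derivC ?hornerMn ?hornerXn ?hornerC ?expr1n /= ?mulr1n ?mulr0n ?subr0 ?sub0r ?subrr // mulr2n addrK.
have ex ij: exists NP : nat * {poly K},
   (forall t, t != 0 -> NP.2.[t] = t ^+ NP.1 * phi (diag2 t) ij.1 ij.2) /\
   NP.2^`().[1] = NP.1%:R * (1%:M : 'M[K]_n) ij.1 ij.2 + dphi (m2 1 0 0 (-1)) ij.1 ij.2.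
 have e11: ('X : {poly K}).[1] = 1 by rewrite hornerX.
 have [N [Q [h1 h2]]]:= frac_curve_tangent (P ij.1 ij.2) e11 dg1.
 exists (N, Q);split=> /= [t t0|].
  rewrite h1 hornerX // hdg // hP;first by rewrite mxE.
  exact: Sdg.
 rewrite h2 ddg derivX hornerC mulr1;congr (_ * _ + _);last by rewrite mxE.
 by have:= congr1 (fun M : 'M[K]_n=> M ij.1 ij.2) (hP 1%:M (det1 _ _));rewrite phi1 [RHS]mxE=> <-.
have [NP hNP]:= choice ex.
pose N := (\sum_ij (NP ij).1)%N.
pose Psi : 'M[{poly K}]_n := \matrix_(i, j) ('X^(N - (NP (i, j)).1) * (NP (i, j)).2).
have leN ij: ((NP ij).1 <= N)%N by rewrite /N (bigD1 ij) //= leq_addr.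
have hPsi t: t != 0 -> hmx t Psi = t ^+ N *: phi (diag2 t).
 move=> t0;mxP=> i j;rewrite !mxE /hev hornerM hornerXn.
 by rewrite (proj1 (hNP (i, j))) // mulrA -exprD subnK.
have d1: diag2 (1 : K) = 1%:M by rewrite diag2E invr1 m2_1.
have dPsi: hmx 1 (dermx Psi) = N%:R%:M + dphi (m2 1 0 0 (-1)).
 mxP=> i j;rewrite mxE [dermx _ _ _]mxE [Psi _ _]mxE /hev derivM hornerD !hornerM.
 rewrite hornerXn expr1n mul1r (proj2 (hNP (i, j))) (proj1 (hNP (i, j))) ?oner_neq0 // expr1n mul1r.
 rewrite d1 phi1 derivXn hornerMn hornerXn expr1n [RHS]mxE addrA;congr (_ + _)=> /=.
 rewrite -mulrDl -natrD subnK //.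
 by rewrite !mxE -[RHS]mulr_natr mulr_natr;case: (i == j);rewrite ?mulr1 ?mulr0 ?mulr1n ?mulr0n.
have eqP': 'X^k2 *: (Psi *m map_mx polyC X) = 'X^k1 *: (map_mx polyC X *m Psi).
 mxP=> i j;sub0P.
 apply: (@poly_zero K 'X)=> [|t];first by rewrite polyX_eq0.
 rewrite hornerX=> t0;rewrite hornerD hornerN.
 have:= congr1 (fun M : 'M[K]_n=> t ^+ N * M i j) (hX' t t0).
 rewrite !mxZE !hornerM !hornerXn.
 have hA: ((Psi *m map_mx polyC X) i j).[t] = t ^+ N * (phi (diag2 t) *m X) i j.
  have:= congr1 (fun M : 'M[K]_n=> M i j) (hmxM t Psi (map_mx polyC X)).
  by rewrite /hmx [X in X = _]mxE /hev -/(hmx t Psi) -/(hmx t _) hPsi // hmxC -scalemxAl mxZE.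
 have hB: ((map_mx polyC X *m Psi) i j).[t] = t ^+ N * (X *m phi (diag2 t)) i j.
  have:= congr1 (fun M : 'M[K]_n=> M i j) (hmxM t (map_mx polyC X) Psi).
  by rewrite /hmx [X in X = _]mxE /hev -/(hmx t Psi) -/(hmx t _) hPsi // hmxC -scalemxAr mxZE.
 rewrite hA hB=> h.
 by rewrite mulrCA h mulrCA subrr.
have:= congr1 (fun M=> hmx 1 (dermx M)) eqP'.
have dZ k0 (M : 'M[{poly K}]_n) : hmx 1 (dermx ('X^k0 *: M)) = k0%:R *: hmx 1 M + hmx 1 (dermx M).
 mxP=> i j;rewrite !mxE /hev derivM hornerD !hornerM derivXn hornerMn !hornerXn !expr1n.
 by rewrite mul1r.
rewrite !dZ !dermxM !dermxC mulmx0 addr0 mul0mx add0r !hmxM hmxC dPsi.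
rewrite hPsi ?oner_neq0 // expr1n scale1r d1 phi1 mulmx1 mul1mx.
rewrite mulmxDl mulmxDr mul_scalar_mx mul_mx_scalar=> h.
have h2: k2%:R *: X + dphi (m2 1 0 0 (-1)) *m X = k1%:R *: X + X *m dphi (m2 1 0 0 (-1)).
 by apply: (addrI (N%:R *: X));rewrite addrCA h addrCA.
rewrite /lb ek rmorphB /= scalerBl.
by apply: (addrI (k2%:R *: X));rewrite addrA h2 addrK -!pmulrn [RHS]addrC subrK.
Qed.
End SL2Subgroup.
Lemma invmxM (R : comUnitRingType) n (A B : 'M[R]_n) : A \in unitmx -> B \in unitmx ->
 invmx (A *m B) = invmx B *m invmx A.
move=> uA uB;have uAB: A *m B \in unitmx by rewrite unitmx_mul uA.
rewrite -[LHS]mulmx1 -[1%:M](mulmxV uA) -{2}[A](mulmxK uB) !mulmxA.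
by rewrite -(mulmxA (invmx _)) mulVmx // mul1mx.
Qed.

(** * The radical of the trace form *)

Section TraceForm.
Variables (K : acf) (n : nat) (G : set 'M[K]_n).
Hypothesis hG : simple_group G.
Implicit Types (A X Y Z : 'M[K]_n).
Let aG : alg_group G. by case: hG=> [[]]. Qed.
Let mG : mxgroup G. by case: aG. Qed.
Definition rad X := Lie G X /\ forall Y, Lie G Y -> \tr (X *m Y) = 0.
Lemma radB X Y : rad X -> rad Y -> rad (X - Y).
move=> [hX rX] [hY rY];split=> [|Z hZ];first exact: LieB.
by rewrite mulmxBl linearB /= rX ?rY ?subr0.
Qed.
Lemma radZ (a : K) X : rad X -> rad (a *: X).
by move=> [hX rX];split=> [|Z hZ];[exact: LieZ|rewrite -scalemxAl linearZ /= rX ?mulr0].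
Qed.
Lemma rad0 : rad 0.
by split=> [|Z hZ];[exact: Lie0|rewrite mul0mx linear0]. Qed.
Lemma radD X Y : rad X -> rad Y -> rad (X + Y).
move=> hX hY;rewrite -[Y]opprK;apply: radB=> //.
by rewrite -scaleN1r;exact: radZ.
Qed.
Lemma rad_lb X Y : rad X -> Lie G Y -> rad (lb X Y).
move=> [hX rX] hY;split=> [|Z hZ];first exact: Lie_lb.
by rewrite trace_lb rX //;exact: Lie_lb.
Qed.
Lemma rad_Ad A X : G A -> rad X -> rad (A *m X *m invmx A).
move=> gA [hX rX];have uA := mxgrpU mG gA;split=> [|Y hY];first exact: Lie_Ad.
rewrite -[Y](mulmxK uA) -!mulmxA mxtrace_mulC -!mulmxA (mulmxA (invmx A)).
have:= Lie_Ad mG (mxgrpV mG gA) hY;rewrite invmxK=> /rX <-.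
by rewrite mulmxA mxtrace_mulC !mulmxA mulmxKV // mxtrace_mulC !mulmxA.
Qed.
Lemma tr_comm_nilp N Y : nilp N -> N *m Y = Y *m N -> \tr (N *m Y) = 0.
move=> [k hk] cNY;apply: trace_nilp;exists k.
have ->: (N *m Y) ^+ k = N ^+ k *m Y ^+ k.
 elim: k {hk}=> [|k IH];first by rewrite !expr0 [RHS]mul1mx.
 rewrite exprS IH !exprS -!mulmxE !mulmxA;congr (_ *m _);rewrite -!mulmxA;congr (_ *m _).
 elim: k {IH}=> [|k IH];first by rewrite expr0 mul1mx [_ *m 1]mulmx1.
 by rewrite exprS -mulmxE !mulmxA -cNY -!mulmxA IH.
by rewrite hk [LHS]mul0mx.
Qed.
Lemma trace_qdiag Q (s s' : 'rV[K]_n) : Q \in unitmx ->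
 \tr (qdiag Q s *m qdiag Q s') = \sum_i s 0 i * s' 0 i.
move=> uQ;rewrite /qdiag -!mulmxA (mulmxA Q) mulmxV // mul1mx mxtrace_mulC -!mulmxA mulmxV // mulmx1.
by rewrite mulmx_diag mxtrace_diag;eqb=> i _;rewrite mxE.
Qed.
Lemma qdiag_comm_rel Q s y Y : Q \in unitmx -> rel_le s y ->
 Y *m qdiag Q s = qdiag Q s *m Y -> Y *m qdiag Q y = qdiag Q y *m Y.
move=> uQ rsy cY;pose Y' := Q *m Y *m invmx Q.
have e1: Y' *m diag_mx s = diag_mx s *m Y'.
 have:= congr1 (fun M=> Q *m M *m invmx Q) cY;rewrite /qdiag /Y' !mulmxA mulmxV // mul1mx.
 by rewrite -!mulmxA mulmxV // mulmx1 !mulmxA.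
have e2: Y' *m diag_mx y = diag_mx y *m Y'.
 mxP=> i j;have:= congr1 (fun M : 'M[K]_n=> M i j) e1.
 rewrite !mul_mx_diag !mul_diag_mx ![(\matrix_(_, _) _) _ _]mxE.
 have [->|nz]:= eqVneq (Y' i j) 0;first by rewrite !mulr0 !mul0r.
 rewrite mulrC=> /(mulIf nz)=> sij;rewrite mulrC;congr (_ * _).
 pose l : 'rV[int]_n := \row_k ((k == i)%:Z - (k == j)%:Z).
 have hl z: \sum_k (l 0 k)%:~R * (z : 'rV[K]_n) 0 k = z 0 i - z 0 j.
  under eq_bigr=> k _ do rewrite mxE rmorphB /= mulrBl.
  by rewrite sumrB (bigD1 i) //= eqxx mul1r big1 ?addr0=> [|k /negPf ->];[
   rewrite (bigD1 j) //= eqxx mul1r big1 ?addr0 // => k /negPf -> | ];rewrite mul0r.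
 by have:= rsy l;rewrite !hl -sij subrr=> /(_ erefl) /eqP;rewrite subr_eq0=> /eqP.
have:= congr1 (fun M=> invmx Q *m M *m Q) e2;rewrite /Y' /qdiag !mulmxA mulVmx // mul1mx.
by rewrite -!mulmxA mulmxA=> ->;rewrite !mulmxA mulmxKV.
Qed.
(** The rational hull of the semisimple part lies in Lie G and commutes with the nilpotent part, so
    its traces against [X] are its traces against the semisimple part. These vanish, and
    [hull_nondegenerate] kills the semisimple part. *)
Lemma rad_nilp X : rad X -> nilp X.
move=> [hX rX];have [S [[Q [s [uQ eS]]] nN cS]]:= jordan_exists X.
have cSN: qdiag Q s *m (X - S) = (X - S) *m qdiag Q s.
 by rewrite -eS mulmxBr mulmxBl (cS X).
have hX': Lie G (qdiag Q s + (X - S)) by rewrite -eS addrC subrK.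
have [r [M [c [es hM]]]]:= rational_hull s.
suff s0: s = 0.
 by move: nN;rewrite eS s0 /qdiag linear0 mulmx0 mul0mx subr0.
apply: (hull_nondegenerate es)=> i.
have hm := jordan_qdiag aG uQ nN cSN hX' (hM i).
have:= rX _ hm;rewrite -[X in X *m _](subrK S) mulmxDl linearD /=.
rewrite (tr_comm_nilp nN) ?add0r;last first.
 by rewrite (qdiag_comm_rel uQ (hM i)) // cSN.
rewrite eS trace_qdiag // => h;rewrite -[RHS]h;eqb=> j _.
by rewrite !mxE.
Qed.

(** By simplicity the exponentials of the radical generate the trivial group or a dense one. In the
    dense case [Ad] is trivial modulo the radical, so [e] and [f], eigenvectors of [t] with
    eigenvalues other than 1, lie in it. Then the bracket with [e, f] would be nilpotent, against
    [[e, f], e] = 2e. *)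
Theorem rad_trivial e f t (a : K) : nilp e -> Lie G e -> e != 0 -> Lie G f ->
 G t -> t *m e *m invmx t = a *: e -> t *m f *m invmx t = a^-1 *: f -> a != 1 ->
 lb (lb e f) e = 2%:R *: e -> forall X, rad X -> X = 0.
move=> ne Le e0 Lf gt te tf a1 he X0 rX0.
have hexp: zcl (gen (exp_fam G)) = G by apply: simple_exp hG _;exists e.
pose F : set (set 'M[K]_n) := [set C | exists2 X, rad X & C = expcv X].
have FF C: F C -> exp_fam G C.
 by move=> [X rX ->];exists X;split=> //;[case: rX|exact: rad_nilp].
have gF: gen_fam F by move=> C /FF /exp_fam2.
have mS := mxgrp_gen gF.
have sS: sirr (gen F) by apply: sirr_gen gF _=> C [X rX ->];exact/sirr_exp_curve/rad_nilp.
have SG: gen F `<=` G.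
 apply: gen_sub=> // C [X rX ->] _ [s _ <-].
 by apply: (mexp_grp aG);[case: rX|exact: rad_nilp].
have nS: forall g x, G g -> gen F x -> gen F (g *m x *m invmx g).
 apply: gen_normal=> // C g [X rX ->] gg;exists (g *m X *m invmx g);first exact: rad_Ad.
 have ug := mxgrpU mG gg.
 rewrite predeqE=> A;split=> [[_ [s _ <-] <-]|[s _ <-]].
  exists s=> //;have [-> _]:= mexp_conj ug (nilpZ s (rad_nilp rX)).
  by rewrite -scalemxAr -scalemxAl.
 exists (mexp (s *: X));first by exists s.
 have [-> _]:= mexp_conj ug (nilpZ s (rad_nilp rX)).
 by rewrite -scalemxAr -scalemxAl.
have [S1|SE]:= simple_normal hG mS (sirr_sconn sS) SG nS.
 apply: (mexp_eq1 (rad_nilp rX0))=> s.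
 by apply: S1;apply: (gen_gen (C := expcv X0));[exists X0|exists s].
have AdS A Y: gen F A -> Lie G Y -> rad (A *m Y *m invmx A - Y).
 move=> hA hY;elim: hA=> [|B C A' hB IH FC hC] in Y hY *.
  by rewrite invmx1 mul1mx mulmx1 subrr;exact: rad0.
 have [X rX eC]:= FC;move: hC;rewrite eC=> -[s _ <-].
 have nX := nilpZ s (rad_nilp rX);have gB := SG _ hB.
 have uB := mxgrpU mG gB;have uX := mexpU nX.
 have rsX: rad (s *: X) by exact: radZ.
 have [m hm]:= ad_nilp nX.
 have r1: rad (mexp (s *: X) *m Y *m invmx (mexp (s *: X)) - Y).
  rewrite mexpV // (mexp_Ad nX (hm Y));case: m hm=> [|m] hm.
   by have:= hm Y;rewrite /= => ->;rewrite big_ord0 subrr;exact: rad0.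
  rewrite big_ord_recl /= fact0 invr1 scale1r addrC addKr.
  elim/big_rec: _=> [|i Z _ hZ];first exact: rad0.
  apply: radD=> //;apply: radZ;apply: rad_lb=> //.
  by elim: (nat_of_ord i)=> [//|j IHj] /=;apply: Lie_lb=> //;case: rsX.
 rewrite invmxM // !mulmxA.
 have ->: B *m mexp (s *: X) *m Y *m invmx (mexp (s *: X)) *m invmx B - Y =
  B *m (mexp (s *: X) *m Y *m invmx (mexp (s *: X)) - Y) *m invmx B + (B *m Y *m invmx B - Y).
  by rewrite mulmxBr mulmxBl !mulmxA addrA subrK.
 by apply: radD;[exact: rad_Ad|exact: IH].
(* From the generated group to its closure: with the adjugate as inverse the condition is polynomial
   in [A]. *)
have AdG A Y: G A -> Lie G Y -> rad (A *m Y *m invmx A - Y).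
 move=> gA hY;split=> [|Z hZ].
  by apply: LieB=> //;exact: Lie_Ad.
 pose p := \tr ((gmx K n *m cmx _ Y *m \adj (gmx K n) - cmx _ Y) *m cmx _ Z).
 have trE (M : 'M_n) (B : 'M[K]_n) : mxeval (\tr M) B = \tr (mev M B).
  by rewrite /mxeval /mxtrace rmorph_sum;eqb=> i _;rewrite mxE.
 have pE B: G B -> mxeval p B = \tr ((B *m Y *m invmx B - Y) *m Z).
  move=> gB;have d1 := det1G hexp gB.
  rewrite trE mevM mev_c /invmx (mxgrpU mG gB) d1 invr1 scale1r;congr (\tr (_ *m _)).
  have ->: mev (gmx K n *m cmx _ Y *m \adj (gmx K n) - cmx _ Y) B =
   mev (gmx K n *m cmx _ Y *m \adj (gmx K n)) B - mev (cmx _ Y) B.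
   by mxP=> i j;rewrite !mxE /mxeval mevalB.
  rewrite !mevM mev_g !mev_c;congr (_ *m _ - _).
  by mxP=> i j;rewrite mxE mxeval_adj.
 rewrite -pE //;move: gA;rewrite -SE=> -[_];apply=> B hB.
 by rewrite pE;[case: (AdS B Y hB hY)=> _;apply|exact: SG].
have radX Y (b : K) : Lie G Y -> t *m Y *m invmx t = b *: Y -> b != 1 -> rad Y.
 move=> hY tY b1;have:= radZ (b - 1)^-1 (AdG t Y gt hY).
 by rewrite tY -{2}[Y]scale1r -scalerBl scalerA mulVf ?subr_eq0 // scale1r.
have re := radX e a Le te a1.
have rf: rad f by apply: radX Lf tf _;apply: contra a1=> /eqP h;rewrite -[a]invrK h invr1.
have [m hm]:= ad_nilp (rad_nilp (rad_lb re Lf)).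
have it: iter m (lb (lb e f)) e = 2%:R ^+ m *: e.
 elim: m {hm}=> [|m IH] /=;first by rewrite expr0 scale1r.
 by rewrite IH lbZr he scalerA -exprSr.
have:= hm e;rewrite it=> /eqP;rewrite scaler_eq0 (negPf e0) orbF expf_eq0.
by rewrite pnatr_eq0 andbF.
Qed.
End TraceForm.

(** * Functions with zero differential on a connected group *)

Lemma mxeval_prod (K : acf) n (I : Type) (r : seq I) (P : pred I)
  (F : I -> {mpoly K[n * n]}) A :
 mxeval (\prod_(i <- r | P i) F i) A = \prod_(i <- r | P i) mxeval (F i) A.
apply: (big_morph (fun p=> mxeval p A))=> [p q|];first exact: mxevalM.
by rewrite -mpolyC1 mxevalC.
Qed.

Section ConstantFunctions.
Variables (K : acf) (n : nat) (G : set 'M[K]_n).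
Hypothesis hexp : zcl (gen (exp_fam G)) = G.
(** If [p] took infinitely many values on [S], generic smoothness would produce a tangent vector
    with derivative 1. So there are finitely many values, and connectedness leaves only the one at
    1. *)
Lemma constant_of_tangent S p : conn_group S -> S `<=` G ->
 (forall A X, S A -> Lie S X -> dmx p A (A *m X) = 0) ->
 forall A, S A -> mxeval p A = mxeval p 1%:M.
move=> [aS cS] SG hd;have mS: mxgroup S by case: aS.
have [hinf|]:= pselect (forall q : {poly K}, q != 0 -> exists2 A, S A & q.[mxeval p A] != 0).
 have [||z [xi [h1 h2 _]]] :=
  @generic_smoothness K (n * n) [set z | S (vec_mx z)] p 1;last 1 first.
 - pose A := vec_mx (\row_i z i) : 'M[K]_n;pose X := vec_mx (\row_i xi i) : 'M[K]_n.
  have eA: (fun k=> mxvec A 0 k) = z by apply/funext=> k;rewrite vec_mxK mxE.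
  have van q: vanish S q -> mxeval q A = 0 /\ dmx q A X = 0.
   move=> hq;have [|e1 e2]:= h1 q;first by move=> v /hq;rewrite /mxeval vec_mxK.
   rewrite /mxeval /dmx /mxeval eA;split=> //;rewrite -[RHS]e2.
   by eqb=> i _;rewrite vec_mxK mxE.
  have SA: S A by apply: (closed_in_det1 hexp)=> // q /van [].
  have uA := mxgrpU mS SA.
  have LX: Lie S (invmx A *m X) by apply: Lie_left=> // q /van [].
  have:= hd _ _ SA LX;rewrite mulmxA mulmxV // mul1mx=> e.
  suff : (1 : K) = 0 by move/eqP;rewrite oner_eq0.
  rewrite -h2 -[RHS]e /dmx /mxeval eA.
  by eqb=> i _;rewrite vec_mxK mxE.
 - move=> q /hinf [A SA qA];exists (mxvec A);first by rewrite /= mxvecK.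
  by move: qA;rewrite /mxeval.
 - exact: oner_neq0.
move=> /existsNP [q /not_implyP [q0 hq]].
have {}hq A : S A -> root q (mxeval p A).
 by move=> SA;apply/negPn/negP=> qA;apply: hq;exists A.
have [rs ers]:= closed_field_poly_normal q;set p1 := mxeval p 1%:M.
have S1: S 1%:M by exact: mxgrp1.
pose q2 := \prod_(r <- rs | r != p1) (p - r%:MP).
have q2E A: mxeval q2 A = \prod_(r <- rs | r != p1) (mxeval p A - r).
 by rewrite mxeval_prod;eqb=> r _;rewrite /mxeval mevalB mevalC.
have [||h|h]:= zconnected_sconn cS (I1 := [set p - p1%:MP]) (I2 := [set q2]).
- move=> A SA;have [e|ne]:= eqVneq (mxeval p A) p1;[left|right]=> _ ->.
  by rewrite /mxeval mevalB mevalC -/(mxeval p A) e subrr.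
 rewrite q2E;have:= hq A SA;rewrite ers rootZ ?lead_coef_eq0 // root_prod_XsubC=> hin.
 by rewrite (big_rem _ hin) /= ne subrr mul0r.
- move=> A SA /(_ _ erefl) e1 /(_ _ erefl);rewrite q2E=> /eqP.
 move: e1;rewrite /mxeval mevalB mevalC=> /eqP;rewrite subr_eq0 -/(mxeval p A)=> /eqP ->.
 by rewrite prodf_seq_eq0=> /hasP [r _ /andP [r1]];rewrite subr_eq0 eq_sym (negPf r1).
- by move=> A SA;have:= h A SA _ erefl;rewrite /mxeval mevalB mevalC=> /eqP;rewrite subr_eq0=> /eqP.
have /eqP := h _ S1 _ erefl;rewrite q2E -/p1.
by rewrite prodf_seq_eq0=> /hasP [r _ /andP [r1]];rewrite subr_eq0 eq_sym (negPf r1).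
Qed.
End ConstantFunctions.

(** * Tori, their characters and their centralizers *)

Section IntegerSeparation.
Variables (n : nat) (V : set 'rV[int]_n).
Hypotheses (VD : forall u v, V u -> V v -> V (u + v)) (VZ : forall (k : int) u, V u -> V (k *: u)) (V0 : V 0).
Definition idot (l u : 'rV[int]_n) := \sum_i l 0 i * u 0 i.
Lemma idotD l u v : idot l (u + v) = idot l u + idot l v.
by rewrite -big_split;eqb=> i _;rewrite mxE mulrDr. Qed.
Lemma idotZ l k u : idot l (k *: u) = k * idot l u.
by rewrite mulr_sumr;eqb=> i _;rewrite mxE mulrCA. Qed.
(** An element in general position with respect to finitely many forms: when the next form vanishes
    at [u] but not at some [v], [u] is replaced by C u + v, with [C] too large for a cancellation in
    the earlier forms. *)
Lemma integer_separation (L : seq 'rV[int]_n) : exists2 u, V u &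
 forall l, l \in L -> idot l u = 0 -> forall v, V v -> idot l v = 0.
elim: L=> [|l L [u Vu hu]];first by exists 0.
have [h|]:= pselect (forall v, V v -> idot l v = 0).
 by exists u=> // l';rewrite inE=> /orP [/eqP ->|/hu].
move=> /existsNP [v /not_implyP [Vv hv]].
have [h|nz]:= eqVneq (idot l u) 0;last first.
 exists u=> // l';rewrite inE=> /orP [/eqP ->|/hu //].
 by move=> e;rewrite e eqxx in nz.
pose C : int := 1 + \sum_(l' <- L) `|idot l' v|.
exists (C *: u + v);first by apply: VD=> //;exact: VZ.
move=> l';rewrite inE idotD idotZ=> /orP [/eqP ->|l'L];first by rewrite h mulr0 add0r.
have [z|nz]:= eqVneq (idot l' u) 0;first by move=> _;exact: hu.
move=> e;exfalso.
have C1: `|idot l' v| < C.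
 rewrite /C (big_rem l') //= addrA (lt_le_trans (y := 1 + `|idot l' v|)) ?ltrDr //.
 by rewrite lerDl sumr_ge0.
move: e=> /eqP;rewrite addr_eq0=> /eqP e.
have : `|C * idot l' u| = `|idot l' v| by rewrite e normrN.
rewrite normrM=> e';have : `|C| <= `|C| * `|idot l' u|.
 by rewrite ler_peMr // -gtz0_ge1 normr_gt0.
by rewrite e' leNgt (lt_le_trans C1) // ler_norm.
Qed.
End IntegerSeparation.

Section TorusLie.
Variables (K : acf) (n : nat).
Implicit Types (A X Y : 'M[K]_n) (s : seq 'I_n).
Lemma mul_qdiag (Q : 'M[K]_n) u v : Q \in unitmx ->
 qdiag Q u *m qdiag Q v = qdiag Q (\row_i (u 0 i * v 0 i)).
move=> uQ;rewrite /qdiag -!mulmxA (mulmxA Q) mulmxV // mul1mx;congr (_ *m _).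
by rewrite mulmxA mulmx_diag.
Qed.
Lemma qdiagD (Q : 'M[K]_n) u v : qdiag Q (u + v) = qdiag Q u + qdiag Q v.
by rewrite /qdiag linearD /= mulmxDr mulmxDl. Qed.
Lemma qdiagZ (Q : 'M[K]_n) a u : qdiag Q (a *: u) = a *: qdiag Q u.
by rewrite /qdiag linearZ /= -scalemxAr -scalemxAl. Qed.
Lemma qdiag_sum (Q : 'M[K]_n) (I : finType) (F : I -> 'rV[K]_n) :
 qdiag Q (\sum_i F i) = \sum_i qdiag Q (F i).
apply: (big_morph (qdiag Q))=> [u v|];first exact: qdiagD.
by rewrite /qdiag linear0 mulmx0 mul0mx.
Qed.
Lemma qdiag_inj (Q : 'M[K]_n) : Q \in unitmx -> injective (qdiag Q).
move=> uQ u v /(congr1 (fun M=> Q *m M *m invmx Q)).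
rewrite /qdiag !mulmxA mulmxV // !mul1mx -!mulmxA mulmxV // !mulmx1=> e.
by apply/rowP=> i;have:= congr1 (fun M : 'M[K]_n=> M i i) e;rewrite !mxE eqxx !mulr1n.
Qed.
(** A matrix commutes with a diagonal one when it has no entries between different eigenvalues. *)
Lemma qdiag_comm_fun Q (u v : 'rV[K]_n) Y : Q \in unitmx ->
 (forall i j, u 0 i = u 0 j -> v 0 i = v 0 j) ->
 Y *m qdiag Q u = qdiag Q u *m Y -> Y *m qdiag Q v = qdiag Q v *m Y.
move=> uQ huv cY;pose Y' := Q *m Y *m invmx Q.
have e1: Y' *m diag_mx u = diag_mx u *m Y'.
 have:= congr1 (fun M=> Q *m M *m invmx Q) cY;rewrite /qdiag /Y' !mulmxA mulmxV // mul1mx.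
 by rewrite -!mulmxA mulmxV // mulmx1 !mulmxA.
have e2: Y' *m diag_mx v = diag_mx v *m Y'.
 mxP=> i j;have:= congr1 (fun M : 'M[K]_n=> M i j) e1.
 rewrite !mul_mx_diag !mul_diag_mx ![(\matrix_(_, _) _) _ _]mxE.
 have [->|nz]:= eqVneq (Y' i j) 0;first by rewrite !mulr0 !mul0r.
 by rewrite mulrC=> /(mulIf nz) /huv ->;rewrite mulrC.
have:= congr1 (fun M=> invmx Q *m M *m Q) e2;rewrite /Y' /qdiag !mulmxA mulVmx // mul1mx.
by rewrite -!mulmxA mulmxA=> ->;rewrite !mulmxA mulmxKV.
Qed.
Lemma rel_le_fun (u v : 'rV[K]_n) : rel_le u v -> forall i j, u 0 i = u 0 j -> v 0 i = v 0 j.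
move=> r i j uij;pose l : 'rV[int]_n := \row_k ((k == i)%:Z - (k == j)%:Z).
have hl z: \sum_k (l 0 k)%:~R * (z : 'rV[K]_n) 0 k = z 0 i - z 0 j.
 under eq_bigr=> k _ do rewrite mxE rmorphB /= mulrBl.
 by rewrite sumrB (bigD1 i) //= eqxx mul1r big1 ?addr0=> [|k /negPf ->];[
  rewrite (bigD1 j) //= eqxx mul1r big1 ?addr0 // => k /negPf -> | ];rewrite mul0r.
by have:= r l;rewrite !hl uij subrr=> /(_ erefl) /eqP;rewrite subr_eq0=> /eqP.
Qed.
Lemma codiagonal (Q Q' : 'M[K]_n) u v : Q \in unitmx -> Q' \in unitmx ->
 qdiag Q u *m qdiag Q' v = qdiag Q' v *m qdiag Q u ->
 exists2 P, P \in unitmx & (exists u', qdiag Q u = qdiag P u') /\ exists v', qdiag Q' v = qdiag P v'.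
move=> uQ uQ' c.
have dg R w: R \in unitmx -> diagonalizable (qdiag R w).
 move=> uR;exists R=> //;apply/diagonalizable_forLR=> //;exists w.
 by rewrite mxpoly.conjVmx.
have [h _]:= codiagonalizableP [:: qdiag Q u;qdiag Q' v].
have [|P uP /= /and3P [d1 d2 _]]:= h.
 split=> [A B|A];rewrite !inE=> /orP [] /eqP -> //;try exact: dg.
  by case/orP=> /eqP ->.
 by case/orP=> /eqP ->.
exists P=> //;split;[move/(diagonalizable_forLR uP): d1|move/(diagonalizable_forLR uP): d2];
 by move=> [w ->];exists w;rewrite mxpoly.conjVmx.
Qed.
Lemma qdiag_codiagonal (Q P : 'M[K]_n) (u v u' : 'rV[K]_n) : Q \in unitmx -> P \in unitmx ->
 (forall i j, u 0 i = u 0 j -> v 0 i = v 0 j) -> qdiag Q u = qdiag P u' ->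
 is_diag_mx (P *m qdiag Q v *m invmx P).
move=> uQ uP huv e;apply/is_diag_mxP=> i j ij.
have cE: qdiag P (delta_mx 0 i) *m qdiag Q u = qdiag Q u *m qdiag P (delta_mx 0 i).
 rewrite e !mul_qdiag //;congr (qdiag _ _);apply/rowP=> k.
 by rewrite !mxE mulrC.
have:= congr1 (fun M=> P *m M *m invmx P) (qdiag_comm_fun uQ huv cE).
move: (qdiag Q v)=> W;rewrite /qdiag !mulmxA mulmxV // mul1mx.
have ->: P *m W *m invmx P *m diag_mx (delta_mx 0 i) *m P *m invmx P =
 P *m W *m invmx P *m diag_mx (delta_mx 0 i) by rewrite mulmxK.
rewrite -[diag_mx _ *m P *m W *m _]mulmxA -[diag_mx _ *m P *m _]mulmxA -(mulmxA P W).
move: (P *m (W *m invmx P))=> M.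
move=> /(congr1 (fun M : 'M[K]_n=> M i j));rewrite mul_diag_mx mul_mx_diag mxE [in RHS]mxE.
have ji: (j == i) = false by rewrite -val_eqE /= eq_sym (negPf ij).
by rewrite !mxE !eqxx ji /= mul1r mulr0.
Qed.

Section Characters.
Variables (G T : set 'M[K]_n) (Q : 'M[K]_n).
Hypotheses (hexp : zcl (gen (exp_fam G)) = G) (cT : conn_group T) (TG : T `<=` G)
 (uQ : Q \in unitmx) (dQ : forall t, T t -> is_diag_mx (Q *m t *m invmx Q)).
Definition tdiag X : 'rV[K]_n := \row_i (Q *m X *m invmx Q) i i.
Lemma tdiagK X : is_diag_mx (Q *m X *m invmx Q) -> X = qdiag Q (tdiag X).
move=> /is_diag_mxP h;rewrite /qdiag.
have ->: diag_mx (tdiag X) = Q *m X *m invmx Q.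
 by mxP=> i j;rewrite mxE;have [->|ne]:= eqVneq i j;rewrite ?mulr1n ?mulr0n;[rewrite mxE|rewrite h].
by rewrite !mulmxA mulVmx // mul1mx mulmxKV.
Qed.
Lemma qdiagK v : tdiag (qdiag Q v) = v.
apply/rowP=> i;rewrite mxE /qdiag !mulmxA mulmxV // mul1mx -!mulmxA mulmxV // mulmx1.
by rewrite mxE eqxx mulr1n.
Qed.
Let mT : mxgroup T. by case: cT=> [[]]. Qed.
Let ent i j : {mpoly K[n * n]} := (cmx _ Q *m gmx K n *m cmx _ (invmx Q)) i j.
Let mxevalent i j A : mxeval (ent i j) A = (Q *m A *m invmx Q) i j.
have ->: mxeval (ent i j) A = mev (cmx _ Q *m gmx K n *m cmx _ (invmx Q)) A i j by rewrite mxE.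
by rewrite !mevM !mev_c mev_g.
Qed.
Let dmxent i j A X : dmx (ent i j) A X = (Q *m X *m invmx Q) i j.
have ->: dmx (ent i j) A X = dev (cmx _ Q *m gmx K n *m cmx _ (invmx Q)) A X i j by rewrite mxE.
by rewrite !dev_mul !dev_c dev_g mulmx0 addr0 mul0mx add0r !mev_c.
Qed.
Lemma Lie_torus_diag X : Lie T X -> is_diag_mx (Q *m X *m invmx Q).
move=> hX;apply/is_diag_mxP=> i j ij.
have /LieP h := hX;rewrite -(dmxent i j 1%:M);apply: h=> t Tt.
by rewrite mxevalent;move/is_diag_mxP: (dQ Tt);apply.
Qed.
Lemma Lie_torus_qdiag X : Lie T X -> X = qdiag Q (tdiag X).
by move=> /Lie_torus_diag;exact: tdiagK. Qed.
Lemma torus_qdiag X : T X -> X = qdiag Q (tdiag X).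
by move=> /dQ;exact: tdiagK. Qed.
Let prodp s := \prod_(k <- s) ent k k.
Let prodpE s A : mxeval (prodp s) A = \prod_(k <- s) tdiag A 0 k.
by rewrite mxeval_prod;eqb=> k _;rewrite mxevalent [RHS]mxE.
Qed.
Let tdiagM A B : T A -> Lie T B -> forall k, tdiag (A *m B) 0 k = tdiag A 0 k * tdiag B 0 k.
move=> /torus_qdiag eA /Lie_torus_qdiag eB k.
by rewrite {1}eA {1}eB mul_qdiag // qdiagK mxE.
Qed.
Let dprodp s A X : T A -> Lie T X ->
 dmx (prodp s) A (A *m X) = (\prod_(k <- s) tdiag A 0 k) * \sum_(k <- s) tdiag X 0 k.
move=> TA LX;elim: s=> [|k s IH];first by rewrite /prodp !big_nil -mpolyC1 dmxC mulr0.
rewrite /prodp !big_cons dmxM -/(prodp s) IH prodpE dmxent mxevalent.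
have ->: (Q *m (A *m X) *m invmx Q) k k = tdiag (A *m X) 0 k by rewrite [RHS]mxE.
have ->: (Q *m A *m invmx Q) k k = tdiag A 0 k by rewrite [RHS]mxE.
by rewrite tdiagM //;ring.
Qed.
Let tdiag1 k : tdiag 1%:M 0 k = 1.
by rewrite mxE mulmx1 mulmxV // mxE eqxx. Qed.
Let prod_det A : T A -> \prod_k tdiag A 0 k = 1.
move=> TA;have:= det1G hexp (TG TA);rewrite {1}(torus_qdiag TA) /qdiag !det_mulmx det_diag.
by rewrite mulrAC -det_mulmx mulVmx // det1 mul1r.
Qed.
Let sum_tr X : Lie T X -> \sum_k tdiag X 0 k = 0.
move=> LX;have T1: T 1%:M by exact: mxgrp1.
have:= dprodp (index_enum 'I_n) T1 LX;rewrite mul1mx.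
rewrite [in RHS]big1 ?mul1r=> [<-|k _];last exact: tdiag1.
have ->: prodp (index_enum 'I_n) = (prodp (index_enum 'I_n) - 1%:MP) + 1%:MP by rewrite subrK.
rewrite dmxD dmxC addr0;have /LieP := LX;apply=> A TA.
by rewrite /mxeval mevalB mevalC -/(mxeval _ _) prodpE prod_det // subrr.
Qed.
(** Two monomials in the diagonal entries are compared through their quotient, whose differential is
    0. The list [s2] makes this quotient polynomial: since the determinant is 1, the inverse of an
    entry is the product of all the others. *)
Lemma torus_character s s' :
 (forall X, Lie T X -> \sum_(k <- s) tdiag X 0 k = \sum_(k <- s') tdiag X 0 k) ->
 forall t, T t -> \prod_(k <- s) tdiag t 0 k = \prod_(k <- s') tdiag t 0 k.
move=> h t Tt;pose s2 := flatten [seq rem k (index_enum 'I_n) | k <- s'].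
have prodrem A: T A -> forall k, tdiag A 0 k * \prod_(l <- rem k (index_enum 'I_n)) tdiag A 0 l = 1.
 by move=> TA k;rewrite -[RHS](prod_det TA) [RHS](big_rem k) ?mem_index_enum.
have inv2 A: T A -> \prod_(k <- s') tdiag A 0 k * \prod_(k <- s2) tdiag A 0 k = 1.
 move=> TA;rewrite /s2;elim: (s')=> [|k r IH];first by rewrite !big_nil mulr1.
 by rewrite /= big_cat big_cons /= mulrACA prodrem // IH mulr1.
have sum2 X: Lie T X -> \sum_(k <- s2) tdiag X 0 k = - \sum_(k <- s') tdiag X 0 k.
 move=> LX;rewrite /s2;elim: (s')=> [|k r IH];first by rewrite !big_nil oppr0.
 rewrite /= big_cat big_cons /= IH opprD;congr (_ + _);apply/eqP;rewrite eq_sym eqr_oppLR -addr_eq0.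
 by have:= sum_tr LX;rewrite (big_rem k) ?mem_index_enum //= => ->.
have:= constant_of_tangent hexp cT TG (p := prodp (s ++ s2)) _ Tt.
rewrite !prodpE [in RHS]big1=> [|k _];last exact: tdiag1.
have /[swap]/[apply]: forall A X, T A -> Lie T X -> dmx (prodp (s ++ s2)) A (A *m X) = 0.
 by move=> A X TA LX;rewrite dprodp // !big_cat /= sum2 // h // subrr mulr0.
rewrite big_cat /= => e;have:= inv2 t Tt=> e2.
have nz: \prod_(k <- s2) tdiag t 0 k != 0.
 by apply/eqP=> z;move: e2;rewrite z mulr0=> /esym/eqP;rewrite oner_eq0.
by apply: (mulIf nz);rewrite e e2.
Qed.
Lemma torus_hull X : Lie T X -> exists r (M : 'M[int]_(r, n)) (c : 'rV[K]_r),
 X = \sum_i c 0 i *: qdiag Q (map_mx intr (row i M)) /\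
 forall i, Lie T (qdiag Q (map_mx intr (row i M))) /\ forall w, w != 0 -> T (qlam Q (row i M) w).
move=> LX;have aT: alg_group T by case: cT.
have eX := Lie_torus_qdiag LX.
have n0: nilp (0 : 'M[K]_n) by exists 1%N;rewrite expr1.
have c0: qdiag Q (tdiag X) *m 0 = 0 *m qdiag Q (tdiag X) by rewrite mulmx0 mul0mx.
have L0: Lie T (qdiag Q (tdiag X) + 0) by rewrite addr0 -eX.
have [r [M [c [es hM]]]]:= rational_hull (tdiag X).
exists r, M, c;split=> [|i];last first.
 split;first exact: jordan_qdiag aT uQ n0 c0 L0 _ (hM i).
 by move=> w;exact: jordan_qlam aT uQ n0 c0 L0 _ _ (hM i).
rewrite {1}eX es;under [RHS]eq_bigr=> i _ do rewrite -qdiagZ.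
rewrite -qdiag_sum;congr qdiag;apply/rowP=> j;rewrite mxE summxE.
by eqb=> i _;rewrite !mxE.
Qed.
End Characters.
End TorusLie.

Section WeightComponents.
Variables (K : acf) (n : nat) (Q : 'M[K]_n) (mu : 'rV[K]_n).
Hypothesis uQ : Q \in unitmx.
Implicit Types (Y : 'M[K]_n) (k : K).
Let x1 := qdiag Q mu : 'M[K]_n.
Definition qcomp k Y : 'M[K]_n := invmx Q *m
 (\matrix_(i, j) if mu 0 i - mu 0 j == k then (Q *m Y *m invmx Q) i j else 0) *m Q.
Let conjQ Y := Q *m Y *m invmx Q.
Let conjQK A : conjQ (invmx Q *m A *m Q) = A.
by rewrite /conjQ !mulmxA mulmxV // mul1mx mulmxK. Qed.
Let conjQ_inj Y Z : conjQ Y = conjQ Z -> Y = Z.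
by move/(congr1 (fun M=> invmx Q *m M *m Q));rewrite /conjQ !mulmxA mulVmx // !mul1mx !mulmxKV. Qed.
Let conjQ_lb Y i j : conjQ (lb x1 Y) i j = (mu 0 i - mu 0 j) * conjQ Y i j.
have ->: conjQ (lb x1 Y) = lb (diag_mx mu) (conjQ Y).
 rewrite /lb /x1 /qdiag /conjQ mulmxBr mulmxBl !mulmxA mulmxV // mul1mx.
 by congr (_ - _);rewrite ?mulmxKV // mulmxK.
by rewrite /lb mul_diag_mx mul_mx_diag !mxE mulrBl;congr (_ - _);rewrite mulrC.
Qed.
Lemma lb_qcomp k Y : lb x1 (qcomp k Y) = k *: qcomp k Y.
apply: conjQ_inj;mxP=> i j;rewrite conjQ_lb /conjQ -scalemxAr -scalemxAl mxZE.
rewrite -/(conjQ _) /qcomp conjQK mxE;case: eqP=> [->//|_];by rewrite !mulr0.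
Qed.
Definition qdiffs : seq K := undup [seq mu 0 ij.1 - mu 0 ij.2 | ij <- enum {: 'I_n * 'I_n}].
Lemma mem_qdiffs i j : mu 0 i - mu 0 j \in qdiffs.
by rewrite mem_undup;apply/mapP;exists (i, j);rewrite ?mem_enum. Qed.
Lemma qcomp_sum Y : Y = \sum_(k <- qdiffs) qcomp k Y.
apply: conjQ_inj;rewrite /conjQ mulmx_sumr mulmx_suml;mxP=> i j;rewrite summxE.
rewrite (bigD1_seq _ (mem_qdiffs i j)) ?undup_uniq //= -![_ *m invmx Q]/(conjQ _) conjQK [in RHS]mxE eqxx.
rewrite big1 ?addr0 // => k kn;rewrite -/(conjQ (qcomp k Y)) conjQK mxE.
by rewrite eq_sym (negPf kn).
Qed.
(** The component is obtained from [Y] by Lagrange interpolation in the bracket with the diagonal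
    matrix, so it stays in every subspace stable under that bracket. *)
Lemma qcomp_sub (V : set 'M[K]_n) k Y : (forall A B (a : K), V A -> V B -> V (a *: A + B)) ->
 (forall A, V A -> V (lb x1 A)) -> V Y -> V (qcomp k Y).
move=> Vl Vx VY;have V0: V 0 by have:= Vl _ _ (-1) VY VY;rewrite scaleN1r addNr.
have [kin|kn]:= boolP (k \in qdiffs);last first.
 suff ->: qcomp k Y = 0 by [].
 apply: conjQ_inj;rewrite conjQK;mxP=> i j;rewrite mxE /conjQ mulmx0 mul0mx [RHS]mxE.
 by case: eqVneq=> // e;case/negP: kn;rewrite -e mem_qdiffs.
pose op (d : K) Z := (k - d)^-1 *: (lb x1 Z + (- d) *: Z).
have Vop d Z: V Z -> V (op d Z).
 move=> VZ;rewrite /op -[_ *: _]addr0;apply: (Vl)=> //.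
 by rewrite addrC;apply: Vl=> //;exact: Vx.
have opE d Z i j: conjQ (op d Z) i j = (mu 0 i - mu 0 j - d) / (k - d) * conjQ Z i j.
 rewrite /op /conjQ -scalemxAr -scalemxAl mxZE mulmxDr mulmxDl mxDE -/(conjQ _) conjQ_lb.
 rewrite -scalemxAr -scalemxAl mxZE -/(conjQ Z);ring.
pose ds := seq.filter (predC1 k) qdiffs.
suff ->: qcomp k Y = foldr op Y ds by elim: ds=> //= d ds IH;exact: Vop.
apply: conjQ_inj;rewrite conjQK;mxP=> i j;rewrite mxE.
have fE: forall s : seq K, conjQ (foldr op Y s) i j =
  (\prod_(d <- s) ((mu 0 i - mu 0 j - d) / (k - d))) * conjQ Y i j.
 by elim=> [|d s IH] /=;rewrite ?big_nil ?mul1r // opE IH big_cons mulrA.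
rewrite fE;case: eqP=> [->|/eqP ne].
 rewrite big_seq big1 ?mul1r // => d;rewrite mem_filter /= => /andP [dk _].
 by rewrite divff // subr_eq0 eq_sym.
rewrite (big_rem (mu 0 i - mu 0 j)) ?mem_filter /= ?ne ?mem_qdiffs //.
by rewrite subrr !mul0r.
Qed.
End WeightComponents.

Section MaximalTorus.
Variables (K : acf) (n : nat).
Implicit Types (A X Y : 'M[K]_n) (m : 'rV[int]_n).
Lemma qlamD (Q : 'M[K]_n) m m' w : Q \in unitmx -> w != 0 ->
 qlam Q (m + m') w = qlam Q m w *m qlam Q m' w.
move=> uQ w0;rewrite /qlam mul_qdiag //;congr (qdiag _ _);apply/rowP=> i.
by rewrite !mxE expfzDr.
Qed.
Lemma qlamZ (Q : 'M[K]_n) (k : int) m w : qlam Q (k *: m) w = qlam Q m (w ^ k).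
by congr (qdiag _ _);apply/rowP=> i;rewrite !mxE exprz_exp. Qed.
Lemma qlam1 (Q : 'M[K]_n) m : Q \in unitmx -> qlam Q m 1 = 1%:M.
move=> uQ;rewrite -(qdiag1 uQ);congr (qdiag _ _);apply/rowP=> i.
by rewrite !mxE exp1rz.
Qed.
(** A power of [w] beyond all the exponents makes the one-parameter subgroup polynomial. *)
Lemma qlam_curve (Q : 'M[K]_n) m : Q \in unitmx -> exists (N : nat) gam,
 [/\ forall w, w != 0 -> (w ^+ N.+1)^-1 *: hmx w gam = qlam Q m w,
   hmx 1 gam = 1%:M & hmx 1 (dermx gam) = N.+1%:R%:M + qdiag Q (map_mx intr m)].
move=> uQ;pose N := (\sum_i `|m 0%R i|).+1%N;pose k i := absz (m 0 i + N%:Z).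
have kE i: (k i)%:Z = m 0 i + N%:Z.
 have h: leq (absz (m 0 i)) N by rewrite /N (bigD1 i) //= -addnS leq_addr.
 by rewrite /k;lia.
pose D : 'M[{poly K}]_n := diag_mx (\row_i 'X^(k i)).
pose gam := map_mx polyC (invmx Q) *m D *m map_mx polyC Q.
have hD w: hmx w D = diag_mx (\row_i w ^+ k i).
 by mxP=> i j;rewrite !mxE /hev hornerMn hornerXn.
have hg w: hmx w gam = qdiag Q (\row_i w ^+ k i) by rewrite !hmxM !hmxC hD.
have h1: hmx 1 gam = 1%:M.
 by rewrite hg -(qdiag1 uQ);congr (qdiag _ _);apply/rowP=> i;rewrite !mxE expr1n.
exists (\sum_i `|m 0%R i|)%N, gam;rewrite -/N;split=> // [w w0|].
 rewrite hg -qdiagZ;congr (qdiag _ _);apply/rowP=> i;rewrite !mxE.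
 by rewrite !exprnP kE expfzDr // mulrC mulfK // expfz_neq0.
rewrite !dermxM !dermxC mul0mx add0r mulmx0 addr0 !hmxM !hmxC.
have ->: hmx 1 (dermx D) = diag_mx (\row_i (k i)%:R).
 by mxP=> i j;rewrite !mxE /hev derivMn hornerMn derivXn hornerMn hornerXn expr1n.
have ->: N%:R%:M = qdiag Q (\row__ N%:R).
 have ->: (\row__ N%:R : 'rV[K]_n) = N%:R *: (\row__ 1) by apply/rowP=> i;rewrite !mxE mulr1.
 by rewrite qdiagZ qdiag1 // scalemx1.
rewrite -qdiagD;congr (qdiag _ _);apply/rowP=> i;rewrite !mxE.
by rewrite pmulrn kE rmorphD /= addrC.
Qed.
Lemma torus_of_qlam T (Q : 'M[K]_n) m : Q \in unitmx ->
 (forall w, w != 0 -> T (qlam Q m w)) -> Lie T (qdiag Q (map_mx intr m)).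
move=> uQ hT;have [N [gam [h1 h2 h3]]]:= qlam_curve m uQ.
have:= Lie_frac_curve (e := 'X^(N.+1)) (G := T) (t0 := 1) _ h2 _.
rewrite hornerXn expr1n h3 derivXn hornerMn hornerXn expr1n addrC addKr;apply=> // t.
by rewrite hornerXn expf_eq0 /= => tN;rewrite h1 //;exact: hT.
Qed.
Variables (G T : set 'M[K]_n) (Q : 'M[K]_n).
Hypotheses (hG : simple_group G) (hT : max_torus G T) (hexp : zcl (gen (exp_fam G)) = G)
 (hrad : forall X, rad G X -> X = 0)
 (uQ : Q \in unitmx) (dQ : forall t, T t -> is_diag_mx (Q *m t *m invmx Q)).
Let aG : alg_group G. by case: hG=> [[]]. Qed.
Let mG : mxgroup G. by case: aG. Qed.
Let TG : T `<=` G. by case: hT. Qed.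
Let cT : conn_group T. by case: hT=> _ []. Qed.
Let aT : alg_group T. by case: cT. Qed.
Let mT : mxgroup T. by case: aT. Qed.
Definition tint m := Lie T (qdiag Q (map_mx intr m)) /\ forall w, w != 0 -> T (qlam Q m w).
Lemma tintD m m' : tint m -> tint m' -> tint (m + m').
move=> [h1 h2] [h3 h4];split=> [|w w0].
 by rewrite raddfD qdiagD;exact: LieD.
by rewrite qlamD //;apply: (mxgrpM mT);[exact: h2|exact: h4].
Qed.
Lemma tintZ (k : int) m : tint m -> tint (k *: m).
move=> [h1 h2];split=> [|w w0].
 have ->: map_mx intr (k *: m) = k%:~R *: map_mx intr m :> 'rV[K]_n.
  by apply/rowP=> i;rewrite !mxE rmorphM.
 by rewrite qdiagZ;exact: LieZ.
by rewrite qlamZ;apply: h2;rewrite expfz_neq0.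
Qed.
Lemma tint0 : tint 0.
split=> [|w w0];first by rewrite raddf0 /qdiag linear0 mulmx0 mul0mx;exact: Lie0.
have ->: qlam Q 0 w = 1%:M;last exact: mxgrp1.
by rewrite -(qdiag1 uQ);congr (qdiag _ _);apply/rowP=> i;rewrite !mxE expr0z.
Qed.
(** A family of cocharacters of maximal rank spans, since by [torus_hull] each element of Lie T is a
    combination of cocharacters. *)
Lemma torus_span : exists r (M : 'M[int]_(r, n)), (forall i, tint (row i M)) /\
 forall X, Lie T X -> exists c : 'rV[K]_r, X = qdiag Q (c *m map_mx intr M).
pose P k := `[< exists r (M : 'M[int]_(r, n)), (forall i, tint (row i M)) /\
 \rank (map_mx intr M : 'M[K]_(r, n)) = k >].
have exP: exists k, P k.
 by exists 0%N;apply/asboolP;exists 0%N, 0;split;[case|rewrite flatmx0 mxrank0].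
have ub k: P k -> (k <= n)%N by move=> /asboolP [r [M [_ <-]]];exact: rank_leq_col.
have:= ex_maxnP exP ub;case=> k /asboolP [r [M [hM eM]]] kmax.
have sub m: tint m -> (map_mx intr m <= (map_mx intr M : 'M[K]_(r, n)))%MS.
 move=> hm;have:= kmax (\rank (map_mx intr (col_mx M m) : 'M[K]_(r + 1, n))).
 rewrite -eM=> h;have {}h : (\rank (col_mx (map_mx intr M) (map_mx intr m) : 'M[K]_(r + 1, n)) <=
  \rank (map_mx intr M : 'M[K]_(r, n)))%N.
  rewrite -map_col_mx;apply: h;apply/asboolP;exists (r + 1)%N, (col_mx M m);split=> // i.
  by rewrite -(@fintype.splitK _ _ i);case: (fintype.split i)=> j /=;
   rewrite ?rowKu ?rowKd ?row_id.
 have s: ((map_mx intr M : 'M[K]_(r, n)) <= col_mx (map_mx intr M) (map_mx intr m : 'rV[K]_n))%MS.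
  by rewrite -addsmxE addsmxSl.
 have:= mxrank_leqif_sup s=> -[_];rewrite eqn_leq mxrankS //= h=> /esym.
 by apply: submx_trans;rewrite -addsmxE addsmxSr.
exists r, M;split=> // X LX.
have [r' [M' [c [eX hM']]]]:= torus_hull cT uQ dQ LX.
have : ((\sum_i c 0 i *: (map_mx intr (row i M') : 'rV[K]_n))%R <= (map_mx intr M : 'M[K]_(r, n)))%MS.
 by apply: summx_sub=> i _;apply: scalemx_sub;apply: sub;exact: hM'.
move=> /submxP [d hd];exists d;rewrite -hd eX qdiag_sum.
by eqb=> i _;rewrite qdiagZ.
Qed.
(** One cocharacter that tells all the weights of conjugation apart, so that weight components for
    the whole torus are eigencomponents of a single element. *)
Lemma torus_separating : exists2 mu, tint mu & forall i j k l,
 mu 0 i - mu 0 j = mu 0 k - mu 0 l -> forall m, tint m -> m 0 i - m 0 j = m 0 k - m 0 l.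
pose d (x : 'I_n * 'I_n * 'I_n * 'I_n) : 'rV[int]_n := \row_p
 ((p == x.1.1.1)%:Z - (p == x.1.1.2)%:Z - ((p == x.1.2)%:Z - (p == x.2)%:Z)).
have dE x u: idot (d x) u = u 0 x.1.1.1 - u 0 x.1.1.2 - (u 0 x.1.2 - u 0 x.2).
 have e1 y: \sum_p (p == y)%:Z * u 0 p = u 0 y.
  by rewrite (bigD1 y) //= eqxx mul1r big1 ?addr0 // => p /negPf ->;rewrite mul0r.
 rewrite /idot;under eq_bigr=> p _ do rewrite mxE !mulrBl.
 by rewrite !sumrB !e1.
have [mu hmu h]:= integer_separation tintD tintZ tint0 (map d (enum {: 'I_n * 'I_n * 'I_n * 'I_n})).
exists mu=> // i j k l e m hm;sub0P.
have:= dE (i, j, k, l) m;rewrite /= => <-;apply: h=> //;last by rewrite dE e subrr.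
by apply/map_f;rewrite mem_enum.
Qed.
Lemma tint_Lie_eq i j k l : (forall m, tint m -> m 0 i - m 0 j = m 0 k - m 0 l) ->
 forall X, Lie T X -> tdiag Q X 0 i - tdiag Q X 0 j = tdiag Q X 0 k - tdiag Q X 0 l.
move=> h X LX;have [r [M [hM hX]]]:= torus_span;have [c ->]:= hX X LX.
rewrite qdiagK // ![(c *m _) _ _]mxE -!sumrB;eqb=> p _;rewrite -!mulrBr;congr (_ * _).
by have:= h _ (hM p);rewrite !mxE -!rmorphB /= => ->.
Qed.
(** [T] and the one-parameter subgroups in the rational hull of [s] are simultaneously
    diagonalizable and generate a connected group. Its closure is a torus, hence equal to [T] by
    maximality. *)
Lemma semisimple_centralizer (Q' : 'M[K]_n) s : Q' \in unitmx -> Lie G (qdiag Q' s) ->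
 (forall X, Lie T X -> X *m qdiag Q' s = qdiag Q' s *m X) -> Lie T (qdiag Q' s).
move=> uQ' LS cS;have [mu hmu sep]:= torus_separating.
have Lmu: Lie T (qdiag Q (map_mx intr mu)) by case: hmu.
(* It suffices to diagonalize the separating element together with [qdiag Q' s]: everything else in
   the two families is a function of one of these. *)
have [P uP [[u' eu] [v' ev]]]:= codiagonal uQ uQ' (cS _ Lmu).
have [r [M [c [es hM]]]]:= rational_hull s.
have n0: nilp (0 : 'M[K]_n) by exists 1%N;rewrite expr1.
have c0: qdiag Q' s *m 0 = 0 *m qdiag Q' s by rewrite mulmx0 mul0mx.
have L0: Lie G (qdiag Q' s + 0) by rewrite addr0.
have Gc i w: w != 0 -> G (qlam Q' (row i M) w).
 by move=> w0;exact: jordan_qlam aG uQ' n0 c0 L0 _ _ (hM i) w0.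
pose curve i : set 'M[K]_n := [set qlam Q' (row i M) w | w in [set w | w != 0]].
pose F : set (set 'M[K]_n) := [set C | C = T \/ exists i, C = curve i].
have FG C: F C -> C `<=` G.
 by move=> [->//|[i ->]] _ [w w0 <-];exact: Gc.
have qlamV i w: w != 0 -> invmx (qlam Q' (row i M) w) = qlam Q' (row i M) w^-1.
 move=> w0;have e: qlam Q' (row i M) w *m qlam Q' (row i M) w^-1 = 1%:M.
  rewrite /qlam mul_qdiag // -(qdiag1 uQ');congr (qdiag _ _);apply/rowP=> j.
  by rewrite !mxE -expfzMl mulfV // exp1rz.
 by have uq := mxgrpU mG (Gc i w w0);rewrite -[RHS](mulKmx uq) e mulmx1.
have gF: gen_fam F.
 move=> C [->|[i ->]].
  by split;[exact: mxgrp1|move=> A;exact: mxgrpU|move=> A;exact: mxgrpV].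
 split;first by exists 1;[exact: oner_neq0|exact: qlam1].
  by move=> _ [w w0 <-];exact: (mxgrpU mG (Gc i w w0)).
 by move=> _ [w w0 <-];exists w^-1;rewrite ?qlamV //= invr_neq0.
have sF C: F C -> C 1%:M /\ sconn C.
 move=> FC;split;first by case: (gF C FC).
 case: FC=> [->|[i ->]];first by apply: zconnected_sconn;case: cT.
 apply: sirr_sconn;have [N [gam [h1 _ _]]]:= qlam_curve (row i M) uQ'.
 have ->: curve i = [set ('X^(N.+1)).[w]^-1 *: hmx w gam | w in [set w | ('X^(N.+1)).[w] != 0]].
  rewrite predeqE=> A;split=> -[w w0 <-];exists w;rewrite /= ?hornerXn ?h1 //.
  - by rewrite expf_neq0.
  - by move: w0;rewrite /= hornerXn expf_eq0.
  - by move: w0;rewrite /= hornerXn expf_eq0.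
 by apply: sirr_frac_curve;rewrite -size_poly_eq0 size_polyXn.
have mS := mxgrp_gen gF;have TS: T `<=` zcl (gen F).
 by move=> A TA;apply: zcl_sub;[case: mS|apply: (gen_gen (C := T))=> //;left].
have dT A: gen F A -> is_diag_mx (P *m A *m invmx P).
 elim=> [|B C A' _ IH FC CA'];first by rewrite mulmx1 mulmxV // scalar_mx_is_diag.
 have ->: P *m (B *m A') *m invmx P = (P *m B *m invmx P) *m (P *m A' *m invmx P).
  by rewrite !mulmxA mulmxKV.
 have dA: is_diag_mx (P *m A' *m invmx P).
  case: FC CA'=> [->|[i ->]]=> [TA|[w w0 <-]].
   rewrite (torus_qdiag uQ dQ TA);apply: (qdiag_codiagonal uQ uP _ eu)=> i j.
   rewrite ![map_mx _ _ _ _]mxE=> /eqP;rewrite eqr_int=> /eqP eij.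
   have h m: tint m -> m 0 i - m 0 j = m 0 i - m 0 i by apply: sep;rewrite eij.
   have:= torus_character hexp cT TG uQ dQ (s := [:: i]) (s' := [:: j]) _ TA.
   rewrite !big_seq1;apply=> X LX;rewrite !big_seq1.
   by have:= tint_Lie_eq h LX;rewrite subrr=> /eqP;rewrite subr_eq0=> /eqP.
  apply: (qdiag_codiagonal uQ' uP _ ev)=> a b /(rel_le_fun (hM i)).
  by rewrite !mxE=> /eqP;rewrite eqr_int=> /eqP ->.
 move: IH dA=> /diag_mxP [D1 ->] /diag_mxP [D2 ->];rewrite mulmx_diag;exact: diag_mx_is_diag.
have cT': conn_group (zcl (gen F)) by apply: conn_group_zcl=> //;exact: sconn_gen.
have tT': torus (zcl (gen F)).
 split=> //;exists P=> // A [uA hA];apply/is_diag_mxP=> i j ij.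
 pose p := (cmx _ P *m gmx K n *m cmx _ (invmx P)) i j.
 have pE B: mxeval p B = (P *m B *m invmx P) i j.
  have ->: mxeval p B = mev (cmx _ P *m gmx K n *m cmx _ (invmx P)) B i j by rewrite [RHS]mxE.
  by rewrite !mevM !mev_c mev_g.
 rewrite -pE;apply: hA=> B /dT /is_diag_mxP h;rewrite pE;exact: h.
have eT: zcl (gen F) = T.
 case: hT=> _ _ hmax;apply: hmax=> //.
 by apply: alg_group_zcl_sub=> //;apply: gen_sub.
rewrite es;have ->: c *m map_mx intr M = \sum_i c 0 i *: map_mx intr (row i M).
 by rewrite mulmx_sum_row;eqb=> i _;rewrite map_row.
rewrite qdiag_sum;apply: Lie_sum=> i _;rewrite qdiagZ;apply: LieZ.
apply: torus_of_qlam=> // w w0;rewrite -eT;apply: zcl_sub;first by case: mS.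
by apply: (gen_gen (C := curve i));[right;exists i|exists w].
Qed.
Lemma torus_nondegenerate X : Lie T X -> (forall Y, Lie T Y -> \tr (X *m Y) = 0) -> X = 0.
move=> LX h;have eX := Lie_torus_qdiag uQ dQ LX.
have aT' := aT.
have n0: nilp (0 : 'M[K]_n) by exists 1%N;rewrite expr1.
have c0: qdiag Q (tdiag Q X) *m 0 = 0 *m qdiag Q (tdiag Q X) by rewrite mulmx0 mul0mx.
have L0: Lie T (qdiag Q (tdiag Q X) + 0) by rewrite addr0 -eX.
have [r [M [c [es hM]]]]:= rational_hull (tdiag Q X).
rewrite eX (hull_nondegenerate es)=> [|i];first by rewrite /qdiag linear0 mulmx0 mul0mx.
have:= h _ (jordan_qdiag aT uQ n0 c0 L0 (hM i));rewrite {1}eX trace_qdiag // => e.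
by rewrite -[RHS]e;eqb=> j _;rewrite !mxE.
Qed.

(** The semisimple part of an element of the centralizer lies in Lie T by maximality. A sum of two
    nilpotent elements of the centralizer is nilpotent, because its semisimple part is orthogonal to
    Lie T; so traces of products of such elements vanish. This places the nilpotent part of [X] in
    the radical of the trace form. *)
Theorem torus_centralizer X : Lie G X -> (forall Y, Lie T Y -> Y *m X = X *m Y) -> Lie T X.
pose Z X := Lie G X /\ forall Y, Lie T Y -> Y *m X = X *m Y.
have jor Y: Z Y -> exists S, [/\ Lie T S, nilp (Y - S), Z (Y - S) & S *m (Y - S) = (Y - S) *m S].
 move=> [LY cY];have [_ [[Q' [s [uQ' ->]]] nN cS]]:= jordan_exists Y;set S := qdiag Q' s.
 have cSN: S *m (Y - S) = (Y - S) *m S by rewrite mulmxBr mulmxBl (cS Y).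
 have LS: Lie G S.
  have L': Lie G (S + (Y - S)) by rewrite addrC subrK.
  exact: (jordan_qdiag aG uQ' nN cSN L' (fun _ h=> h)).
 have LTS: Lie T S.
  by apply: semisimple_centralizer=> // A /cY;exact: cS.
 exists S;split=> //;split;first exact: LieB.
 by move=> A LA;rewrite mulmxBr mulmxBl cY // cS //;exact: cY.
have nilS Y N: Z N -> nilp N -> Lie T Y -> \tr (N *m Y) = 0.
 by move=> [_ cN] nN LY;apply: tr_comm_nilp=> //;rewrite cN.
have nilD N N': Z N -> nilp N -> Z N' -> nilp N' -> nilp (N + N').
 move=> zN nN zN' nN'.
 have zD: Z (N + N').
  case: zN=> h1 h2;case: zN'=> h3 h4;split;first exact: LieD.
  by move=> Y LY;rewrite mulmxDr mulmxDl h2 ?h4.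
 have [S [LS n2 z2 _]]:= jor _ zD.
 suff S0: S = 0 by move: n2;rewrite S0 subr0.
 apply: torus_nondegenerate=> // Y LY.
 have ->: S = N + N' - (N + N' - S) by rewrite opprB addrC subrK.
 by rewrite mulmxBl mulmxDl !(linearB, linearD) /= !nilS // addr0 subrr.
have nil_sq (N : 'M[K]_n) : nilp N -> \tr (N *m N) = 0.
 by move=> nN;apply: tr_comm_nilp.
have nilN N N': Z N -> nilp N -> Z N' -> nilp N' -> \tr (N *m N') = 0.
 move=> zN nN zN' nN';have:= nil_sq _ (nilD _ _ zN nN zN' nN').
 rewrite mulmxDl !mulmxDr !linearD /= !nil_sq // add0r addr0 (mxtrace_mulC N' N)=> /eqP.
 by rewrite -mulr2n mulrn_eq0=> /eqP.
move=> LX cX;have zX: Z X by [].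
have [S [LS nN zN _]]:= jor _ zX.
suff N0: X - S = 0 by rewrite -[X](subrK S) N0 add0r.
apply: hrad;split=> [|Y LY];first by case: zN.
have [mu [Lmu Tmu] sep]:= torus_separating;set nu : 'rV[K]_n := map_mx intr mu in Lmu;set x1 := qdiag Q nu in Lmu.
rewrite (qcomp_sum nu uQ Y) mulmx_sumr raddf_sum /= big1_seq // => k _.
have Lk: Lie G (qcomp Q nu k Y).
 apply: (@qcomp_sub K n Q nu uQ (Lie G))=> // [A B a LA LB|A LA];first exact: Lielin.
 by apply: Lie_lb=> //;apply: (Lie_sub TG).
(* Components of nonzero weight are orthogonal to the centralizer; the component of weight 0 belongs
   to it. *)
have [k0|kn]:= eqVneq k 0;last first.
 have:= trace_lb (X - S) x1 (qcomp Q nu k Y);rewrite lb_qcomp // -scalemxAr linearZ /=.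
 have ->: lb (X - S) x1 = 0 by case: zN=> _ h;rewrite /lb h ?subrr.
 by rewrite mul0mx linear0=> /esym/eqP;rewrite mulf_eq0 (negPf kn)=> /eqP.
have zk: Z (qcomp Q nu k Y).
 split=> // A LA;have [r [M [hM /(_ _ LA) [c ->]]]]:= torus_span.
 have e: c *m map_mx intr M = \sum_i c 0 i *: map_mx intr (row i M).
  by rewrite mulmx_sum_row;eqb=> i _;rewrite map_row.
 rewrite e qdiag_sum mulmx_suml mulmx_sumr;eqb=> i _.
 rewrite qdiagZ -scalemxAl -scalemxAr;congr (_ *: _).
 apply/esym;apply: (qdiag_comm_fun (u := nu))=> // [a b|].
  rewrite ![map_mx _ _ _ _]mxE=> /eqP;rewrite eqr_int=> /eqP eab.
  have:= sep a b a a _ _ (hM i);rewrite eab !subrr=> /(_ erefl) /eqP.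
  by rewrite subr_eq0=> /eqP ->.
 by have:= lb_qcomp nu uQ k Y;rewrite k0 scale0r=> /eqP;rewrite subr_eq0=> /eqP.
have [S' [LS' nN' zN' _]]:= jor _ zk.
rewrite -[qcomp _ _ _ _](subrK S') mulmxDr linearD /= nilN //.
by rewrite nilS // addr0.
Qed.
End MaximalTorus.

(** * Weights, roots and root strings *)

Section SL2Chains.
Variables (K : acf) (n : nat) (e f h : 'M[K]_n).
Hypotheses (ef : lb e f = h) (he : lb h e = 2%:R *: e) (hf : lb h f = - (2%:R *: f)) (nf : nilp f).
Implicit Types (y : 'M[K]_n) (lam : K).
Lemma chain_weight y lam j : lb h y = lam *: y ->
 lb h (iter j (lb f) y) = (lam - (2 * j)%:R) *: iter j (lb f) y.
move=> hy;elim: j=> [|j IH] /=;first by rewrite muln0 subr0.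
rewrite jacobi hf lbNl lbZl IH lbZr mulnS natrD -scaleNr -scalerDl.
by congr (_ *: _);ring.
Qed.
Lemma chain_singular y lam j : lb e y = 0 -> lb h y = lam *: y ->
 lb e (iter j.+1 (lb f) y) = (j.+1%:R * (lam - j%:R)) *: iter j (lb f) y.
move=> ey hy;elim: j=> [|j IH].
 by rewrite /= jacobi ef hy ey lb0r addr0 subr0 mul1r.
rewrite [iter j.+2 _ _]/= jacobi ef -/(iter j.+1 (lb f) y) (chain_weight _ hy) IH lbZr.
rewrite -[lb f (iter j _ y)]/(iter j.+1 (lb f) y) -scalerDl;congr (_ *: _).
by rewrite natrM -!natr1;ring.
Qed.
(** The chain under [f] ends by nilpotency; at its end the scalar of [chain_singular] must vanish,
    which makes the weight equal to the length of the chain. *)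
Lemma chain_nat y lam : y != 0 -> lb e y = 0 -> lb h y = lam *: y ->
 exists N : nat, lam = N%:R /\ forall j, (j <= N)%N -> iter j (lb f) y != 0.
move=> y0 ey hy;have [m hm]:= ad_nilp nf.
have ex: exists k, iter k (lb f) y == 0 by exists m;rewrite hm.
have:= ex_minnP ex;case=> [[|N] /= /eqP e0 min];first by rewrite e0 eqxx in y0.
have nz j: (j <= N)%N -> iter j (lb f) y != 0.
 by move=> jN;apply/negP=> /min;rewrite ltnNge jN.
exists N;split=> //;have:= chain_singular N ey hy;rewrite [iter N.+1 _ _]/= e0 lb0r=> /esym/eqP.
by rewrite scaler_eq0 (negPf (nz N _)) // orbF mulf_eq0 pnatr_eq0 /= subr_eq0=> /eqP.
Qed.
End SL2Chains.

(* A nonzero ad x-eigenvalue excludes infinitely many nonzero powers. *)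
Lemma nilp_weight (K : acf) n (x X : 'M[K]_n) (c : K) : c != 0 ->
 lb x X = c *: X -> nilp X.
move=> c0 hx;case: n=> [|n] in x X hx *;first by exists 1%N;apply: thinmx0.
have hk k: lb x (X ^+ k) = (k%:R * c) *: X ^+ k.
 elim: k=> [|k IH];first by rewrite expr0 mul0r scale0r /lb mulmx1 mul1mx subrr.
 have ->: lb x (X ^+ k.+1) = lb x X *m X ^+ k + X *m lb x (X ^+ k).
  rewrite exprS -mulmxE /lb mulmxBl mulmxBr !mulmxA;move: (x *m X *m _) (X *m x *m _) (X *m X ^+ k *m x).
  by move=> A B C;rewrite addrA subrK.
 by rewrite IH hx -scalemxAl -scalemxAr mulmxE -exprS -scalerDl -natr1;congr (_ *: _);ring.
case: (pselect (nilp X))=> // nn;exfalso.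
pose p := char_poly (lin_mx (mulmx x) - lin_mx (mulmxr x) : 'M[K]_(n.+1 * n.+1)).
have rp k: root p (k%:R * c).
 rewrite -eigenvalue_root_char;apply/eigenvalueP;exists (mxvec (X ^+ k)).
  by rewrite mulmxBr !mul_vec_lin /= -linearB -linearZ;congr mxvec;exact: hk.
 by apply/eqP=> /(congr1 vec_mx);rewrite mxvecK linear0=> e;apply: nn;exists k.
have p0: p != 0 by rewrite monic_neq0 // char_poly_monic.
have:= max_poly_roots p0 (rs := [seq k%:R * c | k <- iota 0 (size p)]).
rewrite size_map size_iota ltnn=> h;have : false;last by [].
apply: h;first by apply/allP=> _ /mapP [k _ ->].
rewrite map_inj_uniq ?iota_uniq // => i j /(mulIf c0) /eqP.
by rewrite eqr_nat=> /eqP.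
Qed.

Section Weights.
Variables (K : acf) (n r : nat).
Variables (G T : set 'M[K]_n) (Q : 'M[K]_n) (M : 'M[int]_(r, n)).
(** The rows of [M] are cocharacters that span Lie T, so a weight can be recorded as the integer
    vector of its values on them. The rows may be dependent, so [tt] need not be injective;
    equalities in Lie T are therefore stated for [tt c] and not for [c]. *)
Record root_dat : Prop := RootDatum {
 rd_simple : simple_group G;
 rd_max : max_torus G T;
 rd_exp : zcl (gen (exp_fam G)) = G;
 rd_rad : forall X, rad G X -> X = 0;
 rd_unit : Q \in unitmx;
 rd_diag : forall t, T t -> is_diag_mx (Q *m t *m invmx Q);
 rd_int : forall i, tint T Q (row i M);
 rd_span : forall X, Lie T X -> exists c : 'rV[K]_r, X = qdiag Q (c *m map_mx intr M) }.
Hypothesis rd : root_dat.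
Implicit Types (X Y Z : 'M[K]_n) (a b : 'rV[int]_r) (c : 'rV[K]_r).
Let uQ := rd_unit rd.
Let aG : alg_group G. by case: (rd_simple rd)=> [[]]. Qed.
Let mG : mxgroup G. by case: aG. Qed.
Let TG : T `<=` G. by case: (rd_max rd). Qed.
Definition tt c := qdiag Q (c *m map_mx intr M) : 'M[K]_n.
Definition ev a c : K := \sum_i c 0 i * (a 0 i)%:~R.
Definition wt a Y := forall c, lb (tt c) Y = ev a c *: Y.
Definition wsp a : set 'M[K]_n := [set Y | Lie G Y /\ wt a Y].
Definition wij i j : 'rV[int]_r := \row_k (M k i - M k j).
Definition wlist : seq 'rV[int]_r := undup [seq wij ij.1 ij.2 | ij <- enum {: 'I_n * 'I_n}].
Lemma ttD c c' : tt (c + c') = tt c + tt c'.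
by rewrite /tt mulmxDl qdiagD. Qed.
Lemma ttZ (k : K) c : tt (k *: c) = k *: tt c.
by rewrite /tt -scalemxAl qdiagZ. Qed.
Lemma tt_Lie c : Lie T (tt c).
have ->: tt c = \sum_i c 0 i *: qdiag Q (map_mx intr (row i M)).
 rewrite /tt mulmx_sum_row qdiag_sum;eqb=> i _.
 by rewrite -qdiagZ map_row.
by apply: Lie_sum=> i _;apply: LieZ;case: (rd_int rd i).
Qed.
Lemma tt_LieG c : Lie G (tt c). exact: (Lie_sub TG) (tt_Lie c). Qed.
Lemma tt_comm c c' : lb (tt c) (tt c') = 0.
rewrite /lb /tt !mul_qdiag //;apply/eqP;rewrite subr_eq0;apply/eqP.
by congr (qdiag _ _);apply/rowP=> i;rewrite !mxE mulrC.
Qed.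
Lemma evDr a c c' : ev a (c + c') = ev a c + ev a c'.
by rewrite -big_split;eqb=> i _;rewrite mxE mulrDl. Qed.
Lemma evZr a (k : K) c : ev a (k *: c) = k * ev a c.
by rewrite mulr_sumr;eqb=> i _;rewrite mxE mulrA. Qed.
Lemma evDl a b c : ev (a + b) c = ev a c + ev b c.
by rewrite -big_split;eqb=> i _;rewrite mxE rmorphD /= mulrDr. Qed.
Lemma evNl a c : ev (- a) c = - ev a c.
by rewrite -sumrN;eqb=> i _;rewrite mxE rmorphN /= mulrN. Qed.
Lemma evBl a b c : ev (a - b) c = ev a c - ev b c.
by rewrite evDl evNl. Qed.
Lemma evZl (k : int) a c : ev (k *: a) c = k%:~R * ev a c.
by rewrite mulr_sumr;eqb=> i _;rewrite mxE rmorphM /= mulrCA. Qed.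
Lemma ev0l c : ev 0 c = 0.
by apply: big1=> i _;rewrite mxE mulr0. Qed.
Lemma ev_delta a i : ev a (delta_mx 0 i) = (a 0 i)%:~R.
rewrite /ev (bigD1 i) //= mxE !eqxx mul1r big1 ?addr0 // => j /negPf ji.
by rewrite mxE ji andbF mul0r.
Qed.
Lemma ev_inj a b : (forall c, ev a c = ev b c) -> a = b.
move=> h;apply/rowP=> i;have:= h (delta_mx 0 i);rewrite !ev_delta=> /eqP.
by rewrite eqr_int=> /eqP.
Qed.
Let cj Y := Q *m Y *m invmx Q.
Let cjK A : cj (invmx Q *m A *m Q) = A.
by rewrite /cj !mulmxA mulmxV // mul1mx mulmxK. Qed.
Let cj_inj Y Z : cj Y = cj Z -> Y = Z.
by move/(congr1 (fun A=> invmx Q *m A *m Q));rewrite /cj !mulmxA mulVmx // !mul1mx !mulmxKV. Qed.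
Let cj_lb c Y i j : cj (lb (tt c) Y) i j = ev (wij i j) c * cj Y i j.
have ->: cj (lb (tt c) Y) = lb (diag_mx (c *m map_mx intr M)) (cj Y).
 rewrite /lb /tt /qdiag /cj mulmxBr mulmxBl !mulmxA mulmxV // mul1mx.
 by congr (_ - _);rewrite ?mulmxKV // mulmxK.
rewrite /lb mul_diag_mx mul_mx_diag mxDE [(- _ : 'M__) i j]mxE ![(\matrix_(_, _) _) i j]mxE.
rewrite [cj Y i j * _]mulrC -mulrBl;congr (_ * _).
rewrite !mxE -sumrB;eqb=> k _;rewrite !mxE rmorphB /=;ring.
Qed.
Lemma wtP a Y : wt a Y <-> forall i j, (Q *m Y *m invmx Q) i j != 0 -> wij i j = a.
split=> [h i j nz|h c];last first.
 apply: cj_inj;mxP=> i j;rewrite cj_lb /cj -scalemxAr -scalemxAl mxZE.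
 by have [->|/h ->]:= eqVneq ((Q *m Y *m invmx Q) i j) 0;rewrite ?mulr0.
apply: ev_inj=> c;have:= congr1 (fun A : 'M[K]_n=> cj A i j) (h c).
by rewrite /= cj_lb /cj -scalemxAr -scalemxAl mxZE=> /(mulIf nz).
Qed.
Lemma wt_lb a b Y Z : wt a Y -> wt b Z -> wt (a + b) (lb Y Z).
by move=> hY hZ c;rewrite jacobi hY hZ lbZl lbZr -scalerDl evDl.
Qed.
Lemma wtD a Y Z : wt a Y -> wt a Z -> wt a (Y + Z).
by move=> hY hZ c;rewrite lbDr hY hZ scalerDr. Qed.
Lemma wtZ a (k : K) Y : wt a Y -> wt a (k *: Y).
by move=> hY c;rewrite lbZr hY !scalerA mulrC. Qed.
Lemma wt0 a : wt a 0. by move=> c;rewrite lb0r scaler0. Qed.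
Lemma wsp_lb a b Y Z : wsp a Y -> wsp b Z -> wsp (a + b) (lb Y Z).
by move=> [h1 h2] [h3 h4];split;[exact: Lie_lb|exact: wt_lb]. Qed.
Lemma wspZ a (k : K) Y : wsp a Y -> wsp a (k *: Y).
by move=> [h1 h2];split;[exact: LieZ|exact: wtZ]. Qed.
Lemma wspD a Y Z : wsp a Y -> wsp a Z -> wsp a (Y + Z).
by move=> [h1 h2] [h3 h4];split;[exact: LieD|exact: wtD]. Qed.
Lemma wsp0 a : wsp a 0. by split;[exact: Lie0|exact: wt0]. Qed.
Lemma wsp_iter a b Y Z k : wsp a Y -> wsp b Z -> wsp (b + a *+ k) (iter k (lb Y) Z).
move=> hY hZ;elim: k=> [|k IH];first by rewrite addr0.
by have:= wsp_lb hY IH;rewrite addrCA mulrS.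
Qed.
Lemma tt_wsp c : wsp 0 (tt c).
by split;[exact: tt_LieG|move=> c';rewrite tt_comm ev0l scale0r]. Qed.
Lemma wsp_torus X : wsp 0 X -> exists c, X = tt c.
move=> [LX h];have []:= rd_span rd (X := X) _;last by move=> c ->;exists c.
apply: (torus_centralizer (rd_simple rd) (rd_max rd) (rd_exp rd) (rd_rad rd) uQ (rd_diag rd))=> //.
move=> Y /(rd_span rd) [c ->];apply/eqP;rewrite -subr_eq0.
by have:= h c;rewrite ev0l scale0r=> /eqP.
Qed.
Lemma trace_wt a b Y Z : wt a Y -> wt b Z -> a + b != 0 -> \tr (Y *m Z) = 0.
move=> hY hZ;apply: contraNeq=> nz;apply/eqP/ev_inj=> c;rewrite ev0l.
have:= trace_lb (tt c) Y Z;rewrite lbC;have:= trace_lb Y (tt c) Z.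
rewrite [lb Y _]lbC hY hZ -scaleNr -scalemxAl -scalemxAr !linearZ /= => e _.
by apply: (mulIf nz);rewrite mul0r evDl mulrDl -e mulNr addrN.
Qed.
Lemma wt_nilp a Y : a != 0 -> wt a Y -> nilp Y.
move=> a0 hY;have [i ai]: exists i, a 0 i != 0.
 apply/existsP;apply: contraNT a0=> /existsPn h;apply/eqP/rowP=> i.
 by rewrite mxE;apply/eqP/negPn/h.
apply: (@nilp_weight K n (tt (delta_mx 0 i)) Y (ev a (delta_mx 0 i)))=> //.
by rewrite ev_delta intr_eq0.
Qed.
Definition wcomp a Y : 'M[K]_n := invmx Q *m
 (\matrix_(i, j) if wij i j == a then (Q *m Y *m invmx Q) i j else 0) *m Q.
Lemma wcomp_wt a Y : wt a (wcomp a Y).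
by apply/wtP=> i j;rewrite -/(cj _) cjK mxE;have [//|_]:= eqVneq (wij i j) a;rewrite eqxx. Qed.
Lemma mem_wlist i j : wij i j \in wlist.
by rewrite mem_undup;apply/mapP;exists (i, j);rewrite ?mem_enum. Qed.
Lemma wlistP a : a \in wlist -> exists i j, a = wij i j.
by rewrite mem_undup=> /mapP [[i j] _ ->];exists i, j. Qed.
Lemma wt_wlist a Y : wt a Y -> Y != 0 -> a \in wlist.
move=> /wtP h Y0;have [[i j] /= nz]: exists ij, cj Y ij.1 ij.2 != 0.
 apply/existsP;apply: contraNT Y0=> /existsPn h0;apply/eqP/cj_inj/matrixP=> i j.
 by rewrite /cj mulmx0 mul0mx [RHS]mxE;apply/eqP/negPn/(h0 (i, j)).
by rewrite -(h i j nz) mem_wlist.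
Qed.
Lemma wcomp_sum Y : Y = \sum_(a <- wlist) wcomp a Y.
apply: cj_inj;rewrite /cj mulmx_sumr mulmx_suml;mxP=> i j;rewrite summxE.
rewrite (bigD1_seq _ (mem_wlist i j)) ?undup_uniq //= -![_ *m invmx Q]/(cj _) cjK [in RHS]mxE eqxx.
rewrite big1 ?addr0 // => k kn;rewrite -/(cj (wcomp k Y)) cjK mxE.
by rewrite eq_sym (negPf kn).
Qed.
(** The separating cocharacter reduces components for the torus to those of one element, which
    interpolation keeps in the subspace. *)
Lemma wcomp_sub (V : set 'M[K]_n) a Y : (forall A B (k : K), V A -> V B -> V (k *: A + B)) ->
 (forall c A, V A -> V (lb (tt c) A)) -> V Y -> V (wcomp a Y).
move=> Vl Vt VY;have V0: V 0 by have:= Vl _ _ (-1) VY VY;rewrite scaleN1r addNr.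
have [/wlistP [i0 [j0 ->]]|na]:= boolP (a \in wlist);last first.
 suff ->: wcomp a Y = 0 by [].
 apply: cj_inj;rewrite cjK /cj mulmx0 mul0mx;mxP=> i j;rewrite mxE [RHS]mxE.
 by case: eqVneq=> // e;case/negP: na;rewrite -e mem_wlist.
have [mu hmu sep]:= torus_separating (rd_max rd) uQ.
have [c ec]: exists c : 'rV[K]_r, map_mx intr mu = c *m map_mx intr M.
 by case: hmu=> /(rd_span rd) [c /(qdiag_inj uQ) ->] _;exists c.
have muE i j: (mu 0 i - mu 0 j)%:~R = ev (wij i j) c.
 have e k: (mu 0 k)%:~R = (c *m map_mx intr M) 0 k by rewrite -ec mxE.
 rewrite rmorphB /= !e !mxE -sumrB;eqb=> k _;rewrite !mxE rmorphB /=;ring.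
suff ->: wcomp (wij i0 j0) Y = qcomp Q (map_mx intr mu) (mu 0 i0 - mu 0 j0)%:~R Y.
 by apply: qcomp_sub=> // A;rewrite ec;exact: Vt.
congr (_ *m _ *m _);mxP=> i j;rewrite !mxE.
rewrite -rmorphB /= eqr_int.
suff ->: (wij i j == wij i0 j0) = (mu 0 i - mu 0 j == mu 0 i0 - mu 0 j0) by [].
apply/eqP/eqP=> [e|e];first by apply/eqP;rewrite -(eqr_int K) !muE e.
apply/rowP=> k;rewrite !mxE;have:= sep _ _ _ _ e _ (rd_int rd k).
by rewrite !mxE.
Qed.
Lemma wcompP a Y : Lie G Y -> wsp a (wcomp a Y).
move=> LY;split;last exact: wcomp_wt.
apply: (wcomp_sub (V := Lie G))=> // [A B k|c A hA];first exact: Lielin.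
by apply: Lie_lb=> //;exact: tt_LieG.
Qed.
Lemma trace_nondegenerate X : Lie G X -> (forall a Y, wsp a Y -> \tr (X *m Y) = 0) -> X = 0.
move=> LX h;apply: (rd_rad rd);split=> // Y LY.
rewrite (wcomp_sum Y) mulmx_sumr raddf_sum /= big1 // => a _.
by apply: h;exact: wcompP.
Qed.
Lemma tt_trace_nondegenerate c : (forall c', \tr (tt c *m tt c') = 0) -> tt c = 0.
move=> h;apply: (torus_nondegenerate (rd_max rd) uQ (rd_diag rd) (tt_Lie c)).
by move=> Y /(rd_span rd) [c' ->];exact: h.
Qed.
End Weights.

Section Roots.
Variables (K : acf) (n r : nat).
Variables (G T : set 'M[K]_n) (Q : 'M[K]_n) (M : 'M[int]_(r, n)).
Hypothesis rd : root_dat G T Q M.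
Implicit Types (X Y Z e f : 'M[K]_n) (a b : 'rV[int]_r) (c : 'rV[K]_r).
Let tt_def c : tt Q M c = qdiag Q (c *m map_mx intr M). by []. Qed.
Notation tt := (tt Q M).
Notation wsp := (wsp G Q M).
Notation wt := (wt Q M).
Definition nzw a := exists2 Y, wsp a Y & Y != 0.
Definition rt a := a != 0 /\ nzw a.
Let uQ := rd_unit rd.
Lemma rt_partner a e : a != 0 -> wsp a e -> e != 0 -> exists2 f, wsp (- a) f & \tr (e *m f) != 0.
move=> a0 he e0;apply: contrapT=> h;case/eqP: e0.
apply: (trace_nondegenerate rd);first by case: he.
move=> b Y hY;have [ab|ab]:= eqVneq (a + b) 0;last exact: (trace_wt (proj2 he) (proj2 hY) ab).
have eb: b = - a by apply/eqP;rewrite -addr_eq0 addrC ab.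
apply: contrapT=> /eqP nz;apply: h;exists Y=> //;by rewrite -eb.
Qed.
Lemma rtN a : rt a -> rt (- a).
move=> [a0 [e he e0]];have [f hf nz]:= rt_partner a0 he e0.
split;first by rewrite oppr_eq0.
by exists f=> //;apply: contraNneq nz=> ->;rewrite mulmx0 linear0.
Qed.

(* [e, f] is tr(e f) times the vector dual to a under the trace form. *)
Lemma lb_opposite a e f : wsp a e -> wsp (- a) f -> exists2 c, lb e f = tt c &
 forall c', \tr (tt c *m tt c') = \tr (e *m f) * ev a c'.
move=> he hf;have:= wsp_lb rd he hf;rewrite subrr=> /(wsp_torus rd) [c ec].
exists c=> // c';rewrite -ec trace_lb.
case: hf=> _ hf;rewrite lbC hf evNl scaleNr opprK -scalemxAr linearZ /= mulrC.
by [].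
Qed.
Lemma ev_wij i j c : ev (wij M i j) c = (c *m map_mx intr M) 0 i - (c *m map_mx intr M) 0 j.
rewrite ![(_ *m _) _ _]mxE -sumrB;eqb=> k _;rewrite !mxE rmorphB /=;ring.
Qed.
(** If [a] killed the vector dual to it, it would kill its whole rational hull, since the vanishing
    is an integer relation between diagonal entries. By duality the hull would be orthogonal to the
    vector, which would then be 0. *)
Lemma rt_dual a : rt a -> exists2 c, ev a c != 0 & exists2 k : K, k != 0 &
 forall c', \tr (tt c *m tt c') = k * ev a c'.
move=> [a0 [e he e0]];have [f hf nz]:= rt_partner a0 he e0.
have [c ec hc]:= lb_opposite he hf.
exists c;last by exists (\tr (e *m f)).
apply/eqP=> ac0;case/eqP: a0;apply/ev_inj=> c';rewrite ev0l;apply: (mulfI nz).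
rewrite -hc mulr0;suff ->: tt c = 0 by rewrite mul0mx linear0.
have [i [j eij]]: exists i j, a = wij M i j by apply/wlistP/(wt_wlist rd _ e0);case: he.
set s := c *m map_mx intr M.
have n0: nilp (0 : 'M[K]_n) by exists 1%N;rewrite expr1.
have c0: qdiag Q s *m 0 = 0 *m qdiag Q s by rewrite mulmx0 mul0mx.
have L0: Lie T (qdiag Q s + 0) by rewrite addr0;exact: tt_Lie rd c.
have aT: alg_group T by case: (rd_max rd)=> _ [[]].
have [r' [M' [d [es hM']]]]:= rational_hull s.
suff s0: s = 0 by rewrite tt_def -/s s0 /qdiag linear0 mulmx0 mul0mx.
apply: (hull_nondegenerate es)=> p.
have Lp := jordan_qdiag aT uQ n0 c0 L0 (hM' p);have [cp ep]:= rd_span rd Lp.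
have {}ep := qdiag_inj uQ ep.
have : \tr (tt c *m tt cp) = 0.
 rewrite hc;suff ->: ev a cp = 0 by rewrite mulr0.
 apply/eqP;rewrite eij ev_wij -ep subr_eq0;apply/eqP;apply: (rel_le_fun (hM' p)).
 by apply/eqP;rewrite -subr_eq0 -ev_wij -eij ac0.
rewrite !tt_def -/s -ep trace_qdiag // => e1;rewrite -[RHS]e1;eqb=> q _.
by rewrite !mxE.
Qed.
(** The coroot: the multiple of the dual vector on which [a] takes the value 2. The coordinates are
    a choice, but for a root [a] the element [tt (hc a)] is determined. *)
Definition hc a : 'rV[K]_r := xget 0 [set c | ev a c = 2%:R /\
 exists2 k : K, k != 0 & forall c', \tr (tt c *m tt c') = k * ev a c'].
Lemma hcP a : rt a -> ev a (hc a) = 2%:R /\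
 exists2 k : K, k != 0 & forall c', \tr (tt (hc a) *m tt c') = k * ev a c'.
move=> /rt_dual [c ac [k k0 hk]].
apply: (@xgetPex _ 0 [set c | ev a c = 2%:R /\
 exists2 k : K, k != 0 & forall c', \tr (tt c *m tt c') = k * ev a c']).
have two0: (2%:R : K) != 0 by rewrite pnatr_eq0.
exists ((2%:R / ev a c) *: c);split;first by rewrite evZr divfK.
exists ((2%:R / ev a c) * k);first by rewrite mulf_neq0 // mulf_neq0 // invr_neq0.
by move=> c';rewrite ttZ -scalemxAl linearZ /= hk mulrA.
Qed.
Lemma tt_dual_eq c c' : (forall c0, \tr (tt c *m tt c0) = \tr (tt c' *m tt c0)) -> tt c = tt c'.
move=> h;have : tt (c - c') = 0.
 apply: (tt_trace_nondegenerate rd)=> c0.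
 by rewrite ttD -scaleN1r ttZ scaleN1r mulmxBl linearB /= h subrr.
by rewrite ttD -scaleN1r ttZ scaleN1r=> /eqP;rewrite subr_eq0=> /eqP.
Qed.
Lemma lb_opposite_hc a e f : rt a -> wsp a e -> wsp (- a) f -> exists2 k : K,
 lb e f = k *: tt (hc a) & (k == 0) = (\tr (e *m f) == 0).
move=> ra he hf;have [_ [k k0 hk]]:= hcP ra;have [c -> hc']:= lb_opposite he hf.
exists (\tr (e *m f) / k);last by rewrite mulf_eq0 invr_eq0 (negPf k0) orbF.
rewrite -ttZ;apply: tt_dual_eq=> c0;rewrite hc' ttZ -scalemxAl linearZ /= hk.
by rewrite mulrA divfK.
Qed.
Lemma rt_triple a e : rt a -> wsp a e -> e != 0 -> exists f, [/\ wsp (- a) f,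
 lb e f = tt (hc a), lb (tt (hc a)) e = 2%:R *: e,
 lb (tt (hc a)) f = - (2%:R *: f) & \tr (e *m f) != 0].
move=> ra he e0;have a0: a != 0 by case: ra.
have [f hf nz]:= rt_partner a0 he e0;have [k ek k0]:= lb_opposite_hc ra he hf.
have {}k0 : k != 0 by rewrite k0.
have ea: ev a (hc a) = 2%:R by case: (hcP ra).
exists (k^-1 *: f);split.
- exact: wspZ.
- by rewrite lbZr ek scalerA mulVf // scale1r.
- by case: he=> _ ->;rewrite ea.
- by rewrite lbZr;case: hf=> _ ->;rewrite evNl ea scaleNr scalerN !scalerA mulrC.
- by rewrite -scalemxAr linearZ mulf_neq0 // invr_neq0.
Qed.
Definition pr b a : int := xget 0 [set k : int | ev b (hc a) = k%:~R].
Lemma singular_top a b e y : a != 0 -> wsp a e -> wsp b y -> y != 0 ->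
 exists q, [/\ wsp (b + a *+ q) (iter q (lb e) y), iter q (lb e) y != 0 & lb e (iter q (lb e) y) = 0].
move=> a0 he hy y0;have [m hm]:= ad_nilp (wt_nilp a0 (proj2 he)).
have ex: exists k, iter k (lb e) y == 0 by exists m;rewrite hm.
have:= ex_minnP ex;case=> [[|q] /= /eqP e0 min];first by rewrite e0 eqxx in y0.
exists q;split=> //;first exact: (wsp_iter rd).
by apply/negP=> /min;rewrite ltnn.
Qed.
Lemma evMn a c q : ev (a *+ q) c = q%:R * ev a c.
by rewrite -scaler_nat -[X in ev X _]scale1r;elim: q=> [|q IH];rewrite ?mulr0n ?scale0r ?scaler0 ?ev0l ?mul0r // mulrSr !scalerDl !scale1r evDl -[X in ev X c + _]scale1r IH -natr1 mulrDl mul1r. Qed.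
Lemma prP a b : rt a -> nzw b -> ev b (hc a) = (pr b a)%:~R.
move=> ra [y hy y0];apply: (@xgetPex _ 0 [set k : int | ev b (hc a) = k%:~R]).
have [a0 [e he e0]]:= ra.
have [f [hf ef h1 h2 _]]:= rt_triple ra he e0.
have [q [hz z0 ez]]:= singular_top a0 he hy y0.
have nf: nilp f by apply: (@wt_nilp _ _ _ Q M (- a));[rewrite oppr_eq0|case: hf].
have hw: lb (tt (hc a)) (iter q (lb e) y) = ev (b + a *+ q) (hc a) *: iter q (lb e) y.
 by case: hz=> _ ->.
have [N [eN _]]:= chain_nat ef h2 nf z0 ez hw.
exists (N%:Z - (2 * q)%:Z);rewrite /= rmorphB /= -!pmulrn -eN evDl evMn.
by case: (hcP ra)=> -> _;rewrite natrM;ring.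
Qed.
Lemma prNr a b : rt a -> nzw b -> pr b (- a) = - pr b a.
move=> ra nb;have ra' := rtN ra;apply/eqP;rewrite -(eqr_int K) rmorphN /=.
rewrite -(prP ra' nb) -(prP ra nb).
have [e1 [k k0 hk]]:= hcP ra;have [e2 [k' k'0 hk']]:= hcP ra'.
have e: tt (hc (- a)) = (- (k' / k)) *: tt (hc a).
 rewrite -ttZ;apply: tt_dual_eq=> c0;rewrite hk' ttZ -scalemxAl linearZ /= hk evNl.
 by rewrite mulrA mulNr divfK // mulNr mulrN.
have evtt b' c c': nzw b' -> tt c = tt c' -> ev b' c = ev b' c'.
 move=> [y [_ hy] y0] ec;have:= hy c;rewrite ec hy=> /eqP.
 by rewrite -subr_eq0 -scalerBl scaler_eq0 (negPf y0) orbF subr_eq0=> /eqP ->.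
have e3: - (k' / k) = -1.
 have na: nzw a by case: ra.
 have:= evtt a (hc (- a)) _ na (etrans e (esym (ttZ _ _ _ _))).
 move: e2;rewrite evZr evNl e1=> /eqP;rewrite eqr_oppLR=> /eqP -> /eqP.
 rewrite -[X in X == _]mulN1r=> /eqP /(mulIf _) <- //;by rewrite pnatr_eq0.
have:= evtt b _ _ nb (etrans e (esym (ttZ _ _ _ _))).
by rewrite evZr e3 mulN1r=> ->.
Qed.
(** From [b] one descends with [f] to the bottom of the string and climbs again with [e]; the number
    of nonzero steps from the bottom, given by the lowest weight, reaches [j] steps above [b]. *)
Lemma string_up a b j : rt a -> nzw b -> (j%:Z <= - pr b a) -> nzw (b + a *+ j).
move=> ra nb hj;have [a0 [e he e0]]:= ra.
have [y hy y0]:= nb.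
have [f [hf ef h1 h2 _]]:= rt_triple ra he e0.
have a0': - a != 0 by rewrite oppr_eq0.
have [q [hz z0 fz]]:= singular_top a0' hf hy y0.
have ne: nilp e by apply: (@wt_nilp _ _ _ Q M a)=> //;case: he.
have fe: lb f e = - tt (hc a) by rewrite lbC ef.
have h3: lb (- tt (hc a)) f = 2%:R *: f by rewrite lbNl h2 opprK.
have h4: lb (- tt (hc a)) e = - (2%:R *: e) by rewrite lbNl h1.
set z := iter q (lb f) y in hz z0 fz.
have hw: lb (- tt (hc a)) z = - ev (b + (- a) *+ q) (hc a) *: z.
 by rewrite lbNl;case: hz=> _ ->;rewrite scaleNr.
have [N [eN hN]]:= chain_nat fe h4 ne z0 fz hw.
have eN': N%:Z = - pr b a + (2 * q)%:Z.
 apply/eqP;rewrite -(eqr_int K) -pmulrn -eN evDl evMn evNl (prP ra nb).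
 rewrite rmorphD rmorphN /= -!pmulrn natrM;case: (hcP ra)=> -> _;apply/eqP;ring.
exists (iter (q + j) (lb e) z);last by apply: hN;lia.
have:= wsp_iter rd (q + j) he hz;rewrite mulNrn mulrnDr -addrA;congr (wsp _ _).
by congr (_ + _);rewrite addKr.
Qed.
Lemma string_down a b j : rt a -> nzw b -> (j%:Z <= pr b a) -> nzw (b - a *+ j).
by move=> ra nb hj;have:= @string_up (- a) b j (rtN ra) nb;rewrite (prNr ra nb) opprK mulNrn;apply.
Qed.
Definition refl a b := b - pr b a *: a.
Lemma reflection a b : rt a -> nzw b -> nzw (refl a b).
move=> ra nb;rewrite /refl;have [h|h]:= leP 0 (pr b a).
 by have:= @string_down a b `|pr b a|%N ra nb _;rewrite -scaler_nat natz gez0_abs //;apply.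
have:= @string_up a b `|pr b a|%N ra nb _;rewrite -scaler_nat natz ltz0_abs // scaleNr;apply=> //.
Qed.
(** After subtraction of a multiple of [e] the vector has trace 0 against [f], hence commutes with
    it. If nonzero, it would be a singular vector of weight -2 for the opposite triple, but such
    weights are natural numbers. *)
Lemma rt_line a e e' : rt a -> wsp a e -> e != 0 -> wsp a e' -> exists k : K, e' = k *: e.
move=> ra he e0 he';have a0: a != 0 by case: ra.
have [f [hf ef h1 h2 nz]]:= rt_triple ra he e0.
exists (\tr (e' *m f) / \tr (e *m f));apply/eqP;rewrite -subr_eq0;apply/negPn/negP.
set e2 := _ - _=> e20;have he2: wsp a e2.
 by rewrite /e2 -scaleNr;apply: wspD=> //;apply: wspZ.
have t0: \tr (e2 *m f) = 0.
 by rewrite /e2 mulmxBl -scalemxAl linearB linearZ /= divfK // subrr.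
have [k ek k0]:= lb_opposite_hc ra he2 hf;move: k0;rewrite t0 eqxx=> /eqP k0.
have fe2: lb f e2 = 0 by rewrite lbC ek k0 scale0r oppr0.
have ne: nilp e by apply: (@wt_nilp _ _ _ Q M a)=> //;case: he.
have fe: lb f e = - tt (hc a) by rewrite lbC ef.
have h3: lb (- tt (hc a)) f = 2%:R *: f by rewrite lbNl h2 opprK.
have h4: lb (- tt (hc a)) e = - (2%:R *: e) by rewrite lbNl h1.
have hw: lb (- tt (hc a)) e2 = - 2%:R *: e2.
 by rewrite lbNl;case: he2=> _ ->;rewrite scaleNr;case: (hcP ra)=> -> _.
have [N [/eqP eN _]]:= chain_nat fe h4 ne e20 fe2 hw.
by move: eN;rewrite eq_sym -addr_eq0 -natrD pnatr_eq0 addnS.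
Qed.
(** Suppose [e, y] = 0. The chain that descends from the top of the string through [a + b] reaches
    the line of [y] after [q + 1] steps, and there the bracket with [e] is not 0, as the top weight
    exceeds [q]. *)
Lemma lb_root_neq0 a b e y : rt a -> rt b -> wsp a e -> e != 0 -> wsp b y -> y != 0 ->
 nzw (a + b) -> a + b != 0 -> lb e y != 0.
move=> ra rb he e0 hy y0 [z hz z0] ab0;apply/eqP=> ey.
have a0: a != 0 by case: ra.
have [f [hf ef h1 h2 nz]]:= rt_triple ra he e0.
have nf: nilp f by apply: (@wt_nilp _ _ _ Q M (- a));[rewrite oppr_eq0|case: hf].
have wy: lb (tt (hc a)) y = ev b (hc a) *: y by case: hy=> _ ->.
have [N1 [eN1 _]]:= chain_nat ef h2 nf y0 ey wy.
have [q [hu u0 eu]]:= singular_top a0 he hz z0;set u := iter q (lb e) z in hu u0 eu.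
have wu: lb (tt (hc a)) u = ev (a + b + a *+ q) (hc a) *: u by case: hu=> _ ->.
have [N [eN hN]]:= chain_nat ef h2 nf u0 eu wu.
have eN': N = (N1 + 2 * q.+1)%N.
 apply/eqP;rewrite -(eqr_nat K) -eN !evDl evMn eN1 natrD natrM -natr1.
 case: (hcP ra)=> -> _;apply/eqP;ring.
have hfu: wsp b (iter q.+1 (lb f) u).
 have:= wsp_iter rd q.+1 hf hu;congr (wsp _ _).
 by rewrite mulNrn mulrS opprD addrA addrAC addrK addrAC subrr add0r.
have [k ek]:= rt_line rb hy y0 hfu.
have:= chain_singular ef h2 q eu wu;rewrite ek lbZr ey scaler0=> /esym/eqP.
rewrite scaler_eq0 (negPf (hN q _)) ?orbF;last by lia.
rewrite mulf_eq0 pnatr_eq0 /= eN eN' subr_eq0 eqr_nat=> /eqP;lia.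
Qed.
Lemma no_double_root a : rt a -> ~ nzw (a *+ 2).
move=> ra h;have [a0 [e he e0]]:= ra.
have a20: a + a != 0.
 apply: contra a0=> /eqP /rowP h0;apply/eqP/rowP=> i;by have /eqP := h0 i;rewrite !mxE -mulr2n mulrn_eq0=> /eqP.
by have:= lb_root_neq0 ra ra he e0 he e0 h a20;rewrite lbxx eqxx.
Qed.
Lemma no_multiple_root a k : rt a -> (1 < k)%N -> ~ nzw (a *+ k).
move=> ra k1 h;apply: (no_double_root ra).
have ->: a *+ 2 = a *+ k - a *+ (k - 2) by rewrite -mulrnBr ?leq_subr // subKn.
apply: string_down=> //.
have /eqP := prP ra h;rewrite evMn;case: (hcP ra)=> -> _.
rewrite -natrM pmulrn eqr_int=> /eqP <-;lia.
Qed.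
End Roots.

(** * Borel subgroups and positive roots *)

Lemma mexpD (K : acf) n (X : 'M[K]_n) (s t : K) : nilp X ->
 mexp ((s + t) *: X) = mexp (s *: X) *m mexp (t *: X).
move=> nX;have nX' := nilpN nX.
pose sh (p : {poly K}) := p \Po ('X + s%:P).
pose H := map_mx sh (pexp X);pose F := H *m pexp (- X).
have hH u: hmx u H = mexp ((s + u) *: X).
 rewrite -hpexp //;mxP=> i j;rewrite !mxE /hev /sh horner_comp.
 by rewrite hornerD hornerX hornerC addrC.
have dH: dermx H = H *m map_mx polyC X.
 have ->: H *m map_mx polyC X = map_mx sh (pexp X *m map_mx polyC X).
  mxP=> i j;rewrite [RHS]mxE [in RHS]mxE [LHS]mxE /sh raddf_sum /=.
  by eqb=> k _;rewrite rmorphM /= [H i k]mxE [map_mx polyC X k j]mxE comp_polyC.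
 rewrite -dpexp //;mxP=> i j;rewrite !mxE /sh deriv_comp.
 by rewrite derivD derivX derivC addr0 mulr1.
have dF: dermx F = 0.
 rewrite /F dermxM dH dpexp // pexp_comm // map_mxN mulNmx mulmxN -!mulmxA.
 by rewrite addrN.
have:= mx_deriv0 dF t;rewrite !hmxM !hH !hpexp // addr0 scalerN scale0r mexp0 mulmx1=> <-.
have nt := nilpZ t nX;have:= mexpN (nilpN nt);rewrite opprK=> e.
by rewrite -mulmxA e mulmx1.
Qed.

Section SL2Weyl.
Variables (K : acf) (n : nat) (e f h : 'M[K]_n).
Hypotheses (ef : lb e f = h) (he : lb h e = 2%:R *: e) (hf : lb h f = - (2%:R *: f))
 (ne : nilp e) (nf : nilp f).
Implicit Types (Y t : 'M[K]_n) (x : K).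
Definition Ad (A Y : 'M[K]_n) := A *m Y *m invmx A.
Lemma AdM A B Y : A \in unitmx -> B \in unitmx -> Ad (A *m B) Y = Ad A (Ad B Y).
by move=> uA uB;rewrite /Ad invmxM // !mulmxA. Qed.
Lemma AdD A Y Z : Ad A (Y + Z) = Ad A Y + Ad A Z.
by rewrite /Ad mulmxDr mulmxDl. Qed.
Lemma AdZ A (a : K) Y : Ad A (a *: Y) = a *: Ad A Y.
by rewrite /Ad -scalemxAr -scalemxAl. Qed.
Lemma AdN A Y : Ad A (- Y) = - Ad A Y.
by rewrite /Ad mulmxN mulNmx. Qed.
Lemma AdB A Y Z : Ad A (Y - Z) = Ad A Y - Ad A Z.
by rewrite AdD AdN. Qed.
Lemma Ad0 A : Ad A 0 = 0. by rewrite /Ad mulmx0 mul0mx. Qed.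
Lemma Ad1 Y : Ad 1%:M Y = Y. by rewrite /Ad mul1mx invmx1 mulmx1. Qed.
Lemma Ad_lb A Y Z : A \in unitmx -> Ad A (lb Y Z) = lb (Ad A Y) (Ad A Z).
by move=> uA;rewrite /Ad /lb mulmxBr mulmxBl !mulmxA;congr (_ - _);rewrite !mulmxKV. Qed.
Lemma AdVK A Y : A \in unitmx -> Ad (invmx A) (Ad A Y) = Y.
by move=> uA;rewrite -AdM ?unitmx_inv // mulVmx // Ad1. Qed.
Lemma Ad_mexp3 X Y : nilp X -> lb X (lb X (lb X Y)) = 0 ->
 Ad (mexp X) Y = Y + lb X Y + 2%:R^-1 *: lb X (lb X Y).
move=> nX h3;rewrite /Ad mexpV // (@mexp_Ad _ _ X Y 3 nX h3).
by rewrite !big_ord_recl big_ord0 /= fact0 invr1 !scale1r addr0 addrA.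
Qed.
Let nE x : nilp (x *: e). exact: nilpZ. Qed.
Let nF x : nilp (x *: f). exact: nilpZ. Qed.
Lemma Ad_exp_e x : Ad (mexp (x *: e)) e = e.
have z: lb (x *: e) e = 0 by rewrite lbZl lbxx scaler0.
by rewrite (Ad_mexp3 (nE x)) z ?lb0r ?scaler0 ?addr0. Qed.
Lemma Ad_exp_f x : Ad (mexp (x *: f)) f = f.
have z: lb (x *: f) f = 0 by rewrite lbZl lbxx scaler0.
by rewrite (Ad_mexp3 (nF x)) z ?lb0r ?scaler0 ?addr0. Qed.
Let eh : lb e h = - (2%:R *: e). by rewrite lbC he. Qed.
Let fh : lb f h = 2%:R *: f. by rewrite lbC hf opprK. Qed.
Let fe : lb f e = - h. by rewrite lbC ef. Qed.
Lemma Ad_exp_e_h x : Ad (mexp (x *: e)) h = h - (x * 2%:R) *: e.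
have e1: lb (x *: e) h = - ((x * 2%:R) *: e) by rewrite lbZl eh scalerN scalerA.
have e2: lb (x *: e) (lb (x *: e) h) = 0 by rewrite e1 lbNr lbZr lbZl lbxx !scaler0 oppr0.
by rewrite (Ad_mexp3 (nE x)) // e2 ?lb0r // scaler0 addr0 e1.
Qed.
Lemma Ad_exp_f_h x : Ad (mexp (x *: f)) h = h + (x * 2%:R) *: f.
have e1: lb (x *: f) h = (x * 2%:R) *: f by rewrite lbZl fh scalerA.
have e2: lb (x *: f) (lb (x *: f) h) = 0 by rewrite e1 lbZr lbZl lbxx !scaler0.
by rewrite (Ad_mexp3 (nF x)) // e2 ?lb0r // scaler0 addr0 e1.
Qed.
Let two_half (a : K) : 2%:R^-1 * (a * 2%:R) = a.
by rewrite mulrC mulfK // pnatr_eq0. Qed.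
Lemma Ad_exp_e_f x : Ad (mexp (x *: e)) f = f + x *: h - (x ^+ 2) *: e.
have e1: lb (x *: e) f = x *: h by rewrite lbZl ef.
have e2: lb (x *: e) (lb (x *: e) f) = - ((x ^+ 2 * 2%:R) *: e).
 by rewrite e1 lbZr lbZl eh !scalerN !scalerA expr2.
have e3: lb (x *: e) (lb (x *: e) (lb (x *: e) f)) = 0 by rewrite e2 lbNr lbZr lbZl lbxx !scaler0 oppr0.
by rewrite (Ad_mexp3 (nE x)) // e2 e1 scalerN scalerA two_half.
Qed.
Lemma Ad_exp_f_e x : Ad (mexp (x *: f)) e = e - x *: h - (x ^+ 2) *: f.
have e1: lb (x *: f) e = - (x *: h) by rewrite lbZl fe scalerN.
have e2: lb (x *: f) (lb (x *: f) e) = - ((x ^+ 2 * 2%:R) *: f).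
 by rewrite e1 lbNr lbZr lbZl fh !scalerA expr2.
have e3: lb (x *: f) (lb (x *: f) (lb (x *: f) e)) = 0 by rewrite e2 lbNr lbZr lbZl lbxx !scaler0 oppr0.
by rewrite (Ad_mexp3 (nF x)) // e2 e1 scalerN scalerA two_half.
Qed.
(** A representative of the reflection defined by the triple; different [x] give representatives
    that differ by a torus element of SL_2. *)
Definition wel x := mexp (x *: e) *m mexp (- x^-1 *: f) *m mexp (x *: e).
Lemma wel_unit x : wel x \in unitmx.
by rewrite !unitmx_mul !mexpU //;exact: nilpZ. Qed.
Let Ad_wel x Y : Ad (wel x) Y = Ad (mexp (x *: e)) (Ad (mexp (- x^-1 *: f)) (Ad (mexp (x *: e)) Y)).
have u1: mexp (x *: e) \in unitmx by apply: mexpU;exact: nilpZ.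
have u2: mexp (- x^-1 *: f) \in unitmx by apply: mexpU;exact: nilpZ.
by rewrite /wel !AdM // unitmx_mul u1.
Qed.
Lemma Ad_wel_e x : x != 0 -> Ad (wel x) e = - (x ^- 2 *: f).
move=> x0;rewrite Ad_wel Ad_exp_e Ad_exp_f_e !AdB !AdZ Ad_exp_e Ad_exp_e_h Ad_exp_e_f.
mxP=> i j;rewrite !mxE -exprVn;move: (h i j) (f i j) (e i j)=> H F E;field.
by rewrite x0.
Qed.
Lemma Ad_wel_f x : x != 0 -> Ad (wel x) f = - (x ^+ 2 *: e).
move=> x0;rewrite Ad_wel Ad_exp_e_f !(AdD, AdN, AdZ) Ad_exp_f_h.
rewrite Ad_exp_f Ad_exp_f_e.
rewrite !(AdD, AdN, AdZ) Ad_exp_e Ad_exp_e_h Ad_exp_e_f.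
mxP=> i j;rewrite !mxE;move: (h i j) (f i j) (e i j)=> H F E;field.
by rewrite x0.
Qed.
Lemma Ad_wel_t t c : lb t e = c *: e -> lb t f = - (c *: f) -> Ad (wel 1) t = t - c *: h.
move=> te tf;have e1 x: Ad (mexp (x *: e)) t = t - (x * c) *: e.
 have e1: lb (x *: e) t = - ((x * c) *: e) by rewrite lbZl lbC te scalerN scalerA.
 have e2: lb (x *: e) (lb (x *: e) t) = 0 by rewrite e1 lbNr lbZr lbZl lbxx !scaler0 oppr0.
 by rewrite (Ad_mexp3 (nE x)) // e2 ?lb0r // scaler0 addr0 e1.
have f1 x: Ad (mexp (x *: f)) t = t + (x * c) *: f.
 have f1: lb (x *: f) t = (x * c) *: f by rewrite lbZl lbC tf opprK scalerA.
 have f2: lb (x *: f) (lb (x *: f) t) = 0 by rewrite f1 lbZr lbZl lbxx !scaler0.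
 by rewrite (Ad_mexp3 (nF x)) // f2 ?lb0r // scaler0 addr0 f1.
rewrite Ad_wel e1 !(AdD, AdN, AdZ) f1 Ad_exp_f_e !(AdD, AdN, AdZ) e1 Ad_exp_e Ad_exp_e_h Ad_exp_e_f.
mxP=> i j;rewrite !mxE;move: (h i j) (f i j) (e i j) (t i j)=> H F E W;by field.
Qed.

(* Conjugation by wel 2 * wel 1 ^-1 multiplies e by 4 and f by 1/4, so that the exponentials are
   commutators of elements of the group that they generate. *)
Lemma sl2_not_solvable B : mxgroup B -> (forall x, B (mexp (x *: e))) ->
 (forall x, B (mexp (x *: f))) -> mx_solvable B -> e = 0.
move=> mB Be Bf [k hk].
pose F : set (set 'M[K]_n) := [set C | C = expcv e \/ C = expcv f].
have gF: gen_fam F.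
 have fam X: nilp X -> [/\ expcv X 1%:M, expcv X `<=` @GLset K n &
   forall A, expcv X A -> expcv X (invmx A)].
  move=> nX;split;first by exists 0=> //;rewrite scale0r mexp0.
   by move=> _ [x _ <-];apply: mexpU;exact: nilpZ.
  by move=> _ [x _ <-];exists (- x)=> //;rewrite mexpV ?scaleNr //;exact: nilpZ.
 by move=> C [->|->];exact: fam.
have mS := mxgrp_gen gF;set S := gen F in mS.
have Se x: S (mexp (x *: e)) by apply: (gen_gen (C := expcv e));[left|exists x].
have Sf x: S (mexp (x *: f)) by apply: (gen_gen (C := expcv f));[right|exists x].
have Sw x: S (wel x) by do 2?[apply: (mxgrpM mS)].
pose s := wel 2%:R *m invmx (wel 1).
have Ss: S s by apply: (mxgrpM mS)=> //;exact: (mxgrpV mS).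
have us: s \in unitmx by exact: (mxgrpU mS).
have u1 := wel_unit 1;have u1': invmx (wel 1) \in unitmx by rewrite unitmx_inv.
have two0: (2%:R : K) != 0 by rewrite pnatr_eq0.
have Vf: Ad (invmx (wel 1)) f = - e.
 by rewrite -[RHS](AdVK _ u1) AdN Ad_wel_e ?oner_neq0 // expr1n invr1 scale1r opprK.
have Ve: Ad (invmx (wel 1)) e = - f.
 by rewrite -[RHS](AdVK _ u1) AdN Ad_wel_f ?oner_neq0 // expr1n scale1r opprK.
have se: Ad s e = 4%:R *: e.
 by rewrite /s AdM ?wel_unit // Ve AdN Ad_wel_f // opprK -natrX.
have sf: Ad s f = 4%:R^-1 *: f.
 by rewrite /s AdM ?wel_unit // Vf AdN Ad_wel_e // opprK -natrX.
have comm X (a : K) x : nilp X -> Ad s X = a *: X -> a != 1 ->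
  s *m mexp (x / (a - 1) *: X) *m invmx s *m invmx (mexp (x / (a - 1) *: X)) = mexp (x *: X).
 move=> nX sX a1;have nx := nilpZ (x / (a - 1)) nX.
 have [-> _]:= mexp_conj us nx;rewrite mexpV // -/(Ad s _) AdZ sX scalerA -scaleNr -mexpD //.
 by congr (mexp (_ *: _));field;rewrite subr_eq0.
have key m: S `<=` iter m (@commutator_group K n) B.
 elim: m=> [|m IH] /=.
  by apply: gen_sub=> // C [->|->] _ [x _ <-].
 move=> z Sz D mD hD;move: z Sz;apply: gen_sub=> // C [->|->] _ [x _ <-].
  rewrite -(@comm e 4%:R x) //;first by apply: hD;apply: IH.
  by rewrite pnatr_eq1.
 rewrite -(@comm f 4%:R^-1 x) //;first by apply: hD;apply: IH.
 by rewrite invr_eq1 pnatr_eq1.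
apply: mexp_eq1=> // x;have:= key k _ (Se x).
by rewrite hk.
Qed.
End SL2Weyl.

Section BorelRoots.
Variables (K : acf) (n r : nat).
Variables (G T B : set 'M[K]_n) (Q : 'M[K]_n) (M : 'M[int]_(r, n)).
Hypotheses (rd : root_dat G T Q M) (hB : borel_subgroup G B) (TB : T `<=` B).
Implicit Types (X Y Z e f : 'M[K]_n) (a b : 'rV[int]_r) (c : 'rV[K]_r).
Notation tt := (tt Q M).
Notation wsp := (wsp G Q M).
Notation wt := (wt Q M).
Notation rt := (rt G Q M).
Notation nzw := (nzw G Q M).
Notation hc := (hc Q M).
Notation pr := (pr Q M).
Notation wij := (wij M).
Let uQ := rd_unit rd.
Let BG : B `<=` G. by case: hB. Qed.
Let cB : conn_group B. by case: hB. Qed.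
Let aB : alg_group B. by case: cB. Qed.
Let mB : mxgroup B. by case: aB. Qed.
Definition psi a := rt a /\ exists Y, [/\ wsp a Y, Lie B Y & Y != 0].
Lemma psi_Lie a Y : psi a -> wsp a Y -> Lie B Y.
move=> [ra [Z [hZ LZ Z0]]] hY;have [k ->]:= rt_line rd ra hZ Z0 hY.
exact: LieZ.
Qed.
(** Two opposite roots in Lie B would put the exponentials of an sl_2-triple into a solvable
    group. *)
Lemma psi_opp a : psi a -> ~ psi (- a).
move=> pa pa';have [ra [e [he Le e0]]]:= pa.
have [f [hf ef h1 h2 _]]:= rt_triple rd ra he e0.
have a0: a != 0 by case: ra.
have ne: nilp e := wt_nilp a0 (proj2 he).
have nf: nilp f by apply: (@wt_nilp _ _ _ Q M (- a));[rewrite oppr_eq0|case: hf].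
case/eqP: e0;apply: (sl2_not_solvable ef h1 h2 ne nf mB).
- by move=> x;apply: mexp_grp.
- by move=> x;apply: mexp_grp=> //;exact: psi_Lie pa' hf.
- by case: hB.
Qed.
Lemma psi_add a b : psi a -> psi b -> nzw (a + b) -> psi (a + b).
move=> pa pb nab;have [ra [e [he Le e0]]]:= pa;have [rb [y [hy Ly y0]]]:= pb.
have ab0: a + b != 0.
 apply: contra_not_neq (psi_opp pa)=> ab;suff <-: b = - a by [].
 by apply/eqP;rewrite -addr_eq0 addrC ab.
split;first by split.
exists (lb e y);split;first exact: (wsp_lb rd).
 exact: Lie_lb.
exact: (lb_root_neq0 rd ra rb he e0 hy y0 nab ab0).
Qed.
Lemma tt_LieB c : Lie B (tt c). exact: (Lie_sub TB) (tt_Lie rd c). Qed.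
Lemma wcomp_LieB a Y : Lie B Y -> Lie B (wcomp Q M a Y).
move=> LY;apply: (wcomp_sub rd (V := Lie B))=> // [A C k|c A hA];first exact: Lielin.
by apply: Lie_lb=> //;exact: tt_LieB.
Qed.
Lemma psi_wcomp a Y : Lie B Y -> wcomp Q M a Y != 0 -> a = 0 \/ psi a.
move=> LY nz;have [->|a0]:= eqVneq a 0;[by left|right].
have hw: wsp a (wcomp Q M a Y) by apply: (wcompP rd);exact: (Lie_sub BG).
split;first by split=> //;exists (wcomp Q M a Y).
by exists (wcomp Q M a Y);split=> //;exact: wcomp_LieB.
Qed.

(* The eigenvalues of a coroot on K^n are rational: their differences are integers by sl2-theory
   on 'M_n and their sum is 0. *)
Lemma coroot_integral a : rt a -> forall i j, exists k : int, ev (wij i j) (hc a) = k%:~R.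
move=> ra i j;have [a0 [e he e0]]:= ra.
have [f [hf ef h1 h2 _]]:= rt_triple rd ra he e0.
have ne: nilp e := wt_nilp a0 (proj2 he).
have nf: nilp f by apply: (@wt_nilp _ _ _ Q M (- a));[rewrite oppr_eq0|case: hf].
pose y : 'M[K]_n := invmx Q *m delta_mx i j *m Q.
have cy: Q *m y *m invmx Q = delta_mx i j by rewrite /y !mulmxA mulmxV // mul1mx mulmxK.
have hy: wt (wij i j) y.
 apply/(wtP rd)=> k l;rewrite cy mxE;case: (k =P i)=> [->|_] /=;last by rewrite eqxx.
 by case: (l =P j)=> [->|_] //=;rewrite eqxx.
have y0: y != 0.
 apply: contra_eq_neq cy=> ->;rewrite mulmx0 mul0mx eq_sym;apply/eqP=> /matrixP /(_ i j).
 by rewrite !mxE !eqxx /= => /eqP;rewrite oner_eq0.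
have [m hm]:= ad_nilp ne.
have ex: exists k, iter k (lb e) y == 0 by exists m;rewrite hm.
have:= ex_minnP ex;case=> [[|q] /= /eqP q0 min];first by rewrite q0 eqxx in y0.
have z0: iter q (lb e) y != 0 by apply/negP=> /min;rewrite ltnn.
have hz: wt (wij i j + a *+ q) (iter q (lb e) y).
 elim: (q)=> [|p IH];first by rewrite addr0.
 by have:= wt_lb (proj2 he) IH;rewrite addrCA mulrS.
have [N [eN _]]:= chain_nat ef h2 nf z0 q0 (hz (hc a)).
exists (N%:Z - (2 * q)%:Z);rewrite rmorphB /= -!pmulrn -eN evDl evMn.
by case: (hcP rd ra)=> -> _;rewrite natrM;ring.
Qed.
(** The diagonal entries of the coroot become integers after multiplication by [n], so n^2 times its
    trace norm is a sum of integer squares, which is [k]; the factor 2 is the value of [a] on its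
    coroot. The positivity of [k] is what allows signs of pairings to be compared. *)
Lemma coroot_norm a : rt a -> exists k : nat, (0 < k)%N /\
 forall c, (n ^ 2 * 2)%:R * \tr (tt (hc a) *m tt c) = k%:R * ev a c.
move=> ra;have [a0 [e he e0]]:= ra.
have [f [hf ef h1 h2 _]]:= rt_triple rd ra he e0.
set s := hc a *m map_mx intr M.
have ett: tt (hc a) = qdiag Q s by [].
have sumK: \sum_i s 0 i = 0.
 have : \tr (lb e f) = 0 by rewrite /lb linearB /= mxtrace_mulC subrr.
 by rewrite ef ett /qdiag mxtrace_mulC mulmxA mulmxV // mul1mx mxtrace_diag=> ->.
have n0: (0 < n)%N by case: (n) e e0 {he ef hf f h1 h2}=> [|//] e;rewrite [e]flatmx0 eqxx.
have hz i: exists z : int, n%:R * s 0 i = z%:~R.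
 have ch j: exists k : int, s 0 i - s 0 j = k%:~R.
  by have [k hk]:= coroot_integral ra i j;exists k;rewrite -hk ev_wij.
 have [k hk]:= choice ch;exists (\sum_j k j).
 rewrite rmorph_sum /= -(eq_bigr _ (fun j _=> hk j)) sumrB sumK subr0 sumr_const card_ord.
 by rewrite mulr_natl.
have [z ez]:= choice hz;exists (\sum_i `|z i| ^ 2)%N.
have [ea [k k0 hk]]:= hcP rd ra.
have tr2: (n ^ 2)%:R * \tr (tt (hc a) *m tt (hc a)) = (\sum_i `|z i| ^ 2)%N%:R.
 rewrite ett trace_qdiag // mulr_sumr natr_sum;eqb=> i _.
 rewrite natrX expr2 mulrACA ez -rmorphM /= pmulrn;congr (_%:~R).
 by rewrite -mulnn PoszM !abszE -normrM ger0_norm // -expr2 sqr_ge0.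
split.
 rewrite lt0n;apply: contra_neq k0=> e1;move: tr2;rewrite e1 hk ea.
 move/eqP;rewrite !mulf_eq0 !pnatr_eq0 expn_eq0 andbT orbF=> /orP [/eqP nn|/eqP //].
 by rewrite nn in n0.
move=> c;rewrite -tr2 !hk ea natrM;ring.
Qed.
End BorelRoots.

Section PositiveGrading.
Variables (K : acf) (n r : nat).
Variables (G T B : set 'M[K]_n) (Q : 'M[K]_n) (M : 'M[int]_(r, n)).
Hypotheses (rd : root_dat G T Q M) (hB : borel_subgroup G B) (TB : T `<=` B).
Implicit Types (X Y Z e f : 'M[K]_n) (a b : 'rV[int]_r) (c : 'rV[K]_r).
Notation tt := (tt Q M).
Notation rt := (rt G Q M).
Notation nzw := (nzw G Q M).
Notation hc := (hc Q M).
Notation pr := (pr Q M).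
Notation wij := (wij M).
Notation wlist := (wlist M).
Notation psi := (psi G B Q M).
Notation refl := (refl Q M).
Definition psil : seq 'rV[int]_r := seq.filter (fun a=> `[< psi a >]) wlist.
Lemma mem_psil a : (a \in psil) <-> psi a.
rewrite mem_filter;split=> [/andP [/asboolP //]|pa];apply/andP;split;first exact/asboolP.
by case: pa=> [[_ [Y hY Y0]] _];apply: (wt_wlist rd _ Y0);case: hY.
Qed.
Lemma psi_nzw a : psi a -> nzw a. by case=> -[]. Qed.
Lemma psi_rt a : psi a -> rt a. by case. Qed.
Lemma pr_refl a b : rt a -> nzw b -> pr (refl a b) a = - pr b a.
move=> ra nb;apply/eqP;rewrite -(eqr_int K) -(prP rd ra (reflection rd ra nb)) /refl evBl evZl.
by rewrite (prP rd ra nb);case: (hcP rd ra)=> -> _;rewrite rmorphN /=;apply/eqP;ring.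
Qed.
Lemma refl_refl a b : rt a -> nzw b -> refl a (refl a b) = b.
by move=> ra nb;rewrite {1}/refl pr_refl // /refl scaleNr opprK subrK. Qed.
Lemma pr_self a : rt a -> pr a a = 2.
move=> ra;apply/eqP;rewrite -(eqr_int K) -(prP rd ra);last by case: ra.
by case: (hcP rd ra)=> -> _.
Qed.
Lemma psi_string a b j : psi a -> psi b -> (j%:Z <= - pr b a) -> psi (b + a *+ j).
move=> pa pb;elim: j=> [|j IH] hj;first by rewrite addr0.
have {}IH : psi (b + a *+ j) by apply: IH;lia.
rewrite mulrS addrCA;apply: (psi_add rd hB)=> //.
by rewrite addrCA -mulrS;apply: (string_up rd)=> //;[exact: psi_rt|exact: psi_nzw].
Qed.
Lemma psi_sum_pos a : psi a -> 0 < \sum_(b <- psil) pr b a.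
move=> pa;have ra := psi_rt pa;pose S' := [seq b <- psil | refl a b \in psil].
have nw b: b \in psil -> nzw b by move=> /mem_psil /psi_nzw.
have neg b: b \in psil -> pr b a < 0 -> refl a b \in psil.
 move=> /mem_psil pb lt;apply/mem_psil;rewrite /refl.
 have:= @psi_string a b `|pr b a|%N pa pb _;rewrite -scaler_nat natz ltz0_abs // scaleNr.
 exact.
rewrite (bigID (fun b=> refl a b \in psil)) /=.
have ->: \sum_(b <- psil | refl a b \in psil) pr b a = 0.
 rewrite -big_filter -/S'.
 have uS: uniq S' by rewrite !filter_uniq // undup_uniq.
 have memS b: (b \in S') = (refl a b \in psil) && (b \in psil) by rewrite mem_filter.
 have nwS b: b \in S' -> nzw b by rewrite memS=> /andP [_];exact: nw.
 have sub b: b \in S' -> refl a b \in S'.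
  by move=> hb;rewrite memS refl_refl //;[rewrite andbC -memS|exact: nwS].
 have inj: {in S' &, injective (refl a)}.
  by move=> b b' h1 h2 e;rewrite -(refl_refl ra (nwS _ h1)) e refl_refl //;exact: nwS.
 have pm: perm_eq S' (map (refl a) S').
  apply: uniq_perm=> //;first by rewrite map_inj_in_uniq.
  move=> b;apply/idP/mapP=> [hb|[b' hb' ->]];last exact: sub.
  by exists (refl a b);[exact: sub|rewrite refl_refl //;exact: nwS].
 have : \sum_(b <- S') pr b a = - \sum_(b <- S') pr b a.
  rewrite {1}(perm_big _ pm) big_map /= -sumrN;apply: eq_big_seq=> b hb.
  by rewrite pr_refl //;exact: nwS.
 move: (\sum_(b <- S') pr b a)=> z;lia.
rewrite add0r (big_rem a) /=;last exact/mem_psil.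
have ->: refl a a \notin psil.
 apply/negP=> /mem_psil;rewrite /refl pr_self //.
 have ->: a - (2 : int) *: a = - a by apply/rowP=> i;rewrite !mxE;ring.
 exact: psi_opp rd hB _ pa.
rewrite pr_self // ltr_pwDl // big_seq_cond sumr_ge0 // => b /andP [hb hb2].
by rewrite leNgt;apply: contra hb2;apply: neg;exact: mem_rem hb.
Qed.
(** A weighted sum of the positive coroots is positive on the positive roots. It is scaled by a
    large [C] and perturbed by an integral element [u] on which no nonzero weight vanishes. *)
Lemma positive_grading : exists (x : 'rV[K]_r) (d : 'rV[int]_r -> int),
 [/\ forall a, a \in wlist -> ev a x = (d a)%:~R,
   forall a, a \in wlist -> a != 0 -> d a != 0
  & forall a, psi a -> 0 < d a].
have kex a: exists k : nat, rt a -> (0 < k)%N /\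
  forall c, (n ^ 2 * 2)%:R * \tr (tt (hc a) *m tt c) = k%:R * ev a c.
 have [ra|nra]:= pselect (rt a);last by exists 0%N.
 by have [k hk]:= coroot_norm rd ra;exists k.
have [k hk]:= choice kex.
(* These factors equalize the norms of the coroots, so that the symmetry of the trace form turns the
   sum of the pairings with the coroot of [a] into the value of [a] on [x0]. *)
pose P b := (\prod_(b' <- rem b psil) k b')%N.
pose x0 : 'rV[K]_r := \sum_(b <- psil) (P b)%:R *: hc b.
have ev_sum a (F : 'rV[int]_r -> 'rV[K]_r) s : ev a (\sum_(b <- s) F b) = \sum_(b <- s) ev a (F b).
 by elim: s=> [|b s IH];rewrite ?big_nil ?big_cons ?evDr ?IH //;apply: big1=> i _;rewrite mxE mul0r.
have int0 a: exists z : int, a \in wlist -> ev a x0 = z%:~R.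
 have [aw|_]:= boolP (a \in wlist);last by exists 0.
 have [i [j ea]]:= wlistP aw.
 have ch b: exists z : int, rt b -> ev a (hc b) = z%:~R.
  have [rb|nrb]:= pselect (rt b);last by exists 0.
  by have [z hz]:= coroot_integral rd rb i j;exists z=> _;rewrite ea.
 have [z hz]:= choice ch;exists (\sum_(b <- psil) (P b)%:Z * z b)=> _.
 rewrite /x0 ev_sum rmorph_sum /=;apply: eq_big_seq=> b /mem_psil /psi_rt rb.
 by rewrite evZr hz // rmorphM /= -pmulrn.
have [d0 hd0]:= choice int0.
have pos0 a: psi a -> 0 < d0 a.
 move=> pa;have ra := psi_rt pa;have am: a \in psil by apply/mem_psil.
 have aw: a \in wlist by move: am;rewrite mem_filter=> /andP [].
 have [ka0 hka]:= hk a ra.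
 have e1: (k a)%:R * ev a x0 = (\prod_(b <- psil) k b)%N%:R * \sum_(b <- psil) (pr b a)%:~R.
  rewrite /x0 ev_sum !mulr_sumr;apply: eq_big_seq=> b bm.
  have rb: rt b by move/mem_psil: bm=> /psi_rt.
  have [kb0 hkb]:= hk b rb.
  rewrite evZr mulrCA -hka mxtrace_mulC hkb (prP rd ra) //;last by case: rb.
  by rewrite (big_rem b bm) /= natrM -/(P b);ring.
 have pos1: 0 < (\prod_(b <- psil) k b)%:Z * \sum_(b <- psil) pr b a.
  rewrite mulr_gt0 ?psi_sum_pos // ltz_nat big_seq prodn_cond_gt0 // => b /mem_psil /psi_rt rb.
  by have []:= hk b rb.
 have e2: (k a)%:Z * d0 a = (\prod_(b <- psil) k b)%:Z * \sum_(b <- psil) pr b a.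
  apply/eqP;rewrite -(eqr_int K) !rmorphM /= -!pmulrn rmorph_sum /= -e1 -hd0 //.
 by move: pos1;rewrite -e2 pmulr_rgt0 // ltz_nat.
have [u _ hu]:= @integer_separation r setT (fun _ _ _ _=> I) (fun _ _ _=> I) I wlist.
have du a: ev a (map_mx intr u) = (idot a u)%:~R :> K.
 rewrite /ev rmorph_sum /=;eqb=> i _.
 by rewrite !mxE rmorphM mulrC.
pose C : int := 1 + \sum_(a <- wlist) `|idot a u|.
have leC a: a \in wlist -> `|idot a u| < C.
 move=> aw;rewrite /C (big_rem a) //= addrA (lt_le_trans (y := 1 + `|idot a u|)) ?ltrDr //.
 by rewrite lerDl sumr_ge0.
exists (C%:~R *: x0 + map_mx intr u), (fun a=> C * d0 a + idot a u);split.
- by move=> a aw;rewrite evDr evZr du hd0 // [RHS]intrD intrM.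
- move=> a aw a0;have hau: idot a u != 0.
  apply: contra a0=> /eqP /(hu a aw) h;apply/eqP/rowP=> i;rewrite mxE.
  have:= h (delta_mx 0 i) I;rewrite /idot (bigD1 i) //= mxE !eqxx mulr1 big1 ?addr0 // => j ji.
  by rewrite mxE (negPf ji) andbF mulr0.
 have:= leC a aw;move: (d0 a)=> D;have [->|D0]:= eqVneq D 0;first by rewrite mulr0 add0r.
 move: hau D0;move: (idot a u) (C)=> w c w0 D0;rewrite ltr_norml=> /andP [h1 h2].
 have [h|h]: 1 <= D \/ D <= -1 by lia.
  by apply/eqP=> e;nia.
 by apply/eqP=> e;nia.
- move=> a pa;have aw: a \in wlist by move/mem_psil: (pa);rewrite mem_filter=> /andP [].
 have:= leC a aw;have:= pos0 a pa;move: (d0 a) (idot a u) (C)=> D w c D0.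
 by rewrite ltr_norml=> /andP [h1 h2];nia.
Qed.
End PositiveGrading.

(** * Degrees with respect to a grading element *)

Section Heights.
Variables (K : acf) (n : nat) (Q : 'M[K]_n) (s : 'rV[K]_n).
Hypothesis uQ : Q \in unitmx.
Implicit Types (Y Z : 'M[K]_n) (m : nat).
Let x := qdiag Q s.
Let cj Y := Q *m Y *m invmx Q.

(* hgr m Y: all the ad x-components of Y have a natural number >= m as eigenvalue. *)
Definition hgr m Y := forall i j, (Q *m Y *m invmx Q) i j != 0 ->
 exists2 p : nat, s 0 i - s 0 j = p%:R & (m <= p)%N.
Lemma hgr0 m : hgr m 0.
by move=> i j;rewrite mulmx0 mul0mx mxE eqxx. Qed.
Lemma hgrD m Y Z : hgr m Y -> hgr m Z -> hgr m (Y + Z).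
move=> hY hZ i j;rewrite mulmxDr mulmxDl mxDE=> nz.
have [e|/hY //]:= eqVneq ((Q *m Y *m invmx Q) i j) 0.
by apply: hZ;rewrite e add0r in nz.
Qed.
Lemma hgrZ m (k : K) Y : hgr m Y -> hgr m (k *: Y).
move=> hY i j;rewrite -scalemxAr -scalemxAl mxZE=> nz;apply: hY.
by apply: contraNneq nz=> ->;rewrite mulr0.
Qed.
Lemma hgrB m Y Z : hgr m Y -> hgr m Z -> hgr m (Y - Z).
by move=> hY hZ;rewrite -scaleN1r;apply: hgrD=> //;exact: hgrZ. Qed.
Lemma hgrM m m' Y Z : hgr m Y -> hgr m' Z -> hgr (m + m') (Y *m Z).
move=> hY hZ i j nz.
have e: Q *m (Y *m Z) *m invmx Q = (Q *m Y *m invmx Q) *m (Q *m Z *m invmx Q).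
 by rewrite !mulmxA mulmxKV.
have [k /andP [h1 h2]]: exists k, ((Q *m Y *m invmx Q) i k != 0) && ((Q *m Z *m invmx Q) k j != 0).
 apply/existsP;apply: contraNT nz=> /existsPn h;rewrite e mxE big1 // => k _.
 by have:= h k;rewrite negb_and !negbK=> /orP [] /eqP ->;rewrite ?mul0r ?mulr0.
have [p e1 hp]:= hY _ _ h1;have [q e2 hq]:= hZ _ _ h2.
exists (p + q)%N;last exact: leq_add.
by rewrite natrD -e1 -e2 addrA subrK.
Qed.
Lemma hgr_le m m' Y : (m' <= m)%N -> hgr m Y -> hgr m' Y.
by move=> le hY i j /hY [p -> hp];exists p=> //;exact: leq_trans hp. Qed.
Lemma hgr_lb m m' Y Z : hgr m Y -> hgr m' Z -> hgr (m + m') (lb Y Z).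
by move=> hY hZ;apply: hgrB;[exact: hgrM|rewrite addnC;exact: hgrM]. Qed.
Lemma hgr_sum m (I : Type) (r : seq I) (P : pred I) (F : I -> 'M[K]_n) :
 (forall i, P i -> hgr m (F i)) -> hgr m (\sum_(i <- r | P i) F i).
by move=> h;elim/big_rec: _=> [|i y Pi hy];[exact: hgr0|apply: hgrD=> //;exact: h]. Qed.
Lemma hgr_bound : exists D, forall Y, hgr D Y -> Y = 0.
pose f (ij : 'I_n * 'I_n) : nat := xget 0%N [set p : nat | s 0 ij.1 - s 0 ij.2 = p%:R].
exists (\sum_ij f ij).+1=> Y hY;suff : cj Y = 0.
 move/(congr1 (fun M=> invmx Q *m M *m Q));rewrite /cj mulmx0 mul0mx.
 by rewrite !mulmxA mulVmx // mul1mx mulmxKV.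
mxP=> i j;rewrite [RHS]mxE;apply/eqP/negPn/negP=> nz.
have [p e1]:= hY i j nz;have hp: f (i, j) = p.
 apply: xget_unique=> // q;rewrite /= e1=> /eqP;rewrite eqr_nat=> /eqP ->.
 by [].
by rewrite leqNgt ltnS (bigD1 (i, j)) //= hp leq_addr.
Qed.
Lemma hgr_comm Y : lb x Y = 0 -> hgr 0 Y.
move=> h i j nz;exists 0%N=> //.
have : cj (lb x Y) i j = 0 by rewrite h /cj mulmx0 mul0mx mxE.
have ->: cj (lb x Y) = lb (diag_mx s) (cj Y).
 rewrite /lb /x /qdiag /cj mulmxBr mulmxBl !mulmxA mulmxV // mul1mx.
 by congr (_ - _);rewrite ?mulmxKV // mulmxK.
rewrite /lb mul_diag_mx mul_mx_diag mxDE [(- _ : 'M__) i j]mxE ![(\matrix_(_, _) _) i j]mxE.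
rewrite [cj Y i j * _]mulrC -mulrBl=> /eqP;rewrite mulf_eq0 [cj _ _ _ == _](negPf nz) orbF.
by move/eqP.
Qed.
Lemma hgr1 : hgr 0 1%:M.
by apply: hgr_comm;rewrite /lb mulmx1 mul1mx subrr. Qed.
Lemma hgr_nilp Y : hgr 1 Y -> nilp Y.
move=> hY;have [D hD]:= hgr_bound;exists D;apply: hD;elim: D=> [|D IH];first exact: hgr1.
by rewrite exprS -add1n -mulmxE;exact: hgrM.
Qed.
Lemma hgr_mexp m Y : (0 < m)%N -> hgr m Y -> hgr m (mexp Y - 1%:M).
move=> m0 hY;have nY: nilp Y by apply: hgr_nilp;exact: hgr_le hY.
have [k hk]:= nY;rewrite (@mexpE _ _ _ k.+1);last by rewrite exprS hk mulr0.
rewrite big_ord_recl /= fact0 invr1 scale1r expr0 addrC addKr.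
apply: hgr_sum=> i _;apply: hgrZ;rewrite /bump /= add1n;elim: (nat_of_ord i)=> [|j IH].
 by rewrite expr1.
by rewrite exprS -mulmxE;apply: (@hgr_le (m + m));[exact: leq_addr|exact: hgrM].
Qed.

(* (k + v)^-1 = (1 + N)^-1 k^-1 with N = k^-1 v nilpotent, and (1 + N)^-1 - 1 = - N sum (- N)^j. *)
Lemma hgr_inv m A k : (0 < m)%N -> A \in unitmx -> k \in unitmx -> hgr 0 k -> hgr 0 (invmx k) ->
 hgr m (A - k) -> hgr m (invmx A - invmx k).
move=> m0 uA uk hk hk' hAk.
have hN: hgr m (1%:M - invmx k *m A).
 have ->: 1%:M - invmx k *m A = - (invmx k *m (A - k)) by rewrite mulmxBr mulVmx // opprB.
 by rewrite -scaleN1r;apply: hgrZ;rewrite -[m]add0n;exact: hgrM.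
set N := 1%:M - invmx k *m A in hN;have nN: nilp N by apply: hgr_nilp;exact: hgr_le hN.
have [D hD]:= nN;have geo: (1%:M - N) *m (\sum_(i < D) N ^+ i) = 1%:M.
 have : forall d, (1%:M - N) *m (\sum_(i < d) N ^+ i) = 1%:M - N ^+ d.
  elim=> [|d IH];first by rewrite big_ord0 mulmx0 expr0 subrr.
  by rewrite big_ord_recr mulmxDr IH mulmxBl mul1mx exprS mulmxE addrA subrK.
 by move=> ->;rewrite hD subr0.
have eA: invmx A = (\sum_(i < D) N ^+ i) *m invmx k.
 have e1: A = k *m (1%:M - N) by rewrite /N opprB addrC subrK mulmxA mulmxV // mul1mx.
 have : A *m ((\sum_(i < D) N ^+ i) *m invmx k) = 1%:M.
  by rewrite {1}e1 -mulmxA (mulmxA (_ - N)) geo mul1mx mulmxV.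
 by move/(congr1 (mulmx (invmx A)));rewrite mulKmx // mulmx1.
have ->: invmx A - invmx k = ((\sum_(i < D) N ^+ i) - 1%:M) *m invmx k by rewrite mulmxBl mul1mx -eA.
rewrite -[m]addn0;apply: hgrM=> //;case: D hD {geo eA}=> [|D] hD.
 have ->: (1%:M : 'M[K]_n) = 0 by rewrite -hD.
 by rewrite big_ord0 subrr;exact: hgr0.
rewrite big_ord_recl expr0 addrC addKr;apply: hgr_sum=> i _;rewrite /= /bump /= add1n.
elim: (nat_of_ord i)=> [|j IH];first by rewrite expr1.
by rewrite exprS -mulmxE;apply: (@hgr_le (m + m));[exact: leq_addr|exact: hgrM].
Qed.
Definition vexp (V : set 'M[K]_n) : set (set 'M[K]_n) :=
 [set C | exists2 X, V X /\ nilp X & C = expcv X].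
Lemma hgr_vexp (V : set 'M[K]_n) u : (forall Y, V Y -> hgr 1 Y) -> gen (vexp V) u -> hgr 1 (u - 1%:M).
move=> Vh;elim=> [|A C c hA IH [X [VX nX] ->] [t _ <-]];first by rewrite subrr;exact: hgr0.
have h1: hgr 1 (mexp (t *: X) - 1%:M) by apply: hgr_mexp=> //;apply: hgrZ;exact: Vh.
have h0: hgr 0 (mexp (t *: X)).
 rewrite -[mexp _](subrK 1%:M);apply: hgrD;last exact: hgr1.
 exact: hgr_le h1.
have ->: A *m mexp (t *: X) - 1%:M = (A - 1%:M) *m mexp (t *: X) + (mexp (t *: X) - 1%:M).
 by rewrite mulmxBl mul1mx addrA subrK.
by apply: hgrD=> //;rewrite -[1%N]addn0;exact: hgrM.
Qed.
Lemma gen_fam_vexp (V : set 'M[K]_n) : gen_fam (vexp V).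
move=> C [X [VX nX] ->];split;first by exists 0=> //;rewrite scale0r mexp0.
 by move=> _ [t _ <-];apply: mexpU;exact: nilpZ.
by move=> _ [t _ <-];exists (- t)=> //;rewrite mexpV ?scaleNr //;exact: nilpZ.
Qed.

(* Exponentials of the lowest components remove the components of positive degree one degree
   at a time. *)
Lemma eliminate (V : set 'M[K]_n) y : (forall A B (k : K), V A -> V B -> V (k *: A + B)) ->
 (forall A B, V A -> V B -> V (lb A B)) -> (forall A, V A -> V (lb x A)) ->
 (forall Y, V Y -> hgr 1 Y) -> V y ->
 exists2 u, gen (vexp V) u & Ad u (x + y) = x.
move=> Vl Vb Vx Vh;have [D hD]:= hgr_bound.
have gl := mxgrpU (mxgrp_gen (@gen_fam_vexp V)).
suff h: forall k m y, (D <= m + k)%N -> (0 < m)%N -> V y -> hgr m y ->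
  exists2 u, gen (vexp V) u & Ad u (x + y) = x.
 by move=> Vy;apply: (h D 1%N)=> //;exact: Vh.
elim=> [|k IH] m {}y hm m0 Vy hy.
 have ->: y = 0 by apply: hD;apply: hgr_le hy;rewrite -[m]addn0.
 by exists 1%:M;[exact: gen1|rewrite Ad1 addr0].
pose z := m%:R^-1 *: qcomp Q s m%:R y.
have mK: (m%:R : K) != 0 by rewrite pnatr_eq0 -lt0n.
have V0: V 0 by have:= Vl _ _ (-1) Vy Vy;rewrite scaleN1r addNr.
have VD A B: V A -> V B -> V (A + B) by move=> hA hB;have:= Vl _ _ 1 hA hB;rewrite scale1r.
have VZ (c : K) A : V A -> V (c *: A) by move=> hA;have:= Vl _ _ c hA V0;rewrite addr0.
have Vz: V z by apply: VZ;exact: qcomp_sub.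
have xz: lb x z = m%:R *: z by rewrite /z lbZr lb_qcomp // !scalerA mulrC.
have hz: hgr m z.
 apply: hgrZ=> i j;rewrite /qcomp !mulmxA mulmxV // mul1mx mulmxK // mxE.
 have [e _|_]:= eqVneq (s 0 i - s 0 j) m%:R;last by rewrite eqxx.
 by exists m.
have nz: nilp z by apply/hgr_nilp/Vh.
have hyz: hgr m.+1 (y - m%:R *: z).
 rewrite /z scalerA mulfV // scale1r=> i j.
 rewrite mulmxBr mulmxBl mxDE [(- _ : 'M__) i j]mxE /qcomp !mulmxA mulmxV // mul1mx mulmxK // [(\matrix_(_, _) _) i j]mxE.
 have [_|ne]:= eqVneq (s 0 i - s 0 j) m%:R;first by rewrite subrr eqxx.
 rewrite subr0=> /hy [p e1 hp];exists p=> //;rewrite ltn_neqAle hp andbT.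
 by apply: contraNneq ne=> e;rewrite e1 e.
have [N hN]:= ad_nilp nz.
have Adz: exists2 R, V R /\ hgr m.+1 R & Ad (mexp z) (x + y) = x + (y - m%:R *: z) + R.
 rewrite /Ad mexpV // (@mexp_Ad _ _ z (x + y) N.+2 nz);last by rewrite /= hN !lb0r.
 rewrite !big_ord_recl /= !fact0 !invr1 !scale1r.
 have e1: lb z (x + y) = - (m%:R *: z) + lb z y by rewrite lbDr (lbC z x) xz.
 have V1: V (lb z y) by exact: Vb.
 have h1: hgr m.+1 (lb z y).
  by apply: (@hgr_le (m + m));[rewrite -addn1 leq_add2l|exact: hgr_lb].
 exists (lb z y + \sum_(i < N) ((bump 0 (bump 0 i))`!%:R)^-1 *: lb z (lb z (iter i (lb z) (x + y))));last first.
  by rewrite e1 -!addrA.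
 have VR i: V (lb z (iter i (lb z) (lb z (x + y)))) /\ hgr m.+1 (lb z (iter i (lb z) (lb z (x + y)))).
  elim: i=> [|i [IH1 IH2]] /=.
   rewrite e1 lbDr lbNr lbZr lbxx scaler0 oppr0 add0r;split;first exact: Vb.
   by apply: (@hgr_le (m + m.+1));[exact: leq_addl|exact: hgr_lb].
  by split;[exact: Vb|apply: (@hgr_le (m + m.+1));[exact: leq_addl|exact: hgr_lb]].
 split.
  apply: (VD)=> //;elim/big_rec: _=> [//|i A _ hA];apply: (VD)=> //;apply: VZ.
  by have []:= VR i;rewrite -iterSr.
 apply: hgrD=> //;apply: hgr_sum=> i _;apply: hgrZ;by have []:= VR i;rewrite -iterSr.
case: Adz=> R [VR hR] eR.
have Vr: V (y - m%:R *: z + R) by apply: (VD)=> //;rewrite -scaleNr;apply: (VD)=> //;exact: VZ.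
have hm': (D <= m.+1 + k)%N by rewrite addSnnS.
have [u gu hu]:= IH m.+1 _ hm' isT Vr (hgrD hyz hR).
have uu := gl _ gu;have uz := mexpU nz.
exists (u *m mexp z);last by rewrite (AdM _ uu uz) eR -addrA.
apply: gen_mul=> //;apply: (gen_gen (C := expcv z));first by exists z.
by exists 1=> //;rewrite scale1r.
Qed.
End Heights.

Section Extension.
Variables (K : acf) (n : nat) (Q : 'M[K]_n) (s : 'rV[K]_n).
Hypothesis uQ : Q \in unitmx.
Implicit Types (S D : set 'M[K]_n) (A k : 'M[K]_n).
Let x := qdiag Q s.
Lemma commutator_grp S : mxgroup S -> mxgroup (commutator_group S) /\ commutator_group S `<=` S.
move=> mS;have sub: commutator_group S `<=` S.
 move=> z hz;apply: hz=> // y1 y2 h1 h2.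
 by do !apply: (mxgrpM mS)=> //;exact: (mxgrpV mS).
split=> //;split=> [A /sub|D mD _|A C hA hC D mD hD|A hA D mD hD].
- exact: mxgrpU.
- exact: mxgrp1.
- by apply: (mxgrpM mD);[exact: hA|exact: hC].
- by apply: (mxgrpV mD);exact: hA.
Qed.
Lemma commutator_group_sub S D : S `<=` D -> commutator_group S `<=` commutator_group D.
by move=> SD z hz E mE hE;apply: hz=> // y1 y2 /SD h1 /SD h2;exact: hE. Qed.
(** For [m = 1] and [S] the centralizer of [x] in a Borel subgroup, this is what the Borel subgroup
    becomes when everything of positive degree is allowed in its unipotent part. *)
Definition ext m S : set 'M[K]_n := [set A | A \in unitmx /\ exists2 k, S k & hgr Q s m (A - k)].
Definition central S := forall k, S k -> lb x k = 0.
Let unit_hgr S k : mxgroup S -> central S -> S k ->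
 [/\ k \in unitmx, hgr Q s 0 k & hgr Q s 0 (invmx k)].
move=> mS cS Sk;split;first exact: (mxgrpU mS).
 by apply: hgr_comm=> //;exact: cS.
by apply: hgr_comm=> //;apply: cS;exact: (mxgrpV mS).
Qed.
Lemma ext_mxgroup m S : (0 < m)%N -> mxgroup S -> central S -> mxgroup (ext m S).
move=> m0 mS cS;split.
- by move=> A [].
- by split;[exact: unitmx1|exists 1%:M;[exact: mxgrp1|rewrite subrr;exact: hgr0]].
- move=> A C [uA [k Sk hk]] [uC [l Sl hl]];split;first by rewrite unitmx_mul uA.
 exists (k *m l);first exact: (mxgrpM mS).
 have [_ k0 _]:= unit_hgr mS cS Sk;have [_ l0 _]:= unit_hgr mS cS Sl.
 have ->: A *m C - k *m l = (A - k) *m l + (k *m (C - l) + (A - k) *m (C - l)).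
  by rewrite !mulmxBl !mulmxBr;move: (A *m C) (k *m C) (A *m l) (k *m l)=> a b c d;
   mxP=> i j;rewrite !mxE;ring.
 apply: hgrD;first by rewrite -[m]addn0;exact: hgrM.
 apply: hgrD;first by rewrite -[m]add0n;exact: hgrM.
 by apply: (@hgr_le _ _ _ _ (m + m));[exact: leq_addr|exact: hgrM].
- move=> A [uA [k Sk hk]];split;first by rewrite unitmx_inv.
 have [uk k0 k1]:= unit_hgr mS cS Sk.
 by exists (invmx k);[exact: (mxgrpV mS)|exact: (hgr_inv uQ m0 uA uk)].
Qed.
Lemma ext_commutator S D : mxgroup S -> central S -> D `<=` ext 1 S ->
 commutator_group D `<=` ext 1 (commutator_group S).
move=> mS cS DS z hz;have [mC subC]:= commutator_grp mS.
have cC: central (commutator_group S) by move=> k /subC;exact: cS.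
apply: hz;first exact: ext_mxgroup.
have mE := @ext_mxgroup 1 S isT mS cS.
move=> A C /DS hA /DS hC;have [uA [k Sk hk]]:= hA;have [uC [l Sl hl]]:= hC.
split.
 by apply: (mxgrpU mE);do !apply: (mxgrpM mE)=> //;exact: (mxgrpV mE).
exists (k *m l *m invmx k *m invmx l).
 by move=> E mE' hE;apply: hE.
have [uk k0 k1]:= unit_hgr mS cS Sk;have [ul l0 l1]:= unit_hgr mS cS Sl.
have prod (a b a' b' : 'M[K]_n) : hgr Q s 1 (a - b) -> hgr Q s 0 b -> hgr Q s 1 (a' - b') -> hgr Q s 0 b' ->
  hgr Q s 1 (a *m a' - b *m b') /\ hgr Q s 0 (b *m b').
 move=> h1 h2 h3 h4;split;last by rewrite -[0%N]addn0;exact: hgrM.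
 have ->: a *m a' - b *m b' = (a - b) *m b' + (b *m (a' - b') + (a - b) *m (a' - b')).
  by rewrite !mulmxBl !mulmxBr;move: (a *m a') (b *m a') (a *m b') (b *m b')=> ? ? ? ?;
   mxP=> i j;rewrite !mxE;ring.
 apply: hgrD;first by rewrite -[1%N]addn0;exact: hgrM.
 apply: hgrD;first by rewrite -[1%N]add0n;exact: hgrM.
 by apply: (@hgr_le _ _ _ _ (1 + 1))=> //;exact: hgrM.
have hki: hgr Q s 1 (invmx A - invmx k) by exact: (hgr_inv uQ).
have hli: hgr Q s 1 (invmx C - invmx l) by exact: (hgr_inv uQ).
have [p1 p2]:= prod _ _ _ _ hk k0 hl l0.
have [p3 p4]:= prod _ _ _ _ p1 p2 hki k1.
by have []:= prod _ _ _ _ p3 p4 hli l1.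
Qed.
Lemma ext1_commutator m D : (0 < m)%N -> D `<=` ext m [set 1%:M] ->
 commutator_group D `<=` ext (m + m) [set 1%:M].
move=> m0 hD z hz.
have m1: mxgroup [set 1%:M : 'M[K]_n].
 split=> [_ ->|//|_ _ -> ->|_ ->];rewrite /GLset /= ?unitmx1 ?mulmx1 ?invmx1 //.
have c1: central [set 1%:M] by move=> _ ->;rewrite /lb mulmx1 mul1mx subrr.
have m20: (0 < m + m)%N by rewrite addn_gt0 m0.
apply: hz;first exact: ext_mxgroup.
have mE := ext_mxgroup m0 m1 c1.
move=> A C /hD hA /hD hC;have [uA [_ -> hk]]:= hA;have [uC [_ -> hl]]:= hC.
have gA: ext m [set 1%:M] (invmx A) by exact: (mxgrpV mE).
have gC: ext m [set 1%:M] (invmx C) by exact: (mxgrpV mE).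
have h0 E: ext m [set 1%:M] E -> hgr Q s 0 E.
 move=> [_ [_ -> h]];rewrite -[E](subrK 1%:M);apply: hgrD;last exact: hgr1.
 exact: hgr_le h.
split.
 by apply: (mxgrpU mE);do !apply: (mxgrpM mE)=> //;exact: (mxgrpV mE).
exists 1%:M=> //.
have ->: A *m C *m invmx A *m invmx C - 1%:M = lb (A - 1%:M) (C - 1%:M) *m invmx A *m invmx C.
 have ->: lb (A - 1%:M) (C - 1%:M) = A *m C - C *m A.
  rewrite /lb !mulmxBl !mulmxBr !mulmx1 !mul1mx;move: (A *m C) (C *m A)=> a b.
  by mxP=> i j;rewrite !mxE;ring.
 by rewrite !mulmxBl mulmxK // mulmxV.
rewrite -[(m + m)%N]addn0 -[(m + m + 0)%N]addn0;apply: hgrM=> //;last exact: h0.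
by apply: hgrM=> //;[exact: hgr_lb|exact: h0].
Qed.
(** Commutators follow those of [S] until the part of degree 0 is 1; from then on each further
    commutator raises the degree of the rest, and degrees are bounded. *)
Lemma ext_solvable S D : mxgroup S -> central S -> mx_solvable S -> D `<=` ext 1 S -> mxgroup D ->
 mx_solvable D.
move=> mS cS [k hk] hD mD;have [d hd]:= hgr_bound s uQ.
have it (A : set 'M[K]_n) : mxgroup A -> forall j, mxgroup (iter j (@commutator_group K n) A).
 by move=> mA;elim=> [//|j IH] /=;case: (commutator_grp IH).
have itc j: central (iter j (@commutator_group K n) S).
 elim: j=> [//|j IH] /= z;have [_ sub]:= commutator_grp (it _ mS j).
 by move=> /sub;exact: IH.
have e1 j: iter j (@commutator_group K n) D `<=` ext 1 (iter j (@commutator_group K n) S).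
 by elim: j=> [//|j IH];exact: (ext_commutator (it _ mS j) (itc j) IH).
have e2 j: iter (j + k) (@commutator_group K n) D `<=` ext j.+1 [set 1%:M].
 elim: j=> [|j IH];first by rewrite -hk;exact: e1.
 move=> z /(ext1_commutator (ltn0Sn j) IH) [uz [o ho hz]];split=> //;exists o=> //.
 by apply: hgr_le hz;rewrite addSn ltnS leq_addl.
exists (d + k)%N;rewrite predeqE=> z;split=> [/e2 [_ [o -> hz]]|->];last exact: (mxgrp1 (it _ mD _)).
have:= hd _ (hgr_le (leqnSn d) hz);move/eqP;rewrite subr_eq0=> /eqP;exact.
Qed.
End Extension.

Section AdjointCurves.
Variables (K : acf) (n : nat) (G : set 'M[K]_n).
Hypotheses (mG : mxgroup G) (hexp : zcl (gen (exp_fam G)) = G).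
(** The differential of inversion, obtained from the product of a matrix with its adjugate: this is
    the determinant, which is constant on [G]. *)
Lemma dev_adj A X : G A -> Lie G X -> dev (\adj (gmx K n)) A (A *m X) = - (X *m invmx A).
move=> gA LX;have uA := mxgrpU mG gA;have d1 := det1G hexp gA.
have madj: mev (\adj (gmx K n)) A = invmx A.
 rewrite /invmx uA d1 invr1 scale1r;mxP=> i j.
 by rewrite mxE mxeval_adj.
have dd: dmx (\det (gmx K n)) A (A *m X) = 0.
 have ->: \det (gmx K n) = (\det (gmx K n) - 1%:MP) + 1%:MP by rewrite subrK.
 rewrite dmxD dmxC addr0;apply: (dmx_left mG)=> // C gC.
 by rewrite /mxeval mevalB mevalC -/(mxeval _ _) mxeval_det (det1G hexp gC) subrr.
have:= congr1 (fun M=> dev M A (A *m X)) (mul_mx_adj (gmx K n)).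
rewrite dev_mul dev_g madj mev_g.
have ->: dev (\det (gmx K n))%:M A (A *m X) = 0.
 mxP=> i j;rewrite !mxE;case: (i == j);rewrite ?mulr1n ?mulr0n ?dd //.
 by rewrite -(mpolyC0) dmxC.
move/eqP;rewrite addrC addr_eq0=> /eqP e.
by rewrite -[LHS](mulKmx uA) e mulmxN -!mulmxA mulKmx.
Qed.
Lemma dev_Ad A X Y : G A -> Lie G X ->
 dev (gmx K n *m cmx _ Y *m \adj (gmx K n)) A (A *m X) = Ad A (lb X Y).
move=> gA LX;rewrite !dev_mul dev_adj // dev_g dev_c mulmx0 addr0 mevM mev_g mev_c.
have ->: mev (\adj (gmx K n)) A = invmx A.
 rewrite /invmx (mxgrpU mG gA) (det1G hexp gA) invr1 scale1r;mxP=> i j.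
 by rewrite mxE mxeval_adj.
by rewrite /Ad /lb mulmxBr mulmxBl mulmxN !mulmxA.
Qed.
Lemma mev_Ad A Y : G A -> mev (gmx K n *m cmx _ Y *m \adj (gmx K n)) A = Ad A Y.
move=> gA;rewrite !mevM mev_g mev_c /Ad;congr (_ *m _).
rewrite /invmx (mxgrpU mG gA) (det1G hexp gA) invr1 scale1r;mxP=> i j.
by rewrite mxE mxeval_adj.
Qed.
End AdjointCurves.

Section BorelPositive.
Variables (K : acf) (n r : nat).
Variables (G T B : set 'M[K]_n) (Q : 'M[K]_n) (M : 'M[int]_(r, n)).
Hypotheses (rd : root_dat G T Q M) (hB : borel_subgroup G B) (TB : T `<=` B).
Implicit Types (X Y Z e f : 'M[K]_n) (a b : 'rV[int]_r) (c : 'rV[K]_r).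
Notation tt := (tt Q M).
Notation wt := (wt Q M).
Notation rt := (rt G Q M).
Notation wij := (wij M).
Notation wlist := (wlist M).
Notation psi := (psi G B Q M).
Variables (x : 'rV[K]_r) (d : 'rV[int]_r -> int).
Hypotheses (dx : forall a, a \in wlist -> ev a x = (d a)%:~R)
 (dpsi : forall a, psi a -> 0 < d a).
Let uQ := rd_unit rd.
Let mG : mxgroup G. by case: (rd_simple rd)=> [[[]]]. Qed.
Let hexp := rd_exp rd.
Let BG : B `<=` G. by case: hB. Qed.
Let cB : conn_group B. by case: hB. Qed.
Let aB : alg_group B. by case: cB. Qed.
Let mB : mxgroup B. by case: aB. Qed.
Let s := x *m map_mx intr M.
Let hgr := hgr Q s.
Let ttx : tt x = qdiag Q s. by []. Qed.
Lemma diff_ev i j : s 0 i - s 0 j = (d (wij i j))%:~R.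
by rewrite /s -ev_wij dx // mem_wlist. Qed.
Lemma hgr_wt m a Y : wt a Y -> m%:Z <= d a -> hgr m Y.
move=> /(wtP rd) h da i j /h e;exists `|d a|%N;last by lia.
by rewrite diff_ev e pmulrn gez0_abs //;lia.
Qed.
Lemma hgr_tt c : hgr 0 (tt c).
by apply: hgr_comm=> //;rewrite -ttx;exact: (tt_comm rd). Qed.
Lemma LieB_decomp Y : Lie B Y -> exists c, hgr 1 (Y - tt c).
move=> LY.
have [c ec]: exists c, wcomp Q M 0 Y = tt c.
 by apply: (wsp_torus rd);apply: (wcompP rd);exact: (Lie_sub BG).
exists c;have hn a: a != 0 -> hgr 1 (wcomp Q M a Y).
 move=> a0;have [->|nz]:= eqVneq (wcomp Q M a Y) 0;first exact: hgr0.
 have [e|pa]:= psi_wcomp rd hB TB LY nz;first by rewrite e eqxx in a0.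
 by apply: (hgr_wt (wcomp_wt rd a Y));have:= dpsi pa;lia.
have [w0|nw0]:= boolP (0 \in wlist).
 rewrite {1}(wcomp_sum rd Y) (bigD1_seq 0) ?undup_uniq //= ec addrAC subrr add0r.
 by apply: hgr_sum=> a;exact: hn.
have tc0: tt c = 0.
 have [//|nz]:= eqVneq (tt c) 0.
 by case/negP: nw0;apply: (wt_wlist rd _ nz);rewrite -ec;exact: (wcomp_wt rd).
rewrite tc0 subr0 {1}(wcomp_sum rd Y) big_seq_cond;apply: hgr_sum=> a /andP [aw _].
by apply: hn;apply: contraNneq nw0=> <-.
Qed.
Lemma LieB_lb Y Z : Lie B Y -> Lie B Z -> hgr 1 (lb Y Z).
move=> /LieB_decomp [c hc] /LieB_decomp [c' hc'].
rewrite -[Y](subrK (tt c)) -[Z](subrK (tt c')).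
move: (Y - tt c) (Z - tt c') hc hc'=> N N' hN hN'.
rewrite lbDr !lbDl (tt_comm rd) addr0.
have h1: hgr 1 (lb N (tt c')) := @hgr_lb K n Q s uQ 1 0 _ _ hN (hgr_tt (c:=c')).
have h2: hgr 1 (lb (tt c) N') := @hgr_lb K n Q s uQ 0 1 _ _ (hgr_tt (c:=c)) hN'.
have h3: hgr 1 (lb N N') := hgr_le (isT : (1 <= 2)%N) (@hgr_lb K n Q s uQ 1 1 _ _ hN hN').
by apply: hgrD=> //;exact: hgrD.
Qed.
(** An entry of the conjugate that is not of positive degree is a function on [B] with zero
    differential, because brackets in Lie B have positive degree; hence it is constant. *)
Lemma Ad_torus_element (b : 'M[K]_n) : B b -> hgr 1 (Ad b (tt x) - tt x).
move=> Bb i j;rewrite mulmxBr mulmxBl mxDE [(- _ : 'M__) i j]mxE=> nz.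
apply: contrapT=> hn;move: nz;rewrite subr_eq0=> /eqP;apply.
pose pM := cmx (n * n) Q *m (gmx K n *m cmx _ (tt x) *m \adj (gmx K n)) *m cmx _ (invmx Q).
have pE A: G A -> mxeval (pM i j) A = (Q *m Ad A (tt x) *m invmx Q) i j.
 move=> gA;have ->: mxeval (pM i j) A = mev pM A i j by rewrite [RHS]mxE.
 by rewrite /pM mevM mevM (mev_Ad mG hexp) // !mev_c.
have:= constant_of_tangent hexp cB BG (p := pM i j) _ Bb.
rewrite (pE b (BG Bb)) (pE _ (mxgrp1 mG)) Ad1.
apply=> A X BA LX;have gA := BG BA.
have ->: dmx (pM i j) A (A *m X) = dev pM A (A *m X) i j by rewrite [RHS]mxE.
rewrite /pM dev_mul dev_c mulmx0 addr0 dev_mul dev_c mul0mx add0r !mev_c (dev_Ad mG hexp _ gA (Lie_sub BG LX)).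
have h1: hgr 1 (Ad A (lb X (tt x))).
 rewrite Ad_lb ?(mxgrpU mB BA) //;apply: LieB_lb;apply: Lie_Ad=> //.
 exact: (tt_LieB rd TB).
by apply/eqP/negPn/negP=> /h1.
Qed.
Let V : set 'M[K]_n := [set Y | Lie B Y /\ hgr 1 Y].
Let S : set 'M[K]_n := [set k | B k /\ lb (tt x) k = 0].
Let mS : mxgroup S.
split=> [k [Bk _]|||];first exact: (mxgrpU mB).
- by split;[exact: mxgrp1|rewrite /lb mulmx1 mul1mx subrr].
- move=> k l [Bk hk] [Bl hl];split;first exact: (mxgrpM mB).
 have ->: lb (tt x) (k *m l) = lb (tt x) k *m l + k *m lb (tt x) l.
  by rewrite /lb mulmxBl mulmxBr !mulmxA addrA subrK.
 by rewrite hk hl mul0mx mulmx0 addr0.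
- move=> k [Bk hk];split;first exact: (mxgrpV mB).
 have uk := mxgrpU mB Bk;move/eqP: hk;rewrite subr_eq0=> /eqP e.
 apply/eqP;rewrite subr_eq0;apply/eqP.
 by rewrite -[LHS](mulKmx uk) [k *m _]mulmxA -e -mulmxA mulmxV // mulmx1.
Qed.
(** Conjugation by [b] changes the grading element only in positive degree, and by [eliminate] some
    product [u] of exponentials from [B] changes it back. Then [u b] centralizes the grading
    element. *)
Lemma Borel_ext : B `<=` ext Q s 1 S.
move=> b Bb;have ub := mxgrpU mB Bb;have gb := BG Bb;split=> //.
have Vl A C (k : K) : V A -> V C -> V (k *: A + C).
 by move=> [h1 h2] [h3 h4];split;[exact: Lielin|apply: hgrD=> //;exact: hgrZ].
have Vb A C: V A -> V C -> V (lb A C).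
 move=> [h1 h2] [h3 h4];split;[exact: Lie_lb|exact: LieB_lb].
have Vx A: V A -> V (lb (qdiag Q s) A).
 move=> [h1 h2];have h3 := tt_LieB rd TB x;split;[exact: Lie_lb|exact: LieB_lb].
have Vy: V (Ad b (tt x) - tt x).
 split;last exact: Ad_torus_element.
 have h3 := tt_LieB rd TB x;apply: LieB=> //;exact: Lie_Ad.
have [u gu hu]:= eliminate uQ Vl Vb Vx (fun Y=> @proj2 _ _) Vy.
have mU := mxgrp_gen (@gen_fam_vexp K n V).
have subB: gen (vexp V) `<=` B.
 apply: gen_sub=> // C [X [[LX _] nX] ->] _ [t _ <-];exact: mexp_grp.
have uu := mxgrpU mU gu;have Bu := subB _ gu.
have e1: Ad (u *m b) (tt x) = tt x by rewrite AdM //;move: hu;rewrite -ttx addrC subrK.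
exists (u *m b).
 split;first exact: (mxgrpM mB).
 have um: u *m b \in unitmx by rewrite unitmx_mul uu.
 have:= congr1 (fun A=> A *m (u *m b)) e1;rewrite /Ad mulmxKV // => e2.
 by apply/eqP;rewrite subr_eq0 -e2.
have ->: b - u *m b = (invmx u - 1%:M) *m (u *m b) by rewrite mulmxBl mul1mx mulKmx.
have h0: hgr 0 (u *m b).
 apply: hgr_comm=> //;rewrite -ttx;apply/eqP;rewrite subr_eq0;apply/eqP.
 have um: u *m b \in unitmx by rewrite unitmx_mul uu.
 by have:= congr1 (fun A=> A *m (u *m b)) e1;rewrite /Ad mulmxKV.
have h1: hgr 1 (invmx u - 1%:M).
 apply: (hgr_vexp uQ (V := V));first by move=> Y [].
 exact: (mxgrpV mU).
exact: (@hgrM K n Q s uQ 1 0 _ _ h1 h0).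
Qed.
Let dl : 'M[{mpoly K[n * n]}]_n := cmx _ (invmx Q) *m (\matrix_(i, j)
 if s 0 i - s 0 j == 0 then (cmx _ Q *m gmx K n *m cmx _ (invmx Q)) i j else 0) *m cmx _ Q.
Let mev_dl A : mev dl A = qcomp Q s 0 A.
rewrite /dl !mevM !mev_c /qcomp;congr (_ *m _ *m _);mxP=> i j.
rewrite [mev _ _ i j]mxE ![(\matrix_(_, _) _) i j]mxE;case: eqP=> _;last by rewrite /mxeval meval0.
have ->: mxeval ((cmx (n * n) Q *m gmx K n *m cmx (n * n) (invmx Q)) i j) A =
 mev (cmx (n * n) Q *m gmx K n *m cmx (n * n) (invmx Q)) A i j by rewrite [RHS]mxE.
by rewrite !mevM !mev_c mev_g.
Qed.
(** Membership is read off from the part of degree 0, a linear function of the matrix, and from the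
    vanishing of certain entries; both conditions pass to the closure. *)
Lemma closure_ext F : F `<=` ext Q s 1 S -> zcl F `<=` ext Q s 1 S.
move=> hF A [uA hA];split=> //.
have cjq Y i j: (Q *m qcomp Q s 0 Y *m invmx Q) i j =
  if s 0 i - s 0 j == 0 then (Q *m Y *m invmx Q) i j else 0.
 by rewrite /qcomp !mulmxA mulmxV // mul1mx mulmxK // mxE.
have inj Y Z: (forall i j, (Q *m Y *m invmx Q) i j = (Q *m Z *m invmx Q) i j) -> Y = Z.
 move=> h;have : Q *m Y *m invmx Q = Q *m Z *m invmx Q by apply/matrixP.
 by move/(congr1 (fun N=> invmx Q *m N *m Q));rewrite !mulmxA mulVmx // !mul1mx !mulmxKV.
have qext C k: S k -> hgr 1 (C - k) -> qcomp Q s 0 C = k.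
 move=> [_ hk] hC;apply: inj=> i j;rewrite cjq.
 have hk0: hgr 0 k by apply: hgr_comm=> //;rewrite -ttx.
 have e: (Q *m C *m invmx Q) i j = (Q *m k *m invmx Q) i j + (Q *m (C - k) *m invmx Q) i j.
  by rewrite -mxDE -mulmxDl -mulmxDr [k + _]addrC subrK.
 case: eqVneq=> [sij|sij].
  rewrite e;have [->|/hC [p]]:= eqVneq ((Q *m (C - k) *m invmx Q) i j) 0;first by rewrite addr0.
  by rewrite sij=> /esym/eqP;rewrite pnatr_eq0=> /eqP ->.
 apply/esym/eqP/negPn/negP=> nz;move: hk;move/(congr1 (fun N=> (Q *m N *m invmx Q) i j)).
 rewrite mulmx0 mul0mx [RHS]mxE.
 have ->: Q *m lb (tt x) k *m invmx Q = lb (diag_mx s) (Q *m k *m invmx Q).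
  rewrite /lb ttx /qdiag mulmxBr mulmxBl !mulmxA mulmxV // mul1mx.
  by congr (_ - _);rewrite ?mulmxKV // mulmxK.
 rewrite /lb mul_diag_mx mul_mx_diag mxDE [(- _ : 'M__) i j]mxE ![(\matrix_(_, _) _) i j]mxE.
 rewrite [X in _ - X]mulrC -mulrBl=> /eqP;rewrite mulf_eq0 (negPf nz) orbF.
 exact/negP.
exists (qcomp Q s 0 A);first split.
- apply: (closed_in_det1 hexp aB BG)=> p hp;rewrite -mev_dl -mxevps;apply: hA=> C /hF [_ [k Sk hk]].
 by rewrite mxevps mev_dl (qext C k) //;apply: hp;case: Sk.
- by rewrite ttx lb_qcomp // scale0r.
move=> i j;rewrite mulmxBr mulmxBl mxDE [(- _ : 'M__) i j]mxE cjq.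
have [_|ne]:= eqVneq (s 0 i - s 0 j) 0;first by rewrite subrr eqxx.
rewrite subr0=> nz;apply: contrapT=> hn;case/eqP: nz.
pose p := (cmx (n * n) Q *m gmx K n *m cmx _ (invmx Q)) i j.
have pE C: mxeval p C = (Q *m C *m invmx Q) i j.
 have ->: mxeval p C = mev (cmx _ Q *m gmx K n *m cmx _ (invmx Q)) C i j by rewrite [RHS]mxE.
 by rewrite !mevM !mev_c mev_g.
rewrite -pE;apply: hA=> C /hF [_ [k Sk hk]];rewrite pE.
have e: (Q *m C *m invmx Q) i j = (Q *m k *m invmx Q) i j + (Q *m (C - k) *m invmx Q) i j.
 by rewrite -mxDE -mulmxDl -mulmxDr [k + _]addrC subrK.
have ek: (Q *m k *m invmx Q) i j = 0 by rewrite -(qext C k Sk hk) cjq (negPf ne).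
rewrite e ek add0r;apply/eqP/negPn/negP=> nz;have [p0 e1 h1]:= hk _ _ nz.
by apply: hn;exists p0.
Qed.

(** [B] and the root subgroup of a root of positive degree generate a connected group whose closure
    lies in [ext Q s 1 S] and so is solvable; by maximality it is [B]. *)
Theorem positive_root_in_borel a : rt a -> 0 < d a -> psi a.
move=> ra da;have [a0 [e he e0]]:= ra;have [Le we]:= he.
have h1: hgr 1 e by apply: (hgr_wt we);lia.
have ne: nilp e := wt_nilp a0 we.
pose F : set (set 'M[K]_n) := [set C | C = B \/ C = expcv e].
have aG: alg_group G by case: (rd_simple rd)=> [[]].
have gF: gen_fam F.
 move=> C [->|->].
  by split;[exact: mxgrp1|move=> A;exact: (mxgrpU mB)|move=> A;exact: (mxgrpV mB)].
 by apply: (@gen_fam_vexp K n [set e]);exists e.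
have cS: central Q s S by move=> k [_];rewrite ttx.
have mE := @ext_mxgroup K n Q s uQ 1 S isT mS cS.
have mU := mxgrp_gen gF.
have sub: gen F `<=` ext Q s 1 S.
 apply: gen_sub=> // C [->|->];first exact: Borel_ext.
 move=> _ [t _ <-];split;first by apply: mexpU;exact: nilpZ.
 exists 1%:M;first exact: (mxgrp1 mS).
 by apply: hgr_mexp=> //;exact: hgrZ.
have subG: gen F `<=` G.
 apply: gen_sub=> // C [->|->] //;move=> _ [t _ <-];exact: mexp_grp.
have solS: mx_solvable S.
 case: hB=> _ _ [k hk] _;exists k;rewrite predeqE=> z;split.
  suff h: iter k (@commutator_group K n) S `<=` iter k (@commutator_group K n) B by rewrite -hk=> /h.
  by elim: (k)=> [A []//|j IH] /=;exact: commutator_group_sub.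
 have : mxgroup (iter k (@commutator_group K n) S).
  by elim: (k)=> [|j IH] /=;[exact: mS|case: (commutator_grp IH)].
 by move=> mk ->;exact: (mxgrp1 mk).
have mD: mxgroup (zcl (gen F)) by exact: mxgroup_zcl.
have solD: mx_solvable (zcl (gen F)).
 exact: (ext_solvable uQ mS cS solS (closure_ext sub) mD).
have cD: conn_group (zcl (gen F)).
 apply: conn_group_zcl=> //;apply: sconn_gen=> C FC;split;first by case: (gF C FC).
 case: FC=> ->;first by apply: zconnected_sconn;case: cB.
 exact/sirr_sconn/sirr_exp_curve.
have BD: B `<=` zcl (gen F).
 move=> b Bb;apply: zcl_sub;first by case: mU.
 by apply: (gen_gen (C := B))=> //;left.
have eD: zcl (gen F) = B.
 by case: hB=> _ _ _;apply=> //;exact: alg_group_zcl_sub.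
split=> //;exists e;split=> //.
have <-: hmx 0 (dermx (pexp e)) = e.
 by rewrite dpexp // hmxM hmxC hpexp // scale0r mexp0 mul1mx.
apply: (Lie_curve (d := 1));first exact: oner_neq0.
 move=> t _;rewrite hpexp // -eD;apply: zcl_sub;first by case: mU.
 by apply: (gen_gen (C := expcv e));[right|exists t].
by rewrite hpexp // scale0r mexp0.
Qed.
End BorelPositive.

Theorem borel_grading (K : acf) n r (G T B Q : _) (M : 'M[int]_(r, n)) :
 @root_dat K n r G T Q M -> borel_subgroup G B -> T `<=` B ->
 exists (x : 'rV[K]_r) (d : 'rV[int]_r -> int),
 [/\ forall a, a \in wlist M -> ev a x = (d a)%:~R,
   forall a, a \in wlist M -> a != 0 -> d a != 0
  & forall a, rt G Q M a -> (0 < d a) <-> psi G B Q M a].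
move=> rd hB TB;have [x [d [h1 h2 h3]]]:= positive_grading rd hB.
exists x, d;split=> // a ra;split;last exact: h3.
exact: (positive_root_in_borel rd hB TB h1 h3 ra).
Qed.

(** * From the root datum of the group to the roots of its Lie algebra *)

Section GroupRoots.
Variables (K : acf) (n r l : nat) (A : 'M[int]_l).
Variables (G B T : set 'M[K]_n) (a : 'I_l -> 'M[K]_n -> K) (c : 'I_l -> K -> 'M[K]_n).
Hypotheses (hG : simple_group_of_type A G B T a c) (l0 : (0 < l)%N) (A2 : forall i, A i i = 2).
Implicit Types (X Y : 'M[K]_n) (i j : 'I_l).
Let sG : simple_group G. by case: hG. Qed.
Let mG : mxgroup G. exact: simple_grp. Qed.
Let hT : max_torus G T. by case: hG=> _ []. Qed.
Let TG : T `<=` G. by case: hT. Qed.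
Let mT : mxgroup T. by case: hT=> _ [[[]]]. Qed.
Let hB : borel_subgroup G B. by case: hG=> _ []. Qed.
Let TB : T `<=` B. by case: hG=> _ []. Qed.
Lemma coroot_triple i : exists e f (phi : 'M[K]_2 -> 'M[K]_n),
 [/\ [/\ nilp e, Lie G e & e != 0], nilp f /\ Lie G f,
   forall t, T t -> Ad t e = a i t *: e /\ Ad t f = (a i t)^-1 *: f,
   forall X (k : int), (forall z : K, z != 0 -> Ad (c i z) X = z ^ k *: X) ->
    lb (lb e f) X = k%:~R *: X
  & [/\ alg_hom (@SL2 K) G phi, forall z, z != 0 -> c i z = phi (diag2 z),
    forall x, phi (upper2 x) = mexp (x *: e) & forall x, phi (lower2 x) = mexp (x *: f)]].
have [phi [hphi phi1 hu hl hc]]: coroot G T (a i) (c i) by case: hG.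
have [e [f [[ne Le] [nf Lf] ue lf rule]]]:= sl2_triple_of_hom mG hphi.
have hd z: z != 0 -> c i z = phi (diag2 z) by move/hc=> [].
exists e, f, phi;split=> //.
- split=> //;apply: contraNneq phi1=> e0.
 by rewrite ue e0 scaler0 mexp0.
- move=> t Tt;have ut := mxgrpU mT Tt.
 have conj X (k : K) (u : K -> 'M[K]_2) : nilp X -> (forall x, phi (u x) = mexp (x *: X)) ->
   (forall x, t *m phi (u x) *m invmx t = phi (u (k * x))) -> Ad t X = k *: X.
  move=> nX hX hk;have [_ nX']:= mexp_conj ut nX.
  apply: mexp_inj=> [||x];[exact: nX'|exact: nilpZ|].
  have [e1 _]:= mexp_conj ut (nilpZ x nX).
  by rewrite scalerA mulrC -hX -hk hX e1 -scalemxAr -scalemxAl.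
 split;first by apply: (conj _ _ (@upper2 K))=> // x;exact: hu.
 by apply: (conj _ _ (@lower2 K))=> // x;exact: hl.
- by move=> X k hX;apply: rule hX=> z z0;have []:= hc z z0.
Qed.
Lemma coroot_torus i (z : K) : z != 0 -> T (c i z).
have [phi [_ _ _ _ h]]: coroot G T (a i) (c i) by case: hG.
by move/h=> [].
Qed.
(** One simple coroot supplies the nilpotent element for [simple_exp] and the triple for
    [rad_trivial]. *)
Lemma root_datum_exists : exists Q r' (M : 'M[int]_(r', n)), root_dat G T Q M.
pose i := Ordinal l0.
have [e [f [phi [[ne Le e0] [nf Lf] hT' rule _]]]]:= coroot_triple i.
have hexp: zcl (gen (exp_fam G)) = G by apply: simple_exp=> //;exists e.
have [t Tt at1]: exists2 t, T t & a i t != 1.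
 by case: hG=> _ _ [hs _ _] _ _;have [[]]:= hs i.
have he: lb (lb e f) e = 2%:R *: e.
 have:= rule e 2;rewrite -pmulrn;apply=> z z0.
 have [-> _]:= hT' _ (coroot_torus i z0);congr (_ *: _).
 by case: hG=> _ _ _ _ ->;rewrite // A2.
have [h1 h2]:= hT' t Tt.
have hrad := rad_trivial sG ne Le e0 Lf (TG Tt) h1 h2 at1 he.
have [Q uQ dQ]: exists2 Q : 'M[K]_n, Q \in unitmx & forall t, T t -> is_diag_mx (Q *m t *m invmx Q).
 by case: hT=> _ [].
have [r' [M [h3 h4]]]:= torus_span hT uQ dQ.
by exists Q, r', M;split.
Qed.
Variables (Q : 'M[K]_n) (M : 'M[int]_(r, n)).
Hypothesis rd : root_dat G T Q M.
Notation tt := (tt Q M).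
Notation wt := (wt Q M).
Notation wsp := (wsp G Q M).
Notation rt := (rt G Q M).
Notation hc := (hc Q M).
Notation pr := (pr Q M).
Notation psi := (psi G B Q M).
Let uQ := rd_unit rd.
Implicit Types (al be : 'rV[int]_r) (w : 'M[K]_n -> K).
(** The differential of a character, read off on the cocharacters in [M]. *)
Definition gweight w al := forall k (z : K), z != 0 -> w (qlam Q (row k M) z) = z ^ al 0 k.
(** Exponents are recovered from the value at 2, which is not a root of unity. *)
Lemma exp2_inj (p q : int) : (2%:R : K) ^ p = 2%:R ^ q -> p = q.
have n2: (2%:R : K) != 0 by rewrite pnatr_eq0.
have h1 (k : nat) : (2%:R : K) ^+ k = 1 -> k = 0%N.
 by rewrite -natrX=> /eqP;rewrite pnatr_eq1 -(expn0 2) eqn_exp2l // => /eqP.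
move=> e;sub0P.
have : (2%:R : K) ^ (p - q) = 1 by rewrite expfzDr // e -expfzDr // subrr.
case: (p - q)=> k;first by move/h1=> ->.
by rewrite NegzE -exprnN=> /(congr1 GRing.inv);rewrite invrK invr1=> /h1.
Qed.
Lemma gweight_inj w al be : gweight w al -> gweight w be -> al = be.
move=> h1 h2;apply/rowP=> k;apply: exp2_inj.
by rewrite -h1 ?h2 // pnatr_eq0.
Qed.
Lemma Ad_qdiag_entry (u : 'rV[K]_n) Y (i j : 'I_n) : (forall k, u 0 k != 0) ->
 (Q *m Ad (qdiag Q u) Y *m invmx Q) i j = u 0 i / u 0 j * (Q *m Y *m invmx Q) i j.
move=> u0;pose v : 'rV[K]_n := \row_k (u 0 k)^-1.
have uv: qdiag Q u *m qdiag Q v = 1%:M.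
 rewrite mul_qdiag // -(qdiag1 uQ);congr (qdiag _ _);apply/rowP=> k.
 by rewrite !mxE mulfV.
have iq: invmx (qdiag Q u) = qdiag Q v.
 have uu: qdiag Q u \in unitmx by case/mulmx1_unit: uv.
 by rewrite -[RHS](mulKmx uu) uv mulmx1.
have ->: Q *m Ad (qdiag Q u) Y *m invmx Q = diag_mx u *m (Q *m Y *m invmx Q) *m diag_mx v.
 by rewrite /Ad iq /qdiag !mulmxA mulmxV // mul1mx mulmxK.
rewrite mul_mx_diag mxE mul_diag_mx mxE [v 0 j]mxE mulrAC;congr (_ * _).
Qed.
Let qlam_entry (m : 'rV[int]_n) (z : K) Y (i j : 'I_n) : z != 0 ->
 (Q *m Ad (qlam Q m z) Y *m invmx Q) i j = z ^ (m 0 i - m 0 j) * (Q *m Y *m invmx Q) i j.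
move=> z0;rewrite Ad_qdiag_entry=> [|k];last by rewrite mxE expfz_neq0.
by rewrite ![(\row_k0 _) _ _]mxE expfzDr // -invr_expz.
Qed.
Lemma group_weight w Y : Y != 0 -> (forall t, T t -> Ad t Y = w t *: Y) ->
 exists2 al, wt al Y & gweight w al.
move=> Y0 hY.
have [[i j] /= nz]: exists ij, (Q *m Y *m invmx Q) ij.1 ij.2 != 0.
 apply/existsP;apply: contraNT Y0=> /existsPn h0;apply/eqP.
 have : Q *m Y *m invmx Q = 0 by mxP=> i j;rewrite [RHS]mxE;apply/eqP/negPn/(h0 (i, j)).
 move/(congr1 (fun N=> invmx Q *m N *m Q));rewrite !mulmxA mulVmx // mul1mx mulmxKV //.
 by rewrite mulmx0 mul0mx.
have val k z (i' j' : 'I_n) : z != 0 -> (Q *m Y *m invmx Q) i' j' != 0 ->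
  w (qlam Q (row k M) z) = z ^ wij M i' j' 0 k.
 move=> z0 nz';have [_ /(_ z z0) Tq]:= rd_int rd k.
 have:= congr1 (fun N : 'M[K]_n=> (Q *m N *m invmx Q) i' j') (hY _ Tq).
 rewrite qlam_entry // -scalemxAr -scalemxAl mxZE=> /(mulIf nz') <-.
 by rewrite !mxE.
exists (wij M i j);last by move=> k z z0;exact: val.
apply/(wtP rd)=> i' j' nz';apply/rowP=> k;apply: exp2_inj.
by rewrite -!val ?pnatr_eq0.
Qed.
(** The ratio of two diagonal entries is a character with the given differential; by
    [torus_character] other pairs of entries of the same weight have the same ratio. *)
Lemma weight_character al : al \in wlist M -> exists2 w, gweight w al &
 forall Y, wt al Y -> forall t, T t -> Ad t Y = w t *: Y.
move=> /wlistP [i [j eal]].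
have cT: conn_group T by case: hT=> _ [].
have dT t: T t -> t = qdiag Q (tdiag Q t) by exact: (torus_qdiag uQ (rd_diag rd)).
have tnz t k: T t -> tdiag Q t 0 k != 0.
 move=> Tt;have:= mxgrpU mT Tt;rewrite {1}(dT t Tt) /qdiag !unitmx_mul uQ unitmx_inv uQ /= andbT.
 by rewrite unitmxE det_diag unitfE=> /prodf_neq0;apply.
exists (fun t=> tdiag Q t 0 i / tdiag Q t 0 j).
 move=> k z z0;rewrite qdiagK // ![(\row_k0 _) _ _]mxE eal !mxE expfzDr // -invr_expz.
 by [].
move=> Y /(wtP rd) hY t Tt.
have inj Y1 Y2: (forall p q, (Q *m Y1 *m invmx Q) p q = (Q *m Y2 *m invmx Q) p q) -> Y1 = Y2.
 move=> h;have : Q *m Y1 *m invmx Q = Q *m Y2 *m invmx Q by apply/matrixP.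
 by move/(congr1 (fun N=> invmx Q *m N *m Q));rewrite !mulmxA mulVmx // !mul1mx !mulmxKV.
apply: inj=> p q;rewrite {1}(dT t Tt) Ad_qdiag_entry=> [|k];last exact: tnz.
rewrite -scalemxAr -scalemxAl mxZE.
have [->|nz]:= eqVneq ((Q *m Y *m invmx Q) p q) 0;first by rewrite !mulr0.
congr (_ * _);have epq := hY p q nz.
have:= torus_character (rd_exp rd) cT TG uQ (rd_diag rd) (s := [:: p;j]) (s' := [:: i;q]) _ Tt.
rewrite !big_cons !big_nil !mulr1=> h;apply/eqP;rewrite eqr_div ?tnz //;apply/eqP.
apply: h=> X /(rd_span rd) [c0 ->];rewrite !big_cons !big_nil !addr0 !qdiagK //.
have e1 := ev_wij M p q c0;have e2 := ev_wij M i j c0;rewrite epq eal e2 in e1.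
by move/eqP: e1;rewrite subr_eq addrAC eq_sym subr_eq=> /eqP.
Qed.
(** The differential of the SL_2 of a simple root gives a triple whose [e, f] must be the coroot
    defined by the trace form. Hence exponents under the coroot of the group are the pairings
    [pr]. *)
Lemma simple_weight_exists i : exists al (phi : 'M[K]_2 -> 'M[K]_n) e f,
 [/\ gweight (a i) al, psi al, wsp al e /\ wsp (- al) f,
   e != 0 /\ lb e f = tt (hc al)
  & [/\ forall b, nzw G Q M b -> forall Y, wsp b Y -> forall k : int,
     (forall z : K, z != 0 -> Ad (c i z) Y = z ^ k *: Y) -> Y != 0 -> pr b al = k,
    alg_hom (@SL2 K) G phi, forall z, z != 0 -> c i z = phi (diag2 z),
    forall x, phi (upper2 x) = mexp (x *: e)
   & forall x, phi (lower2 x) = mexp (x *: f)]].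
have [e [f [phi [[ne Le e0] [nf Lf] hef rule [h1 h1' h2 h3]]]]]:= coroot_triple i.
have he: lb (lb e f) e = 2%:R *: e.
 have:= rule e 2;rewrite -pmulrn;apply=> z z0.
 have [-> _]:= hef _ (coroot_torus i z0);congr (_ *: _).
 by case: hG=> _ _ _ _ ->;rewrite // A2.
have e20: 2%:R *: e != 0 by rewrite scaler_eq0 pnatr_eq0.
have f0: f != 0 by apply: contraNneq e20=> f0;rewrite -he f0 lb0r lb0l.
have [al wal gal]:= group_weight e0 (fun t Tt=> (hef t Tt).1).
have [be wbe gbe]:= group_weight (w := fun t=> (a i t)^-1) f0 (fun t Tt=> (hef t Tt).2).
have eba: be = - al.
 apply: (gweight_inj gbe)=> k z z0.
 by rewrite gal // invr_expz mxE.
rewrite {}eba {gbe} in wbe.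
have we: wsp al e by []. have wf: wsp (- al) f by [].
have [h eh]: exists h, lb e f = tt h.
 by apply: (wsp_torus rd);have:= wsp_lb rd we wf;rewrite subrr.
have al0: al != 0.
 apply: contraNneq e20=> al0;rewrite -he eh;have [_ ->]:= we.
 by rewrite al0 ev0l scale0r.
have ra: rt al by split=> //;exists e.
have hcE: lb e f = tt (hc al).
 have [f' [wf' ef' h2e _ tr0]]:= rt_triple rd ra we e0.
 have f'0: f' != 0 by apply: contraNneq tr0=> ->;rewrite mulmx0 mxtrace0.
 have [k ek]:= rt_line rd (rtN rd ra) wf' f'0 wf.
 have e2: lb e f = k *: tt (hc al) by rewrite ek lbZr ef'.
 have : k *: (2%:R *: e) = 2%:R *: e by rewrite -{1}h2e -lbZl -e2.
 move/eqP;rewrite -{2}[2%:R *: e]scale1r -subr_eq0 -scalerBl scaler_eq0 (negPf e20) orbF subr_eq0=> /eqP k1.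
 by rewrite e2 k1 scale1r.
exists al, phi, e, f;split=> //.
- have [[_ [Y [Y0 LY hY]]] _]: simple_root B T (a i) by case: hG=> _ _ [hs _ _] _ _;exact: hs.
 have [al' wal' gal']:= group_weight Y0 hY.
 have BG: B `<=` G by case: hB.
 split=> //;exists Y;split=> //;rewrite (gweight_inj gal gal');split=> //.
 exact: (Lie_sub BG).
- split=> // b nb Y wY k hY Y0;have:= rule Y k hY.
 have [_ wtY]:= wY;rewrite hcE wtY (prP rd ra nb)=> /eqP.
 by rewrite -subr_eq0 -scalerBl scaler_eq0 (negPf Y0) orbF subr_eq0=> /eqP /intr_inj.
Qed.
(** By [coroot_norm] both pairings are positive rational multiples of the trace of the product of
    the two coroots. *)
Lemma pr_sign al be : rt al -> rt be -> (0 < pr al be) = (0 < pr be al).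
move=> ra rb;have [p [p0 hp]]:= coroot_norm rd ra;have [q [q0 hq]]:= coroot_norm rd rb.
have e: p%:R * ev al (hc be) = q%:R * ev be (hc al) by rewrite -hp -hq mxtrace_mulC.
rewrite (prP rd rb ra.2) (prP rd ra rb.2) !pmulrn -!intrM in e.
have {}e : p%:Z * pr al be = q%:Z * pr be al by exact: (@intr_inj K).
have p0': 0 < p%:Z by []. have q0': 0 < q%:Z by [].
by apply/idP/idP=> h;[rewrite -(pmulr_rgt0 _ q0') -e|rewrite -(pmulr_rgt0 _ p0') e];rewrite pmulr_rgt0.
Qed.
Lemma group_root_psi w al Y : Defs.root B T w -> root_vector B T w Y -> wt al Y -> psi al.
move=> [[t Tt wt1] _] [Y0 LY hY] wY;have BG: B `<=` G by case: hB.
have sY: wsp al Y by split=> //;exact: (Lie_sub BG).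
split;last by exists Y.
split;last by exists Y.
apply: contraNneq wt1=> al0;rewrite al0 in sY.
have [h eh]:= wsp_torus rd sY.
have : Ad t Y = Y.
 have ut := mxgrpU mT Tt.
 have cm: t *m Y = Y *m t.
  rewrite eh -[tt h]/(qdiag Q _) (torus_qdiag uQ (rd_diag rd) Tt) !mul_qdiag //;congr (qdiag _ _).
  by apply/rowP=> k;rewrite !mxE mulrC.
 by rewrite /Ad cm mulmxK.
rewrite /Ad hY // => /eqP;rewrite -{2}[Y]scale1r -subr_eq0 -scalerBl scaler_eq0 (negPf Y0) orbF subr_eq0.
by [].
Qed.
Lemma psi_simple_or_sum be : psi be ->
 (exists i, gweight (a i) be) \/ (exists b1 b2, [/\ psi b1, psi b2 & be = b1 + b2]).
move=> pb;have [[b0 _] [Y [wY LY Y0]]]:= pb.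
have [w gw hw]:= weight_character (wt_wlist rd wY.2 Y0).
have TM k (z : K) : z != 0 -> T (qlam Q (row k M) z) by have [_]:= rd_int rd k;exact.
have rw: Defs.root B T w.
 split;last by exists Y;split=> //;exact: hw wY.2.
 have [k bk]: exists k, be 0 k != 0.
  apply/existsP;apply: contraNT b0=> /existsPn h;apply/eqP/rowP=> k.
  by rewrite mxE;apply/eqP/negPn/h.
 exists (qlam Q (row k M) 2%:R);first by apply: TM;rewrite pnatr_eq0.
 rewrite gw ?pnatr_eq0 //;apply: contraNneq bk=> e;apply/eqP.
 by apply: exp2_inj;rewrite e expr0z.
have [s|ns]:= pselect (simple_root B T w).
 left;have [i hi]: exists i, forall t, T t -> w t = a i t by case: hG=> _ _ [_ _ h] _ _;exact: h.
 by exists i=> k z z0;rewrite -hi ?gw //;exact: TM.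
right;have [w1 [w2 [r1 r2 e12]]]: exists b1 b2, [/\ Defs.root B T b1, Defs.root B T b2
  & forall t, T t -> w t = b1 t * b2 t].
 by apply: contrapT=> h;apply: ns;split.
have get u: Defs.root B T u -> exists2 b, psi b & gweight u b.
 move=> ru;have [_ [Z vZ]]:= ru;have [Z0 _ hZ]:= vZ.
 by have [b wb gb]:= group_weight Z0 hZ;exists b=> //;exact: group_root_psi vZ wb.
have [b1 p1 g1]:= get _ r1;have [b2 p2 g2]:= get _ r2.
exists b1, b2;split=> //;apply: (gweight_inj gw)=> k z z0.
by rewrite e12 ?g1 ?g2 // ?mxE ?expfzDr //;exact: TM.
Qed.
Definition comb (al : 'I_l -> 'rV[int]_r) (k : 'rV[int]_l) : 'rV[int]_r := \sum_i k 0 i *: al i.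
(** Induction on the degree of [borel_grading], which is positive and additive on positive roots. *)
Lemma psi_comb (al : 'I_l -> 'rV[int]_r) be : (forall i, gweight (a i) (al i)) -> psi be ->
 exists2 k, be = comb al k & forall i, 0 <= k 0 i.
move=> hal;have [x [d [h1 h2 h3]]]:= borel_grading rd hB TB.
have wl b: psi b -> b \in wlist M by case=> [[_ [Y [_ wY] Y0]]] _;exact: (wt_wlist rd wY Y0).
have dp b: psi b -> 0 < d b by move=> pb;apply/h3=> //;case: pb.
have dD b1 b2: psi b1 -> psi b2 -> psi (b1 + b2) -> d (b1 + b2) = d b1 + d b2.
 move=> p1 p2 p3;apply: (@intr_inj K);rewrite rmorphD /= -!h1 ?wl //.
 exact: evDl.
have [m]:= ubnP (absz (d be));elim: m be=> // m IH be lm pb.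
have [[i gi]|[b1 [b2 [p1 p2 eb]]]]:= psi_simple_or_sum pb.
 exists (delta_mx 0 i)=> [|j];last by rewrite mxE;case: (_ && _).
 rewrite /comb (bigD1 i) //= big1=> [|j ji];first by rewrite mxE !eqxx scale1r addr0;exact: (gweight_inj gi).
 by rewrite mxE eqxx (negPf ji) scale0r.
have p3: psi (b1 + b2) by rewrite -eb.
move: lm;rewrite eb (dD _ _ p1 p2 p3)=> lm.
have:= dp _ p1;have:= dp _ p2=> q2 q1.
have [k1 -> n1]:= IH b1 ltac:(lia) p1;have [k2 -> n2]:= IH b2 ltac:(lia) p2.
exists (k1 + k2)=> [|i];last by rewrite mxE addr_ge0.
by rewrite /comb -big_split;eqb=> i _;rewrite mxE scalerDl.
Qed.
End GroupRoots.

(** * Positive roots as integer vectors *)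

Section PositiveList.
Variables (l : nat) (C : seq (seq int)).
Implicit Types (s : seq int) (i j : nat).
Definition pairing s i : int := foldr +%R 0 [seq s`_j * (nth [::] C j)`_i | j <- iota 0 l].
Definition srefl i s : seq int := set_nth 0 s i (s`_i - pairing s i).
Definition unitv i : seq int := [seq (j == i)%:Z | j <- iota 0 l].
Definition sht s : int := foldr +%R 0 s.
Definition raise_all (R : seq (seq int)) :=
 undup (R ++ flatten [seq [seq srefl i s | i <- iota 0 l & pairing s i < 0] | s <- R]).
(** The highest roots of E6 and F4 both have height 11, so 12 rounds are ample; that the result is
    complete is certified by [positives_ok]. *)
Definition positives := iter 12 raise_all [seq unitv i | i <- iota 0 l].
(** A computable certificate: every vector that is not simple can be lowered inside the list by a
    simple reflection, and every reflection that raises a vector stays in the list. *)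
Definition positives_ok (R : seq (seq int)) :=
 [&& all (fun s=> [&& size s == l, all (fun x : int=> 0 <= x) s &
    has (fun i=> (s == unitv i) || [&& 0 < pairing s i, srefl i s \in R & srefl i s != unitv i]) (iota 0 l)]) R,
   all (fun s=> all (fun i=> (0 <= pairing s i) || (srefl i s \in R)) (iota 0 l)) R,
   all (fun i=> unitv i \in R) (iota 0 l) &
   all (fun i=> (nth [::] C i)`_i == 2) (iota 0 l)].
Lemma pairingE s i : pairing s i = \sum_(j < l) s`_j * (nth [::] C j)`_i.
rewrite /pairing -(big_mkord xpredT (fun j=> s`_j * (nth [::] C j)`_i)) /index_iota subn0.
by elim: (iota 0 l)=> [|j t IH] /=;rewrite ?big_nil ?big_cons // IH.
Qed.
Lemma size_sreflect i s : (i < l)%N -> size s = l -> size (srefl i s) = l.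
by move=> il sl;rewrite size_set_nth sl;apply/maxn_idPr. Qed.
Lemma nth_sreflect i s j : (srefl i s)`_j = s`_j - (j == i)%:Z * pairing s i.
by rewrite nth_set_nth /=;case: eqVneq=> [->|_];rewrite ?mul1r // mul0r subr0. Qed.
Lemma nth_unitv i j : (i < l)%N -> (unitv i)`_j = (j == i)%:Z.
move=> il;have [jl|lj]:= ltnP j l;first by rewrite (nth_map 0%N) ?size_iota // nth_iota.
by rewrite nth_default ?size_map ?size_iota //;case: eqVneq=> // e;move: lj;rewrite e leqNgt il.
Qed.
Lemma pairing_sreflect i s : (i < l)%N -> (nth [::] C i)`_i = 2 ->
 pairing (srefl i s) i = - pairing s i.
move=> il h2;rewrite [LHS]pairingE.
under eq_bigr=> j _ do rewrite nth_sreflect mulrBl.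
rewrite big_split sumrN /= -pairingE (bigD1 (Ordinal il)) //= big1=> [|j ji].
 by rewrite eqxx h2;lia.
by rewrite -(inj_eq val_inj) /= in ji;rewrite (negPf ji) !mul0r.
Qed.
Lemma sreflectK i s : (i < l)%N -> (nth [::] C i)`_i = 2 -> size s = l ->
 srefl i (srefl i s) = s.
move=> il h2 sl;apply: (@eq_from_nth _ 0)=> [|j _];first by rewrite !size_sreflect.
by rewrite !nth_sreflect pairing_sreflect //;lia.
Qed.
Lemma sheightE s : size s = l -> sht s = \sum_(j < l) s`_j.
move=> <-;rewrite -(big_mkord xpredT (fun j=> s`_j)) -(big_nth 0 xpredT id) /sht.
by elim: s=> [|x s IH] /=;rewrite ?big_nil ?big_cons ?IH.
Qed.
Lemma sheight_sreflect i s : (i < l)%N -> size s = l ->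
 sht (srefl i s) = sht s - pairing s i.
move=> il sl;rewrite !sheightE ?size_sreflect //.
under eq_bigr=> j _ do rewrite nth_sreflect.
rewrite big_split sumrN /=;congr (_ - _);rewrite (bigD1 (Ordinal il)) //= eqxx mul1r big1 ?addr0 // => j ji.
by rewrite -(inj_eq val_inj) /= in ji;rewrite (negPf ji) mul0r.
Qed.
Variables (Phi : seq int -> Prop) (R : seq (seq int)).
Hypotheses (ok : positives_ok R)
 (Phi_size : forall s, Phi s -> size s = l /\ forall i, 0 <= s`_i)
 (Phi_unit : forall i, (i < l)%N -> Phi (unitv i))
 (Phi_refl : forall s i, (i < l)%N -> Phi s -> s <> unitv i -> Phi (srefl i s))
 (Phi_pos : forall s, Phi s -> exists2 i, (i < l)%N & 0 < pairing s i).
(** Induction on the height in both directions: a positive pairing lets a vector be reflected to a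
    lower one, and the way back is provided by the certificate or by the closure of [Phi] under
    reflections. *)
Lemma positivesP s : Phi s <-> s \in R.
have /and4P [/allP ok1 /allP ok2 /allP ok3 /allP ok4]:= ok.
have c2 i: (i < l)%N -> (nth [::] C i)`_i = 2 by move=> il;apply/eqP/ok4;rewrite mem_iota.
have hpos t: size t = l -> (forall i, 0 <= t`_i) -> 0 <= sht t.
 by move=> st h;rewrite sheightE //;apply: sumr_ge0.
split.
 have [m]:= ubnP (absz (sht s));elim: m s=> // m IH s sm Ps.
 have [i il pi]:= Phi_pos Ps;have [ss s0]:= Phi_size Ps.
 have [->|ne]:= eqVneq s (unitv i);first by apply: ok3;rewrite mem_iota.
 have Pr := Phi_refl il Ps ltac:(by apply/eqP).
 have [sr r0]:= Phi_size Pr;have h0 := hpos _ ss s0;have h1 := hpos _ sr r0.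
 have hr := sheight_sreflect il ss.
 have inR: srefl i s \in R by apply: IH=> //;move: hr h0 h1 pi sm;clear;lia.
 have /allP/(_ i) := ok2 _ inR;rewrite mem_iota il sreflectK ?c2 // => /(_ isT) /orP [|//].
 by rewrite pairing_sreflect ?c2 //;move: pi;clear;lia.
have [m]:= ubnP (absz (sht s));elim: m s=> // m IH s sm sR.
have /and3P [/eqP ss /allP s0 hh]:= ok1 _ sR.
case: (elimT (@seq.hasP _ _ _) hh)=> i;rewrite mem_iota /= => il.
have nn t: t \in R -> 0 <= sht t.
 move=> /ok1 /and3P [/eqP st /allP t0 _];apply: hpos=> // j.
 have [jt|tj]:= ltnP j (size t);last by rewrite nth_default.
 by apply: t0;exact: mem_nth.
case/orP=> [/eqP ->|/and3P [pi rR ne]];first exact: Phi_unit.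
rewrite -(sreflectK il (c2 _ il) ss);apply: Phi_refl=> //;last by apply/eqP.
apply: IH=> //;have h0 := nn _ sR;have h1 := nn _ rR;have hr := sheight_sreflect il ss.
by move: hr h0 h1 pi sm;clear;lia.
Qed.
End PositiveList.
Definition tableE6 : seq (seq int) :=
 [:: [:: 2;0;-1;0;0;0];[:: 0;2;0;-1;0;0];[:: -1;0;2;-1;0;0];
   [:: 0;-1;-1;2;-1;0];[:: 0;0;0;-1;2;-1];[:: 0;0;0;0;-1;2]].
Definition tableF4 : seq (seq int) :=
 [:: [:: 2;-1;0;0];[:: -1;2;-2;0];[:: 0;-1;2;-1];[:: 0;0;-1;2]].
Definition posE6 := Eval vm_compute in positives 6 tableE6.
Definition posF4 := Eval vm_compute in positives 4 tableF4.
Lemma posE6_ok : positives_ok 6 tableE6 posE6. by vm_compute. Qed.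
Lemma posF4_ok : positives_ok 4 tableF4 posF4. by vm_compute. Qed.
Lemma tableE6P i j : cartanE6 i j = (nth [::] tableE6 i)`_j.
by rewrite mxE;case: i j=> [[|[|[|[|[|[|i]]]]]] hi] [[|[|[|[|[|[|j]]]]]] hj]. Qed.
Lemma tableF4P i j : cartanF4 i j = (nth [::] tableF4 i)`_j.
by rewrite mxE. Qed.

Section SimpleSystem.
Variables (K : acf) (n r l : nat) (A : 'M[int]_l) (C : seq (seq int)).
Variables (G B T : set 'M[K]_n) (a : 'I_l -> 'M[K]_n -> K) (c : 'I_l -> K -> 'M[K]_n).
Variables (Q : 'M[K]_n) (M : 'M[int]_(r, n)).
Hypotheses (hG : simple_group_of_type A G B T a c) (l0 : (0 < l)%N) (A2 : forall i, A i i = 2).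
Hypotheses (rd : root_dat G T Q M) (AC : forall i j, A i j = (nth [::] C i)`_j).
Notation tt := (tt Q M).
Notation wsp := (wsp G Q M).
Notation rt := (rt G Q M).
Notation hc := (hc Q M).
Notation pr := (pr Q M).
Notation psi := (psi G B Q M).
Record simple_system (al : 'I_l -> 'rV[int]_r) (phi : 'I_l -> 'M[K]_2 -> 'M[K]_n)
  (e f : 'I_l -> 'M[K]_n) : Prop := SimpleSystem {
 ss_weight : forall i, gweight Q M (a i) (al i);
 ss_psi : forall i, psi (al i);
 ss_e : forall i, wsp (al i) (e i);
 ss_f : forall i, wsp (- al i) (f i);
 ss_e0 : forall i, e i != 0;
 ss_ef : forall i, lb (e i) (f i) = tt (hc (al i));
 ss_pr : forall i j, pr (al j) (al i) = A j i;
 ss_hom : forall i, alg_hom (@SL2 K) G (phi i);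
 ss_diag : forall i z, z != 0 -> c i z = phi i (diag2 z);
 ss_up : forall i x, phi i (upper2 x) = mexp (x *: e i);
 ss_low : forall i x, phi i (lower2 x) = mexp (x *: f i) }.
Lemma simple_system_exists : exists al phi e f, simple_system al phi e f.
have /choice [al /choice [phi /choice [e /choice [f h]]]]:= simple_weight_exists hG A2 rd.
exists al, phi, e, f;split=> i;try by have [? ? [? ?] [? ?] [? ? ? ? ?]]:= h i.
move=> j;have [_ pi _ _ [rule _ _ _ _]]:= h i.
have [gj [rj _] [ej _] [ej0 _] _]:= h j.
have mG: mxgroup G by apply: simple_grp;case: hG.
apply: (rule _ rj.2 (e j))=> // z z0.
have Tc := coroot_torus hG i z0.
have [w gw hw]:= weight_character hG rd (wt_wlist rd ej.2 ej0).
rewrite (hw _ ej.2 _ Tc).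
have ->: w (c i z) = a j (c i z).
 have [[_ [Y vY]] _]: simple_root B T (a j) by case: hG=> _ _ [hs _ _] _ _;exact: hs.
 have [Y0 LY hY]:= vY;have [b wb gb]:= group_weight rd Y0 hY.
 rewrite (gweight_inj gb gj) in wb.
 have:= hw _ wb _ Tc;rewrite /Ad hY // => /eqP.
 by rewrite -subr_eq0 -scalerBl scaler_eq0 (negPf Y0) orbF subr_eq0=> /eqP.
by case: hG=> _ _ _ _ ->.
Qed.
Variables (al : 'I_l -> 'rV[int]_r) (phi : 'I_l -> 'M[K]_2 -> 'M[K]_n) (e f : 'I_l -> 'M[K]_n).
Hypothesis ss : simple_system al phi e f.
Variables R : seq (seq int).
Hypotheses (Rok : positives_ok l C R)
 (Ainj : forall k : 'I_l -> int, (forall i, \sum_j k j * A j i = 0) -> forall j, k j = 0).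
Let hB : borel_subgroup G B. by case: hG=> _ []. Qed.
Let TB : T `<=` B. by case: hG=> _ []. Qed.
Definition cmb (s : seq int) : 'rV[int]_r := \sum_(i < l) s`_i *: al i.
Lemma rt_al i : rt (al i). by case: (ss_psi ss i). Qed.
Lemma ev_sum_al (k : 'I_l -> int) (h : 'rV[K]_r) : ev (\sum_j k j *: al j) h = \sum_j (k j)%:~R * ev (al j) h.
elim/big_rec2: _=> [|j y x _ <-];first by rewrite ev0l.
rewrite evDl;congr (_ + _);rewrite /ev mulr_sumr;eqb=> i _.
by rewrite mxE intrM;ring.
Qed.
Lemma ev_sum_coroot (k : 'I_l -> int) i :
 ev (\sum_j k j *: al j) (hc (al i)) = (\sum_j k j * A j i)%:~R.
rewrite ev_sum_al rmorph_sum;eqb=> j _.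
by rewrite [RHS]rmorphM (prP rd (rt_al i) (rt_al j).2) (ss_pr ss).
Qed.
Lemma ev_cmb s i : ev (cmb s) (hc (al i)) = (pairing l C s i)%:~R.
by rewrite ev_sum_coroot pairingE;congr (_%:~R);eqb=> j _;rewrite AC. Qed.
Lemma pr_cmb s i : nzw G Q M (cmb s) -> pr (cmb s) (al i) = pairing l C s i.
by move=> ns;apply: (@intr_inj K);rewrite -(prP rd (rt_al i) ns) ev_cmb. Qed.
Lemma al_free (k : 'I_l -> int) : \sum_j k j *: al j = 0 -> forall j, k j = 0.
move=> e0;apply: Ainj=> i;apply: (@intr_inj K).
by rewrite -ev_sum_coroot e0 ev0l.
Qed.
Lemma cmb_inj s s' : size s = l -> size s' = l -> cmb s = cmb s' -> s = s'.
move=> sl sl' es;apply: (@eq_from_nth _ 0)=> [|i];first by rewrite sl.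
rewrite sl=> il;sub0P.
apply: (@al_free (fun j=> s`_j - s'`_j) _ (Ordinal il)).
under eq_bigr=> j _ do rewrite scalerBl.
by rewrite big_split sumrN /= -/(cmb s) -/(cmb s') es subrr.
Qed.
Lemma cmb_unitv (i : 'I_l) : cmb (unitv l i) = al i.
rewrite /cmb (bigD1 i) //= big1=> [|j ji];first by rewrite nth_unitv // eqxx addr0 scale1r.
by rewrite -(inj_eq val_inj) /= in ji;rewrite nth_unitv // (negPf ji) scale0r.
Qed.
Lemma cmb_sreflect s (i : 'I_l) : nzw G Q M (cmb s) -> cmb (srefl l C i s) = refl Q M (al i) (cmb s).
move=> ns;rewrite /refl (pr_cmb i ns) /cmb.
under eq_bigr=> j _ do rewrite nth_sreflect scalerBl.
rewrite big_split sumrN /=;congr (_ - _);rewrite (bigD1 i) //= eqxx mul1r big1 ?addr0 // => j ji.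
by rewrite -(inj_eq val_inj) /= in ji;rewrite (negPf ji) mul0r scale0r.
Qed.
Lemma psi_or_opp b : rt b -> psi b \/ psi (- b).
move=> rb;have [x [d [h1 h2 h3]]]:= borel_grading rd hB TB.
have wl b': rt b' -> b' \in wlist M by case=> _ [Y [_ wY] Y0];exact: (wt_wlist rd wY Y0).
have:= h2 _ (wl _ rb) rb.1;have rb' := rtN rd rb.
have dN: d (- b) = - d b.
 apply: (@intr_inj K);rewrite rmorphN /= -!h1;[exact: evNl|exact: wl|exact: wl].
have [h|h]:= ltP 0 (d b)=> d0;[by left;exact/h3|right;apply/h3=> //].
by rewrite dN;move: h d0;lia.
Qed.
Lemma psi_cmb be : psi be -> exists2 s, be = cmb s & size s = l /\ forall i, 0 <= s`_i.
move=> /(psi_comb hG l0 rd (ss_weight ss)) [k -> k0].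
exists (mkseq (fun i=> if insub i is Some j then k 0 j else 0) l).
 by eqb=> i _;rewrite nth_mkseq // valK.
split=> [|i];first by rewrite size_mkseq.
have [il|li]:= ltnP i l;last by rewrite nth_default ?size_mkseq.
by rewrite nth_mkseq //;case: insubP.
Qed.
Lemma positive_roots s : size s = l -> (psi (cmb s) <-> s \in R).
move=> sl;pose Phi s := size s = l /\ psi (cmb s).
suff h: Phi s <-> s \in R by split=> [p|/h []];[apply/h|].
have c2 i: (i < l)%N -> (nth [::] C i)`_i = 2.
 by move=> il;rewrite -(A2 (Ordinal il)) AC.
have nn t: Phi t -> forall i, 0 <= t`_i.
 by case=> st /psi_cmb [t' et [st' h]];rewrite (cmb_inj st st' et).
apply: (positivesP Rok)=> {s sl} [s ps|i il|s i il [sl ps] ne|s [sl ps]].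
- by split;[case: ps|exact: nn].
- split;first by rewrite size_map size_iota.
 by rewrite (cmb_unitv (Ordinal il));exact: (ss_psi ss).
- have sr := size_sreflect C il sl;split=> //;have rs := ps.1.
 have e1 := cmb_sreflect (Ordinal il) rs.2;rewrite /= in e1.
 have nr: nzw G Q M (cmb (srefl l C i s)) by rewrite e1;apply: (reflection rd) rs.2;exact: rt_al.
 have rr: rt (cmb (srefl l C i s)).
  split=> //;apply/eqP=> e0;move: (rs.1);rewrite -(sreflectK il (c2 _ il) sl).
  by rewrite (cmb_sreflect (Ordinal il) nr) e0 /refl (_ : pr 0 _ = 0) ?scale0r ?subrr ?eqxx //
       -e0 (pr_cmb (Ordinal il) nr) pairingE big1 // => j _;rewrite (al_free e0) mul0r.
 (* Were the reflection negative, all coefficients except the one at [i] would vanish, and the root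
    would be a multiple of the simple root, hence equal to it. *)
 have [//|/psi_cmb [t et [tl t0]]]:= psi_or_opp rr;exfalso.
 have s0 := nn s (conj sl ps).
 have z j: (j < l)%N -> j != i -> s`_j = 0.
  move=> jl ji;have:= @al_free (fun j=> t`_j + (srefl l C i s)`_j) _ (Ordinal jl).
  rewrite nth_sreflect (negPf ji) mul0r subr0=> h;have:= t0 j;have:= s0 j.
  suff : t`_j + s`_j = 0 by lia.
  apply: h.
  under eq_bigr=> k _ do rewrite scalerDl.
  by rewrite big_split /= -/(cmb t) -/(cmb (srefl l C i s)) -et addNr.
 have es: cmb s = al (Ordinal il) *+ absz s`_i.
  rewrite /cmb (bigD1 (Ordinal il)) //= big1=> [|j ji];last by rewrite z ?scale0r.
  by rewrite addr0 -scaler_nat natz gez0_abs.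
 have [m2|m1|m1]:= ltngtP 1 (absz s`_i);first by
  apply: (no_multiple_root rd (rt_al (Ordinal il)) m2);rewrite -es;exact: rs.2.
  by move: (rs.1);rewrite es (_ : absz _ = 0%N) ?mulr0n ?eqxx //;lia.
 apply: ne;apply: (cmb_inj sl);first by rewrite size_map size_iota.
 by rewrite es -m1 mulr1n (cmb_unitv (Ordinal il)).
have rs := ps.1.
(* The root pairs to 2 with its own coroot and is a nonnegative combination of simple roots, so some
   simple root pairs positively with it. *)
have e2: \sum_(j < l) s`_j * pr (al j) (cmb s) = 2.
 apply: (@intr_inj K);rewrite rmorph_sum /= -(pr_self rd rs) -(prP rd rs rs.2) ev_sum_al.
 by eqb=> j _;rewrite [LHS]rmorphM (prP rd rs (rt_al j).2).
have [i hi]: exists i : 'I_l, 0 < pr (al i) (cmb s).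
 apply/existsP;apply: contraT=> /existsPn h.
 suff : \sum_(j < l) s`_j * pr (al j) (cmb s) <= 0 by rewrite e2.
 by apply: sumr_le0=> j _;apply: mulr_ge0_le0;[exact: nn|rewrite leNgt h].
exists (i : nat);first exact: ltn_ord.
by rewrite -(pr_cmb i rs.2) -(pr_sign rd (rt_al i) rs).
Qed.
Lemma rt_positive b : rt b -> exists2 s, s \in R & b = cmb s \/ b = - cmb s.
move=> /psi_or_opp [] pb;have [s es [sl _]]:= psi_cmb pb;rewrite es in pb;exists s.
- exact/positive_roots.
- by left.
- exact/positive_roots.
- by right;rewrite -es opprK.
Qed.
End SimpleSystem.

(** * Parabolic subgroups as stabilizers of highest weight lines *)
(** A function regular on the whole projective line is constant. *)
Lemma poly_of_inverse (K : acf) (F H : {poly K}) : (forall x, x != 0 -> F.[x] = H.[x^-1]) ->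
 forall x, F.[x] = F.[0].
move=> h;pose N := size H;pose G0 := \sum_(i < N) H`_i *: 'X^(N - i).
have e: 'X^N * F = G0.
 apply/eqP;rewrite -subr_eq0;apply/eqP/(@poly_zero _ 'X);rewrite ?polyX_eq0 // => x;rewrite hornerX=> x0.
 rewrite hornerD hornerN;apply/eqP;rewrite subr_eq0;apply/eqP.
 rewrite hornerM hornerXn /G0 horner_sum.
 rewrite h // horner_coef mulr_sumr;eqb=> i _;rewrite hornerZ hornerXn exprVn.
 by rewrite mulrCA expfB // mulrC.
have sG: (size G0 <= N.+1)%N.
 apply: (leq_trans (size_sum _ _ _));apply/bigmax_leqP=> i _.
 by apply: (leq_trans (size_scale_leq _ _));rewrite size_polyXn ltnS leq_subr.
have s1: (size F <= 1)%N.
 have [->|F0]:= eqVneq F 0;first by rewrite size_poly0.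
 have:= congr1 (fun p : {poly K}=> size p) e;rewrite size_monicM ?monicXn // size_polyXn=> es.
 by move: sG;rewrite -es;lia.
by move=> x;rewrite (size1_polyC s1) !hornerC.
Qed.

Section LineStabilizer.
Variables (K : acf) (n m : nat) (G : set 'M[K]_n) (rho : 'M[K]_n -> 'M[K]_m) (v : 'cV[K]_m).
Hypotheses (aG : alg_group G) (dG : forall A, G A -> \det A = 1).
Hypotheses (hrho : alg_hom G (@GLset K m) rho) (v0 : v != 0).
Notation P := (line_stabilizer G rho v).
Let mG : mxgroup G. by case: aG. Qed.
Let rhoM A B : G A -> G B -> rho (A *m B) = rho A *m rho B.
by case: hrho=> _ _;apply. Qed.
Lemma rho_poly (w : 'cV[K]_m) : exists R : 'I_m -> {mpoly K[n * n]},
 forall A k, G A -> (rho A *m w) k 0 = mxeval (R k) A.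
case: hrho=> reg _ _.
have /choice [p hp]: forall ij : 'I_m * 'I_m, exists p : {mpoly K[n * n]},
  forall A, G A -> rho A ij.1 ij.2 = mxeval p A.
 move=> [i j];have [p [k h]]:= reg i j;exists p=> A GA.
 by rewrite h // dG // expr1n divr1.
exists (fun k=> \sum_j w j 0 *: p (k, j))=> A k GA.
rewrite mxE /mxeval raddf_sum;eqb=> j _.
by rewrite /= mevalZ mulrC (hp (k, j)).
Qed.
Lemma rho1 : rho 1%:M = 1%:M.
have G1 := mxgrp1 mG;have u: rho 1%:M \in unitmx by case: hrho=> _ h _;exact: h.
by rewrite -[LHS](mulKmx u) -rhoM // mulmx1 mulVmx.
Qed.
Lemma mxgroup_line : mxgroup P.
split.
- by move=> A [GA _];exact: mxgrpU GA.
- by split;[exact: mxgrp1|exists 1;rewrite rho1 mul1mx scale1r].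
- move=> A B [GA [a ea]] [GB [b eb]];split;first exact: mxgrpM.
 by exists (b * a);rewrite rhoM // -mulmxA eb -scalemxAr ea scalerA.
move=> A [GA [a ea]];have GV := mxgrpV mG GA;split=> //;exists a^-1.
have u := mxgrpU mG GA.
have e1: v = a *: (rho (invmx A) *m v).
 by rewrite scalemxAr -ea mulmxA -rhoM // mulVmx // rho1 mul1mx.
have a0: a != 0 by apply: contraNneq v0=> a0;rewrite e1 a0 scale0r.
by rewrite {2}e1 scalerA mulVf // scale1r.
Qed.
Lemma alg_line : alg_group P.
suff <-: zcl P = P by exact: (alg_group_zcl mxgroup_line).
apply/seteqP;split;last by apply: zcl_sub;case: mxgroup_line.
move=> A [uA hA].
have GA: G A by apply: (alg_group_eqs aG uA)=> p hp;apply: hA=> B [GB _];exact: hp.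
split=> //;have [R hR]:= rho_poly v.
have [l vl]: exists l, v l 0 != 0.
 apply/existsP;apply: contraNT v0=> /existsPn h;apply/eqP/colP=> k.
 by rewrite mxE;apply/eqP/negPn/h.
exists ((rho A *m v) l 0 / v l 0);apply/colP=> k;rewrite mxZE.
have : mxeval (R k * (v l 0)%:MP - R l * (v k 0)%:MP) A = 0.
 apply: hA=> B [GB [b eb]];rewrite /mxeval mevalB !mevalM !mevalC -!/(mxeval _ _) -!hR // eb !mxZE.
 by ring.
rewrite /mxeval mevalB !mevalM !mevalC -!/(mxeval _ _) -!hR // => /eqP;rewrite subr_eq0=> /eqP h.
by apply: (mulIf vl);rewrite h mulrAC divfK.
Qed.
Lemma additive_fix X : nilp X -> (forall x, P (mexp (x *: X))) -> forall x, rho (mexp (x *: X)) *m v = v.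
move=> nX hX;have [R hR]:= rho_poly v.
have [l vl]: exists l, v l 0 != 0.
 apply/existsP;apply: contraNT v0=> /existsPn h;apply/eqP/colP=> k.
 by rewrite mxE;apply/eqP/negPn/h.
pose c := (v l 0)^-1 *: pev polyC (pexp X) (R l).
have hc x: rho (mexp (x *: X)) *m v = c.[x] *: v.
 have [Gx [k ek]]:= hX x;rewrite ek;congr (_ *: _).
 by rewrite /c hornerZ pev_horner hpexp // -hR // ek mxZE mulrC mulfK.
have e: c * (c \Po (- 'X)) = 1.
 apply/eqP;rewrite -subr_eq0;apply/eqP/(poly_zero (oner_neq0 _))=> x _;rewrite hornerD hornerN;apply/eqP;rewrite subr_eq0;apply/eqP.
 rewrite hornerM horner_comp hornerN hornerX hornerC;apply: (mulIf vl).
 have : rho (mexp (x *: X)) *m (rho (mexp (- x *: X)) *m v) = v.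
  have [G1 _]:= hX x;have [G2 _]:= hX (- x).
  by rewrite mulmxA -rhoM // scaleNr mexpN ?rho1 ?mul1mx //;exact: nilpZ.
 rewrite !hc -scalemxAr hc scalerA=> /(congr1 (fun w : 'cV[K]_m=> w l 0));rewrite mxZE mul1r mulrC.
 by rewrite mulrC [c.[-x] * _]mulrC.
have uc: c \is a GRing.unit by apply/unitrPr;exists (c \Po (- 'X)).
have s1: (size c <= 1)%N by move: uc;rewrite poly_unitE=> /andP [/eqP ->].
move=> x;rewrite hc;have : c.[0] *: v = v by rewrite -hc scale0r mexp0 rho1 mul1mx.
by rewrite (size1_polyC s1) !hornerC.
Qed.
Variables (phi : 'M[K]_2 -> 'M[K]_n) (e f : 'M[K]_n).
Hypotheses (hphi : alg_hom (@SL2 K) G phi) (ne : nilp e) (nf : nilp f).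
Hypotheses (ue : forall x, phi (upper2 x) = mexp (x *: e)) (lf : forall x, phi (lower2 x) = mexp (x *: f)).
Hypothesis Pe : forall x, P (mexp (x *: e)).
Let phiM A B : SL2 A -> SL2 B -> phi (A *m B) = phi A *m phi B.
by case: hphi=> _ _;apply. Qed.
Let phiG A : SL2 A -> G (phi A). by case: hphi=> _ h _;exact: h. Qed.
Let w0 : 'M[K]_2 := m2 0 (- 1) 1 0.
Let Su x : SL2 (upper2 x : 'M[K]_2). by rewrite /SL2 /= upper2E det_m2;ring. Qed.
Let Sl x : SL2 (lower2 x : 'M[K]_2). by rewrite /SL2 /= lower2E det_m2;ring. Qed.
Let Sw : SL2 w0. by rewrite /SL2 /= det_m2;ring. Qed.
Let Sd x : x != 0 -> SL2 (diag2 x : 'M[K]_2).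
by move=> x0;rewrite /SL2 /= diag2E det_m2;field. Qed.
Let SM (A B : 'M[K]_2) : SL2 A -> SL2 B -> SL2 (A *m B).
by rewrite /SL2 /= det_mulmx=> -> ->;rewrite mulr1. Qed.
Let rp A B (w : 'cV[K]_m) : SL2 A -> SL2 B -> rho (phi (A *m B)) *m w = rho (phi A) *m (rho (phi B) *m w).
by move=> SA SB;rewrite phiM // rhoM ?mulmxA;[|exact: phiG|exact: phiG]. Qed.
Let fu x : rho (phi (upper2 x)) *m v = v. by rewrite ue;exact: additive_fix. Qed.
(** If the torus of the SL_2 fixes [v], the factorization of lower(y) as upper(1/y) w diag(y)
    upper(1/y) makes the orbit map of the lower unipotent group polynomial in 1/y as well as in
    y. *)
Lemma lower_in_stabilizer : (forall x, x != 0 -> rho (phi (diag2 x)) *m v = v) ->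
 forall x, P (phi (lower2 x)).
move=> hd x;split;first exact: phiG.
exists 1;rewrite scale1r.
have [R hR]:= rho_poly v;have [R' hR']:= rho_poly (rho (phi w0) *m v).
have key y: y != 0 -> rho (phi (lower2 y)) *m v = rho (phi (upper2 y^-1)) *m (rho (phi w0) *m v).
 move=> y0;have ->: lower2 y = upper2 y^-1 *m (w0 *m (diag2 y *m upper2 y^-1)).
  by rewrite lower2E upper2E diag2E !m2M;congr m2;field.
 have sd := Sd y0.
 by do 3![rewrite rp;[|by []|by do ?[apply: SM=> //]]];rewrite fu hd.
apply/colP=> k;pose F := pev polyC (pexp f) (R k);pose H := pev polyC (pexp e) (R' k).
have FE y: (rho (phi (lower2 y)) *m v) k 0 = F.[y].
 by rewrite hR ?pev_horner ?hpexp -?lf //;exact: phiG.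
rewrite FE (@poly_of_inverse _ F H)=> [|y y0].
 by rewrite -FE lf scale0r mexp0 rho1 mul1mx.
by rewrite -FE key // hR' ?pev_horner ?hpexp -?ue //;exact: phiG.
Qed.
(** Diagonal matrices of SL_2 are products of upper and lower unipotent ones, all of which fix
    [v]. *)
Lemma diag_fix_of_lower : (forall x, P (mexp (x *: f))) ->
 forall x, x != 0 -> rho (phi (diag2 x)) *m v = v.
move=> Pf x x0;have fl y: rho (phi (lower2 y)) *m v = v by rewrite lf;exact: additive_fix.
have ->: diag2 x = upper2 1 *m (lower2 (- 1) *m (upper2 1 *m (upper2 (- x^-1) *m (lower2 x *m upper2 (- x^-1))))).
 by rewrite !lower2E !upper2E diag2E !m2M;congr m2;field.
by do 5![rewrite rp;[|by []|by do ?[apply: SM=> //]]];rewrite !(fu, fl).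
Qed.
End LineStabilizer.

(** * Open double cosets *)

Section CommutingDerivations.
Variables (R : comNzRingType) (D1 D2 D3 : R -> R).
Hypotheses (a1 : {morph D1 : x y / x + y}) (a2 : {morph D2 : x y / x + y}) (a3 : {morph D3 : x y / x + y}).
Hypotheses (l1 : forall x y, D1 (x * y) = D1 x * y + x * D1 y) (l2 : forall x y, D2 (x * y) = D2 x * y + x * D2 y)
 (l3 : forall x y, D3 (x * y) = D3 x * y + x * D3 y).
Let C x := D1 (D2 x) = D2 (D1 x) + D3 x.
Lemma der_commD x y : C x -> C y -> C (x + y).
by rewrite /C=> hx hy;rewrite a2 !a1 hx hy a2 a3;ring. Qed.
Lemma der_commM x y : C x -> C y -> C (x * y).
by rewrite /C=> hx hy;rewrite l2 l1 a1 a2 !l1 !l2 hx hy l3;ring. Qed.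
End CommutingDerivations.

Section InvariantFields.
Variables (K : acf) (n : nat).
Implicit Types (p q : {mpoly K[n * n]}) (X Y Z A : 'M[K]_n) (N : 'M[{mpoly K[n * n]}]_n) (w : seq 'M[K]_n).
Lemma vfieldD N p q : vfd N (p + q) = vfd N p + vfd N q.
by rewrite /vfd -big_split;eqb=> k _;rewrite mderivD mulrDl. Qed.
Lemma vfieldM N p q : vfd N (p * q) = vfd N p * q + p * vfd N q.
rewrite /vfd mulr_suml mulr_sumr -big_split;eqb=> k _ /=.
by rewrite mderivM;ring.
Qed.
Lemma vfieldC N c : vfd N c%:MP = 0.
by rewrite /vfd big1 // => k _;rewrite mderivC mul0r. Qed.
Lemma vfield0 N : vfd N 0 = 0.
by rewrite /vfd big1 // => k _;rewrite raddf0 mul0r. Qed.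
Lemma vfieldX N i j : vfd N 'X_(mxi i j) = N i j.
rewrite /vfd (bigD1 (mxi i j)) //= big1 ?addr0=> [|k ki];last first.
 by rewrite mderivX mnm1E eq_sym (negPf ki) ?scale0r ?mulr0n mul0r.
rewrite mderivX mnm1E eqxx ?scale1r ?mulr1n mxvecE.
have ->: (U_(mxi i j) - U_(mxi i j) = 0 :> 'X_{1..n * n})%MM by apply/mnmP=> k;rewrite mnmBE subnn mnm0E.
by rewrite mpolyX0 mul1r.
Qed.
Lemma vfield_mulr N Y i j : vfd N ((gmx K n *m cmx _ Y) i j) = (N *m cmx _ Y) i j.
rewrite !mxE;elim/big_rec2: _=> [|k y x _ <-];first exact: vfield0.
by rewrite vfieldD vfieldM ![cmx _ Y _ _]mxE vfieldC mulr0 addr0 mxE vfieldX.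
Qed.
Lemma vfield_mull N Y i j : vfd N ((cmx _ Y *m gmx K n) i j) = (cmx _ Y *m N) i j.
rewrite !mxE;elim/big_rec2: _=> [|k y x _ <-];first exact: vfield0.
by rewrite vfieldD vfieldM ![cmx _ Y _ _]mxE vfieldC mul0r add0r [gmx K n _ _]mxE vfieldX.
Qed.
Definition ldir X p := vfd (gmx K n *m cmx _ X) p.
Definition rdir X p := vfd (cmx _ X *m gmx K n) p.
Lemma mxeval_ldir X p A : mxeval (ldir X p) A = dmx p A (A *m X).
by rewrite mxevvf mevM mev_g mev_c. Qed.
Lemma mxeval_rdir X p A : mxeval (rdir X p) A = dmx p A (X *m A).
by rewrite mxevvf mevM mev_g mev_c. Qed.
(** Derivations and their commutators need only be compared on the matrix entries. *)
Lemma ldir_comm X Y p : ldir X (ldir Y p) = ldir Y (ldir X p) + ldir (lb X Y) p.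
rewrite /ldir;elim/mxp_ind: p=> [c|i j|p q hp hq|p q hp hq].
- set z := c%:MP;have hz N: vfd N z = 0 by exact: vfieldC.
 by rewrite !hz !vfield0 addr0.
- rewrite !vfieldX !vfield_mulr /lb -!mulmxA -mxDE -mulmxDr;congr ((_ *m _) i j).
 by rewrite /cmx -!map_mxM -raddfD /= subrKC.
- by apply: (der_commD _ _ _ hp hq)=> u v;exact: vfieldD.
- by apply: (der_commM _ _ _ _ _ hp hq)=> u v;[exact: vfieldD|exact: vfieldD|exact: vfieldM|exact: vfieldM|exact: vfieldM].
Qed.
Lemma rdir_ldir X Y p : rdir X (ldir Y p) = ldir Y (rdir X p).
suff : rdir X (ldir Y p) = ldir Y (rdir X p) + vfd 0 p.
 have ->: vfd 0 p = 0 by rewrite /vfd big1 // => k _;rewrite linear0 mxE mulr0.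
 by rewrite addr0.
rewrite /ldir /rdir;elim/mxp_ind: p=> [c|i j|p q hp hq|p q hp hq].
- set z := c%:MP;have hz N: vfd N z = 0 by exact: vfieldC.
 by rewrite !hz !vfield0 addr0.
- by rewrite !vfieldX vfield_mulr vfield_mull mulmxA [X in _ + X]mxE addr0.
- by apply: (der_commD _ _ _ hp hq)=> u v;exact: vfieldD.
- by apply: (der_commM _ _ _ _ _ hp hq)=> u v;[exact: vfieldD|exact: vfieldD|exact: vfieldM|exact: vfieldM|exact: vfieldM].
Qed.
Lemma ldirD X p q : ldir X (p + q) = ldir X p + ldir X q. exact: vfieldD. Qed.
Opaque ldir rdir.
Definition word p w := foldr ldir p w.
Lemma wordD w p q : word (p + q) w = word p w + word q w.
by elim: w=> //= X w ->;rewrite ldirD. Qed.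
Lemma word_rcons w p X : word p (rcons w X) = word (ldir X p) w.
by rewrite /word foldr_rcons. Qed.
Lemma word_cat p u w : word p (u ++ w) = word (word p w) u.
by rewrite /word foldr_cat. Qed.
Lemma rdir_word X p w : rdir X (word p w) = word (rdir X p) w.
elim: w=> [|Y w IH];first by [].
transitivity (ldir Y (rdir X (word p w)));first exact: rdir_ldir.
exact: (congr1 (ldir Y) IH).
Qed.
Variables (G S1 S2 : set 'M[K]_n).
Hypotheses (mG : mxgroup G) (m1 : mxgroup S1) (m2 : mxgroup S2) (s1 : S1 `<=` G) (s2 : S2 `<=` G).
Hypothesis sum : forall X, Lie G X -> exists Y Z, [/\ Lie S1 Y, Lie S2 Z & X = Y + Z].
Hypothesis hexp : zcl (gen (exp_fam G)) = G.
Let I p := forall A C, S1 A -> S2 C -> mxeval p (A *m C) = 0.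
Let I_rdir X p : Lie S1 X -> I p -> I (rdir X p).
move=> LX hp A C SA SC;rewrite mxeval_rdir.
have:= dmx_right m1 (p := psub (gmx K n *m cmx _ C) p) (X := X) (A := A).
rewrite dmx_psubst mevM mev_g mev_c dev_mul dev_g dev_c mev_c mulmx0 addr0 mulmxA;apply=> // A' SA'.
by rewrite mxevps mevM mev_g mev_c;exact: hp.
Qed.
Let I_ldir X p : Lie S2 X -> I p -> I (ldir X p).
move=> LX hp A C SA SC;rewrite mxeval_ldir.
have:= dmx_left m2 (p := psub (cmx _ A *m gmx K n) p) (X := X) (A := C).
rewrite dmx_psubst mevM mev_g mev_c dev_mul dev_g dev_c mul0mx add0r mev_c mulmxA;apply=> // C' SC'.
by rewrite mxevps mevM mev_g mev_c;exact: hp.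
Qed.
Lemma word_vanish k p w : I p -> (forall X, X \in w -> Lie G X) -> size w = k ->
 mxeval (word p w) 1%:M = 0.
elim: k p w=> [|k IH] p w Ip hw;first by move=> /size0nil ->;rewrite /= -(mulmx1 1%:M);apply: Ip;exact: mxgrp1.
have move_right Z u v: Lie S2 Z -> (forall X, X \in u ++ v -> Lie G X) -> size (u ++ v) = k ->
  mxeval (word p (u ++ Z :: v)) 1%:M = 0.
 move=> LZ;elim: v u=> [|X v IHv] u huv suv.
  by rewrite cats1 word_rcons;rewrite cats0 in huv suv;apply: IH=> //;exact: I_ldir.
 have LX: Lie G X by apply: huv;rewrite mem_cat inE eqxx orbT.
 have ->: word p (u ++ [:: Z, X & v]) = word p (rcons u X ++ Z :: v) + word p (u ++ lb Z X :: v).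
  rewrite cat_rcons !word_cat -wordD;congr (word _ u);exact: ldir_comm.
 rewrite mxevalD IHv ?cat_rcons // add0r;apply: IH=> //.
  move=> Y;rewrite mem_cat inE=> /or3P [h|/eqP ->|h].
  - by apply: huv;rewrite mem_cat h.
  - by apply: Lie_lb=> //;exact: (Lie_sub s2).
  - by apply: huv;rewrite mem_cat inE h !orbT.
 by move: suv;rewrite !size_cat.
case: w hw=> // X w hw [sw];have LX: Lie G X by apply: hw;rewrite mem_head.
have hw' Y: Y \in w -> Lie G Y by move=> h;apply: hw;rewrite inE h orbT.
have [Y [Z [LY LZ ->]]]:= sum LX.
have h W: mxeval (word p (W :: w)) 1%:M = dmx (word p w) 1%:M W.
 by rewrite -[in RHS](mul1mx W);exact: mxeval_ldir.
have h': mxeval (rdir Y (word p w)) 1%:M = dmx (word p w) 1%:M Y.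
 by rewrite -[in RHS](mulmx1 Y);exact: mxeval_rdir.
have ->: mxeval (word p (Y + Z :: w)) 1%:M = mxeval (word p (Y :: w)) 1%:M + mxeval (word p (Z :: w)) 1%:M.
 transitivity (dmx (word p w) 1%:M (Y + Z));first exact: h.
 rewrite linearD;apply: f_equal2;symmetry;exact: h.
have eZ: mxeval (word p (Z :: w)) 1%:M = 0 by exact: (move_right Z [::] w LZ hw' sw).
refine (eq_trans (f_equal2 +%R (_ : _ = 0) eZ) (addr0 0)).
transitivity (mxeval (word (rdir Y p) w) 1%:M);last by apply: IH=> //;exact: I_rdir.
transitivity (mxeval (rdir Y (word p w)) 1%:M);last by rewrite rdir_word.
exact: (eq_trans (h Y) (esym h')).
Qed.
(** All left-invariant derivatives of [p] vanish at 1, and exponentials propagate this to the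
    generated group: along exp(tX) the derivatives are again of this kind. *)
Lemma product_dense p : I p -> forall A, G A -> mxeval p A = 0.
move=> Ip;suff h A: gen (exp_fam G) A -> forall w, (forall X, X \in w -> Lie G X) -> mxeval (word p w) A = 0.
 move=> A;rewrite -{1}hexp=> -[_];apply=> B gB;exact: (h B gB [::]).
elim=> [|{}A C B _ IH [X [LX nX ->]] [t _ <-]] w hw;first exact: word_vanish.
pose F q := pev polyC (map_mx polyC A *m pexp X) q.
have FE q s: (F q).[s] = mxeval q (A *m mexp (s *: X)).
 by rewrite pev_horner /hmx map_mxM /= -/(hmx s _) -/(hmx s _) hmxC hpexp.
rewrite -FE;suff ->: F (word p w) = 0 by rewrite horner0.
(* The derivative belongs to a longer word but is a smaller polynomial in [t], so the induction is
   on the size. *)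
have [N]:= ubnP (size (F (word p w)));elim: N w hw=> // N IHN w hw sN.
have dF: (F (word p w))^`() = F (word p (X :: w)).
 apply/eqP;rewrite -subr_eq0;apply/eqP/(poly_zero (oner_neq0 _))=> s _.
 rewrite hornerD hornerN FE pev_horner' /= mxeval_ldir dermxM dpexp //.
 have ->: dermx (map_mx polyC A) = 0 by mxP=> i j;rewrite !mxE derivC.
 rewrite mul0mx add0r /hmx !map_mxM /= -!/(hmx s _) !hmxC hpexp // mulmxA subrr //.
have hw' Y: Y \in X :: w -> Lie G Y by rewrite inE=> /predU1P [->|/hw].
have [//|F0]:= eqVneq (F (word p w)) 0.
have d0: (F (word p w))^`() = 0.
 by rewrite dF;apply: IHN=> //;rewrite -dF;exact: leq_trans (lt_size_deriv F0) sN.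
apply/polyP=> -[|i];rewrite coef0.
 by rewrite -horner_coef0 FE scale0r mexp0 mulmx1;exact: IH.
have:= congr1 (fun q : {poly K}=> q`_i) d0;rewrite coef_deriv coef0=> /eqP.
by rewrite mulrn_eq0=> /eqP.
Qed.
End InvariantFields.

Section OpenOrbit.
Variables (K : acf) (n : nat) (G S1 S2 : set 'M[K]_n) (x : 'M[K]_n).
Hypotheses (hexp : zcl (gen (exp_fam G)) = G) (iG : sirr G) (mG : mxgroup G).
Hypotheses (a1 : alg_group S1) (a2 : alg_group S2) (s1 : S1 `<=` G) (s2 : S2 `<=` G) (Gx : G x).
Hypothesis sum : forall X, Lie G X -> exists Y Z, [/\ Lie S1 Y, Lie S2 Z & X = Y + Ad x Z].
Notation N := (n * n + n * n)%N.
Implicit Types (p : {mpoly K[n * n]}).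
Let m1 : mxgroup S1. by case: a1. Qed.
Let m2 : mxgroup S2. by case: a2. Qed.
Let ux : x \in unitmx. exact: mxgrpU Gx. Qed.
Let mx1 (z : 'I_N -> K) : 'M[K]_n := \matrix_(i, j) z (lshift (n * n) (mxi i j)).
Let mx2 (z : 'I_N -> K) : 'M[K]_n := \matrix_(i, j) z (rshift (n * n) (mxi i j)).
Let var1 : 'M[{mpoly K[N]}]_n := \matrix_(i, j) 'X_(lshift (n * n) (mxi i j)).
Let var2 : 'M[{mpoly K[N]}]_n := \matrix_(i, j) 'X_(rshift (n * n) (mxi i j)).
Let g (k : 'I_(n * n)) : {mpoly K[N]} := mxvec (var1 *m map_mx (@mpolyC N K) x *m var2) 0 k.
Let gE z k : (g k).@[z] = mxvec (mx1 z *m x *m mx2 z) 0 k.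
case/mxvec_indexP: k=> i j;rewrite /g !mxvecE.
have ->: mx1 z *m x *m mx2 z = map_mx (meval z) (var1 *m map_mx (@mpolyC N K) x *m var2).
 rewrite !map_mxM;congr (_ *m _ *m _);mxP=> a b;rewrite !mxE /= ?mevalXU //.
 by rewrite mevalC.
by rewrite [RHS]mxE.
Qed.
Let pull (s : 'I_(n * n) -> 'I_N) p : {mpoly K[N]} := mmap (@mpolyC N K) (fun k=> 'X_(s k)) p.
Let pullE s p z : (pull s p).@[z] = p.@[fun k=> z (s k)].
rewrite /pull /mmap raddf_sum mevalE;eqb=> m _ /=.
rewrite mevalM mevalC;congr (_ * _);rewrite /mmap1 rmorph_prod;eqb=> k _ /=.
by rewrite rmorphXn /= mevalXU.
Qed.
(** Right translation by the inverse of [x] turns the double coset into the product of [S1] with a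
    conjugate of [S2]. *)
Lemma double_coset_dense p : (forall b q, S1 b -> S2 q -> mxeval p (b *m x *m q) = 0) ->
 forall A, G A -> mxeval p A = 0.
move=> hp A GA;pose S2' := [set x *m q *m invmx x | q in S2].
have Gi := mxgrpV mG Gx;have ui: invmx x \in unitmx by rewrite unitmx_inv.
have m2': mxgroup S2'.
 split.
 - by move=> _ [q Sq <-];rewrite /GLset /= !unitmx_mul ux ui (mxgrpU m2 Sq).
 - by exists 1%:M;[exact: mxgrp1|rewrite mulmx1 mulmxV].
 - move=> _ _ [q Sq <-] [q' Sq' <-];exists (q *m q');first exact: mxgrpM.
  by rewrite !mulmxA mulmxKV.
 - move=> _ [q Sq <-];exists (invmx q);first exact: mxgrpV.
  by rewrite !invmxM ?unitmx_mul ?ux ?ui ?(mxgrpU m2 Sq) // invmxK mulmxA.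
have ->: A = A *m invmx x *m x by rewrite mulmxKV.
rewrite -(mxev_r x p);apply: (product_dense mG m1 m2' _ _ hexp).
- by move=> _ [q Sq <-];do 2?[apply: mxgrpM=> //];exact: s2.
- move=> X /sum [Y [Z [LY LZ ->]]];exists Y, (Ad x Z);split=> //.
 by apply: (Lie_conj ux _ LZ)=> q Sq;exists q.
- by move=> b _ Sb [q Sq <-];rewrite mxev_r -!mulmxA mulVmx // mulmx1 mulmxA;exact: hp.
- by apply: mxgrpM.
Qed.
(** Pairs of matrices are stored as vectors of length 2n^2. [image_contains_open] returns a point of
    the closure of the set of pairs, which lies in [S1] and [S2] as these groups are closed. *)
Lemma double_coset_contains_open : exists2 p, exists2 A, G A & mxeval p A != 0 &
 forall A, G A -> mxeval p A != 0 -> exists b q, [/\ S1 b, S2 q & A = b *m x *m q].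
pose Z : set 'rV[K]_N := [set z | S1 (mx1 (z 0)) /\ S2 (mx2 (z 0))].
pose Y : set ('I_(n * n) -> K) := [set y | exists2 A, G A & y = fun k=> mxvec A 0 k].
pose mk b q : 'rV[K]_N := row_mx (mxvec b) (mxvec q).
have mk1 b q: mx1 (mk b q 0) = b by mxP=> i j;rewrite mxE row_mxEl mxvecE.
have mk2 b q: mx2 (mk b q 0) = q by mxP=> i j;rewrite mxE row_mxEr mxvecE.
have mkZ b q: S1 b -> S2 q -> Z (mk b q) by move=> Sb Sq;split;rewrite ?mk1 ?mk2.
have gz (z : 'I_N -> K) : (fun k=> (g k).@[z]) = (fun k=> mxvec (mx1 z *m x *m mx2 z) 0 k).
 by apply/funext=> k;exact: gE.
have GM b q: S1 b -> S2 q -> G (b *m x *m q).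
 by move=> /s1 Gb /s2 Gq;do 2?[apply: mxgrpM=> //].
have [||||p [y [A GA ->] py] hp]:= @image_contains_open K N (n * n) Z g Y.
- move=> p [_ [A GA ->] pA];apply: contrapT=> h;move/eqP: pA;apply.
 apply: (double_coset_dense (p := p)) GA=> b q Sb Sq;apply: contrapT=> /eqP nz;apply: h.
 by exists (mk b q);[exact: mkZ|rewrite gz mk1 mk2].
- move=> p q [_ [A GA ->] pA] [_ [C GC ->] qC];apply: contrapT=> h.
 have [|/(_ _ GA) /eqP|/(_ _ GC) /eqP]:= iG (p := p) (q := q);last 2 first.
 + by apply/negP.
 + by apply/negP.
 move=> D GD;suff : mxeval p D * mxeval q D == 0.
  by rewrite mulf_eq0=> /orP [/eqP|/eqP];[left|right].
 rewrite -mxevalM;apply: contrapT=> /negP nz;apply: h.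
 by exists (fun k=> mxvec D 0 k)=> //;exists D.
- by move=> z [h1 h2];rewrite gz;exists (mx1 (z 0) *m x *m mx2 (z 0))=> //;exact: GM.
- by exists (fun k=> mxvec (1%:M : 'M[K]_n) 0 k), 1%:M=> //;exact: mxgrp1.
exists p;first by exists A.
move=> C GC pC;have [|z hz gzC]:= hp (fun k=> mxvec C 0 k) _ pC;first by exists C.
exists (mx1 z), (mx2 z);split.
- apply: (closed_in_det1 hexp a1 s1)=> r hr.
 have:= hz (pull (lshift (n * n)) r);rewrite pullE.
 have e (w : 'I_N -> K) : (fun k=> w (lshift (n * n) k)) = (fun k=> mxvec (mx1 w) 0 k).
  by apply/funext=> k;case/mxvec_indexP: k=> i j;rewrite mxvecE mxE.
 rewrite e;apply=> z0 [h1 _];rewrite pullE e;exact: hr.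
- apply: (closed_in_det1 hexp a2 s2)=> r hr.
 have:= hz (pull (@rshift (n * n) (n * n)) r);rewrite pullE.
 have e (w : 'I_N -> K) : (fun k=> w (rshift (n * n) k)) = (fun k=> mxvec (mx2 w) 0 k).
  by apply/funext=> k;case/mxvec_indexP: k=> i j;rewrite mxvecE mxE.
 rewrite e;apply=> z0 [_ h2];rewrite pullE e;exact: hr.
- have : mxvec C = mxvec (mx1 z *m x *m mx2 z) by apply/rowP=> k;rewrite -gE gzC.
 by move/(congr1 vec_mx);rewrite !mxvecK.
Qed.
Lemma lcoset_eqP A C : G A -> G C -> (lcoset A S2 = lcoset C S2 <-> exists2 q, S2 q & A = C *m q).
move=> GA GC;split.
 move=> e;have : lcoset C S2 A by rewrite -e;exists 1%:M;[exact: mxgrp1|rewrite mulmx1].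
 by case=> q Sq <-;exists q.
move=> [q Sq ->];have uq := mxgrpU m2 Sq;apply/seteqP;split=> _ [r Sr <-].
 by exists (q *m r);[exact: mxgrpM|rewrite mulmxA].
exists (invmx q *m r);first by apply: mxgrpM=> //;exact: mxgrpV.
by rewrite mulmxA mulmxK.
Qed.
(** A double coset is homogeneous under multiplication on both sides, so one open piece can be
    translated everywhere. *)
Lemma open_orbit : coset_space_open G S2 (left_orbit S1 (lcoset x S2)).
have lM b: lcoset b (lcoset x S2) = lcoset (b *m x) S2.
 apply/seteqP;split=> [_ [_ [q Sq <-] <-]|_ [q Sq <-]];first by exists q;rewrite ?mulmxA.
 by exists (x *m q);[exists q|rewrite mulmxA].
split;first by move=> _ [b Sb <-];exists (b *m x);[apply: mxgrpM=> //;exact: s1|rewrite lM].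
have memP A: G A -> left_orbit S1 (lcoset x S2) (lcoset A S2) <-> exists b q, [/\ S1 b, S2 q & A = b *m x *m q].
 move=> GA;split.
  move=> [b Sb];rewrite lM=> /esym /lcoset_eqP [//||q Sq e].
   by apply: mxgrpM=> //;exact: s1.
  by exists b, q.
 move=> [b [q [Sb Sq e]]];exists b=> //;rewrite lM;apply/esym/lcoset_eqP=> //.
  by apply: mxgrpM=> //;exact: s1.
 by exists q.
have [p [A0 GA0 pA0] hp]:= double_coset_contains_open.
(* The equations are all those of the complement of the orbit; for a point [A] of the orbit some
   translate of [p] is among them and does not vanish at [A]. *)
exists [set r | forall A, G A -> ~ left_orbit S1 (lcoset x S2) (lcoset A S2) -> mxeval r A = 0].
apply/seteqP;split=> A.
 move=> [GA oA];split=> // h.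
 have [b [q [Sb Sq eA]]]:= (memP _ GA).1 oA.
 have [b0 [q0 [Sb0 Sq0 eA0]]]:= hp _ GA0 pA0.
 pose c := b0 *m invmx b;pose d := invmx q *m q0.
 have Sc: S1 c by apply: mxgrpM=> //;exact: mxgrpV.
 have Sd: S2 d by apply: mxgrpM=> //;exact: mxgrpV.
 have ub := mxgrpU m1 Sb;have uq := mxgrpU m2 Sq.
 have:= h (ltr c (rtr d p));rewrite mxev_l mxev_r.
 have ->: c *m A *m d = A0 by rewrite eA eA0 /c /d !mulmxA mulmxKV // mulmxK.
 move=> e;case/eqP: pA0;apply: e=> C GC nC;rewrite mxev_l mxev_r.
 apply: contrapT=> /eqP nz;apply: nC;apply/(memP _ GC).
 have GcCd: G (c *m C *m d) by apply: (mxgrpM mG);[apply: (mxgrpM mG)=> //;exact: s1|exact: s2].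
 have [b1 [q1 [Sb1 Sq1 e1]]]:= hp _ GcCd nz.
 have uc := mxgrpU m1 Sc;have ud := mxgrpU m2 Sd.
 exists (invmx c *m b1), (q1 *m invmx d);split.
 - by apply: mxgrpM=> //;exact: mxgrpV.
 - by apply: mxgrpM=> //;exact: mxgrpV.
 transitivity (invmx c *m (b1 *m x *m q1) *m invmx d);last by rewrite !mulmxA.
 by clearbody c d;rewrite -e1 !mulmxA mulVmx // mul1mx mulmxK.
move=> [GA h];split=> //;apply: contrapT=> nA;apply: h=> r hr;exact: hr.
Qed.
End OpenOrbit.

(** * Sums of root vectors with prescribed support *)
Definition addv (s t : seq int) : seq int := [seq x.1 + x.2 | x <- zip s t].
(** The support of a bracket, with multiplicities: terms at a repeated root may cancel, which is why
    [supports_step] keeps only lists without repetition. *)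
Definition sums (R L1 L2 : seq (seq int)) :=
 flatten [seq [seq addv b c | c <- L2 & addv b c \in R] | b <- L1].
(** For y = v + v' the double bracket [y, [z, y]] contains [v, [z, v']] and [v', [z, v]], of the
    same root. As [v, v'] = 0, these are equal and add up instead of cancelling; the other
    conditions exclude further terms. *)
Definition double (R : seq (seq int)) (L1 L2 : seq (seq int)) : seq (seq (seq int)) :=
 if (L1, L2) is ([:: b;b'], [:: c]) then
  if [&& addv b b' \notin R, addv c b \in R, addv c b' \in R, addv b (addv c b) \notin R,
           addv b' (addv c b') \notin R, addv b (addv c b') \in R & addv b' (addv c b) == addv b (addv c b')]
  then [:: [:: addv b (addv c b')]] else [::]
 else [::].
Definition supports_step (R : seq (seq int)) (gens H : seq (seq (seq int))) :=
 undup (H ++ [seq L <- [seq sums R g L | g <- gens, L <- H] | (L != [::]) && uniq L] ++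
  flatten [seq double R L1 L2 | L1 <- H, L2 <- H]).
(** When two brackets with the nilpotent element kill a vector, conjugation by the exponential adds
    a single bracket. If all root components of the result but one are known to lie in the space, so
    does the last one. *)
Definition learn (R LZ : seq (seq int)) (Kn : seq (seq int)) (L : seq (seq int)) :=
 if sums R LZ (sums R LZ L) is [::] then
  if [seq b <- L ++ sums R LZ L | b \notin Kn] is [:: b] then b :: Kn else Kn
 else Kn.

Section RootSums.
Variables (K : acf) (n r l : nat) (A : 'M[int]_l) (C : seq (seq int)).
Variables (G B T : set 'M[K]_n) (a : 'I_l -> 'M[K]_n -> K) (c : 'I_l -> K -> 'M[K]_n).
Variables (Q : 'M[K]_n) (M : 'M[int]_(r, n)).
Hypotheses (hG : simple_group_of_type A G B T a c) (l0 : (0 < l)%N) (A2 : forall i, A i i = 2).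
Hypotheses (rd : root_dat G T Q M) (AC : forall i j, A i j = (nth [::] C i)`_j).
Variables (al : 'I_l -> 'rV[int]_r) (phi : 'I_l -> 'M[K]_2 -> 'M[K]_n) (e f : 'I_l -> 'M[K]_n).
Hypothesis ss : simple_system A G B a c Q M al phi e f.
Variables R : seq (seq int).
Hypotheses (Rok : positives_ok l C R)
 (Ainj : forall k : 'I_l -> int, (forall i, \sum_j k j * A j i = 0) -> forall j, k j = 0).
Notation tt := (tt Q M).
Notation wsp := (wsp G Q M).
Notation rt := (rt G Q M).
Notation psi := (psi G B Q M).
Notation cmb := (cmb al).
Implicit Types (b : seq int) (L : seq (seq int)) (X Y Z v y : 'M[K]_n).
Let hB : borel_subgroup G B. by case: hG=> _ []. Qed.
Let TB : T `<=` B. by case: hG=> _ []. Qed.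
Let PR := positive_roots hG l0 A2 rd AC ss Rok Ainj.
Lemma size_pos b : b \in R -> size b = l.
by have /and4P [/allP h _ _ _]:= Rok;move=> /h /and3P [/eqP]. Qed.
Lemma psi_positive b : b \in R -> psi (cmb b).
by move=> bR;apply/PR=> //;exact: size_pos. Qed.
Lemma rt_pos b : b \in R -> rt (cmb b).
by case/psi_positive. Qed.
Lemma cmb_addv b b' : size b = l -> size b' = l -> cmb (addv b b') = cmb b + cmb b'.
move=> sb sb';rewrite /cmb -big_split;eqb=> i _ /=.
rewrite (nth_map (0, 0)) ?size_zip ?sb ?sb' ?minnn // nth_zip ?sb //= scalerDl //.
Qed.
Lemma size_addv b b' : size b = l -> size b' = l -> size (addv b b') = l.
by move=> sb sb';rewrite size_map size_zip sb sb' minnn. Qed.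
Lemma lb_pos b b' v v' : b \in R -> b' \in R -> wsp (cmb b) v -> wsp (cmb b') v' ->
 v != 0 -> v' != 0 ->
 if addv b b' \in R then wsp (cmb (addv b b')) (lb v v') /\ lb v v' != 0 else lb v v' = 0.
move=> bR bR' wv wv' v0 v0';have sb := size_pos bR;have sb' := size_pos bR'.
have w := wsp_lb rd wv wv';rewrite -cmb_addv // in w.
case: ifPn=> hs.
 split=> //;have [s0 ns]:= rt_pos hs;rewrite cmb_addv // in s0 ns.
 exact: (lb_root_neq0 rd (rt_pos bR) (rt_pos bR') wv v0 wv' v0').
apply/eqP;apply: contraNT hs=> z0;apply/PR;first exact: size_addv.
have pb := psi_positive bR;have pb' := psi_positive bR'.
have ns: nzw G Q M (cmb (addv b b')) by exists (lb v v').
rewrite (cmb_addv sb sb') in ns *;exact: (psi_add rd hB pb pb' ns).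
Qed.
Fixpoint rsum L y : Prop :=
 if L is b :: L' then exists v y', [/\ wsp (cmb b) v, v != 0, rsum L' y' & y = v + y'] else y = 0.
Lemma rsum_cat L1 L2 y1 y2 : rsum L1 y1 -> rsum L2 y2 -> rsum (L1 ++ L2) (y1 + y2).
elim: L1 y1=> [|b L1 IH] y1 /= => [->|[v [y [wv v0 hy ->]]] h2];first by rewrite add0r.
by exists v, (y + y2);split=> //;[exact: IH|rewrite addrA].
Qed.
Lemma rsum1 b v : wsp (cmb b) v -> v != 0 -> rsum [:: b] v.
by move=> wv v0;exists v, 0;rewrite addr0. Qed.
Lemma rsum_scale (k : K) L y : k != 0 -> rsum L y -> rsum L (k *: y).
move=> k0;elim: L y=> [|b L IH] y /=;first by move=> ->;rewrite scaler0.
move=> [v [y' [wv v0 hy ->]]];exists (k *: v), (k *: y');split.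
- exact: wspZ.
- by rewrite scaler_eq0 negb_or k0.
- exact: IH.
- by rewrite scalerDr.
Qed.
Lemma rsum_lb L1 L2 y1 y2 : {subset L1 <= R} -> {subset L2 <= R} -> rsum L1 y1 -> rsum L2 y2 ->
 rsum (sums R L1 L2) (lb y1 y2).
move=> + h2 + hy2;elim: L1 y1=> [|b L1 IH] y1 h1;first by move=> /= ->;rewrite lb0l.
move=> [v [y [wv v0 hy ->]]];rewrite lbDl;apply: rsum_cat;last first.
 by apply: IH hy=> x xL;apply: h1;rewrite inE xL orbT.
have bR: b \in R by apply: h1;rewrite mem_head.
clear IH hy h1;elim: L2 y2 h2 hy2=> [|b' L2 IH2] y2 h2;first by move=> /= ->;rewrite lb0r.
move=> [v' [y' [wv' v0' hy' ->]]];rewrite lbDr /=.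
have h := lb_pos bR (h2 _ (mem_head _ _)) wv wv' v0 v0'.
have:= IH2 y' _ hy';move/(_ (fun x xL=> h2 x (@mem_behead _ (b' :: L2) x xL)))=> h3.
case: ifP h=> [_ [w z]|_ ->];last by rewrite add0r.
by exists (lb v v'), (lb v y').
Qed.
Lemma sums_sub L1 L2 : {subset sums R L1 L2 <= R}.
by move=> x /flattenP [_ /mapP [b _ ->]] /mapP [b' ];rewrite mem_filter=> /andP [? _] ->. Qed.

Section Closed.
Variable V : set 'M[K]_n.
Hypotheses (Vlin : forall (k : K) y z, V y -> V z -> V (k *: y + z)) (Vlb : forall y z, V y -> V z -> V (lb y z)).
Definition suppd L := {subset L <= R} /\ exists2 y, V y & rsum L y.
Lemma supported_sums L1 L2 : suppd L1 -> suppd L2 -> suppd (sums R L1 L2).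
move=> [h1 [y1 V1 s1]] [h2 [y2 V2 s2]];split;first exact: sums_sub.
by exists (lb y1 y2);[exact: Vlb|exact: rsum_lb].
Qed.
Lemma supported_double L1 L2 L : suppd L1 -> suppd L2 -> L \in double R L1 L2 -> suppd L.
move=> [+ [y1 V1 +]] [+ [y2 V2 +]];case: L1=> [|b [|b' [|]]] //;case: L2=> [|d [|]] //= h1 s1 h2 s2.
rewrite /double;case: ifP=> [|_];last by rewrite in_nil.
move=> /and5P [n1 n2 n3 n4 /and3P [n5 n6 /eqP n7]];rewrite inE=> /eqP ->.
have bR: b \in R by apply: h1;rewrite mem_head.
have bR': b' \in R by apply: h1;rewrite !inE eqxx orbT.
have dR: d \in R by apply: h2;rewrite mem_head.
move: s1 s2=> [v [_ [wv v0 [v' [_ [wv' v0' -> ->]]] e1]]] [z [_ [wz z0 -> e2]]].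
rewrite !addr0 in e1 e2.
have k1 := lb_pos bR bR' wv wv' v0 v0';rewrite (negPf n1) in k1.
have:= lb_pos dR bR wz wv z0 v0;rewrite n2=> -[w2 z2].
have:= lb_pos dR bR' wz wv' z0 v0';rewrite n3=> -[w3 z3].
have k4 := lb_pos bR n2 wv w2 v0 z2;rewrite (negPf n4) in k4.
have k5 := lb_pos bR' n3 wv' w3 v0' z3;rewrite (negPf n5) in k5.
have:= lb_pos bR n3 wv w3 v0 z3;rewrite n6=> -[w6 z6].
have e7: lb v' (lb z v) = lb v (lb z v').
 by rewrite [RHS]jacobi k1 lb0r addr0 [LHS]lbC [lb v z]lbC lbNl.
split;first by move=> x;rewrite inE=> /eqP ->.
exists (lb y1 (lb y2 y1));first by apply: Vlb=> //;exact: Vlb.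
have ->: lb y1 (lb y2 y1) = 2%:R *: lb v (lb z v').
 by rewrite e1 e2 (lbDr z) lbDl (lbDr v) (lbDr v') k4 k5 e7 add0r addr0 scaler_nat mulr2n.
by apply: rsum_scale;[rewrite pnatr_eq0|exact: rsum1].
Qed.
Lemma supported_step gens H : (forall L, L \in gens -> suppd L) -> (forall L, L \in H -> suppd L) ->
 forall L, L \in supports_step R gens H -> suppd L.
move=> hg hH L;rewrite mem_undup !mem_cat=> /or3P [||];first exact: hH.
 by rewrite mem_filter=> /andP [_ /allpairsP [[g L'] /= [gg LH ->]]];apply: supported_sums;[exact: hg|exact: hH].
by move=> /flattenP [_ /allpairsP [[L1 L2] /= [H1 H2 ->]]];apply: supported_double;exact: hH.
Qed.
Variables (W : set 'M[K]_n) (LZ : seq (seq int)) (Z : 'M[K]_n).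
Hypotheses (hLZ : {subset LZ <= R}) (sZ : rsum LZ Z) (nZ : nilp Z).
Hypotheses (Wlin : forall (k : K) y z, W y -> W z -> W (k *: y + z)) (W0 : W 0) (WV : forall y, V y -> W (Ad (mexp Z) y)).
(** The roots whose root spaces lie in [W], which will be the sum of the conjugated subalgebra and
    an opposite parabolic subalgebra. *)
Definition known (Kn : seq (seq int)) := forall b, b \in Kn -> forall v, wsp (cmb b) v -> W v.
Let Wline b v : b \in R -> wsp (cmb b) v -> v != 0 -> W v -> forall v', wsp (cmb b) v' -> W v'.
move=> bR wv v0 Wv v' wv';have [k ->]:= rt_line rd (rt_pos bR) wv v0 wv'.
by rewrite -[_ *: _]addr0;exact: Wlin.
Qed.
Lemma rsum_known Kn L y b : known Kn -> {subset L <= R} -> rsum L y -> W y ->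
 [seq b <- L | b \notin Kn] = [:: b] -> forall v, wsp (cmb b) v -> W v.
move=> hK;have nil L' y': rsum L' y' -> [seq b <- L' | b \notin Kn] = [::] -> W y'.
 elim: L' y'=> [|b' L' IH] y' /=;first by move=> -> _.
 move=> [v [y'' [wv v0 hy ->]]];case: ifPn=> // /negPn bK hf.
 by rewrite -[v]scale1r;apply: Wlin;[exact: hK wv|exact: IH].
elim: L y=> [|b' L IH] y //= hL [v [y' [wv v0 hy ->]]] Wy.
have hL': {subset L <= R} by move=> x xL;apply: hL;rewrite inE xL orbT.
case: ifPn=> [_ [<- hf]|/negPn bK hf].
 have Wv: W v by have:= Wlin (-1) (nil _ _ hy hf) Wy;rewrite scaleN1r addrC addrK.
 by apply: Wline wv v0 Wv;apply: hL;rewrite mem_head.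
apply: IH hy _ hf=> //.
by have:= Wlin (-1) (hK _ bK _ wv) Wy;rewrite scaleN1r addKr.
Qed.
Lemma known_learn Kn L : known Kn -> suppd L -> known (learn R LZ Kn L).
move=> hK [hL [y Vy sy]];rewrite /learn.
case e2 : (sums R LZ (sums R LZ L))=> [|] //.
case ef : [seq _ <- _ | _]=> [|b [|]] //.
have s1 := rsum_lb hLZ hL sZ sy;have:= rsum_lb hLZ (@sums_sub _ _) sZ s1;rewrite e2 /= => s2.
have Wy: W (y + lb Z y).
 by have:= WV Vy;rewrite Ad_mexp3 // s2 ?lb0r // scaler0 addr0.
move=> b';rewrite inE=> /predU1P [->|];last exact: hK.
apply: (rsum_known hK _ (rsum_cat sy s1) Wy ef)=> x.
by rewrite mem_cat=> /orP [/hL|/sums_sub].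
Qed.
Lemma known_learn_all Kn H : known Kn -> (forall L, L \in H -> suppd L) -> known (foldl (learn R LZ) Kn H).
elim: H Kn=> //= L H IH Kn hK hH;apply: IH=> [|L' h];last by apply: hH;rewrite inE h orbT.
by apply: known_learn=> //;apply: hH;rewrite mem_head.
Qed.
(** A torus element on which [b] is the only nonvanishing root of [LZ] is changed by the conjugation
    by a root vector for [b] alone. In this way the roots of [LZ] themselves become known. *)
Lemma known_torus Kn b h : known Kn -> V (tt h) -> W (tt h) -> b \in LZ -> uniq LZ ->
 ev (cmb b) h != 0 -> (forall b', b' \in LZ -> b' != b -> ev (cmb b') h = 0) -> sums R LZ [:: b] = [::] ->
 known (b :: Kn).
move=> hK Vh Wh bL uL b0 b'0 e2 b';rewrite inE=> /predU1P [->|];last exact: hK.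
have : exists2 v, wsp (cmb b) v /\ v != 0 & lb Z (tt h) = - ev (cmb b) h *: v.
 elim: (LZ) Z uL b'0 bL sZ=> // d L IH Y /= /andP [dL uL] b'0 bL [v [y [wv v0 sy ->]]].
 rewrite lbDl [lb v _]lbC;have [_ ->]:= wv.
 move: bL;rewrite inE=> /predU1P [eb|bL].
  exists v=> //;first by rewrite eb.
  suff ->: lb y (tt h) = 0 by rewrite addr0 eb scaleNr.
  have : forall d', d' \in L -> ev (cmb d') h = 0.
   by move=> d' d'L;apply: b'0;[rewrite inE d'L orbT|rewrite eb;apply: contraNneq dL=> <-].
  elim: (L) y sy=> [|d' L' IH'] y';first by move=> /= -> _;rewrite lb0l.
  move=> [v' [y'' [wv' _ sy ->]]] hL;rewrite lbDl [lb v' _]lbC;have [_ ->]:= wv'.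
  by rewrite hL ?mem_head // scale0r oppr0 add0r;apply: IH'=> // x xL;apply: hL;rewrite inE xL orbT.
 have [|v1 w1 e1]:= IH y uL _ bL sy;first by move=> d' d'L;apply: b'0;rewrite inE d'L orbT.
 exists v1=> //;rewrite e1 b'0 ?mem_head ?scale0r ?oppr0 ?add0r //.
 by apply: contraNneq dL=> ->.
move=> [v [wv v0] e1].
have bR: b \in R by exact: hLZ.
have s1: rsum [:: b] (lb Z (tt h)) by rewrite e1;apply: rsum_scale;[rewrite oppr_eq0|exact: rsum1].
have:= rsum_lb hLZ _ sZ s1;rewrite e2 /= => s2.
have {}s2 : lb Z (lb Z (tt h)) = 0 by apply: s2=> x;rewrite inE=> /eqP ->.
have Wy: W (tt h + lb Z (tt h)).
 by have:= WV Vh;rewrite Ad_mexp3 // s2 ?lb0r // scaler0 addr0.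
have Wz: W (lb Z (tt h)) by have:= Wlin (-1) Wh Wy;rewrite scaleN1r addKr.
apply: (Wline bR _ _ Wz);rewrite e1;first exact: wspZ.
by rewrite scaler_eq0 negb_or oppr_eq0 b0.
Qed.
End Closed.
End RootSums.
(** The supports of the four simple root vectors of F4. Heights in F4 go up to 11, whence the number
    of rounds below. *)
Definition gensF4 : seq (seq (seq int)) :=
 [:: [:: unitv 6 1];[:: unitv 6 3];[:: unitv 6 2;unitv 6 4];[:: unitv 6 0;unitv 6 5]].
Definition supportsF4 := Eval vm_compute in iter 11 (supports_step posE6 gensF4) gensF4.

(* [movers j] are the roots appearing in a nilpotent element [Z] such that [exp Z]
   moves the base point opposite to the Borel subgroup of [H] into the open orbit on [G/P_j]. *)
Definition movers (j : nat) : seq (seq int) :=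
 match j with
 | 0%N=> [:: [:: 1;1;2;2;1;1]]
 | 1%N=> [:: [:: 0;1;1;1;0;0]]
 | 2%N=> [:: [:: 1;0;1;1;1;0];[:: 1;1;2;2;1;0]]
 | 4%N=> [:: [:: 0;0;1;1;1;1];[:: 0;1;1;2;2;1]]
 | _=> [:: [:: 1;1;1;2;2;1]]
 end.
(** Roots without the simple root [j] belong to the Levi part of the parabolic subalgebra; the
    movers are supplied by [known_torus]. *)
Definition known0 (j : nat) := movers j ++ [seq b <- posE6 | b`_j == 0].
Definition knownE6 (j : nat) := iter 12 (fun k=> foldl (learn posE6 (movers j)) k supportsF4) (known0 j).
Lemma knownE6_check : all (fun j=> let k := knownE6 j in all (fun b=> b \in k) posE6) [:: 0;1;2;4;5]%N.
by vm_compute. Qed.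
(** [D] is [d] times the inverse of the Cartan matrix [C], so that invertibility becomes an integer
    computation; [d] is the determinant, 3 for E6 and 1 for F4. *)
Definition inverse_table l (C D : seq (seq int)) (d : int) :=
 (d != 0) && all (fun i=> all (fun m=> foldr +%R 0 [seq (nth [::] C i)`_j * (nth [::] D j)`_m | j <- iota 0 l] == (i == m)%:Z * d)
  (iota 0 l)) (iota 0 l).

Section InverseTable.
Variables (l : nat) (A : 'M[int]_l) (C D : seq (seq int)) (d : int).
Hypotheses (AC : forall i j, A i j = (nth [::] C i)`_j) (ok : inverse_table l C D d).
Lemma inverse_tableE (i m : 'I_l) : \sum_j A i j * (nth [::] D j)`_m = (i == m)%:Z * d.
have /andP [_ /allP/(_ i)]:= ok;rewrite mem_iota ltn_ord=> /(_ isT) /allP/(_ m);rewrite mem_iota ltn_ord=> /(_ isT) /eqP <-.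
under eq_bigr=> j _ do rewrite AC.
rewrite -(big_mkord xpredT (fun j=> (nth [::] C i)`_j * (nth [::] D j)`_m)) /index_iota subn0.
by elim: (iota 0 l)=> [|j t IH] /=;rewrite ?big_nil ?big_cons // IH.
Qed.
Lemma table_inj (k : 'I_l -> int) : (forall i, \sum_j k j * A j i = 0) -> forall j, k j = 0.
move=> h m;have /andP [d0 _]:= ok;apply: (mulIf d0);rewrite mul0r.
transitivity (\sum_i (\sum_j k j * A j i) * (nth [::] D i)`_m);last by rewrite big1 // => i _;rewrite h mul0r.
under eq_bigr=> i _ do rewrite mulr_suml.
rewrite exchange_big (bigD1 m) //= [X in _ + X]big1=> [|j jm].
 by under eq_bigr=> i _ do rewrite -mulrA;rewrite -mulr_sumr inverse_tableE eqxx mul1r addr0.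
by under eq_bigr=> i _ do rewrite -mulrA;rewrite -mulr_sumr inverse_tableE (negPf jm) mul0r mulr0.
Qed.
Lemma table_solve (K : acf) (y : 'I_l -> K) : exists x : 'I_l -> K, forall i, \sum_j (A i j)%:~R * x j = y i.
have /andP [d0 _]:= ok;have dK: (d%:~R : K) != 0 by rewrite intr_eq0.
exists (fun j=> \sum_(m < l) ((nth [::] D j)`_m)%:~R * y m / d%:~R)=> i.
under eq_bigr=> j _ do rewrite mulr_sumr.
rewrite exchange_big /= (bigD1 i) //= [X in _ + X]big1=> [|m mi].
 under eq_bigr=> j _ do rewrite !mulrA -intrM.
 by rewrite -!mulr_suml -rmorph_sum /= inverse_tableE eqxx mul1r mulrAC mulfV // mul1r addr0.
under eq_bigr=> j _ do rewrite !mulrA -intrM.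
by rewrite -!mulr_suml -rmorph_sum /= inverse_tableE eq_sym (negPf mi) mul0r !mul0r.
Qed.
End InverseTable.
Definition inverseE6 : seq (seq int) :=
 [:: [:: 4;3;5;6;4;2];[:: 3;6;6;9;6;3];[:: 5;6;10;12;8;4];
   [:: 6;9;12;18;12;6];[:: 4;6;8;12;10;5];[:: 2;3;4;6;5;4]].
Definition inverseF4 : seq (seq int) :=
 [:: [:: 2;3;4;2];[:: 3;6;8;4];[:: 2;4;6;3];[:: 1;2;3;2]].
Lemma invE6_ok : inverse_table 6 tableE6 inverseE6 3. by vm_compute. Qed.
Lemma invF4_ok : inverse_table 4 tableF4 inverseF4 1. by vm_compute. Qed.
Definition E6_inj := table_inj tableE6P invE6_ok.
Definition F4_inj := table_inj tableF4P invF4_ok.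

Section TorusSolve.
Variables (K : acf) (n r l : nat) (A : 'M[int]_l) (C D : seq (seq int)) (d : int).
Variables (G B T : set 'M[K]_n) (a : 'I_l -> 'M[K]_n -> K) (c : 'I_l -> K -> 'M[K]_n).
Variables (Q : 'M[K]_n) (M : 'M[int]_(r, n)).
Hypotheses (rd : root_dat G T Q M) (AC : forall i j, A i j = (nth [::] C i)`_j) (ok : inverse_table l C D d).
Variables (al : 'I_l -> 'rV[int]_r) (phi : 'I_l -> 'M[K]_2 -> 'M[K]_n) (e f : 'I_l -> 'M[K]_n).
Hypothesis ss : simple_system A G B a c Q M al phi e f.
Lemma torus_solve (y : 'I_l -> K) : exists x : 'I_l -> K, forall i, ev (al i) (\sum_j x j *: hc Q M (al j)) = y i.
have [x hx]:= table_solve AC ok y;exists x=> i;rewrite -hx.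
elim/big_rec2: _=> [|j u v _ <-];first by rewrite /ev big1 // => k _;rewrite mxE mul0r.
rewrite evDr evZr (prP rd (rt_al ss j) (rt_al ss i).2) (ss_pr ss) mulrC //.
Qed.
Lemma hgr_of_wt (x : 'rV[K]_r) (b : 'rV[int]_r) (Y : 'M[K]_n) (m : nat) : wt Q M b Y -> ev b x = m%:R ->
 hgr Q (x *m map_mx intr M) m Y.
by move=> /(wtP rd) hY ex i j /hY e0;exists m=> //;rewrite -ev_wij e0. Qed.
Lemma ev_cmbE b (x : 'rV[K]_r) : ev (cmb al b) x = \sum_(i < l) (b`_i)%:~R * ev (al i) x.
exact: ev_sum_al. Qed.
End TorusSolve.

(** * The conjugated subalgebra and the opposite parabolic subalgebra span *)

Section OpenLie.
Variables (K : acf) (n r : nat).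
Variables (G B T : set 'M[K]_n) (a : 'I_6 -> 'M[K]_n -> K) (c : 'I_6 -> K -> 'M[K]_n).
Variables (Q : 'M[K]_n) (M : 'M[int]_(r, n)).
Hypotheses (hG : simple_group_of_type cartanE6 G B T a c) (rd : root_dat G T Q M).
Variables (al : 'I_6 -> 'rV[int]_r) (phi : 'I_6 -> 'M[K]_2 -> 'M[K]_n) (e f : 'I_6 -> 'M[K]_n).
Hypothesis ss : simple_system cartanE6 G B a c Q M al phi e f.
Notation tt := (tt Q M).
Notation wsp := (wsp G Q M).
Notation cmb := (cmb al).
Implicit Types (X Y Z v y : 'M[K]_n).
Lemma A2E6 i : cartanE6 i i = 2. by rewrite mxE eqxx. Qed.
Let RA := rt_pos hG (ltn0Sn 5) A2E6 rd tableE6P ss posE6_ok E6_inj.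
Lemma height_grading : exists x0 : 'rV[K]_r, forall b, ev (cmb b) x0 = (\sum_(i < 6) b`_i)%:~R.
have [y hy]:= torus_solve rd tableE6P invE6_ok ss (fun=> 1).
exists (\sum_j y j *: hc Q M (al j))=> b;rewrite ev_cmbE rmorph_sum;eqb=> i _.
by rewrite hy mulr1.
Qed.
Variables (V D : set 'M[K]_n) (j : nat).
Hypotheses (jok : j \in [:: 0;1;2;4;5]%N).
Hypotheses (Vlin : forall (k : K) y z, V y -> V z -> V (k *: y + z)) (Vlb : forall y z, V y -> V z -> V (lb y z)).
Hypotheses (Dlin : forall (k : K) y z, D y -> D z -> D (k *: y + z)).
Hypothesis Vgen : forall L, L \in gensF4 -> suppd G Q M al posE6 V L.
Hypothesis Vtor : forall y0 y1 y2 y3 : K, exists h, V (tt h) /\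
 forall b, ev (cmb b) h = (b`_1)%:~R * y0 + (b`_3)%:~R * y1 + (b`_2 + b`_4)%:~R * y2 + (b`_0 + b`_5)%:~R * y3.
Hypotheses (Dtor : forall h, D (tt h)) (Dneg : forall b v, b \in posE6 -> wsp (- cmb b) v -> D v)
 (Dlev : forall b v, b \in posE6 -> b`_j = 0 -> wsp (cmb b) v -> D v).
Lemma movers_commute : all (fun i=> all (fun z=> sums posE6 (movers i) [:: z] == [::]) (movers i)) [:: 0;1;2;4;5]%N.
by vm_compute. Qed.
Lemma supportedF4 L : L \in supportsF4 -> suppd G Q M al posE6 V L.
have ->: supportsF4 = iter 11 (supports_step posE6 gensF4) gensF4 by vm_compute.
move: L;elim: 11%N=> [|m IH] L;first exact: Vgen.
rewrite iterS;apply: (supported_step hG (ltn0Sn 5) A2E6 rd tableE6P ss posE6_ok E6_inj Vlb Vgen IH).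
Qed.
Lemma mover_exists : exists Z, [/\ Lie G Z, nilp Z & rsum G Q M al (movers j) Z].
have hm: all (fun b=> b \in posE6) (movers j).
 by move: jok;rewrite !inE=> /or4P [|||/orP []] /eqP ->;vm_compute.
have ht: all (fun b : seq int=> 0 < \sum_(i < 6) b`_i) posE6.
 apply/allP=> b bR;rewrite -(@sheightE 6) ?(size_pos posE6_ok) //;move: b bR;apply/allP.
 by vm_compute.
have [x0 hx0]:= height_grading.
suff [Z [LZ hZ sZ]]: exists Z, [/\ Lie G Z, hgr Q (x0 *m map_mx intr M) 1 Z & rsum G Q M al (movers j) Z].
 by exists Z;split=> //;exact: hgr_nilp (rd_unit rd) _ hZ.
elim: (movers j) hm=> [|b L IH] /=;first by exists 0;split=> //;[exact: Lie0|exact: hgr0].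
move=> /andP [bR /IH [Z [LZ hZ sZ]]];have [_ [v wv v0]]:= RA bR.
exists (v + Z);split;last by exists v, Z.
 by apply: LieD=> //;case: wv.
apply: hgrD=> //;have /allP/(_ b bR) hb := ht;have:= hx0 b.
case: (\sum_(i < 6) b`_i) hb=> // p p0 e0.
apply: (hgr_le p0);exact: (hgr_of_wt rd wv.2 e0).
Qed.
(** [D] supplies the torus, the negative roots and the Levi roots, torus elements of [V] supply the
    mover roots, and the computation of [knownE6_check] supplies all the remaining positive
    roots. *)
Lemma open_at_mover : exists Z, [/\ Lie G Z, nilp Z &
 forall X, Lie G X -> exists y q, [/\ V y, D q & X = Ad (mexp Z) y + q]].
have [Z [LZ nZ sZ]]:= mover_exists;exists Z;split=> //.
pose W : set 'M[K]_n := [set X | exists y q, [/\ V y, D q & X = Ad (mexp Z) y + q]].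
have D0: D 0 by have:= Dlin (-1) (Dtor 0) (Dtor 0);rewrite scaleN1r addNr.
have V0: V 0.
 have [h [Vh _]]:= Vtor 0 0 0 0;have:= Vlin (-1) Vh Vh;by rewrite scaleN1r addNr.
have WD q: D q -> W q by move=> Dq;exists 0, q;rewrite Ad0 ?add0r.
have Wlin (k : K) y z : W y -> W z -> W (k *: y + z).
 move=> [y1 [q1 [h1 g1 ->]]] [y2 [q2 [h2 g2 ->]]];exists (k *: y1 + y2), (k *: q1 + q2);split.
 - exact: Vlin.
 - exact: Dlin.
 - by rewrite AdD AdZ scalerDr addrACA.
have WV y: V y -> W (Ad (mexp Z) y) by move=> Vy;exists y, 0;rewrite addr0.
have hm: {subset movers j <= posE6}.
 by apply/allP;move: jok;rewrite !inE=> /or4P [|||/orP []] /eqP ->;vm_compute.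
have k0: known G Q M al W [seq b <- posE6 | b`_j == 0].
 by move=> b;rewrite mem_filter=> /andP [/eqP bj bR] v wv;apply: WD;exact: (Dlev bR bj wv).
have kt := known_torus hG (ltn0Sn 5) A2E6 rd tableE6P ss posE6_ok E6_inj hm sZ nZ Wlin (WD _ D0) WV.
have Wt h: W (tt h) by apply: WD;exact: Dtor.
(* [h1] reads the coefficient of alpha_2, which is 1 on a single mover and 0 and 1 on the two movers
   of a pair; [h2], with its -3, is -1 and 0 on a pair. So the movers of a pair are isolated one
   after the other. *)
have [h1 [Vh1 eh1]]:= Vtor 1 0 0 0;have [h2 [Vh2 eh2]]:= Vtor 0 0 1 (- 3%:R).
have kn: known G Q M al W (known0 j).
 have sz z: z \in movers j -> sums posE6 (movers j) [:: z] = [::].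
  by move: z;have /allP/(_ j jok)/allP h := movers_commute=> z /h /eqP.
 have ne1: (1 : K) != 0 by rewrite oner_eq0.
 have ne2: (- 1 : K) != 0 by rewrite oppr_eq0.
 have none (z : seq int) h b' : b' \in [:: z] -> b' != z -> ev (cmb b') h = 0 by rewrite inE=> /eqP ->;rewrite eqxx.
 have one z: movers j = [:: z] -> ev (cmb z) h1 = 1 -> known G Q M al W (known0 j).
  rewrite /known0=> ez e1;rewrite ez in kt sz *.
  by apply: (kt _ z h1 k0 Vh1 (Wt h1))=> //;[exact: mem_head|rewrite e1|exact: none|apply: sz;exact: mem_head].
 have two z1 z2: movers j = [:: z1;z2] -> z1 != z2 -> ev (cmb z1) h1 = 0 -> ev (cmb z2) h1 = 1 ->
   ev (cmb z1) h2 = - 1 -> ev (cmb z2) h2 = 0 -> known G Q M al W (known0 j).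
  rewrite /known0=> ez z12 e11 e12 e21 e22;rewrite ez in kt sz *.
  have u: uniq [:: z1;z2] by rewrite /= inE z12.
  have k1: known G Q M al W (z2 :: [seq b <- posE6 | b`_j == 0]).
   apply: (kt _ z2 h1 k0 Vh1 (Wt h1))=> //;[by rewrite !inE eqxx orbT|by rewrite e12| |by apply: sz;rewrite !inE eqxx orbT].
   by move=> b';rewrite !inE=> /orP [/eqP -> _|/eqP ->];rewrite ?eqxx.
  apply: (kt _ z1 h2 k1 Vh2 (Wt h2))=> //;[exact: mem_head|by rewrite e21| |apply: sz;exact: mem_head].
  by move=> b';rewrite !inE=> /orP [/eqP ->|/eqP -> _];rewrite ?eqxx.
 move: jok;rewrite !inE=> /or4P [|||/orP []] /eqP ej.
 - by apply: (one [:: 1;1;2;2;1;1]);[rewrite ej|rewrite eh1 /=;ring].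
 - by apply: (one [:: 0;1;1;1;0;0]);[rewrite ej|rewrite eh1 /=;ring].
 - apply: (two [:: 1;0;1;1;1;0] [:: 1;1;2;2;1;0]);rewrite ?eh1 ?eh2 ?ej //=;by ring.
 - apply: (two [:: 0;0;1;1;1;1] [:: 0;1;1;2;2;1]);rewrite ?eh1 ?eh2 ?ej //=;by ring.
 - by apply: (one [:: 1;1;1;2;2;1]);[rewrite ej|rewrite eh1 /=;ring].
move=> X LX;suff : W X by [].
have W0: W 0 by exact: WD.
have kall: known G Q M al W posE6.
 have:= knownE6_check=> /allP/(_ j jok) /allP sub b bR v wv.
 suff kk: known G Q M al W (knownE6 j) by exact: (kk b (sub b bR) v wv).
 rewrite /knownE6;elim: 12%N=> // m IH;rewrite iterS.
 apply: (known_learn_all hG (ltn0Sn 5) A2E6 rd tableE6P ss posE6_ok E6_inj hm sZ nZ Wlin W0 WV IH).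
 exact: supportedF4.
rewrite (wcomp_sum rd X);elim/big_rec: _=> [|b y _ Wy];first exact: W0.
suff Wb: W (wcomp Q M b X) by rewrite -[wcomp _ _ _ _]scale1r;exact: Wlin.
have wb := wcompP rd b LX.
have [b0|b0]:= eqVneq b 0;first by rewrite b0 in wb *;have [h ->]:= wsp_torus rd wb.
have [->//|z0]:= eqVneq (wcomp Q M b X) 0.
have rb: rt G Q M b by split=> //;exists (wcomp Q M b X).
have [s sR [es|es]]:= rt_positive hG (ltn0Sn 5) A2E6 rd tableE6P ss posE6_ok E6_inj rb;rewrite es in wb *.
 exact: kall wb.
by apply: WD;exact: Dneg wb.
Qed.
End OpenLie.

(** * Parabolic subalgebras and the longest element of the Weyl group *)

Section Parabolic.
Variables (K : acf) (n r : nat).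
Variables (G B T : set 'M[K]_n) (a : 'I_6 -> 'M[K]_n -> K) (c : 'I_6 -> K -> 'M[K]_n).
Variables (Q : 'M[K]_n) (M : 'M[int]_(r, n)).
Hypotheses (hG : simple_group_of_type cartanE6 G B T a c) (rd : root_dat G T Q M).
Variables (al : 'I_6 -> 'rV[int]_r) (phi : 'I_6 -> 'M[K]_2 -> 'M[K]_n) (e f : 'I_6 -> 'M[K]_n).
Hypothesis ss : simple_system cartanE6 G B a c Q M al phi e f.
Notation tt := (tt Q M).
Notation wsp := (wsp G Q M).
Notation cmb := (cmb al).
Notation rt := (rt G Q M).
Implicit Types (b : seq int) (L : seq (seq int)) (X Y Z v y : 'M[K]_n).
Let RA := rt_pos hG (ltn0Sn 5) A2E6 rd tableE6P ss posE6_ok E6_inj.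
Let PA := psi_positive hG (ltn0Sn 5) A2E6 rd tableE6P ss posE6_ok E6_inj.
Let mG : mxgroup G. by apply: simple_grp;case: hG. Qed.
Let aG : alg_group G. by case: hG=> -[[]]. Qed.
Let hB : borel_subgroup G B. by case: hG=> _ []. Qed.
Let TB : T `<=` B. by case: hG=> _ []. Qed.
Let ne i : nilp (e i). exact: wt_nilp (rt_al ss i).1 (ss_e ss i).2. Qed.
Let nf i : nilp (f i).
by apply: wt_nilp (ss_f ss i).2;rewrite oppr_eq0;case: (rt_al ss i). Qed.
Let he i : lb (tt (hc Q M (al i))) (e i) = 2%:R *: e i.
by have [_ ->]:= ss_e ss i;rewrite (prP rd (rt_al ss i) (rt_al ss i).2) (pr_self rd (rt_al ss i)). Qed.
Let hf i : lb (tt (hc Q M (al i))) (f i) = - (2%:R *: f i).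
by have [_ ->]:= ss_f ss i;rewrite evNl (prP rd (rt_al ss i) (rt_al ss i).2) (pr_self rd (rt_al ss i)) scaleNr. Qed.
Let evS (b : 'rV[int]_r) (h u : 'rV[K]_r) (k : K) : ev b (h - k *: u) = ev b h - k * ev b u.
by rewrite -scaleNr evDr evZr mulNr. Qed.
Notation s i := (wel (e i) (f i) 1).
Let Gs i : G (s i).
have ge x: G (mexp (x *: e i)) by exact: (mexp_grp aG x (ss_e ss i).1 (ne i)).
have gf x: G (mexp (x *: f i)) by exact: (mexp_grp aG x (ss_f ss i).1 (nf i)).
by rewrite /wel;do 2?[apply: mxgrpM=> //].
Qed.
Lemma Ad_reflection_torus i h : Ad (s i) (tt h) = tt (h - ev (al i) h *: hc Q M (al i)).
rewrite (Ad_wel_t (ss_ef ss i) (he i) (hf i) (ne i) (nf i) (c := ev (al i) h)).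
- by rewrite -scaleNr -ttZ -ttD scaleNr.
- by have [_ ->]:= ss_e ss i.
- by have [_ ->]:= ss_f ss i;rewrite evNl scaleNr.
Qed.
Lemma Ad_reflection i (b : 'rV[int]_r) v : nzw G Q M b -> wsp b v -> wsp (refl Q M (al i) b) (Ad (s i) v).
move=> nb [Lv wv];split;first exact: (Lie_Ad mG (Gs i) Lv).
move=> h;have us := mxgrpU mG (Gs i).
pose h' := h - ev (al i) h *: hc Q M (al i).
have eh: Ad (s i) (tt h') = tt h.
 rewrite Ad_reflection_torus /h' evS (prP rd (rt_al ss i) (rt_al ss i).2) (pr_self rd (rt_al ss i)).
 by congr (tt _);apply/rowP=> k;rewrite !mxE;ring.
rewrite -eh -Ad_lb // wv AdZ;congr (_ *: _).
rewrite /h' /refl evS evBl evZl (prP rd (rt_al ss i) nb) mulrC //.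
Qed.
Definition contains (D : set 'M[K]_n) L := forall b, b \in L -> forall v, wsp (cmb b) v -> D v.
Definition reflect_word (w : seq 'I_6) L := foldl (fun L i=> map (srefl 6 tableE6 (i : 'I_6)) L) L w.
(** Simple reflections are realized by elements of [G], so a word in them carries known root spaces
    to the reflected ones while the torus is preserved. *)
Lemma contains_word (D : set 'M[K]_n) L w : (forall (k : K) v, D v -> D (k *: v)) ->
 (forall h, D (tt h)) -> (forall b, b \in L -> rt (cmb b)) -> contains D L ->
 exists2 x, G x & contains [set Ad x q | q in D] (reflect_word w L) /\ forall h, [set Ad x q | q in D] (tt h).
move=> DZ;suff h: forall x L, G x -> (forall h, [set Ad x q | q in D] (tt h)) ->
  (forall b, b \in L -> rt (cmb b)) -> contains [set Ad x q | q in D] L ->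
  exists2 x, G x & contains [set Ad x q | q in D] (reflect_word w L) /\ forall h, [set Ad x q | q in D] (tt h).
 move=> Dt hL hD;apply: (h 1%:M)=> //;first exact: mxgrp1.
  by move=> t;exists (tt t);[exact: Dt|rewrite Ad1].
 by move=> b bL v wv;exists v;[exact: (hD b bL v wv)|rewrite Ad1].
elim: w=> [|i w IH] x L' Gx Dt hL hD;first by exists x.
have ux := mxgrpU mG Gx;have us := mxgrpU mG (Gs i).
have refE b: b \in L' -> cmb (srefl 6 tableE6 i b) = refl Q M (al i) (cmb b).
 move=> bL;apply: (cmb_sreflect rd tableE6P ss i);exact: (hL b bL).2.
have rr b: b \in L' -> rt (refl Q M (al i) (cmb b)).
 move=> bL;have rb := hL b bL;split;last exact: (reflection rd (rt_al ss i) rb.2).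
 apply/eqP=> e0;have:= refl_refl rd (rt_al ss i) rb.2;rewrite e0 /refl (_ : pr Q M 0 _ = 0) ?scale0r ?subr0.
  by move=> e1;move: (rb.1);rewrite -e1 eqxx.
 apply: (@intr_inj K);rewrite -(prP rd (rt_al ss i)) ?ev0l //.
 by rewrite -e0;exact: (reflection rd (rt_al ss i) rb.2).
apply: (IH (s i *m x)).
- exact: (mxgrpM mG (Gs i) Gx).
- move=> h;have [q Dq eq]:= Dt (h - ev (al i) h *: hc Q M (al i));exists q=> //.
 rewrite AdM // eq Ad_reflection_torus evS (prP rd (rt_al ss i) (rt_al ss i).2) (pr_self rd (rt_al ss i)).
 by congr (tt _);apply/rowP=> k;rewrite !mxE;ring.
- by move=> _ /mapP [b bL ->];rewrite refE //;exact: rr.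
move=> _ /mapP [b bL ->] v;rewrite refE // => wv;have [b0 [u wu u0]]:= hL b bL.
have wu' := Ad_reflection i (ex_intro2 _ _ u wu u0) wu.
have u0': Ad (s i) u != 0 by apply: contraNneq u0=> z;rewrite -(AdVK u us) z Ad0.
have [k ->]:= rt_line rd (rr b bL) wu' u0' wv.
have [q Dq eq]:= hD b bL u wu;exists (k *: q);first exact: DZ.
by rewrite AdM // AdZ eq AdZ.
Qed.
Definition negv b : seq int := map -%R b.
(** The positive roots without the simple root [i], reached by adding simple roots. Their negatives
    lie in the parabolic subalgebra because the simple lowering vectors other than the one at [i]
    do. *)
Definition grow (i : nat) := iter 11 (fun L=> undup (L ++ sums posE6 L [seq unitv 6 k | k <- iota 0 6 & k != i]))
 [seq unitv 6 k | k <- iota 0 6 & k != i].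
Lemma cmb_negv b : size b = 6 -> cmb (negv b) = - cmb b.
move=> sb;rewrite /cmb -sumrN;eqb=> k _.
by rewrite (nth_map 0) ?sb // scaleNr.
Qed.
Lemma grow_contains (D : set 'M[K]_n) (i : nat) : (forall y z, D y -> D z -> D (lb y z)) ->
 (forall (k : K) v, D v -> D (k *: v)) -> (forall k : 'I_6, k != i :> nat -> D (f k)) ->
 forall b, b \in grow i -> b \in posE6 /\ forall v, wsp (- cmb b) v -> D v.
move=> Dlb DZ Df;pose u := [seq unitv 6 k | k <- iota 0 6 & k != i].
have ru (k : nat) : (k < 6)%N -> unitv 6 k \in posE6.
 by move=> k6;have /and4P [_ _ /allP h _]:= posE6_ok;apply: h;rewrite mem_iota.
have hu b: b \in u -> b \in posE6 /\ forall v, wsp (- cmb b) v -> D v.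
 move=> /mapP [k];rewrite mem_filter mem_iota=> /andP [ki k6] ->;split;first exact: ru.
 rewrite (cmb_unitv al (Ordinal k6))=> v wv.
 have f0: f (Ordinal k6) != 0.
  apply: contraNneq (ss_e0 ss (Ordinal k6))=> z;have:= he (Ordinal k6).
  rewrite -(ss_ef ss) z lb0r lb0l=> /esym/eqP.
  by rewrite scaler_eq0 pnatr_eq0.
 have [m ->]:= rt_line rd (rtN rd (rt_al ss _)) (ss_f ss (Ordinal k6)) f0 wv.
 by apply: DZ;exact: Df.
rewrite /grow;elim: 11%N=> [|m IH] b;first exact: hu.
rewrite iterS mem_undup mem_cat=> /orP [/IH //|].
move=> /flattenP [_ /mapP [b1 /IH [p1 h1] ->]] /mapP [b2];rewrite mem_filter=> /andP [p12 /hu [p2 h2]] ->.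
split=> // v wv;have s1 := size_pos posE6_ok p1;have s2 := size_pos posE6_ok p2.
have r1 := rtN rd (RA p1);have r2 := rtN rd (RA p2);have r12 := rtN rd (RA p12).
have [_ [v1 w1 v10]]:= r1;have [_ [v2 w2 v20]]:= r2.
rewrite cmb_addv // opprD in r12 wv.
have z := lb_root_neq0 rd r1 r2 w1 v10 w2 v20 r12.2 r12.1.
have [k ->]:= rt_line rd r12 (wsp_lb rd w1 w2) z wv.
by apply: DZ;apply: Dlb;[exact: h1 w1|exact: h2 w2].
Qed.
(** A word of length 36, the number of positive roots of E6, for the longest element of the Weyl
    group. *)
Definition longest_nat : seq nat := [:: 0;1;2;0;3;1;2;0;3;2;4;3;1;2;0;3;2;4;
 3;1;5;4;3;1;2;0;3;2;4;3;1;5;4;3;2;0].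
Definition reflect_nat (w : seq nat) L := foldl (fun L i=> map (srefl 6 tableE6 i) L) L w.
Definition parabolic_roots (i : nat) := posE6 ++ map negv (grow i).
(** The diagram automorphism -w_0, numbered from 0: the longest element carries the parabolic
    subgroup of the node [i] to the opposite of that of [dual i]. *)
Definition dual (i : nat) : nat := nth 0%N [:: 5;1;4;3;2;0]%N i.
Definition opposite_ok (i : nat) :=
 let L := reflect_nat longest_nat (parabolic_roots i) in
 all (fun b=> negv b \in L) posE6 && all (fun b=> (b`_(dual i) != 0) || (b \in L)) posE6.
Lemma reflect_word_nat w L : all (fun k=> (k < 6)%N) w -> reflect_word [seq inord k | k <- w] L = reflect_nat w L.
rewrite /reflect_word /reflect_nat;elim: w L=> //= k w IH L /andP [k6 hw].
by rewrite inordK //;exact: IH.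
Qed.
Lemma opposite_check : all opposite_ok [:: 0;1;2;4;5]%N.
by vm_compute. Qed.

Section WeightStabilizer.
Variables (om : 'M[K]_n -> K) (P : set 'M[K]_n) (i : 'I_6).
Hypotheses (hom : forall j z, z != 0 -> om (c j z) = z ^+ (i == j)) (hP : parabolic_of_weight G B T om P).
(** The coroot torus of the node [j] fixes the highest weight vector exactly when [j] differs from
    [i]. [lower_in_stabilizer] and [diag_fix_of_lower] translate this into the position of [f j]. *)
Lemma parabolicP : [/\ alg_group P, P `<=` G, B `<=` P, forall j, j != i -> Lie P (f j) & ~ Lie P (f i)].
have [m [rho [v [[_ hrho _] [v0 hb ht] ->]]]]:= hP.
have dG := det1G (rd_exp rd);have aP := alg_line aG dG hrho v0.
have BG: B `<=` G by case: hB.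
have BP: B `<=` line_stabilizer G rho v by move=> b Bb;split;[exact: BG|exact: hb].
have Pe j x: line_stabilizer G rho v (mexp (x *: e j)).
 apply: BP;apply: mexp_grp _ (ne j);first by case: hB=> _ [].
 exact: (psi_Lie rd (ss_psi ss j) (ss_e ss j)).
have hd j x: x != 0 -> rho (phi j (diag2 x)) *m v = x ^+ (i == j) *: v.
 by move=> x0;rewrite -(ss_diag ss) // ht ?hom //;exact: (coroot_torus hG).
split=> // [A []//|j ji|Lf].
 have:= @Lie_curve K n (line_stabilizer G rho v) (pexp (f j)) 1 (oner_neq0 _).
 rewrite dpexp // /hmx map_mxM -!/(hmx 0 _) hmxC hpexp // scale0r mexp0 mul1mx;apply=> // x _.
 rewrite -/(hmx x (pexp (f j))) hpexp // -(ss_low ss j).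
 apply: (lower_in_stabilizer aG dG hrho v0 (ss_hom ss j) (ne j) (nf j) (ss_up ss j) (ss_low ss j) (Pe j))=> y y0.
 by rewrite hd // eq_sym (negPf ji) scale1r.
have two: (2%:R : K) != 0 by rewrite pnatr_eq0.
have:= diag_fix_of_lower aG dG hrho v0 (ss_hom ss i) (ne i) (nf i) (ss_up ss i) (ss_low ss i) (Pe i)
 (fun x=> mexp_grp aP x Lf (nf i)) two.
rewrite hd // eqxx=> /eqP;rewrite -subr_eq0 -[X in _ - X]scale1r -scalerBl scaler_eq0 (negPf v0) orbF.
by rewrite (_ : 2%:R ^+ true - 1 = 1) ?oner_eq0 // expr1;ring.
Qed.
Lemma parabolic_contains : contains (Lie P) (parabolic_roots i) /\ forall h, Lie P (tt h).
have [aP PG BP fP _]:= parabolicP.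
split;last by move=> h;apply: (Lie_sub BP);exact: (tt_LieB rd TB).
move=> b;rewrite mem_cat=> /orP [bR|/mapP [b' b'g ->]] v wv.
 by apply: (Lie_sub BP);exact: (psi_Lie rd (PA bR) wv).
have mP: mxgroup P by case: aP.
have [bR h]:= @grow_contains (Lie P) i (fun y z hy hz=> Lie_lb mP hy hz) (fun k v hv=> LieZ k hv) fP b' b'g.
by apply: h;rewrite -cmb_negv // (size_pos posE6_ok bR).
Qed.
Lemma opposite_parabolic : (i : nat) \in [:: 0;1;2;4;5]%N -> exists2 x, G x & let D := [set Ad x q | q in Lie P] in
 [/\ forall h, D (tt h), forall b v, b \in posE6 -> wsp (- cmb b) v -> D v &
  forall b v, b \in posE6 -> b`_(dual i) = 0 -> wsp (cmb b) v -> D v].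
move=> iok;have [hc1 hc2]:= parabolic_contains.
have rL b: b \in parabolic_roots i -> rt (cmb b).
 rewrite mem_cat=> /orP [/RA //|/mapP [b' b'g ->]].
 have [bR _]:= @grow_contains (fun=> True) i (fun _ _ _ _=> I) (fun _ _ _=> I) (fun _ _=> I) b' b'g.
 by rewrite cmb_negv ?(size_pos posE6_ok bR) //;apply: (rtN rd);exact: RA.
have [x Gx [h1 h2]]:= contains_word [seq inord k | k <- longest_nat] (fun k v hv=> LieZ k hv) hc2 rL hc1.
exists x=> //= ; rewrite reflect_word_nat // in h1.
have /allP/(_ _ iok)/andP [/allP o1 /allP o2]:= opposite_check.
move: h1 o1 o2;set L := reflect_nat _ _;move: L=> L h1 o1 o2.
split=> // b v bR;first by rewrite -cmb_negv ?(size_pos posE6_ok bR) // => wv;exact: h1 (o1 b bR) _ wv.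
move=> bj wv;have /orP [/eqP //|h]:= o2 b bR;exact: (h1 b h v wv).
Qed.
End WeightStabilizer.
End Parabolic.

(** * The center and principal nilpotent elements *)

Lemma comm_zcl (K : acf) n (S : set 'M[K]_n) g : (forall A, S A -> g *m A = A *m g) ->
 forall A, zcl S A -> g *m A = A *m g.
move=> h A [_ hA];mxP=> i j;sub0P.
have e C: mxeval ((cmx _ g *m gmx K n) i j - (gmx K n *m cmx _ g) i j) C = (g *m C) i j - (C *m g) i j.
 have e1 (N : 'M[{mpoly K[n * n]}]_n) : mxeval (N i j) C = mev N C i j by rewrite [RHS]mxE.
 by rewrite /mxeval mevalB -!/(mxeval _ _) !e1 !mevM mev_c mev_g.
by rewrite -e;apply: hA=> C SC;rewrite e h // subrr.
Qed.

Section Center.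
Variables (K : acf) (n r : nat) (G T : set 'M[K]_n) (Q : 'M[K]_n) (M : 'M[int]_(r, n)).
Hypothesis rd : root_dat G T Q M.
Notation tt := (tt Q M).
Lemma lb_tt_center c : (forall b, rt G Q M b -> ev b c = 0) -> forall Y, Lie G Y -> lb (tt c) Y = 0.
move=> h Y LY;rewrite (wcomp_sum rd Y) lb_sumr big1 // => b _.
have [_ ->]:= wcompP rd b LY.
have [->|b0]:= eqVneq b 0;first by rewrite ev0l scale0r.
have [->|z0]:= eqVneq (wcomp Q M b Y) 0;first by rewrite scaler0.
rewrite h ?scale0r //;split=> //;exists (wcomp Q M b Y)=> //;exact: (wcompP rd).
Qed.
(** If all roots vanish at [c], they vanish on its rational hull, whose one-parameter subgroups are
    then central. Such a subgroup is normal, so by simplicity it is trivial or its closure is [G];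
    the second is impossible as [G] is not commutative. *)
Lemma center_trivial c : (forall b, rt G Q M b -> ev b c = 0) -> tt c = 0.
move=> hc;have uQ := rd_unit rd;have sG := rd_simple rd;have mG := simple_grp sG.
have hT := rd_max rd;have TG: T `<=` G by case: hT.
have mT: mxgroup T by case: hT=> _ [[[]]].
have [r' [N [d [ec hN]]]]:= rational_hull c.
suff h k: row k N *m M = 0.
 have : c *m map_mx intr M = 0.
  rewrite ec -mulmxA -map_mxM /=;suff ->: N *m M = 0 by rewrite raddf0 mulmx0.
  by apply/row_matrixP=> k;rewrite row_mul h row0.
 by move=> e0;rewrite -[LHS]/(qdiag Q _) e0 /qdiag linear0 mulmx0 mul0mx.
pose m := row k N *m M.
have tm: tint T Q m.
 rewrite /m mulmx_sum_row;elim/big_rec: _=> [|i x _ hx];first exact: (tint0 hT uQ).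
 by apply: (tintD hT uQ)=> //;apply: tintZ;exact: (rd_int rd).
have em: tt (map_mx intr (row k N)) = qdiag Q (map_mx intr m) by rewrite /m map_mxM.
have ev0 b: rt G Q M b -> ev b (map_mx intr (row k N) : 'rV[K]_r) = 0.
 move=> rb;have sw (u : 'rV[K]_r) : ev b u = \sum_i (b 0 i)%:~R * u 0 i by eqb=> i _;rewrite mulrC.
 by rewrite sw;apply: hN;rewrite -sw;exact: hc.
have cmY Y w: Lie G Y -> Y *m qlam Q m w = qlam Q m w *m Y.
 move=> LY;apply: (qdiag_comm_fun (u := map_mx intr m) uQ).
  by move=> i j;rewrite ![map_mx _ _ _ _]mxE=> /eqP;rewrite eqr_int=> /eqP;rewrite !mxE=> ->.
 by have:= lb_tt_center ev0 LY;rewrite em=> /eqP;rewrite subr_eq0=> /eqP.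
have Tm w: w != 0 -> T (qlam Q m w) by case: tm=> _;apply.
have cG w A: w != 0 -> G A -> qlam Q m w *m A = A *m qlam Q m w.
 move=> w0;rewrite -(rd_exp rd);apply: comm_zcl=> {}A;elim=> [|C D X _ IH [Y [LY nY ->]] [t _ <-]].
  by rewrite mulmx1 mul1mx.
 have ug := mxgrpU mT (Tm w w0).
 have [e1 _]:= mexp_conj ug (nilpZ t nY).
 have eY: qlam Q m w *m (t *: Y) *m invmx (qlam Q m w) = t *: Y.
  by rewrite -scalemxAr -scalemxAl -cmY // mulmxK.
 rewrite eY in e1;have e2: qlam Q m w *m mexp (t *: Y) = mexp (t *: Y) *m qlam Q m w.
  by rewrite -[in RHS]e1 mulmxKV.
 by rewrite [LHS]mulmxA IH -[LHS]mulmxA e2 mulmxA.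
pose S : set 'M[K]_n := [set qlam Q m w | w in [set w | w != 0]].
have qM w w': qlam Q m w *m qlam Q m w' = qlam Q m (w * w').
 by rewrite /qlam mul_qdiag //;congr (qdiag _ _);apply/rowP=> j;rewrite !mxE expfzMl.
have mS: mxgroup S.
 split.
 - by move=> _ [w w0 <-];exact: (mxgrpU mT (Tm w w0)).
 - by exists 1;[exact: oner_neq0|exact: qlam1].
 - by move=> _ _ [w w0 <-] [w' w0' <-];exists (w * w');[rewrite /= mulf_neq0|rewrite qM].
 - move=> _ [w w0 <-];exists w^-1;first by rewrite /= invr_neq0.
  by rewrite -[LHS](mulKmx (mxgrpU mT (Tm w w0))) qM mulfV // qlam1 // mulmx1.
have cS: sconn S.
 apply: sirr_sconn;have [p [gam [h1 _ _]]]:= qlam_curve m uQ.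
 have ->: S = [set ('X^(p.+1)).[w]^-1 *: hmx w gam | w in [set w | ('X^(p.+1)).[w] != 0]].
  rewrite predeqE=> A;split=> -[w w0 <-];exists w;rewrite /= ?hornerXn ?h1 //.
  - by rewrite expf_neq0.
  - by move: w0;rewrite /= hornerXn expf_eq0.
  - by move: w0;rewrite /= hornerXn expf_eq0.
 by apply: sirr_frac_curve;rewrite -size_poly_eq0 size_polyXn.
have [||S1|SG]:= simple_normal sG mS cS.
- by move=> _ [w w0 <-];exact: TG (Tm w w0).
- move=> g _ Gg [w w0 <-];exists w=> //;rewrite -cG //.
 by rewrite mulmxK //;exact: mxgrpU Gg.
- have two: (2%:R : K) != 0 by rewrite pnatr_eq0.
 apply/rowP=> j;rewrite [RHS]mxE -/m;apply: (@exp2_inj K);rewrite expr0z.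
 have e21: qlam Q m 2%:R = qlam Q m 1 by rewrite qlam1 //;apply: S1;exists 2%:R.
 by have /rowP/(_ j) := qdiag_inj uQ e21;rewrite ![(\row__ _) _ _]mxE exp1rz.
have [_ [x [y [Gx Gy nxy]]] _]:= sG.
case: nxy;apply: esym;move: Gx;rewrite -SG;apply: comm_zcl=> _ [w w0 <-].
by apply: esym;exact: cG.
Qed.
End Center.

Section CenterSpan.
Variables (K : acf) (n r l : nat) (A : 'M[int]_l) (C D : seq (seq int)) (d : int).
Variables (G B T : set 'M[K]_n) (a : 'I_l -> 'M[K]_n -> K) (c : 'I_l -> K -> 'M[K]_n).
Variables (Q : 'M[K]_n) (M : 'M[int]_(r, n)).
Hypotheses (hG : simple_group_of_type A G B T a c) (l0 : (0 < l)%N) (A2 : forall i, A i i = 2).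
Hypotheses (rd : root_dat G T Q M) (AC : forall i j, A i j = (nth [::] C i)`_j) (ok : inverse_table l C D d).
Variables (al : 'I_l -> 'rV[int]_r) (phi : 'I_l -> 'M[K]_2 -> 'M[K]_n) (e f : 'I_l -> 'M[K]_n).
Hypothesis ss : simple_system A G B a c Q M al phi e f.
Variables R : seq (seq int).
Hypothesis Rok : positives_ok l C R.
Lemma tt_eq0 h : (forall i, ev (al i) h = 0) -> tt Q M h = 0.
move=> h0;apply: (center_trivial rd)=> b rb.
have c0 s: ev (cmb al s) h = 0 by rewrite ev_cmbE big1 // => i _;rewrite h0 mulr0.
have [s _ [->|->]]:= rt_positive hG l0 A2 rd AC ss Rok (table_inj AC ok) rb;first exact: c0.
by rewrite evNl c0 oppr0.
Qed.
Lemma simple_root_vector i X : root_vector G T (a i) X -> wsp G Q M (al i) X /\ X != 0.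
move=> [X0 LX hX];have [b wb gb]:= group_weight rd X0 hX.
by rewrite (gweight_inj (ss_weight ss i) gb).
Qed.
(** A difference of two simple roots has coefficients of both signs, so it is not a root. *)
Lemma lb_e_f i j : i != j -> lb (e i) (f j) = 0.
move=> ij;apply/eqP;apply: contraT=> nz.
have w := wsp_lb rd (ss_e ss i) (ss_f ss j).
pose k0 (m : 'I_l) : int := (m == i)%:Z - (m == j)%:Z.
have ek: al i - al j = \sum_m k0 m *: al m.
 rewrite /k0;under eq_bigr=> m _ do rewrite scalerBl.
 rewrite sumrB (bigD1 i) //= eqxx scale1r big1 ?addr0=> [|m mi];last by rewrite (negPf mi) scale0r.
 by rewrite (bigD1 j) //= eqxx scale1r big1 ?addr0 // => m mj;rewrite (negPf mj) scale0r.
have fr := al_free rd ss (table_inj AC ok).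
have i0: al i - al j != 0.
 apply/eqP;rewrite ek=> /fr /(_ i);rewrite /k0 eqxx (negPf ij);lia.
have rb: rt G Q M (al i - al j) by split=> //;exists (lb (e i) (f j)).
have [s sR h]:= rt_positive hG l0 A2 rd AC ss Rok (table_inj AC ok) rb.
have s0 (m : 'I_l) : 0 <= s`_m.
 have /and4P [/allP h0 _ _ _]:= Rok;have /and3P [/eqP ssz /allP hs _]:= h0 _ sR.
 by apply: hs;apply: mem_nth;rewrite ssz.
have:= s0 i;have:= s0 j;case: h=> eb.
 have h1: \sum_m (k0 m - s`_m) *: al m = 0.
  by under eq_bigr=> m _ do rewrite scalerBl;rewrite sumrB -ek eb subrr.
 by have:= fr _ h1 j;rewrite /k0 eqxx eq_sym (negPf ij);lia.
have h1: \sum_m (k0 m + s`_m) *: al m = 0.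
 by under eq_bigr=> m _ do rewrite scalerDl;rewrite big_split /= -ek eb addNr.
by have:= fr _ h1 i;rewrite /k0 eqxx (negPf ij);lia.
Qed.
End CenterSpan.

Section PrincipalNilpotent.
Variables (K : acf) (n r : nat).
Variables (G B T : set 'M[K]_n) (a : 'I_6 -> 'M[K]_n -> K) (c : 'I_6 -> K -> 'M[K]_n).
Variables (Q : 'M[K]_n) (M : 'M[int]_(r, n)).
Hypotheses (hG : simple_group_of_type cartanE6 G B T a c) (rd : root_dat G T Q M).
Variables (al : 'I_6 -> 'rV[int]_r) (phi : 'I_6 -> 'M[K]_2 -> 'M[K]_n) (e f : 'I_6 -> 'M[K]_n).
Hypothesis ss : simple_system cartanE6 G B a c Q M al phi e f.
Notation tt := (tt Q M).
Notation cmb := (cmb al).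
Implicit Types (X Y Z v y z : 'M[K]_n).
Let mG : mxgroup G. by apply: simple_grp;case: hG. Qed.
Let RP := rt_positive hG (ltn0Sn 5) A2E6 rd tableE6P ss posE6_ok E6_inj.
Variables (x0 : 'rV[K]_r) (k : 'I_6 -> K).
Hypotheses (hx0 : forall i, ev (al i) x0 = 2%:R) (k0 : forall i, k i != 0).
Let e0 := \sum_i k i *: e i.
(** The grading element is a combination of simple coroots with coefficients [y]. Since [e_i, f_j] =
    0 for distinct nodes, the coefficients y_j / k_j make [e0, f0] equal to it. *)
Lemma principal_lowering : exists f0, [/\ lb e0 f0 = tt x0, lb (tt x0) f0 = - (2%:R *: f0) & nilp f0].
have [y hy]:= torus_solve rd tableE6P invE6_ok ss (fun=> 2%:R).
have ex: tt x0 = \sum_j y j *: tt (hc Q M (al j)).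
 sub0P.
 have ->: tt x0 - \sum_j y j *: tt (hc Q M (al j)) = tt (x0 - \sum_j y j *: hc Q M (al j)).
  rewrite -scaleN1r -[X in _ = tt (_ + X)]scaleN1r ttD ttZ;congr (_ + _ *: _).
  by elim/big_rec2: _=> [|j u v _ ->];rewrite ?ttD ?ttZ // -(scale0r (0 : 'rV[K]_r)) ttZ scale0r.
 apply: (tt_eq0 hG (ltn0Sn 5) A2E6 rd tableE6P invE6_ok ss posE6_ok)=> i.
 by rewrite -scaleN1r evDr evZr hx0 hy mulN1r subrr.
exists (\sum_j (y j / k j) *: f j);split.
- rewrite ex lb_suml;eqb=> i _;rewrite lb_sumr (bigD1 i) //= big1=> [|j ji].
  by rewrite addr0 lbZl lbZr (ss_ef ss) scalerA mulrC divfK.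
 by rewrite lbZl lbZr (lb_e_f hG (ltn0Sn 5) A2E6 rd tableE6P invE6_ok ss posE6_ok) ?scaler0 // eq_sym.
- rewrite lb_sumr scaler_sumr -sumrN;eqb=> i _;rewrite lbZr.
 have [_ ->]:= ss_f ss i;rewrite evNl hx0 scaleNr scalerN !scalerA mulrC //.
apply: (hgr_nilp (rd_unit rd) (s := - x0 *m map_mx intr M));apply: hgr_sum=> i _;apply: hgrZ.
apply: (@hgr_le _ _ _ _ 2 1)=> //;apply: (hgr_of_wt rd (ss_f ss i).2).
by rewrite evNl -scaleN1r evZr hx0 mulN1r opprK.
Qed.
(** The value of a root on [x0] is twice its height, hence not 0, so only the weight 0 is left. *)
Lemma regular_centralizer q : Lie G q -> lb (tt x0) q = 0 -> exists h, q = tt h.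
move=> Lq hq.
have Vc b: Lie G (wcomp Q M b q) /\ lb (tt x0) (wcomp Q M b q) = 0.
 apply: (@wcomp_sub _ _ _ _ _ _ _ rd [set v | Lie G v /\ lb (tt x0) v = 0])=> //.
  by move=> A1 A2' m' [h1 h2] [h3 h4];split;[exact: Lielin|rewrite lbDr lbZr h2 h4 scaler0 addr0].
 move=> h A1 [h1 h2];split;first by apply: Lie_lb=> //;exact: (tt_LieG rd).
 have tc: lb (tt x0) (tt h) = 0 by have [_ ->]:= tt_wsp rd h;rewrite ev0l scale0r.
 by rewrite jacobi tc lb0l add0r h2 lb0r.
have pos (s : seq int) : s \in posE6 -> ev (cmb s) x0 != 0.
 move=> sR;rewrite ev_cmbE;have ->: \sum_(i < 6) (s`_i)%:~R * ev (al i) x0 = (sht s)%:~R * 2%:R.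
  by rewrite (@sheightE 6) ?(size_pos posE6_ok) // rmorph_sum mulr_suml;eqb=> i _;rewrite hx0.
 rewrite mulf_neq0 ?pnatr_eq0 // intr_eq0.
 by move: s sR;apply/allP;vm_compute.
have wq: wsp G Q M 0 q.
 rewrite (wcomp_sum rd q);elim/big_rec: _=> [|b y _ hy];first exact: wsp0.
 apply: wspD=> //;have wb := wcompP rd b Lq.
 have [b0|b0]:= eqVneq b 0;first by rewrite b0 in wb *.
 have [->|w0]:= eqVneq (wcomp Q M b q) 0;first exact: wsp0.
 have rb: rt G Q M b by split=> //;exists (wcomp Q M b q).
 have [_ z0]:= Vc b;have [_ hb]:= wb;rewrite hb in z0;move/eqP: z0.
 rewrite scaler_eq0 (negPf w0) orbF=> /eqP z0.
 have [s sR [es|es]]:= RP rb;have /eqP := pos s sR;first by rewrite -es z0.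
 by rewrite -[cmb s]opprK -es evNl z0 oppr0.
exact: (wsp_torus rd wq).
Qed.
(** The eigencomponents of [z] are killed by [e0], so their eigenvalues are natural numbers by
    sl_2-theory. A component of eigenvalue 0 would be a torus element commuting with [e0], and the
    last hypothesis makes it 0. *)
Lemma centralizer_positive z : Lie G z -> lb e0 z = 0 -> (forall h, lb (tt h) e0 = 0 -> tt h = 0) ->
 hgr Q (x0 *m map_mx intr M) 1 z.
move=> Lz ez hc0;have uQ := rd_unit rd;have [f0 [ef hf nf0]]:= principal_lowering.
have he: lb (tt x0) e0 = 2%:R *: e0.
 rewrite lb_sumr scaler_sumr;eqb=> i _;rewrite lbZr.
 by have [_ ->]:= ss_e ss i;rewrite hx0 !scalerA mulrC.
pose V : set 'M[K]_n := [set v | Lie G v /\ lb e0 v = 0].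
have Vl (A1 A2 : 'M[K]_n) (m : K) : V A1 -> V A2 -> V (m *: A1 + A2).
 by move=> [h1 h2] [h3 h4];split;[exact: Lielin|rewrite lbDr lbZr h2 h4 scaler0 addr0].
have Vx A1: V A1 -> V (lb (tt x0) A1).
 move=> [h1 h2];split;first by apply: Lie_lb=> //;exact: (tt_LieG rd).
 by rewrite jacobi h2 lb0r addr0 lbC [lb e0 _]lbC he lbNr opprK lbZr [lb A1 _]lbC h2 oppr0 scaler0.
rewrite (qcomp_sum (x0 *m map_mx intr M) uQ z);apply: hgr_sum=> m _.
have [Lq eq0]: V (qcomp Q (x0 *m map_mx intr M) m z) by apply: (@qcomp_sub _ _ Q _ uQ V).
set q := qcomp _ _ _ _ in Lq eq0 *;have hq: lb (tt x0) q = m *: q by exact: lb_qcomp.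
have [->|q0]:= eqVneq q 0;first exact: hgr0.
have [N [eN _]]:= chain_nat ef hf nf0 q0 eq0 hq.
case: N eN=> [|N] eN;last first.
 move=> i j;rewrite /q /qcomp !mulmxA mulmxV // mul1mx mulmxK // mxE.
 by case: ifP=> [/eqP -> _|_];[rewrite eN;exists N.+1|rewrite eqxx].
exfalso;rewrite eN scale0r in hq.
have [h eh]:= regular_centralizer Lq hq.
by case/eqP: q0;rewrite eh;apply: hc0;rewrite -eh lbC eq0 oppr0.
Qed.
End PrincipalNilpotent.

(** * Open orbits for the nodes other than 4 *)

Section SphericalF4.
Variables (K : acf) (n r : nat).
Variables (G B T : set 'M[K]_n) (a : 'I_6 -> 'M[K]_n -> K) (c : 'I_6 -> K -> 'M[K]_n).
Variables (Q : 'M[K]_n) (M : 'M[int]_(r, n)).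
Hypotheses (hG : simple_group_of_type cartanE6 G B T a c) (rd : root_dat G T Q M).
Variables (al : 'I_6 -> 'rV[int]_r) (phi : 'I_6 -> 'M[K]_2 -> 'M[K]_n) (e f : 'I_6 -> 'M[K]_n).
Hypothesis ss : simple_system cartanE6 G B a c Q M al phi e f.
Notation tt := (tt Q M).
Notation cmb := (cmb al).
Implicit Types (Y Z v y z : 'M[K]_n).
Let sG : simple_group G. by case: hG. Qed.
Let mG : mxgroup G. exact: simple_grp. Qed.
Let aG : alg_group G. by case: hG=> -[[]]. Qed.
Variable X : 'I_6 -> 'M[K]_n.
Hypotheses (wX : forall i, wsp G Q M (al i) (X i)) (X0 : forall i, X i != 0).
Notation Y := (F4_root_vectors X).
Let s : K := (sqrtC 2)^-1.
Let s0 : s != 0. by rewrite invr_eq0 sqrtC_eq0 pnatr_eq0. Qed.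
Let x_ k : 'M[K]_n := X (inord k).
Lemma F4_vectorE : [/\ Y (inord 0) = x_ 1, Y (inord 1) = x_ 3, Y (inord 2) = s *: (x_ 2 + x_ 4) &
 Y (inord 3) = s *: (x_ 0 + x_ 5)].
by split;rewrite /F4_root_vectors inordK. Qed.
Let ord4 (P : 'I_4 -> Prop) : P (inord 0) -> P (inord 1) -> P (inord 2) -> P (inord 3) -> forall k, P k.
move=> h0 h1 h2 h3 [[|[|[|[|m]]]] hm] //;
 [move: h0|move: h1|move: h2|move: h3];congr P;apply: val_inj;by rewrite /= inordK.
Qed.
Let sum6 (V : nmodType) (F : 'I_6 -> V) :
 \sum_i F i = F (inord 0) + (F (inord 1) + (F (inord 2) + (F (inord 3) + (F (inord 4) + F (inord 5))))).
rewrite !big_ord_recl big_ord0 addr0;do ![congr (_ + _)];congr F;apply: val_inj;by rewrite /= inordK.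
Qed.
Lemma lb_tt_X h i : lb (tt h) (X i) = ev (al i) h *: X i. by have [_ ->]:= wX i. Qed.
Lemma X_free (k : 'I_6 -> K) : \sum_i k i *: X i = 0 -> forall i, k i = 0.
move=> h i;have [y hy]:= torus_solve rd tableE6P invE6_ok ss (fun j=> (j == i)%:R).
set u := \sum_j y j *: _ in hy;have {}hy : forall j, ev (al j) u = (j == i)%:R := hy.
have:= congr1 (lb (tt u)) h;rewrite lb0r lb_sumr (bigD1 i) //= big1=> [|j ji].
 rewrite lbZr lb_tt_X hy eqxx scale1r addr0=> /eqP.
 by rewrite scaler_eq0 (negPf (X0 i)) orbF=> /eqP.
by rewrite lbZr lb_tt_X hy (negPf ji) scale0r scaler0.
Qed.
Variable S : set 'M[K]_n.
Hypotheses (aS : alg_group S) (SG : S `<=` G) (SY : forall k, Lie S (Y k)).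
Variable St : set 'M[K]_n.
Hypotheses (StS : St `<=` Lie S) (St_comm : forall z z', St z -> St z' -> lb z z' = 0).
Hypothesis Stor : forall y : 'I_4 -> K, exists2 z, St z & forall k, lb z (Y k) = y k *: Y k.
Let mS : mxgroup S. by case: aS. Qed.
(** The six root vectors are independent, so an eigenvalue on a sum of two of them is the value of
    both simple roots. *)
Lemma torus_from_Y h (y : 'I_4 -> K) : (forall k, lb (tt h) (Y k) = y k *: Y k) ->
 forall b, ev (cmb b) h = (b`_1)%:~R * y (inord 0) + (b`_3)%:~R * y (inord 1) + (b`_2 + b`_4)%:~R * y (inord 2)
  + (b`_0 + b`_5)%:~R * y (inord 3).
move=> hy b;have [e0 e1 e2 e3]:= F4_vectorE.
pose k (i : 'I_6) : K := ev (al i) h - nth 0 [:: y (inord 3);y (inord 0);y (inord 2);y (inord 1);y (inord 2);y (inord 3)] i.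
have k0: \sum_i k i *: X i = 0.
 have q0 := hy (inord 0);have q1 := hy (inord 1);have q2 := hy (inord 2);have q3 := hy (inord 3).
 move: q0 q1 q2 q3;rewrite e0 e1 e2 e3 !lbZr !lbDr /x_ !lb_tt_X.
 rewrite ![y _ *: (s *: _)]scalerA ![y _ * s]mulrC -!scalerA=> q0 q1 /(scalerI s0) q2 /(scalerI s0) q3.
 rewrite sum6 /k !inordK //= !scalerBl q0 q1 !subrr.
 move: q2 q3;rewrite !scalerDr=> /eqP;rewrite -subr_eq0=> /eqP q2 /eqP;rewrite -subr_eq0=> /eqP q3.
 mxP=> p q;have:= congr1 (fun N : 'M[K]_n=> N p q) q2;have:= congr1 (fun N : 'M[K]_n=> N p q) q3.
 rewrite !mxE=> w3 w2;rewrite -(addr0 0) -[X in _ = X + _]w2 -[X in _ = _ + X]w3;ring.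
have kE i: ev (al i) h = nth 0 [:: y (inord 3);y (inord 0);y (inord 2);y (inord 1);y (inord 2);y (inord 3)] i.
 by sub0P;exact: (X_free k0).
by rewrite ev_cmbE sum6 !kE !inordK //= !intrD;ring.
Qed.
Variables (om : 'M[K]_n -> K) (P : set 'M[K]_n) (i : 'I_6).
Hypotheses (hom : forall j (z : K), z != 0 -> om (c j z) = z ^+ (i == j)) (hP : parabolic_of_weight G B T om P).
Hypothesis iok : (i : nat) \in [:: 0;1;2;4;5]%N.
(** The element [z] of [St] with eigenvalue 2 on all the [Y k] differs from the grading element [x0]
    by something that centralizes the [Y k]. This centralizer has positive degree, so [eliminate]
    provides [u] fixing the [Y k] and carrying [z] to [x0]. Then [Ad u] sends [St] into the
    centralizer of [x0], which is Lie T, and [open_at_mover] becomes applicable. *)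
Lemma spherical_point : exists2 x, G x & coset_space_open G P (left_orbit S (lcoset x P)).
have /choice [kap hkap]: forall j, exists k, X j = k *: e j.
 by move=> j;exact: (rt_line rd (rt_al ss j) (ss_e ss j) (ss_e0 ss j) (wX j)).
have kap0 j: kap j != 0 by apply: contraNneq (X0 j)=> k0;rewrite hkap k0 scale0r.
have eX: \sum_j X j = \sum_j kap j *: e j by eqb=> j _;exact: hkap.
have [f0 f1 f2 f3]:= F4_vectorE.
(* The factors undo the normalization by the square root of 2, so that all six root vectors appear:
   the sum is a principal nilpotent element. *)
have eY: \sum_j X j = Y (inord 0) + Y (inord 1) + s^-1 *: Y (inord 2) + s^-1 *: Y (inord 3).
 rewrite sum6 f0 f1 f2 f3 !scalerA mulVf // !scale1r /x_.
 by mxP=> p q;rewrite !mxE;ring.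
have [y0 hy0]:= torus_solve rd tableE6P invE6_ok ss (fun=> 2%:R).
set x0 := \sum_j y0 j *: _ in hy0.
have hx0: forall j, ev (al j) x0 = 2%:R := hy0.
have lbx0 k: lb (tt x0) (Y k) = 2%:R *: Y k.
 move: k;apply: ord4;rewrite ?f0 ?f1 ?f2 ?f3 ?lbZr ?lbDr /x_ !lb_tt_X !hx0 // -scalerDr !scalerA mulrC //.
pose V : set 'M[K]_n := [set v | Lie G v /\ forall k, lb (Y k) v = 0].
have Vl (A1 A2 : 'M[K]_n) (m : K) : V A1 -> V A2 -> V (m *: A1 + A2).
 move=> [h1 h2] [h3 h4];split;first exact: Lielin.
 by move=> k;rewrite lbDr lbZr h2 h4 scaler0 addr0.
have Vb A1 A2: V A1 -> V A2 -> V (lb A1 A2).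
 move=> [h1 h2] [h3 h4];split;first exact: Lie_lb.
 by move=> k;rewrite jacobi h2 h4 lb0l lb0r addr0.
have Vx A1: V A1 -> V (lb (tt x0) A1).
 move=> [h1 h2];split;first by apply: Lie_lb=> //;exact: (tt_LieG rd).
 by move=> k;rewrite jacobi h2 lb0r addr0 [lb (Y k) _]lbC lbx0 lbNl lbZl h2 scaler0 oppr0.
have Ve v: V v -> lb (\sum_j kap j *: e j) v = 0.
 by move=> [_ h];rewrite -eX eY !lbDl !lbZl !h !scaler0 !addr0.
have hc0 h: lb (tt h) (\sum_j kap j *: e j) = 0 -> tt h = 0.
 rewrite -eX lb_sumr=> h0;apply: (tt_eq0 hG (ltn0Sn 5) A2E6 rd tableE6P invE6_ok ss posE6_ok).
 by apply: X_free;rewrite -[RHS]h0;eqb=> j _;rewrite lb_tt_X.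
have Vh v: V v -> hgr Q (x0 *m map_mx intr M) 1 v.
 move=> Vv;apply: (centralizer_positive hG rd ss hx0 kap0 _ _ hc0);first by case: Vv.
 exact: Ve.
have [z Stz hz]:= Stor (fun=> 2%:R).
have LzG: Lie G z by apply: (Lie_sub SG);exact: StS.
have Vz: V (z - tt x0).
 split;first by apply: LieB=> //;exact: (tt_LieG rd).
 by move=> k;rewrite lbBr [lb _ z]lbC hz [lb _ (tt x0)]lbC lbx0 opprK addrC subrr.
have [u gu eu]:= eliminate (rd_unit rd) Vl Vb Vx Vh Vz.
have {eu} eu : Ad u z = tt x0 by rewrite -[RHS]eu;congr (Ad u _);rewrite addrC subrK.
have Gu: G u.
 by move: gu;apply: gen_sub=> // _ [A1 [VA nA] ->] _ [t _ <-];apply: (mexp_grp aG)=> //;case: VA.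
have uu := mxgrpU mG Gu.
have AuY k: Ad u (Y k) = Y k.
 elim: gu=> [|A1 C1 B1 gA IH [A2 [[_ hA] nA] ->] [t _ <-]];first exact: Ad1.
 have uA: A1 \in unitmx by apply: mxgrpU gA;exact: (mxgrp_gen (@gen_fam_vexp _ _ _)).
 rewrite AdM ?mexpU //;try exact: nilpZ.
 have e0: lb (t *: A2) (Y k) = 0 by rewrite lbZl lbC hA oppr0 scaler0.
 by rewrite Ad_mexp3 ?e0 ?lb0r ?scaler0 ?addr0 //;exact: nilpZ.
pose V1 : set 'M[K]_n := [set Ad u q | q in Lie S].
have V1l (k : K) v w : V1 v -> V1 w -> V1 (k *: v + w).
 by move=> [v' h1 <-] [w' h2 <-];exists (k *: v' + w');[exact: Lielin|rewrite AdD AdZ].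
have V1b v w: V1 v -> V1 w -> V1 (lb v w).
 by move=> [v' h1 <-] [w' h2 <-];exists (lb v' w');[exact: Lie_lb|rewrite Ad_lb].
have V1Y k: V1 (Y k) by exists (Y k);[exact: SY|exact: AuY].
have r1 (k : nat) (t : K) : (k < 6)%N -> t != 0 -> rsum G Q M al [:: unitv 6 k] (t *: x_ k).
 move=> k6 t0;have ->: unitv 6 k = unitv 6 (inord k : 'I_6) by rewrite inordK.
 apply: rsum1;first by rewrite cmb_unitv;apply: (wspZ _ (wX _)).
 by rewrite scaler_eq0 negb_or t0 X0.
have V1g L: L \in gensF4 -> suppd G Q M al posE6 V1 L.
 have n1: (1 : K) != 0 by rewrite oner_eq0.
 rewrite !inE=> /or4P [] /eqP ->;split;try by apply/allP;vm_compute.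
 - by exists (Y (inord 0))=> //;rewrite f0 -[x_ 1]scale1r;exact: r1.
 - by exists (Y (inord 1))=> //;rewrite f1 -[x_ 3]scale1r;exact: r1.
 - by exists (Y (inord 2))=> //;rewrite f2 scalerDr;exact: (rsum_cat (r1 2%N s isT s0) (r1 4%N s isT s0)).
 - by exists (Y (inord 3))=> //;rewrite f3 scalerDr;exact: (rsum_cat (r1 0%N s isT s0) (r1 5%N s isT s0)).
have V1t q0 q1 q2 q3: exists h, V1 (tt h) /\ forall b, ev (cmb b) h =
  (b`_1)%:~R * q0 + (b`_3)%:~R * q1 + (b`_2 + b`_4)%:~R * q2 + (b`_0 + b`_5)%:~R * q3.
 pose q (k : 'I_4) : K := nth 0 [:: q0;q1;q2;q3] k.
 have [z' Stz' hz']:= Stor q.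
 have LzG': Lie G z' by apply: (Lie_sub SG);exact: StS.
 (* [Ad u z'] commutes with [Ad u z], that is with [tt x0], so it lies in Lie T. *)
 have [h eh]:= regular_centralizer hG rd ss hx0 (q := Ad u z') (Lie_Ad mG Gu LzG')
  (etrans (esym (etrans (Ad_lb _ _ uu) (congr1 (fun w=> lb w (Ad u z')) eu))) (etrans (congr1 (Ad u) (St_comm Stz Stz')) (Ad0 u))).
 exists h;rewrite -eh;split;first by exists z'=> //;exact: StS.
 have:= @torus_from_Y h q;rewrite /q !inordK //=;apply=> k.
 by rewrite -eh -{1}(AuY k) -Ad_lb // hz' AdZ AuY.
have [w0 Gw0 [D1 D2 D3]]:= opposite_parabolic hG rd ss hom hP iok.
have jok: dual i \in [:: 0;1;2;4;5]%N by move: iok;rewrite !inE=> /or4P [|||/orP []] /eqP ->.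
have Dl (k : K) v w : [set Ad w0 q | q in Lie P] v -> [set Ad w0 q | q in Lie P] w -> [set Ad w0 q | q in Lie P] (k *: v + w).
 by move=> [v' h1 <-] [w' h2 <-];exists (k *: v' + w');[exact: Lielin|rewrite AdD AdZ].
have [Z [LZ nZ hZ]]:= open_at_mover hG rd ss jok V1l V1b Dl V1g V1t D1 D2 D3.
have GE: G (mexp Z) by rewrite -[Z]scale1r;exact: (mexp_grp aG).
have uE := mxgrpU mG GE;have [aP PG _ _ _]:= parabolicP hG rd ss hom hP.
have Gv: G (invmx (mexp Z *m u)) by apply: (mxgrpV mG);exact: (mxgrpM mG).
have uEu: mexp Z *m u \in unitmx by rewrite unitmx_mul uE.
have uw0 := mxgrpU mG Gw0.
(* Lie G is the sum of the conjugates of Lie S by [mexp Z *m u] and of Lie P by [w0]; conjugating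
   back by the inverse of the first gives the form required by [open_orbit]. *)
have Gx: G (invmx (mexp Z *m u) *m w0) by exact: (mxgrpM mG).
exists (invmx (mexp Z *m u) *m w0)=> //.
apply: (open_orbit (rd_exp rd) (simple_irreducible (rd_exp rd)) mG aS aP SG PG Gx)=> x Lx.
have [y [_ [[y' Ly' <-] [z' Lz' <-] ex]]]:= hZ _ (Lie_Ad mG (mxgrpM mG GE Gu) Lx).
exists y', z';split=> //;rewrite AdM ?unitmx_inv // -[x](AdVK _ uEu).
have ->: Ad (mexp Z *m u) x = Ad (mexp Z *m u) y' + Ad w0 z' by rewrite (AdM y' uE uu);exact: ex.
by rewrite AdD AdVK.
Qed.
End SphericalF4.

(** * Solvable subalgebras are small *)

Section LieCommutator.
Variables (K : acf) (n : nat) (G S : set 'M[K]_n).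
Hypotheses (mG : mxgroup G) (hexp : zcl (gen (exp_fam G)) = G) (mS : mxgroup S) (SG : S `<=` G).
(** Commutators of a fixed [g] with elements near 1 have tangent vectors Ad g Y - Y; this, as a
    function of [g], is differentiated at 1 in the direction [X]. *)
Lemma Lie_commutator X Y : Lie S X -> Lie S Y -> Lie (commutator_group S) (lb X Y).
move=> LX LY;have G1 := mxgrp1 mG;have S1 := mxgrp1 mS.
have cS g h: S g -> S h -> commutator_group S (g *m h *m invmx g *m invmx h) by move=> Sg Sh D mD;apply.
have adj1 A: G A -> mev (\adj (gmx K n)) A = invmx A.
 move=> gA;rewrite /invmx (mxgrpU mG gA) (det1G hexp gA) invr1 scale1r.
 by mxP=> i j;rewrite mxE mxeval_adj.
have step1 p g: (forall A, commutator_group S A -> mxeval p A = 0) -> S g -> dmx p 1%:M (Ad g Y - Y) = 0.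
 move=> hp Sg;have ug := mxgrpU mS Sg.
 pose N := cmx (n * n) g *m gmx K n *m cmx _ (invmx g) *m \adj (gmx K n).
 have mN A: G A -> mev N A = g *m A *m invmx g *m invmx A.
  by move=> gA;rewrite !mevM !mev_c mev_g adj1.
 have /LieP/(_ (psub N p)) := LY;rewrite dmx_psubst mN // invmx1 !mulmx1 mulmxV //.
 have ->: dev N 1%:M Y = Ad g Y - Y.
  rewrite !dev_mul !dev_c dev_g !mevM !mev_c mev_g mul0mx add0r mulmx0 addr0 adj1 // invmx1 !mulmx1.
  have:= dev_adj mG hexp G1 (Lie_sub SG LY);rewrite mul1mx invmx1 mulmx1=> ->.
  by rewrite mulmxV // mul1mx.
 by apply=> A SA;rewrite mxevps mN;[apply: hp;exact: cS|exact: SG].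
apply/LieP=> p hp.
pose N := gmx K n *m cmx (n * n) Y *m \adj (gmx K n).
pose q := \sum_k (mxeval p^`M(k) 1%:M)%:MP * mxvec N 0 k - (dmx p 1%:M Y)%:MP.
have vecE (F : {mpoly K[n * n]} -> K) k : F (mxvec N 0 k) = mxvec (map_mx F N) 0 k.
 by case/mxvec_indexP: k=> i j;rewrite !mxvecE [RHS]mxE.
have qE A: mxeval q A = dmx p 1%:M (mev N A) - dmx p 1%:M Y.
 rewrite /mxeval mevalB mevalC raddf_sum;congr (_ - _);eqb=> k _.
 by rewrite /= mevalM mevalC -/(mxeval _ A) (vecE (fun r=> mxeval r A)).
have dq: dmx q 1%:M X = dmx p 1%:M (dev N 1%:M X).
 have dsum (s : seq 'I_(n * n)) F : dmx (\sum_(k <- s) F k) 1%:M X = \sum_(k <- s) dmx (F k) 1%:M X.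
  elim/big_rec2: _=> [|k y1 y2 _ <-];last by rewrite dmxD.
  by rewrite -(mpolyC0) dmxC.
 rewrite /q -[X in _ + X]mpolyCN dmxD dmxC addr0 dsum;eqb=> k _.
 by rewrite dmxM dmxC mul0r add0r (vecE (fun r=> dmx r 1%:M X)) /mxeval mevalC.
have /LieP/(_ q) := LX;rewrite dq -[in dev _ _ X](mul1mx X) (dev_Ad mG hexp) //;last exact: (Lie_sub SG).
rewrite Ad1;apply=> A SA;rewrite qE (mev_Ad mG hexp) //;last exact: SG.
by rewrite -linearB /=;exact: step1.
Qed.
End LieCommutator.
Lemma Lie_trivial (K : acf) n (X : 'M[K]_n) : Lie [set 1%:M] X -> X = 0.
move=> /LieP h;mxP=> i j;rewrite [RHS]mxE.
have:= h ('X_(mxi i j) - ((1%:M : 'M[K]_n) i j)%:MP).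
rewrite -mpolyCN dmxD dmxC addr0 dmxX;apply=> A ->.
by rewrite mxevalD mxevalX /mxeval mevalC subrr.
Qed.
(** A pair with the properties [P1] and [P2] reproduces itself in the Lie algebra of the next
    commutator group, through brackets with [X, Y]. It would survive down to the trivial group,
    whose Lie algebra is 0. *)
Lemma no_solvable_triple (K : acf) n (G S : set 'M[K]_n) (P1 P2 : 'M[K]_n -> Prop) :
 mxgroup G -> zcl (gen (exp_fam G)) = G -> mxgroup S -> S `<=` G -> mx_solvable S ->
 (forall X Y, P1 X -> P2 Y -> P1 (lb (lb X Y) X) /\ P2 (lb (lb X Y) Y)) -> ~ P1 0 ->
 forall X Y, Lie S X -> Lie S Y -> P1 X -> P2 Y -> False.
move=> mG hexp mS SG [k hk] hP P10 X Y LX LY PX PY.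
suff [X' LX' [Y' _ [PX' _]]]: exists2 X', Lie (iter k (@commutator_group K n) S) X' &
  exists2 Y', Lie (iter k (@commutator_group K n) S) Y' & P1 X' /\ P2 Y'.
 by move: LX';rewrite hk=> /Lie_trivial X0;rewrite X0 in PX'.
elim: k {hk}=> [|k [X' LX' [Y' LY' [PX' PY']]]];first by exists X=> //;exists Y.
have [mSk SkG]: mxgroup (iter k (@commutator_group K n) S) /\ iter k (@commutator_group K n) S `<=` G.
 elim: k {X' Y' LX' LY' PX' PY'}=> [|k [mk kG]] //=.
 by have [h1 h2]:= commutator_grp mk;split=> // A /h2 /kG.
have [h1 h2]:= hP _ _ PX' PY'.
have Lc := Lie_lb mSk LX' LY'.
by exists (lb (lb X' Y') X');[|exists (lb (lb X' Y') Y')]=> //;exact: (Lie_commutator mG hexp mSk SkG).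
Qed.

Section SmallSolvable.
Variables (K : acf) (n r : nat).
Variables (G B T : set 'M[K]_n) (a : 'I_4 -> 'M[K]_n -> K) (c : 'I_4 -> K -> 'M[K]_n).
Variables (Q : 'M[K]_n) (M : 'M[int]_(r, n)).
Hypotheses (hG : simple_group_of_type cartanF4 G B T a c) (rd : root_dat G T Q M).
Variables (al : 'I_4 -> 'rV[int]_r) (phi : 'I_4 -> 'M[K]_2 -> 'M[K]_n) (e f : 'I_4 -> 'M[K]_n).
Hypothesis ss : simple_system cartanF4 G B a c Q M al phi e f.
Notation tt := (tt Q M).
Notation wsp := (wsp G Q M).
Notation cmb := (cmb al).
Notation rt := (rt G Q M).
Implicit Types (X Y Z v : 'M[K]_n) (m : int) (s : seq int).
Let uQ := rd_unit rd.
Let mG : mxgroup G. by apply: simple_grp;case: hG. Qed.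
Lemma A2F4 i : cartanF4 i i = 2. by case: i=> [[|[|[|[|i]]]] hi] //;rewrite mxE. Qed.
Let RA := rt_pos hG (ltn0Sn 3) A2F4 rd tableF4P ss posF4_ok F4_inj.
Let RP := rt_positive hG (ltn0Sn 3) A2F4 rd tableF4P ss posF4_ok F4_inj.

(* The weights 1, 10, 100, 1000 separate the roots, whose coefficients are at most 4. *)
Definition level s : int := s`_0 + 10 * (s`_1 + 10 * (s`_2 + 10 * s`_3)).
Lemma level_sep : all (fun s=> (0 < level s) && all (fun t=> (level s == level t) ==> (s == t)) posF4) posF4.
by vm_compute. Qed.
Variable x0 : 'rV[K]_r.
Hypothesis hx0 : forall i, ev (al i) x0 = 10%:R ^+ i.
Lemma ev_level s : ev (cmb s) x0 = (level s)%:~R.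
rewrite ev_cmbE;under eq_bigr=> i _ do rewrite hx0.
rewrite -(big_mkord xpredT (fun i=> (s`_i)%:~R * 10%:R ^+ i)) /index_iota [iota _ _]/= !big_cons big_nil /level.
by rewrite !rmorphD /= !rmorphM /= !rmorphD /= !rmorphM /= !rmorphD /= !rmorphM /= !exprS expr0;ring.
Qed.
Let mu := x0 *m map_mx intr M.
Definition below m Y := forall i j, (Q *m Y *m invmx Q) i j != 0 ->
 exists2 p : int, mu 0 i - mu 0 j = p%:~R & p <= m.
Lemma belowD m Y Z : below m Y -> below m Z -> below m (Y + Z).
move=> hY hZ i j;rewrite mulmxDr mulmxDl mxDE=> nz.
by have [z|/hY //]:= eqVneq ((Q *m Y *m invmx Q) i j) 0;apply: hZ;move: nz;rewrite z add0r.
Qed.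
Lemma belowZ m (k : K) Y : below m Y -> below m (k *: Y).
move=> hY i j;rewrite -scalemxAr -scalemxAl mxZE=> nz;apply: hY.
by apply: contraNneq nz=> ->;rewrite mulr0.
Qed.
Lemma belowM m m' Y Z : below m Y -> below m' Z -> below (m + m') (Y *m Z).
move=> hY hZ i j;have ->: Q *m (Y *m Z) *m invmx Q = (Q *m Y *m invmx Q) *m (Q *m Z *m invmx Q).
 by rewrite !mulmxA mulmxKV.
rewrite mxE=> nz;have [k nk]: exists k, (Q *m Y *m invmx Q) i k * (Q *m Z *m invmx Q) k j != 0.
 apply/existsP;apply: contraNT nz=> /existsPn h;rewrite big1 // => k _;exact/eqP/negPn/h.
move: nk;rewrite mulf_eq0 negb_or=> /andP [/hY [p ep lp] /hZ [q eq lq]].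
exists (p + q);first by rewrite intrD -ep -eq;ring.
exact: lerD.
Qed.
Lemma below_lb m m' Y Z : below m Y -> below m' Z -> below (m + m') (lb Y Z).
by move=> hY hZ;apply: belowD;[exact: belowM|rewrite -scaleN1r addrC;apply: belowZ;exact: belowM].
Qed.
Lemma below_le m m' Y : m <= m' -> below m Y -> below m' Y.
by move=> le hY i j /hY [p ep lp];exists p=> //;exact: le_trans le. Qed.
Lemma below_wsp b m Y : wsp b Y -> ev b x0 = m%:~R -> below m Y.
by move=> [_ /(wtP rd) hY] eb i j /hY ij;exists m=> //;rewrite -ev_wij ij. Qed.
Definition leads b m X := exists2 v, wsp b v /\ v != 0 & below (m - 1) (X - v).
Let drop4 (V : zmodType) (p q t : V) : p + q + t - p = q + t.
by rewrite [p + q]addrC -!addrA [t - p]addrC addNKr. Qed.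
(** Modulo lower levels [X, Y] is a nonzero multiple of the coroot, which acts on both leading terms
    by nonzero scalars. *)
Lemma leads_bracket b m : rt b -> ev b x0 = m%:~R -> forall X Y, leads b m X -> leads (- b) (- m) Y ->
 leads b m (lb (lb X Y) X) /\ leads (- b) (- m) (lb (lb X Y) Y).
move=> rb eb X Y [v [wv v0] hX] [w [ww w0] hY].
have eNb: ev (- b) x0 = (- m)%:~R by rewrite evNl eb rmorphN.
have bv := below_wsp wv eb;have bw := below_wsp ww eNb.
have [w1 [ww1 ew1 h1 h2 _]]:= rt_triple rd rb wv v0.
have [k ek]: exists k, w = k *: w1.
 apply: (rt_line rd (rtN rd rb) ww1 _ ww);apply: contraNneq v0=> z.
 by move: h1;rewrite -ew1 z lb0r lb0l=> /esym/eqP;rewrite scaler_eq0 pnatr_eq0.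
have k0: k != 0 by apply: contraNneq w0=> z;rewrite ek z scale0r.
set X' := X - v in hX;set Y' := Y - w in hY.
have eX: X = v + X' by rewrite addrC subrK.
have eY: Y = w + Y' by rewrite addrC subrK.
clearbody X' Y'.
have h0: below (-1) (lb X Y - lb v w).
 rewrite eX eY lbDl !lbDr drop4.
 apply: belowD;last apply: belowD.
 - by apply: below_le (below_lb bv hY);lia.
 - by apply: below_le (below_lb hX bw);lia.
 - by apply: below_le (below_lb hX hY);lia.
have bh: below 0 (lb v w) by apply: below_le (below_lb bv bw);lia.
set Z' := lb X Y - lb v w in h0;have eZ: lb X Y = lb v w + Z' by rewrite addrC subrK.
clearbody Z'.
have hvw: lb v w = k *: tt (hc Q M b) by rewrite ek lbZr ew1.
split.
 exists (lb (lb v w) v);first split.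
 - by rewrite hvw lbZl h1;apply: wspZ;exact: wspZ.
 - by rewrite hvw lbZl h1 !scaler_eq0 !negb_or k0 pnatr_eq0.
 rewrite eZ eX lbDl !lbDr drop4;apply: belowD;last apply: belowD.
 - by apply: below_le (below_lb bh hX);lia.
 - by apply: below_le (below_lb h0 bv);lia.
 - by apply: below_le (below_lb h0 hX);lia.
exists (lb (lb v w) w);first split.
- by rewrite hvw lbZl ek lbZr h2;apply: wspZ;apply: wspZ;rewrite -scaleNr;exact: wspZ.
- rewrite hvw lbZl ek lbZr h2 !scaler_eq0 oppr_eq0 !scaler_eq0 !negb_or k0 pnatr_eq0 /=.
 by apply: contraNneq w0=> z;rewrite ek z scaler0.
rewrite eZ eY lbDl !lbDr drop4;apply: belowD;last apply: belowD.
- by apply: below_le (below_lb bh hY);lia.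
- by apply: below_le (below_lb h0 bw);lia.
- by apply: below_le (below_lb h0 hY);lia.
Qed.
Lemma not_leads0 b m : ev b x0 = m%:~R -> ~ leads b m 0.
move=> eb [v [wv v0]];rewrite sub0r=> h.
have [[i j] /= nz]: exists ij : 'I_n * 'I_n, (Q *m v *m invmx Q) ij.1 ij.2 != 0.
 apply/existsP;apply: contraNT v0=> /existsPn h0;apply/eqP.
 have : Q *m v *m invmx Q = 0 by mxP=> i j;rewrite [RHS]mxE;apply/eqP/negPn/(h0 (i, j)).
 by move/(congr1 (fun N=> invmx Q *m N *m Q));rewrite !mulmxA mulVmx // mul1mx mulmxKV // mulmx0 mul0mx.
have [_ /(wtP rd)/(_ i j nz) ij]:= wv.
have [|p ep]:= h i j.
 by rewrite mulmxN mulNmx mxE oppr_eq0.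
by rewrite -ev_wij ij eb in ep;move/(@intr_inj K): ep=> <-;lia.
Qed.
Variable S : set 'M[K]_n.
Hypotheses (mS : mxgroup S) (SG : S `<=` G) (sS : mx_solvable S).
Lemma no_opposite_leads b m X Y : rt b -> ev b x0 = m%:~R -> Lie S X -> Lie S Y ->
 leads b m X -> leads (- b) (- m) Y -> False.
move=> rb eb;apply: (no_solvable_triple mG (rd_exp rd) mS SG sS).
 by move=> X1 Y1;exact: leads_bracket.
exact: not_leads0.
Qed.
(** Distinct roots have distinct levels, none of them 0, so the component of highest level is a
    single one. *)
Lemma leads_exists X : Lie G X -> X != 0 ->
 (exists2 h, tt h != 0 & below (-1) (X - tt h)) \/
 (exists2 s, s \in posF4 & leads (cmb s) (level s) X \/ leads (- cmb s) (- level s) X).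
move=> LX X0;pose L := [seq b <- wlist M | wcomp Q M b X != 0].
have lv1 b: b \in L -> exists m, ev b x0 = m%:~R /\ (b = 0 /\ m = 0 \/ exists2 s, s \in posF4 &
  b = cmb s /\ m = level s \/ b = - cmb s /\ m = - level s).
 rewrite mem_filter=> /andP [nz _];have [b0|b0]:= eqVneq b 0.
  by exists 0;split;[rewrite b0 ev0l|left].
 have rb: rt b by split=> //;exists (wcomp Q M b X)=> //;exact: (wcompP rd).
 have [s sR [es|es]]:= RP rb.
  by exists (level s);rewrite es ev_level;split=> //;right;exists s=> //;left.
 by exists (- level s);rewrite es evNl ev_level rmorphN;split=> //;right;exists s=> //;right.
pose lv b : int := xget 0 [set m | ev b x0 = m%:~R].
have lvE b: b \in L -> ev b x0 = (lv b)%:~R.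
 by move=> /lv1 [m [em _]];apply: (@xgetPex _ 0 [set m : int | ev b x0 = m%:~R]);exists m.
have lv2 b: b \in L -> b = 0 /\ lv b = 0 \/ exists2 s, s \in posF4 &
  b = cmb s /\ lv b = level s \/ b = - cmb s /\ lv b = - level s.
 move=> bL;have [m [em h]]:= lv1 b bL;suff ->: lv b = m by [].
 by apply: (@intr_inj K);rewrite -lvE.
have /allP sep := level_sep.
have inj b b': b \in L -> b' \in L -> lv b = lv b' -> b = b'.
 move=> /lv2 h /lv2 h' el;case: h=> [[eb e1]|[s sR h]];case: h'=> [[eb' e2]|[s' sR' h']].
 - by rewrite eb eb'.
 - by have /andP [p _]:= sep _ sR';case: h'=> -[_ e2];move: p;lia.
 - by have /andP [p _]:= sep _ sR;case: h=> -[_ e1];move: p;lia.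
 have /andP [p /allP/(_ s' sR')/implyP q]:= sep _ sR;have /andP [p' _]:= sep _ sR'.
 case: h=> -[eb e1];case: h'=> -[eb' e2];try by move: p p';lia.
  by rewrite eb eb' (eqP (q _)) //;apply/eqP;lia.
 by rewrite eb eb' (eqP (q _)) //;apply/eqP;lia.
have [b0 b0L bmax]: exists2 b0, b0 \in L & forall b, b \in L -> lv b <= lv b0.
 have : L != [::].
  apply: contraNneq X0=> L0;rewrite (wcomp_sum rd X) big1_seq // => b /= bw.
  apply/eqP/negPn/negP=> nz;have : b \in L by rewrite mem_filter nz.
  by rewrite L0.
 elim: (L)=> // b [|b1 L'] IH _;first by exists b;rewrite ?mem_head // => b';rewrite inE=> /eqP ->.
 have [b0 b0L h]:= IH isT;have [le|lt]:= leP (lv b) (lv b0).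
  by exists b0;rewrite 1?inE ?b0L ?orbT // => b';rewrite inE=> /predU1P [->|/h].
 exists b;first exact: mem_head.
 by move=> b';rewrite inE=> /predU1P [-> //|/h];move: lt;lia.
have low: below (lv b0 - 1) (X - wcomp Q M b0 X).
 have b0w: b0 \in wlist M by move: b0L;rewrite mem_filter=> /andP [].
 rewrite {1}(wcomp_sum rd X) (bigD1_seq b0) //=;last exact: undup_uniq.
 rewrite [X in below _ X]addrC addKr;elim/big_ind: _;first by move=> i j;rewrite mulmx0 mul0mx mxE eqxx.
  by move=> *;exact: belowD.
 move=> b bb;have [->|nz]:= eqVneq (wcomp Q M b X) 0;first by move=> i j;rewrite mulmx0 mul0mx mxE eqxx.
 have wb := wcompP rd b LX.
 have bL: b \in L by rewrite mem_filter nz (wt_wlist rd wb.2 nz).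
 apply: below_le (below_wsp wb (lvE _ bL));have:= bmax _ bL.
 by rewrite le_eqVlt=> /orP [/eqP /(inj _ _ bL b0L) eb|];[by rewrite eb eqxx in bb|lia].
have w0 := wcompP rd b0 LX.
have nz0: wcomp Q M b0 X != 0 by move: b0L;rewrite mem_filter=> /andP [].
case: (lv2 _ b0L)=> [[e0 l0]|[s sR h]].
 left;rewrite e0 in w0 nz0 low;have [h eh]:= wsp_torus rd w0;exists h;first by rewrite -eh.
 by rewrite -eh -[-1]add0r -{1}l0 e0.
by right;exists s=> //;case: h=> -[e1 e2];[left|right];rewrite -e1 -e2;exists (wcomp Q M b0 X).
Qed.
(** Only one of the two roots of opposite sign can occur as a leading root in the solvable algebra,
    and a matrix entry that is nonzero on its root line detects it. *)
Lemma lead_entry s : s \in posF4 -> exists pq : 'I_n * 'I_n, forall X, Lie S X ->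
 leads (cmb s) (level s) X \/ leads (- cmb s) (- level s) X -> (Q *m X *m invmx Q) pq.1 pq.2 != 0.
move=> sR;have es := ev_level s;have esN: ev (- cmb s) x0 = (- level s)%:~R by rewrite evNl es rmorphN.
have entry b m: rt b -> ev b x0 = m%:~R -> exists pq : 'I_n * 'I_n, forall X, leads b m X ->
  (Q *m X *m invmx Q) pq.1 pq.2 != 0.
 move=> rb eb;have [_ [v wv v0]]:= rb.
 have [[i j] /= nz]: exists ij : 'I_n * 'I_n, (Q *m v *m invmx Q) ij.1 ij.2 != 0.
  apply/existsP;apply: contraNT v0=> /existsPn h0;apply/eqP.
  have : Q *m v *m invmx Q = 0 by mxP=> i j;rewrite [RHS]mxE;apply/eqP/negPn/(h0 (i, j)).
  by move/(congr1 (fun N=> invmx Q *m N *m Q));rewrite !mulmxA mulVmx // mul1mx mulmxKV // mulmx0 mul0mx.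
 exists (i, j)=> X [w [ww w0] hX] /=;have [_ /(wtP rd)/(_ i j nz) ij]:= wv.
 have [k ek]:= rt_line rd rb wv v0 ww.
 apply/eqP=> z;have [|p ep lp]:= hX i j.
  rewrite mulmxBr mulmxBl mxDE z add0r mxE oppr_eq0 ek -scalemxAr -scalemxAl mxZE mulf_neq0 //.
  by apply: contraNneq w0=> k0;rewrite ek k0 scale0r.
 by rewrite -ev_wij ij eb in ep;move/(@intr_inj K): ep=> ep;move: lp;rewrite -ep;lia.
have rs := RA sR.
have [[X0 LX0 h0]|no]:= pselect (exists2 X, Lie S X & leads (cmb s) (level s) X).
 have [pq hpq]:= entry _ _ rs es;exists pq=> X LX [/hpq //|hX].
 by case: (no_opposite_leads rs es LX0 LX h0 hX).
have [pq hpq]:= entry _ _ (rtN rd rs) esN;exists pq=> X LX [hX|/hpq //].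
by case: no;exists X.
Qed.
Lemma below_trace p X (h : 'rV[K]_r) : p < 0 -> below p X -> \tr (tt h *m X) = 0.
move=> p0 hX;set D := h *m map_mx intr M.
have ->: \tr (tt h *m X) = \tr (diag_mx D *m (Q *m X *m invmx Q)).
 by rewrite /tt /qdiag -/D -!mulmxA mxtrace_mulC -!mulmxA.
rewrite /mxtrace big1 // => i _;rewrite mul_diag_mx mxE.
have [->|/hX [p' e' l']]:= eqVneq ((Q *m X *m invmx Q) i i) 0;first by rewrite mulr0.
move: e';rewrite subrr=> /esym/eqP;rewrite (_ : 0 = 0%:~R) // intr_eq0=> /eqP e'.
by move: p0 l';rewrite e'=> p0 l';have:= le_lt_trans l' p0;rewrite ltxx.
Qed.
(** The linear forms are 24 entries, one for each positive root, and 4 traces against simple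
    coroots. A nonzero element has its leading term in a root space, where an entry sees it, or in
    Lie T, where a trace does. *)
Lemma solvable_dependent N (Xs : 'I_N -> 'M[K]_n) : (28 < N)%N -> (forall j, Lie S (Xs j)) ->
 exists2 u : 'rV[K]_N, u != 0 & \sum_j u 0 j *: Xs j = 0.
move=> hN LX.
have hs (j : 'I_24) : nth [::] posF4 j \in posF4 by apply: mem_nth;exact: ltn_ord.
have /choice [pq hpq]: forall j : 'I_24, exists pq : 'I_n * 'I_n, forall X, Lie S X ->
  leads (cmb (nth [::] posF4 j)) (level (nth [::] posF4 j)) X \/
  leads (- cmb (nth [::] posF4 j)) (- level (nth [::] posF4 j)) X ->
  (Q *m X *m invmx Q) pq.1 pq.2 != 0.
 by move=> j;exact: lead_entry.
pose A1 : 'M[K]_(N, 24) := \matrix_(j, k) (Q *m Xs j *m invmx Q) (pq k).1 (pq k).2.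
pose A2 : 'M[K]_(N, 4) := \matrix_(j, k) \tr (tt (hc Q M (al k)) *m Xs j).
have [u u0 uA]: exists2 u : 'rV[K]_N, u != 0 & u *m row_mx A1 A2 = 0.
 have k0: kermx (row_mx A1 A2) != 0.
  rewrite -mxrank_eq0 mxrank_ker subn_eq0 -ltnNge;exact: leq_ltn_trans (rank_leq_col _) hN.
 by case/rowV0Pn: k0=> u /sub_kermxP uA u0;exists u.
exists u=> //;set Y := \sum_j _.
have LY: Lie S Y by apply: Lie_sum=> j _;exact: LieZ.
move: uA;rewrite mul_mx_row -[X in _ = X](@row_mx0 _ 1 24 4)=> /eq_row_mx [uA1 uA2].
apply/eqP/negPn/negP=> Y0;case: (leads_exists (Lie_sub SG LY) Y0)=> [[h h0 low]|[s sR hl]].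
 move/eqP: h0;apply;apply: (tt_eq0 hG (ltn0Sn 3) A2F4 rd tableF4P invF4_ok ss posF4_ok)=> k.
 have [k' [k'0 hk']]:= coroot_norm rd (rt_al ss k).
 have : \tr (tt (hc Q M (al k)) *m Y) = 0.
  rewrite /Y mulmx_sumr raddf_sum /=;have:= congr1 (fun v : 'rV[K]_4=> v 0 k) uA2.
  rewrite !mxE=> {2}<-;eqb=> j _;by rewrite mxE -scalemxAr linearZ.
 rewrite -(subrK (tt h) Y) mulmxDr linearD /= (below_trace _ _ low) // add0r=> tr0.
 have:= hk' h;rewrite tr0 mulr0=> /esym/eqP;rewrite mulf_eq0 pnatr_eq0=> /orP [/eqP z|/eqP //].
 by rewrite z in k'0.
have sI: (index s posF4 < 24)%N by rewrite -(_ : size posF4 = 24%N) ?index_mem.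
have:= hpq (Ordinal sI) Y LY;rewrite /= nth_index // => /(_ hl) /eqP;apply.
transitivity ((u *m A1) 0 (Ordinal sI));last by rewrite uA1 mxE.
rewrite [RHS]mxE /Y mulmx_sumr mulmx_suml summxE;eqb=> j _.
by rewrite -scalemxAr -scalemxAl mxZE [A1 _ _]mxE.
Qed.
End SmallSolvable.

Section CurveTangent.
Variables (K : acf) (n : nat) (G S P : set 'M[K]_n) (x y X : 'M[K]_n).
Hypotheses (hexp : zcl (gen (exp_fam G)) = G) (mG : mxgroup G).
Hypotheses (aS : alg_group S) (aP : alg_group P) (SG : S `<=` G) (PG : P `<=` G).
Hypotheses (Gx : G x) (Gy : G y) (nX : nilp X).
Notation N := ((n + 1) * (n + 1))%N.
Let last : 'I_(n + 1) := rshift n ord0.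
Let hh (p : {poly K}) : {mpoly K[N]} := (map_poly (@mpolyC N K) p).['X_(mxi last last)].
Let M1 : 'M[{mpoly K[N]}]_n := \matrix_(i, j) 'X_(mxi (lshift 1 i) (lshift 1 j)).
Let M2 := cmx N (invmx x) *m M1 *m cmx N y *m map_mx hh (pexp X).

(* [generic_smoothness] is applied to the pairs [(b, t)] with [b] in [S] and
   [x^-1 b y exp(t X)] in [P], stored as block diagonal matrices. *)
Lemma tangent_on_curve (s : {poly K}) : s != 0 ->
 (forall t, s.[t] != 0 -> exists b q, [/\ S b, P q & y *m mexp (t *: X) = b *m x *m q]) ->
 exists t Y Z, [/\ s.[t] != 0, Lie S Y, Lie P Z & X = Ad (invmx (y *m mexp (t *: X))) Y + Z].
move=> s0 hs;have mS: mxgroup S by case: aS.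
have mP: mxgroup P by case: aP.
have ux := mxgrpU mG Gx;have uy := mxgrpU mG Gy.
have eM1 (w : 'M[K]_(n + 1)) : map_mx (meval (mxvec w 0)) M1 = ulsubmx w.
 by mxP=> i j;rewrite !mxE mevalXU mxvecE.
have ehh (w : 'M[K]_(n + 1)) p : (hh p).@[mxvec w 0] = p.[w last last].
 rewrite /hh horner_coef raddf_sum /= horner_coef size_map_poly.
 by eqb=> i _;rewrite mevalM coef_map /= mevalC rmorphXn /= mevalXU mxvecE.
have eM2 (w : 'M[K]_(n + 1)) : map_mx (meval (mxvec w 0)) M2 =
  invmx x *m ulsubmx w *m y *m mexp (w last last *: X).
 rewrite /M2 !map_mxM eM1 -hpexp //;congr (_ *m _ *m _ *m _).
 - by rewrite /cmx -map_mx_comp;apply: map_mx_id=> c;exact: mevalC.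
 - by rewrite /cmx -map_mx_comp;apply: map_mx_id=> c;exact: mevalC.
 - by rewrite /hmx -map_mx_comp;apply: eq_map_mx=> p;exact: ehh.
pose Z : set 'rV[K]_N := [set w | S (map_mx (meval (w 0)) M1) /\ P (map_mx (meval (w 0)) M2)].
have [p p0|z [xi [hz ft st]]]:= @generic_smoothness K N Z 'X_(mxi last last) s _ s0.
 have [m]:= poly_nonroot (mulf_neq0 p0 s0);set t : K := m%:R;clearbody t;rewrite hornerM mulf_eq0 negb_or=> /andP [pt /hs [b [q [Sb Pq e]]]].
 have ub := mxgrpU mS Sb.
 (* The equation is used as x^-1 b^-1 y exp(tX) = q, so it is the inverse of [b] that enters the
    pair. *)
 exists (mxvec (block_mx (invmx b) 0 0 (t%:M : 'M_1))).
  rewrite /Z /= eM1 eM2 block_mxKul -mulmxA;split;first exact: mxgrpV.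
  rewrite block_mxEdr mxE eqxx mulr1n -mulmxA e !mulmxA mulmxKV // mulVmx // mul1mx;exact: Pq.
 by rewrite mevalXU mxvecE block_mxEdr mxE eqxx mulr1n.
have ez (v : 'I_N -> K) : v = mxvec (\matrix_(i, j) v (mxi i j)) 0.
 by apply/funext;case/mxvec_indexP=> i j;rewrite mxvecE mxE.
set A : 'M[K]_(n + 1) := \matrix_(i, j) z (mxi i j).
set D : 'M[K]_(n + 1) := \matrix_(i, j) xi (mxi i j).
(* The line through the point in the tangent direction: conditions on the tangent vector become
   derivatives at 0 along it. *)
pose gg : 'M[{poly K}]_(n + 1) := map_mx polyC A + 'X *: map_mx polyC D.
have gg0: hmx 0 gg = A.
 by mxP=> i j;rewrite [LHS]mxE /hev !mxE !hornerE.
have gg1: hmx 0 (dermx gg) = D.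
 mxP=> i j;rewrite [LHS]mxE /hev mxE mxDE mxZE [map_mx _ _ i j]mxE [map_mx _ D i j]mxE.
 by rewrite derivD derivC add0r derivM derivX derivC mulr0 addr0 mul1r hornerC.
have dz (q : {mpoly K[N]}) : \sum_i (q^`M(i)).@[z] * xi i = dmx q A D.
 by rewrite /dmx {1}(ez z) {1}(ez xi).
pose ph := mmap (@polyC K) (fun k=> mxvec gg 0 k).
have key (W : set 'M[K]_n) MM : alg_group W -> W `<=` G ->
  (forall w, Z w -> W (map_mx (meval (w 0)) MM)) ->
  W (hmx 0 (map_mx ph MM)) /\
  Lie W (invmx (hmx 0 (map_mx ph MM)) *m hmx 0 (dermx (map_mx ph MM))).
 move=> aW WG hW;have mW: mxgroup W by case: aW.
 have van p: (forall B, W B -> mxeval p B = 0) ->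
   (pev polyC (map_mx ph MM) p).[0] = 0 /\ (pev polyC (map_mx ph MM) p)^`().[0] = 0.
  move=> hp;have [|q0 q1]:= hz (pev (@mpolyC N K) MM p).
   move=> w /hW Ww;rewrite (@pev_morph K n _ _ (@mpolyC N K) (meval (w 0)) idfun);last by move=> c;exact: mevalC.
   exact: hp.
  have <-: ph (pev (@mpolyC N K) MM p) = pev polyC (map_mx ph MM) p.
   by apply: (@pev_morph K n _ _ (@mpolyC N K) ph polyC)=> c;exact: mmapC.
  rewrite dz in q1;rewrite -[ph _]/(pev polyC gg _) pev_horner pev_horner' gg0 gg1;split=> //.
  by rewrite -q0 (ez z).
 have Wb: W (hmx 0 (map_mx ph MM)).
  by apply: (closed_in_det1 hexp aW WG)=> p hp;rewrite -pev_horner;case: (van p hp).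
 by split=> //;apply: Lie_left=> // p hp;rewrite -pev_horner';case: (van p hp).
have [Sb Lb]:= key S M1 aS SG (fun w=> @proj1 _ _).
have [Pq Lq]:= key P M2 aP PG (fun w=> @proj2 _ _).
have tau: D last last = 1 by rewrite -ft dz dmxX.
set t := A last last.
have stt: s.[t] != 0 by move: st;rewrite mevalXU /t mxE.
(* The corner entry of the tangent vector is 1, so along the line the parameter of the curve is
   exactly t + 'X. *)
pose sh : {poly K} := t%:P + 'X.
have ephh p: ph (hh p) = p \Po sh.
 transitivity (map_poly ph (map_poly (@mpolyC N K) p)).[ph 'X_(mxi last last)].
  by rewrite /ph horner_map.
 rewrite /comp_poly -map_poly_comp.
 have ->: ph 'X_(mxi last last) = sh.
  by rewrite /ph mmapX mmap1U mxvecE mxDE mxZE [map_mx _ A _ _]mxE [map_mx _ D _ _]mxE -/t tau mulr1.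
 by congr (_.[_]);apply: eq_map_poly=> c;exact: mmapC.
have sh0 p: (p \Po sh).[0] = p.[t] by rewrite horner_comp /sh !hornerE.
have shd p: (p \Po sh)^`() = p^`() \Po sh by rewrite deriv_comp /sh derivD derivC derivX add0r mulr1.
set g1 := map_mx ph M1 in Sb Lb.
set e := mexp (t *: X).
have eM: map_mx ph M2 = map_mx polyC (invmx x) *m g1 *m map_mx polyC y *m map_mx (comp_poly sh) (pexp X).
 rewrite /M2 !map_mxM;congr (_ *m _ *m _ *m _).
 - by rewrite /cmx -map_mx_comp;apply: eq_map_mx=> c;exact: mmapC.
 - by rewrite /cmx -map_mx_comp;apply: eq_map_mx=> c;exact: mmapC.
 - by rewrite -map_mx_comp;apply: eq_map_mx=> p;exact: ephh.
have e0: hmx 0 (map_mx (comp_poly sh) (pexp X)) = e.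
 by rewrite /e -hpexp //;mxP=> i j;rewrite !mxE /hev sh0.
have e1: hmx 0 (dermx (map_mx (comp_poly sh) (pexp X))) = e *m X.
 have <-: hmx t (pexp X *m map_mx polyC X) = e *m X by rewrite hmxM hmxC hpexp.
 rewrite -dpexp //;mxP=> i j;rewrite !mxE /hev.
 by rewrite shd sh0.
move: Pq Lq Sb Lb;rewrite eM !dermxM !dermxC !mul0mx !mulmx0 !add0r !addr0.
rewrite !hmxD !hmxM !hmxC e0 e1.
set b := hmx 0 g1;set be := hmx 0 (dermx g1)=> Pq Lq Sb Lb.
have ub := mxgrpU mS Sb;have ue: e \in unitmx by exact/mexpU/nilpZ.
exists t, (- (invmx b *m be)), (invmx (invmx x *m b *m y *m e) *m
 (invmx x *m be *m y *m e + invmx x *m b *m y *m (e *m X)));split=> //;first exact: LieN.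
have uxi: invmx x \in unitmx by rewrite unitmx_inv.
rewrite -/e;clearbody b be e.
have e2: invmx (invmx x *m b *m y *m e) *m (invmx x *m b *m y *m (e *m X)) = X.
 by rewrite [_ *m (e *m X)]mulmxA mulKmx // !unitmx_mul uxi ub uy.
have e3: invmx (invmx x *m b *m y *m e) *m (invmx x *m be *m y *m e) = Ad (invmx (y *m e)) (invmx b *m be).
 by rewrite /Ad invmxK !invmxM ?unitmx_mul ?uxi ?ub ?uy // invmxK !mulmxA mulmxK.
by rewrite mulmxDr e2 e3 AdN addKr.
Qed.
End CurveTangent.

(** * No open orbit for the node 4 *)

Section NotSpherical.
Variables (K : acf) (n r : nat).
Variables (G B T : set 'M[K]_n) (a : 'I_6 -> 'M[K]_n -> K) (c : 'I_6 -> K -> 'M[K]_n).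
Variables (Q : 'M[K]_n) (M : 'M[int]_(r, n)).
Hypotheses (hG : simple_group_of_type cartanE6 G B T a c) (rd : root_dat G T Q M).
Variables (al : 'I_6 -> 'rV[int]_r) (phi : 'I_6 -> 'M[K]_2 -> 'M[K]_n) (e f : 'I_6 -> 'M[K]_n).
Hypothesis ss : simple_system cartanE6 G B a c Q M al phi e f.
Notation tt := (tt Q M).
Notation wsp := (wsp G Q M).
Notation cmb := (cmb al).
Notation rt := (rt G Q M).
Variables (om : 'M[K]_n -> K) (P : set 'M[K]_n) (i4 : 'I_6).
Hypotheses (hom : forall j (z : K), z != 0 -> om (c j z) = z ^+ (i4 == j)) (hP : parabolic_of_weight G B T om P).
Hypothesis i43 : (i4 : nat) = 3%N.
Let uQ := rd_unit rd.
Let mG : mxgroup G. by apply: simple_grp;case: hG. Qed.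
Let hexp := rd_exp rd.
Let TB : T `<=` B. by case: hG=> _ []. Qed.
Let RA := rt_pos hG (ltn0Sn 5) A2E6 rd tableE6P ss posE6_ok E6_inj.
Let sz b : b \in posE6 -> size b = 6%N. exact: (size_pos posE6_ok). Qed.
Definition outer4 := [seq b <- posE6 | 0 < b`_3].
(** The 29 positive roots involving alpha_4 are those whose negatives lie outside Lie P; each one
    descends to alpha_4 inside the list by subtraction of simple roots. *)
Lemma outer4_descend : uniq outer4 && (size outer4 == 29%N) && all (fun b=> (b == unitv 6 3) ||
 has (fun j=> has (fun b'=> (b == addv (unitv 6 j) b') && (sht b' == sht b - 1)) outer4) (iota 0 6)) outer4
 && all (fun b=> 0 < sht b) outer4.
by vm_compute. Qed.
(** Brackets with the simple root vectors preserve Lie P, so a negative root vector in it could be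
    raised step by step to the simple lowering vector of the node 4. *)
Lemma outer4_notin_parabolic b v : b \in outer4 -> wsp (- cmb b) v -> Lie P v -> v = 0.
have [aP PG BP _ nf]:= parabolicP hG rd ss hom hP;have mP: mxgroup P by case: aP.
have /andP [/andP [_ /allP desc] /allP hpos]:= outer4_descend.
have outp b': b' \in outer4 -> b' \in posE6 by rewrite mem_filter=> /andP [].
move=> b4;have [k hk]: exists k : nat, sht b <= k%:Z.
 by exists `|sht b|%N;have:= hpos _ b4;lia.
elim: k b v b4 hk=> [|k IH] b v b4 hk wv Lv;first by have:= hpos _ b4;move: hk;lia.
have bp := outp _ b4;apply/eqP/negPn/negP=> v0.
case/orP: (desc _ b4)=> [/eqP eb|].
 have e4: cmb b = al i4 by rewrite eb (_ : unitv 6 3 = unitv 6 i4) ?(cmb_unitv al) // i43.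
 apply: nf;have:= ss_f ss i4;rewrite -e4=> wf.
 have [m ->]:= rt_line rd (rtN rd (RA bp)) wv v0 wf;exact: LieZ.
case/seq.hasP=> j;rewrite mem_iota leq0n andTb add0n=> j6;case/seq.hasP=> [b' b'4 /andP [/eqP eb /eqP hb']].
pose jj := Ordinal j6;have b'p := outp _ b'4.
have ecb: cmb b = al jj + cmb b'.
 by rewrite eb cmb_addv ?(sz b'p) ?size_map ?size_iota // (cmb_unitv al jj).
have rj := rt_al ss jj;have rb := rtN rd (RA bp);have rb' := rtN rd (RA b'p).
have es: al jj - cmb b = - cmb b' by rewrite ecb opprD addrA subrr add0r.
have we := ss_e ss jj.
have w': wsp (- cmb b') (lb (e jj) v) by rewrite -es;exact: (wsp_lb rd we wv).
have /eqP : lb (e jj) v != 0.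
 apply: (lb_root_neq0 rd rj rb we (ss_e0 ss jj) wv v0);rewrite es;by case: rb'.
apply;apply: (IH b')=> //;first by move: hk;rewrite hb';lia.
apply: Lie_lb=> //;apply: (Lie_sub BP);exact: (psi_Lie rd (ss_psi ss jj) we).
Qed.
Variables (S : set 'M[K]_n) (x : 'M[K]_n) (p0 : {mpoly K[n * n]}).
Hypotheses (aS : alg_group S) (SG : S `<=` G) (Gx : G x) (p0x : exists2 A, G A & mxeval p0 A != 0).
Hypothesis hopen : forall A, G A -> mxeval p0 A != 0 -> exists b q, [/\ S b, P q & A = b *m x *m q].
Hypothesis hdep : forall Xs : 'I_29 -> 'M[K]_n, (forall j, Lie S (Xs j)) ->
 exists2 u : 'rV[K]_29, u != 0 & \sum_j u 0 j *: Xs j = 0.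

Section Projection.
Variables (pq : 'I_29 -> 'I_n * 'I_n) (Xn : 'I_29 -> 'M[K]_n).
Definition outer_part Y : 'rV[K]_29 := \row_j (Q *m Y *m invmx Q) (pq j).1 (pq j).2.
Notation pr := outer_part.
Hypothesis pr_P : forall Z, Lie P Z -> pr Z = 0.
Hypothesis pr_Xn : forall j k, (pr (Xn j) 0 k != 0) = (j == k).
Hypotheses (LXn : forall j, Lie G (Xn j)) (nXn : forall j, nilp (Xn j)).
Let prD Y Z : pr (Y + Z) = pr Y + pr Z.
by apply/rowP=> j;rewrite [LHS]mxE mulmxDr mulmxDl !mxE. Qed.
Let pr_sum (I : finType) (u : I -> K) y (Y : I -> 'M[K]_n) :
 pr (Ad y (\sum_i u i *: Y i)) = \sum_i u i *: pr (Ad y (Y i)).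
apply/rowP=> j;rewrite summxE [LHS]mxE /Ad mulmx_sumr mulmx_suml mulmx_sumr mulmx_suml summxE.
by eqb=> i _;rewrite mxZE [outer_part _ _ _]mxE -!(scalemxAr, scalemxAl) mxZE.
Qed.
Let rows y k (Y : 'I_k -> 'M[K]_n) : 'M[K]_(k, 29) := \matrix_(i, j) pr (Ad (invmx y) (Y i)) 0 j.
Let mul_rows y k (Y : 'I_k -> 'M[K]_n) (v : 'rV[K]_k) : v *m rows y Y = pr (Ad (invmx y) (\sum_i v 0 i *: Y i)).
rewrite pr_sum;apply/rowP=> j;rewrite mxE summxE;eqb=> i _.
by rewrite mxE mxZE.
Qed.
Let indep k := exists y, exists Y : 'I_k -> 'M[K]_n,
 [/\ G y, mxeval p0 y != 0, forall i, Lie S (Y i) & row_free (rows y Y)].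
(** The largest number of vectors of Lie S with conjugates independent under the projection is
    attained at some point [y] of the open set. If the projection of a nilpotent [X] were outside
    their span, [tangent_on_curve] along y exp(tX) would give one vector more, at a parameter where
    the old ones are still independent. So a conjugate of Lie S surjects onto all 29 coordinates,
    against [hdep]. *)
Lemma not_open : False.
have ex0: exists k, `[< indep k >].
 exists 0%N;apply/asboolP;have [A GA pA]:= p0x;exists A, (fun=> 0);split=> //.
  by move=> i;exact: Lie0.
 by rewrite /row_free;have:= rank_leq_row (rows A (fun _ : 'I_0=> 0));rewrite leqn0.
have ub k: `[< indep k >] -> (k <= 29)%N.
 by move/asboolP=> [y [Y [_ _ _ /eqP <-]]];exact: rank_leq_col.
have [k /asboolP [y [Y [Gy py LY fY]]] kmax]:= ex_maxnP ex0 ub.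
have uy := mxgrpU mG Gy.
have [aP PG _ _ _]:= parabolicP hG rd ss hom hP.
have full X: Lie G X -> nilp X -> (pr X <= rows y Y)%MS.
 move=> LX nX;apply/negPn/negP=> nsub.
 have aG: alg_group G by have [[[]]]:= hG.
 pose C0 := col_mx (rows y Y) (pr X).
 have fC0: row_free C0.
  apply: inj_row_free=> v;rewrite -[v]hsubmxK mul_row_col.
  set v1 := lsubmx v;set v2 : 'M_1 := rsubmx v=> e0.
  have v2E: v2 = (v2 0 0)%:M by rewrite -mx11_scalar.
  have v20: v2 = 0.
   rewrite v2E;have [->|nz]:= eqVneq (v2 0 0) 0;first by rewrite raddf0.
   case/negP: nsub;apply/submxP;exists (- (v2 0 0)^-1 *: v1).
   rewrite -scalemxAl;move: e0;rewrite {1}v2E mul_scalar_mx=> /eqP.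
   rewrite addr_eq0=> /eqP ->;rewrite scalerN scaleNr opprK scalerA mulVf //.
   by rewrite scale1r.
  rewrite v20 mul0mx addr0 in e0 *;have /eqP := e0.
  by rewrite mulmx_free_eq0 // => /eqP ->;rewrite row_mx0.
 pose Y1 i := Ad (invmx y) (Y i).
 pose GG i := map_mx polyC Q *m (pexp (- X) *m map_mx polyC (Y1 i) *m pexp X) *m map_mx polyC (invmx Q).
 pose E : 'M[{poly K}]_(k + 1, 29) := col_mx (\matrix_(i, j) GG i (pq j).1 (pq j).2) (map_mx polyC (pr X)).
 (* A right inverse at t = 0 turns independence of the rows of [E] at [t] into nonvanishing of a
    determinant, a polynomial in [t] with value 1 at 0. *)
 pose R0 := pinvmx C0.
 have nX' := nilpN nX.
 have eE t: map_mx (hev t) E = col_mx (rows (y *m mexp (t *: X)) Y) (pr X).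
  rewrite map_col_mx;congr col_mx;last by mxP=> i j;rewrite !mxE /hev hornerC.
  mxP=> i j;rewrite [LHS]mxE [X in hev _ X]mxE [RHS]mxE [RHS]mxE.
  transitivity (hmx t (GG i) (pq j).1 (pq j).2);first by rewrite [RHS]mxE.
  suff ->: hmx t (GG i) = Q *m Ad (invmx (y *m mexp (t *: X))) (Y i) *m invmx Q by [].
  rewrite /GG !hmxM !hmxC !hpexp // scalerN -mexpV;last exact: nilpZ.
  have ue: mexp (t *: X) \in unitmx by exact/mexpU/nilpZ.
  by rewrite /Y1 /Ad !invmxK invmxM // !mulmxA.
 pose D := \det (E *m map_mx polyC R0).
 have De t: D.[t] = \det (map_mx (hev t) E *m R0).
  rewrite /D -[LHS]/(hev t _) -det_map_mx map_mxM;congr (\det (_ *m _)).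
  by rewrite -map_mx_comp;apply: map_mx_id=> z;exact: hornerC.
 have C00: map_mx (hev 0) E = C0 by rewrite eE scale0r mexp0 mulmx1.
 have D0: D.[0] = 1 by rewrite De C00 mulmxVp // det1.
 pose pp := pev polyC (map_mx polyC y *m pexp X) p0.
 have ppE t: pp.[t] = mxeval p0 (y *m mexp (t *: X)) by rewrite pev_horner hmxM hmxC hpexp.
 have Gye t: G (y *m mexp (t *: X)) by apply: mxgrpM=> //;exact: (mexp_grp aG).
 have s0: D * pp != 0.
  apply: contraNneq py=> s0;have:= congr1 (hev 0) s0;rewrite /hev hornerM horner0 D0 mul1r.
  by rewrite ppE scale0r mexp0 mulmx1=> ->.
 have [|t [Y' [Z [st LY' LZ eX]]]]:= tangent_on_curve hexp mG aS aP SG PG Gx Gy nX s0.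
  by move=> t;rewrite hornerM mulf_eq0 negb_or ppE=> /andP [_ /hopen];apply.
 move: st;rewrite hornerM mulf_eq0 negb_or ppE De eE=> /andP [Dt pt].
 pose Y2 (i : 'I_(k + 1)) := match fintype.split i with inl i=> Y i | inr _=> Y' end.
 have : indep (k + 1).
  exists (y *m mexp (t *: X)), Y2;split=> //.
   by move=> i;rewrite /Y2;case: (fintype.split i).
  have ->: rows (y *m mexp (t *: X)) Y2 = col_mx (rows (y *m mexp (t *: X)) Y) (pr X).
   have eprX: pr X = pr (Ad (invmx (y *m mexp (t *: X))) Y') by rewrite {1}eX prD (pr_P LZ) addr0.
   mxP=> i j;rewrite [LHS]mxE [RHS]mxE /Y2;case: (fintype.split i)=> i';first by rewrite [RHS]mxE.
   by rewrite eprX ord1.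
  apply: inj_row_free=> v v0;apply: (can_inj (mulmxK (_ : _ \in unitmx))).
   by rewrite unitmxE;move: Dt;rewrite -unitfE;apply.
  by rewrite mulmxA v0 !mul0mx.
 by move/asboolP/kmax;rewrite addn1 ltnn.
have /choice [u hu]: forall j, exists u : 'rV[K]_k, pr (Xn j) = u *m rows y Y.
 by move=> j;apply/submxP;exact: full.
have [j|v v0 ev0]:= hdep (Xs := fun j=> \sum_i u j 0 i *: Y i).
 by apply: Lie_sum=> i _;exact: LieZ.
case/eqP: v0;apply/rowP=> k';rewrite [RHS]mxE.
have prE j: pr (Ad (invmx y) (\sum_i u j 0 i *: Y i)) = pr (Xn j) by rewrite hu mul_rows.
have:= congr1 (fun A=> pr (Ad (invmx y) A) 0 k') ev0.
rewrite pr_sum summxE;under eq_bigr=> j _ do rewrite prE mxZE.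
rewrite (bigD1 k') //= big1=> [|j jk];last first.
 by have:= pr_Xn j k';rewrite (negPf jk)=> /negbFE /eqP ->;rewrite mulr0.
rewrite addr0 Ad0 (pr_P (@Lie0 K n P)) [X in _ = X -> _]mxE=> /eqP;rewrite mulf_eq0=> /orP [/eqP //|].
by rewrite -[_ == 0]negbK pr_Xn eqxx.
Qed.
End Projection.
(** The coordinates are matrix entries where the 29 negative root vectors are nonzero. Such an entry
    has the weight of its root vector, so it vanishes on the other root vectors and on Lie P. *)
Lemma not_open_orbit : False.
have [aP PG BP _ _]:= parabolicP hG rd ss hom hP;have mP: mxgroup P by case: aP.
have /andP [/andP [/andP [uo /eqP so] _] _]:= outer4_descend.
pose bb (j : 'I_29) := nth [::] outer4 j.
have bb4 j: bb j \in outer4 by apply: mem_nth;rewrite so.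
have bbp j: bb j \in posE6 by have:= bb4 j;rewrite mem_filter=> /andP [].
have /choice [Xn hXn]: forall j, exists Z, wsp (- cmb (bb j)) Z /\ Z != 0.
 by move=> j;have [_ [Z wZ Z0]]:= rtN rd (RA (bbp j));exists Z.
have /choice [pq hpq]: forall j, exists pq : 'I_n * 'I_n, (Q *m Xn j *m invmx Q) pq.1 pq.2 != 0.
 move=> j;have [_]:= hXn j;apply: contraNP=> h0;apply/eqP.
 have : Q *m Xn j *m invmx Q = 0.
  by mxP=> i k;rewrite [RHS]mxE;apply: contrapT=> /eqP nz;apply: h0;exists (i, k).
 by move/(congr1 (fun N=> invmx Q *m N *m Q));rewrite !mulmxA mulVmx // mul1mx mulmxKV // mulmx0 mul0mx.
have wpq j: wij M (pq j).1 (pq j).2 = - cmb (bb j).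
 by have [[_ /(wtP rd) w] _]:= hXn j;exact: w.
apply: (@not_open pq Xn).
- move=> Z LZ;apply/rowP=> j;rewrite [LHS]mxE [RHS]mxE.
 have z0: wcomp Q M (- cmb (bb j)) Z = 0.
  apply: (outer4_notin_parabolic (bb4 j));first exact: (wcompP rd _ (Lie_sub PG LZ)).
  apply: (wcomp_sub rd (V := Lie P))=> // [A C k|h A hA];first exact: Lielin.
  by apply: Lie_lb=> //;apply: (Lie_sub BP);exact: (tt_LieB rd TB).
 have:= congr1 (fun A=> (Q *m A *m invmx Q) (pq j).1 (pq j).2) z0.
 rewrite mulmx0 mul0mx [X in _ = X -> _]mxE=> <-.
 by rewrite /wcomp !mulmxA mulmxV // mul1mx mulmxK // [RHS]mxE wpq eqxx.
- move=> j k;rewrite mxE;have [<-|jk]:= eqVneq j k;first exact: hpq.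
 apply/negbTE/negPn/eqP;apply: contrapT=> /eqP nz;case/eqP: jk.
 have [[_ /(wtP rd) w] _]:= hXn j;have:= w _ _ nz;rewrite wpq=> /oppr_inj ebb.
 apply/val_inj/eqP;rewrite -(nth_uniq [::] _ _ uo) ?so ?ltn_ord //;apply/eqP.
 by apply/esym/(cmb_inj rd ss E6_inj _ _ ebb);exact: sz.
- by move=> j;have [[LX _] _]:= hXn j.
- move=> j;have [[_ w] _]:= hXn j;have [nz _]:= rtN rd (RA (bbp j));exact: (wt_nilp nz w).
Qed.
End NotSpherical.

Theorem theorem16 (R : realType) (n : nat)
  (G B T : set 'M[R[i]]_n)
  (alpha : 'I_6 -> 'M[R[i]]_n -> R[i]) (coalpha : 'I_6 -> R[i] -> 'M[R[i]]_n)
  (omega : 'I_6 -> 'M[R[i]]_n -> R[i])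
  (P : 'I_6 -> set 'M[R[i]]_n)
  (X : 'I_6 -> 'M[R[i]]_n) (H : set 'M[R[i]]_n)
  (hG : simple_group_of_type cartanE6 G B T alpha coalpha)
  (hsc : simply_connected T coalpha)
  (homega : fundamental_weights T coalpha omega)
  (hP : forall i, parabolic_of_weight G B T (omega i) (P i))
  (hX : forall i, root_vector G T (alpha i) (X i))
  (hH : F4_subgroup G H (F4_root_vectors X)) :
  (forall i : 'I_6, i != node 5 4 -> spherical G H (P i)) /\
  ~ spherical G H (P (node 5 4)).
Proof.
have [Q [r [M rd]]]:= root_datum_exists hG (ltn0Sn 5) A2E6.
have [al [phi [e [f ss]]]]:= simple_system_exists hG A2E6 rd.
have [HG [B' [T' [b [c' [hH' hY]]]]]]:= hH.
have [Q' [r' [M' rd']]]:= root_datum_exists hH' (ltn0Sn 3) A2F4.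
have [al' [phi' [e' [f' ss']]]]:= simple_system_exists hH' A2F4 rd'.
have [_ [bB' _ TB'] _ _ _]:= hH'.
have hom i j z: z != 0 -> omega i (coalpha j z) = z ^+ (i == j) by case: (homega i)=> _;exact.
have mG: mxgroup G by apply: simple_grp;case: hG.
have mP i: mxgroup (P i).
 by have [[]]:= parabolicP hG rd ss (hom i) (hP i).
have tor := torus_solve rd' tableF4P invF4_ok ss'.
(* In the first half a Borel subgroup may be chosen, and the one in the root datum of [H] is taken;
   in the second half [BH] is arbitrary. *)
split=> [i i4|[BH [BHH [aBH _] sBH _] [_ [x Gx <-] [_ [I eI]]]]].
 have iok: (i : nat) \in [:: 0;1;2;4;5]%N.
  move: i4;rewrite -(inj_eq val_inj) /= inordK //.
  by case: i=> [[|[|[|[|[|[|i]]]]]] hi].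
 have [B'H [aB' _] _ _]:= bB'.
 have wY k := simple_root_vector rd' ss' (hY k).
 have [||||x Gx ox]:= spherical_point hG rd ss (fun j=> (simple_root_vector rd ss (hX j)).1)
   (fun j=> (simple_root_vector rd ss (hX j)).2) aB' (subset_trans B'H HG) _ (St := range (tt Q' M'))
   _ _ _ (hom i) (hP i) iok.
 - by move=> k;exact: (psi_Lie rd' (ss_psi ss' k) (wY k).1).
 - by move=> _ [h _ <-];exact: (tt_LieB rd' TB').
 - by move=> _ _ [h _ <-] [h' _ <-];exact: (tt_comm rd').
 - move=> y;have [u hu]:= tor y.
  exists (tt Q' M' (\sum_j u j *: hc Q' M' (al' j)));first by eexists.
  by move=> k;rewrite (wY k).1.2 hu.
 exists B'=> //;exists (lcoset x (P i))=> //;by exists x.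
have mBH: mxgroup BH by case: aBH.
have lM y z S: lcoset y (lcoset z S) = lcoset (y *m z) S.
 apply/seteqP;split=> [_ [_ [q Sq <-] <-]|_ [q Sq <-]];first by exists q;rewrite ?mulmxA.
 by exists (z *m q);[exists q|rewrite mulmxA].
(* One equation that does not vanish at [x] cuts out a basic open set inside the double coset. *)
have [p Ip px]: exists2 p, I p & mxeval p x != 0.
 have : (G `\` zero_locus I) x.
  rewrite -eI;split=> //;exists 1%:M;first exact: mxgrp1.
  by rewrite lM mul1mx.
 by move=> [_ nz];apply: contrapT=> h;apply: nz=> p Ip;apply: contrapT=> /eqP px;apply: h;exists p.
(* The torus element on which the simple roots of F4 take the values 1, 10, 100, 1000 realizes
   [level]. *)
have [x0 hx0]:= tor (fun i=> 10%:R ^+ i).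
apply: (not_open_orbit hG rd ss (hom (node 5 4)) (hP _) _ aBH (subset_trans BHH HG) Gx (p0 := p)).
- by rewrite /node /= inordK.
- by exists x.
- move=> A GA pA;have : (G `\` zero_locus I) A by split=> // h;move: pA;rewrite h ?eqxx.
 rewrite -eI=> -[_ [g BHg]];rewrite lM=> e0.
 have : lcoset A (P (node 5 4)) A by exists 1%:M;[exact: mxgrp1|rewrite mulmx1].
 by rewrite -e0=> -[q Pq <-];exists g, q.
- by move=> Xs LXs;exact: (solvable_dependent hH' rd' ss' hx0 mBH BHH sBH).
Qed.
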